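(* Let $X=\bigvee_{i\in I}{G/H_i}_+\wedge\mathbb{S}^1$ be a finite wedge sum of equivariant $1$-spheres and $f:X\to X$ a $G$-map. Then the reduced fixed orbit index $L_G$ satisfies $$L_G(f)=\sum_{i\in I}L(\overline{f}_i)\cdot(H_i),$$ where $f_i$ is the self map of ${G/H_i}_+\wedge\mathbb{S}^1$ induced by $f$ via inclusion of and projection to the $i$-th summand, $\overline{f}_i:\mathbb{S}^1\to\mathbb{S}^1$ is the map $f_i$ induces on the quotient by $G$, and $L$ is the ordinary reduced Lefschetz number. In particular, for every $G$-self map of a finite $G$-CW complex, the reduced fixed orbit index equals the (reduced) homological equivariant Lefschetz number.
   Context: $G$ is a topological group. All $G$-CW complexes are pointed with a $G$-fixed base point (cells $G/H\times D^n$, $H$ closed; the base point is a $0$-cell of type $G$), $G$-maps and $G$-homotopies preserve base points. ${G/H}_+$ is $G/H$ with a disjoint base point, $\mathbb{S}^1$ has trivial action. $(H)$ is the conjugacy class of a closed subgroup $H$; conjugacy classes are ordered by subconjugacy. $\mathbb{U}_G=\bigoplus_{(H)}\mathbb{Z}\cdot(H)$. The ordinary reduced Lefschetz number is $L(\varphi)=\Lambda(\varphi)-1$, $\Lambda$ the usual Lefschetz number. Reduced fixed orbit index (analytical). For a finite $G$-CW complex $X$ put $X_{\geq(H)}=\{x:(G_x)\geq(H)\}$, $X_{>(H)}=\{x\in X_{\geq (H)}:(G_x)\neq(H)\}$, where $G_x$ is the isotropy group. A $G$-map $f:X\to X$ induces self maps $\overline{f_{\geq(H)}}$ of $X_{\geq(H)}/G$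 and $\overline{f_{>(H)}}$ of $X_{>(H)}/G$. Let $i$ be the fixed point index of a self map of a compact ANR (on finite CW complexes it equals the Lefschetz number; it is $0$ for the empty space). Put $i_G(f,X)=\sum_{(H)}\big(i(\overline{f_{\geq(H)}})-i(\overline{f_{>(H)}})\big)\cdot(H)\in\mathbb{U}_G$ (sum over the orbit types of $X$); the reduced fixed orbit index is $L_G(f)=i_G(f,X)-1\cdot(G)$. Homological equivariant Lefschetz number. Let $\mathcal{O}$ be a full subcategory, with finitely many objects and containing all orbit types occurring in the complexes considered, of the category of orbits $G/H$ and $G$-homotopy classes of $G$-maps. The isotropy ring $\mathcal{I}$ is the free abelian group on all $G$-homotopy classes of $G$-maps between orbits in $\mathcal{O}$, with product given by composition when defined and $0$ otherwise. The right ideal $\mathrm{id}_{G/H}\cdot\mathcal{I}=\bigoplus_K\mathbb{Z}[G/K,G/H]_G$ is a finitely generated projective right $\mathcal{I}$-module. For a finite $G$-CW complex $X$, $C_n^G(X;\mathcal{I})=\bigoplus_\sigma \mathrm{id}_{G/H_\sigma}\cdot\mathcal{I}$, the sum over the $n$-cells $\sigma$ of $X$, of type $H_\sigma$; write $[\varphi]\cdot\sigma$ for the element $[\varphi]$ in the $\sigma$-summand. For a cellular $G$-map $f:X\to X$ (every $G$-map is $G$-homotopic to a cellular one), the $\mathcal{I}$-linear map $C_n^G(f;\mathcal{I})$ is $[\varphi]\cdot\sigma\mapsto\sum_\tau\sum_\ell d_\ell^{\sigma,\tau}[\psi_\ell^{\sigma,\tau}\circ\varphi]\cdot\tau$, where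 for $n$-cells $\sigma,\tau$ of types $H,K$ the composite $k:{G/H}_+\wedge\mathbb{S}^n\to X_n/X_{n-1}\xrightarrow{f}X_n/X_{n-1}\to{G/K}_+\wedge\mathbb{S}^n$ (inclusion of the cell $\sigma$, $f$, projection to the cell $\tau$) is deformed equivariantly so that the induced map $\overline{k}:\mathbb{S}^n\to\mathbb{S}^n$ on $G$-quotients is transverse to the point $-1\in\mathbb{S}^n$ (not the base point); if $\overline{k}^{-1}(-1)=\{x_1,\dots,x_m\}$, then $d_\ell^{\sigma,\tau}$ is the local degree of $\overline{k}$ at $x_\ell$, and $\psi_\ell^{\sigma,\tau}:G/H\to G/K$ is defined by $k([g],x_\ell)=(\psi_\ell^{\sigma,\tau}([g]),-1)$. For a finitely generated projective right module $P$ over a ring $R$, the Hattori–Stallings trace $\mathrm{Tr}:\mathrm{End}_R(P)\to R^{ab}$ is the composite of the inverse of the isomorphism $\vartheta:P\otimes_R\mathrm{Hom}_R(P,R)\to\mathrm{End}_R(P)$, $\vartheta(x\otimes\xi)(y)=x\,\xi(y)$, the evaluation $x\otimes\xi\mapsto\xi(x)$ and the projection to $R^{ab}=R/[R,R]$ (quotient by the additive subgroup generated by commutators). Let $\varepsilon:\mathcal{I}\to\mathbb{U}_G$ send $[\varphi:G/H\to G/K]$ to $1\cdot(H)$ if $H=K$ and to $0$ otherwise; the induced map on $\mathcal{I}^{ab}$ is also denoted $\varepsilon$. The unreduced homological equivariant Lefschetz number of $f$ is $\Lambda_G(f)=\sum_{n\ge0}(-1)^n\varepsilon(\mathrm{Tr}\,C_n^G(f;\mathcal{I}))\in\mathbb{U}_G$,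 and the (reduced) homological equivariant Lefschetz number is $\Lambda_G(f)-1\cdot(G)$. *)

(* Defs.v *)
From HB Require Import structures.
From mathcomp Require Import all_boot all_order all_algebra finmap generic_quotient.
From mathcomp Require Import all_classical all_reals.
From mathcomp Require Import topology normedtype derive wedge_sigT.
From mathcomp Require Import freeg ring.

Set Implicit Arguments.
Unset Strict Implicit.
Unset Printing Implicit Defensive.

Import Order.TTheory GRing.Theory Num.Theory numFieldNormedType.Exports.

Local Open Scope classical_set_scope.
Local Open Scope ring_scope.
Local Open Scope quotient_scope.

HB.mixin Record isTopologicalGroup G of Group G & Topological G := {
  mulg_continuous : continuous (fun x : G * G => (x.1 * x.2)%g);
  invg_continuous : continuous (fun x : G => x^-1%g) }.

#[short(type="topologicalGroupType")]
HB.structure Definition TopologicalGroup :=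
  {G of Group G & Topological G & isTopologicalGroup G}.

Section ClosedSubgroups.
Variable G : topologicalGroupType.

Definition is_closed_subgroup (H : set G) : Prop :=
  [/\ closed H, H 1%g & forall x y, H x -> H y -> H (x^-1 * y)%g].

Definition closed_subgroup := {H : set G | `[< is_closed_subgroup H >]}.
HB.instance Definition _ := SubChoice.on closed_subgroup.

Definition subgroup_set (H : closed_subgroup) : set G := val H.

Lemma subgroupP (H : closed_subgroup) : is_closed_subgroup (subgroup_set H).
Proof. exact/asboolP/(valP H). Qed.

Lemma subgroupM (H : closed_subgroup) x y :
  subgroup_set H x -> subgroup_set H y -> subgroup_set H (x * y)%g.
Proof.
have [_ H1 HM] := subgroupP H => Hx Hy.
by have := HM _ _ (HM _ _ Hx H1) Hy; rewrite mulg1 invgK.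
Qed.

Lemma full_subgroup_subproof : `[< is_closed_subgroup setT >].
Proof. by apply/asboolP; split => //; exact: closedT. Qed.

Definition full_subgroup : closed_subgroup := exist _ setT full_subgroup_subproof.

(* [(A) <= (B)] in the subconjugacy relation, and [(A) = (B)]. *)
Definition subconj (A B : set G) : Prop :=
  exists g : G, forall h, A h -> B (g^-1 * h * g)%g.

Definition conjugate (A B : set G) : Prop :=
  exists g : G, forall h, A h <-> B (g^-1 * h * g)%g.

(* Conjugacy classes of closed subgroups are partially ordered by subconjugacy.
   Reflexivity and transitivity always hold. Antisymmetry holds for instance
   for compact G, but fails for some infinite discrete groups; without it the
   map induced on X_{>(H)}/G and the map induced by epsilon on I^ab need not
   exist. *)
Definition subconjugacy_order : Prop :=
  forall H K : closed_subgroup,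
    subconj (subgroup_set H) (subgroup_set K) ->
    subconj (subgroup_set K) (subgroup_set H) ->
    conjugate (subgroup_set H) (subgroup_set K).

Lemma conjugate_refl A : conjugate A A.
Proof. by exists 1%g => h; rewrite invg1 mul1g mulg1. Qed.

Lemma conjugate_sym A B : conjugate A B -> conjugate B A.
Proof.
move=> [g gP]; exists g^-1%g => h; rewrite gP invgK.
by rewrite !mulgA mulVg mul1g -!mulgA mulVg mulg1.
Qed.

Lemma conjugate_trans A B C : conjugate A B -> conjugate B C -> conjugate A C.
Proof.
by move=> [g gP] [k kP]; exists (g * k)%g => h; rewrite gP kP invgM !mulgA.
Qed.

Definition conjugate_rel (H K : closed_subgroup) : bool :=
  `[< conjugate (subgroup_set H) (subgroup_set K) >].

Lemma conjugate_rel_refl : reflexive conjugate_rel.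
Proof. by move=> H; apply/asboolP; exact: conjugate_refl. Qed.

Lemma conjugate_rel_sym : symmetric conjugate_rel.
Proof. by move=> H K; apply/asboolP/asboolP => /conjugate_sym. Qed.

Lemma conjugate_rel_trans : transitive conjugate_rel.
Proof.
move=> K H L /asboolP HK /asboolP KL; apply/asboolP.
exact: conjugate_trans HK KL.
Qed.

Definition conjugate_equiv :=
  EquivRel _ conjugate_rel_refl conjugate_rel_sym conjugate_rel_trans.

Definition conj_class := {eq_quot conjugate_equiv}.
HB.instance Definition _ := Quotient.on conj_class.
HB.instance Definition _ := Choice.on conj_class.

Definition Ugroup := {freeg conj_class}.

Definition class_of (H : closed_subgroup) : Ugroup := << \pi_conj_class H >>.

End ClosedSubgroups.

(* G-spaces.  Only continuity of each translation is required, and not joint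
   continuity of G * X -> X: the theorem holds in this generality, and the
   quotient topology on G/H_+ /\ S^1 need not make the action jointly
   continuous when G is not locally compact. *)

Section GSpaces.
Variable G : topologicalGroupType.

Record gspace := GSpace {
  gs_sort :> topologicalType;
  act : G -> gs_sort -> gs_sort;
  act1 : forall x, act 1%g x = x;
  actM : forall g h x, act (g * h)%g x = act g (act h x);
  act_continuous : forall g, continuous (act g) }.

Record pgspace := PGSpace {
  pg_gspace :> gspace;
  pg_pt : pg_gspace;
  act_pt : forall g, act g pg_pt = pg_pt }.

Definition is_gmap (X Y : gspace) (f : X -> Y) : Prop :=
  continuous f /\ forall g x, f (act g x) = act g (f x).

Definition is_pgmap (X Y : pgspace) (f : X -> Y) : Prop :=
  is_gmap f /\ f (pg_pt X) = pg_pt Y.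

Definition isotropy (X : gspace) (x : X) : set G := [set g | act g x = x].

Section Homotopy.
Variable R : realType.

Definition cylinder (T : Type) : set (T * R) := [set p | 0 <= p.2 <= 1].

Definition is_ghomotopy (X Y : gspace) (f f' : X -> Y) (h : X * R -> Y) : Prop :=
  [/\ {within @cylinder X, continuous h},
      forall g x t, 0 <= t <= 1 -> h (act g x, t) = act g (h (x, t)),
      forall x, h (x, 0) = f x & forall x, h (x, 1) = f' x].

Definition ghomotopic (X Y : gspace) (f f' : X -> Y) : Prop :=
  exists h, is_ghomotopy f f' h.

Definition pghomotopic (X Y : pgspace) (f f' : X -> Y) : Prop :=
  exists h, is_ghomotopy f f' h /\
    forall t, 0 <= t <= 1 -> h (pg_pt X, t) = pg_pt Y.

End Homotopy.
End GSpaces.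

Arguments act {G g0} _ _ : rename.
Arguments pg_pt {G} p.

Section GHomotopyTheory.
Variables (R : realType) (G : topologicalGroupType).

Lemma pair_continuous (T U V : topologicalType) (f : T -> U) (g : T -> V) :
  continuous f -> continuous g -> continuous (fun x => (f x, g x)).
Proof. by move=> cf cg x; exact: cvg_pair (cf x) (cg x). Qed.

Lemma within_precomp (U V W : topologicalType) (phi : U -> V) (f : V -> W)
    (A : set U) (B : set V) :
  {within A, continuous phi} -> (forall x, A x -> B (phi x)) ->
  {within B, continuous f} -> {within A, continuous (f \o phi)}.
Proof.
move=> /subspace_continuousP cphi AB /subspace_continuousP cf.
apply/subspace_continuousP => x Ax.
apply: (@cvg_comp _ _ _ phi f _ (within B (nbhs (phi x)))); last exact/cf/AB.
move=> P /= BP; have := cphi x Ax _ BP; rewrite /nbhs/= /within/=.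
by apply: filterS => y + Ay => /(_ Ay); apply; exact: AB.
Qed.

Lemma ghomotopic_refl (X Y : gspace G) (f : X -> Y) : is_gmap f ->
  ghomotopic R f f.
Proof.
move=> [cf fE]; exists (f \o fst); split => //=.
apply: continuous_subspaceT => x; apply: (@continuous_comp _ _ _ fst f); [exact: cvg_fst|exact: cf].
Qed.

Lemma ghomotopic_sym (X Y : gspace G) (f f' : X -> Y) :
  ghomotopic R f f' -> ghomotopic R f' f.
Proof.
move=> [h [ch hE h0 h1]].
have rev01 (t : R) : 0 <= t <= 1 -> 0 <= 1 - t <= 1.
  by move=> /andP[t0 t1]; rewrite subr_ge0 t1 lerBlDr lerDl.
exists (h \o (fun p => (p.1, 1 - p.2))); split => /= [|g x t /rev01|x|x].
- apply: within_precomp ch; last by move=> x; exact: rev01.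
  have c1 : continuous (fun p : X * R => 1 - p.2).
    by move=> p; apply: cvgB; [exact: cvg_cst|exact: cvg_snd].
  by apply: continuous_subspaceT; apply: pair_continuous => // x; exact: cvg_fst.
- exact: hE.
- by rewrite subr0.
- by rewrite subrr.
Qed.

Lemma ghomotopic_trans (X Y : gspace G) (f1 f2 f3 : X -> Y) :
  ghomotopic R f1 f2 -> ghomotopic R f2 f3 -> ghomotopic R f1 f3.
Proof.
move=> [h [ch hE h0 h1]] [k [ck kE k0 k1]].
pose m (p : X * R) : X * R := (p.1, 2 * p.2).
pose n (p : X * R) : X * R := (p.1, 2 * p.2 - 1).
pose l (p : X * R) : Y := if p.2 <= 2^-1 then h (m p) else k (n p).
have c2 : continuous (fun p : X * R => 2 * p.2).
  by move=> p; apply: cvgM; [exact: cvg_cst|exact: cvg_snd].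
have cm : continuous m by apply: pair_continuous => // p; exact: cvg_fst.
have cn : continuous n.
  have c1 : continuous (fun p : X * R => 2 * p.2 - 1).
    by move=> p; apply: cvgB; [exact: c2|exact: cvg_cst].
  by apply: pair_continuous => // p; exact: cvg_fst.
have half0 : (0 : R) < 2^-1 by rewrite invr_gt0 ltr0n.
have half1 : (2^-1 : R) < 1 by rewrite invf_lt1 ?ltr1n ?ltr0n.
have mle t : (t <= 2^-1) = (2 * t <= 1 :> R).
  by rewrite -ler_pdivlMl ?ltr0n// mulr1.
have nle (t : R) : (2^-1 <= t) = (0 <= 2 * t - 1).
  by rewrite subr_ge0 -ler_pdivrMl ?ltr0n// mulr1.
have nle1 (t : R) : (2 * t - 1 <= 1) = (t <= 1).
  by rewrite lerBlDr -[1 + 1]/(2%:R) ger_pMr ?ltr0n.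
have lt01 (t : R) : ~~ (t <= 2^-1) -> 0 <= t <= 1 -> 0 <= 2 * t - 1 <= 1.
  by rewrite -ltNge => /ltW + /andP[_ t1]; rewrite nle nle1 t1 => ->.
have le01 (t : R) : t <= 2^-1 -> 0 <= t <= 1 -> 0 <= 2 * t <= 1.
  by rewrite mle => -> /andP[t0 _]; rewrite mulr_ge0.
exists l; split.
- have -> : @cylinder R X = [set p | 0 <= p.2 <= 2^-1] `|` [set p | 2^-1 <= p.2 <= 1].
    apply/seteqP; split => p; rewrite /cylinder/=; last first.
      case=> /andP[a b]; first by rewrite a (le_trans b)// ltW.
      by rewrite b andbT (le_trans _ a)// ltW.
    by case: (leP p.2 2^-1) => [? /andP[-> _]|/ltW -> /andP[_ ->]]; [left|right].
  have snd_closed (a b : R) : closed [set p : X * R | a <= p.2 <= b].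
    rewrite (_ : [set _ | _] = snd @^-1` `[a, b]).
      apply: closed_comp; last exact: interval_closed.
      by move=> p _; exact: cvg_snd.
    by apply/seteqP; split=> p /=; rewrite in_itv/=.
  apply: withinU_continuous => //.
  + apply: (@subspace_eq_continuous _ _ _ (h \o m)).
      by move=> p; rewrite inE => /= /andP[_ p2]; rewrite /from_subspace /l /= p2.
    apply: within_precomp ch; first exact: continuous_subspaceT.
    by move=> p /= /andP[a b]; rewrite /cylinder/= -mle b mulr_ge0.
  + apply: (@subspace_eq_continuous _ _ _ (k \o n)).
      move=> p; rewrite inE => /= /andP[a b].
      rewrite /from_subspace /l /=; case: ifPn => // c.
      have E : p.2 = 2^-1 by apply/eqP; rewrite eq_le c a.
      by rewrite /n /m /= E divff ?pnatr_eq0// subrr k0 h1.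
    apply: within_precomp ck; first exact: continuous_subspaceT.
    by move=> p /= /andP[a b]; rewrite /cylinder/= nle1 b -nle a.
- move=> g x t t01; rewrite /l/=; case: ifPn => c; first by rewrite /m/= hE ?le01.
  by rewrite /n/= kE ?lt01.
- by move=> x; rewrite /l/= ltW// /m/= mulr0 h0.
- move=> x; rewrite /l/= leNgt half1/= /n/= mulr1.
  by rewrite (_ : 2 - 1 = 1) ?k1//; apply/eqP; rewrite subr_eq.
Qed.

Lemma ghomotopic_comp (X Y Z : gspace G) (f f' : X -> Y) (k k' : Y -> Z) :
  is_gmap f' -> is_gmap k -> ghomotopic R f f' -> ghomotopic R k k' ->
  ghomotopic R (k \o f) (k' \o f').
Proof.
move=> [cf' f'E] [ck kE] [h [ch hE h0 h1]] [l [cl lE l0 l1]].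
apply: (@ghomotopic_trans _ _ _ (k \o f')).
  exists (k \o h); split=> [|g x t t01|x|x] /=; [|by rewrite hE// kE|by rewrite h0|by rewrite h1].
  move=> x; apply: (@continuous_comp (subspace (@cylinder R X)) _ _ h k).
    exact: ch.
  exact: ck.
exists (l \o (fun p => (f' p.1, p.2))); split => [|g x t t01|x|x] /=;
  [|by rewrite f'E lE|exact: l0|exact: l1].
apply: within_precomp cl => //.
apply: continuous_subspaceT; apply: pair_continuous => p; last exact: cvg_snd.
by apply: (@continuous_comp _ _ _ fst f'); [exact: cvg_fst|exact: cf'].
Qed.

End GHomotopyTheory.

Section Cosets.
Variables (G : topologicalGroupType) (H : closed_subgroup G).

Definition coset_rel (x y : G) : bool := `[< subgroup_set H (x^-1 * y)%g >].

Lemma coset_rel_refl : reflexive coset_rel.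
Proof. by move=> x; apply/asboolP; rewrite mulVg; have [] := subgroupP H. Qed.

Lemma coset_relP x y : reflect (subgroup_set H (x^-1 * y)%g) (coset_rel x y).
Proof. exact: asboolP. Qed.

Lemma coset_rel_sym : symmetric coset_rel.
Proof.
suff S x y : coset_rel x y -> coset_rel y x by move=> x y; apply/idP/idP; exact: S.
have [_ H1 HM] := subgroupP H.
by move=> /coset_relP xy; apply/coset_relP; have := HM _ _ xy H1; rewrite mulg1 invgM invgK.
Qed.

Lemma coset_rel_trans : transitive coset_rel.
Proof.
move=> y x z /coset_relP xy /coset_relP yz; apply/coset_relP.
by have := subgroupM xy yz; rewrite !mulgA -(mulgA x^-1%g) mulgV mulg1.
Qed.

Definition coset_equiv := EquivRel _ coset_rel_refl coset_rel_sym coset_rel_trans.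

Definition coset := {eq_quot coset_equiv}.
HB.instance Definition _ := Topological.copy coset (quotient_topology coset).
HB.instance Definition _ := Quotient.on coset.

Definition coset_of (x : G) : coset := \pi_coset x.

Lemma coset_ofP x y : coset_of x = coset_of y <-> subgroup_set H (x^-1 * y)%g.
Proof. by split=> [/eqmodP/coset_relP//|xy]; apply/eqmodP/coset_relP. Qed.

Lemma coset_ofK c : coset_of (repr c) = c.
Proof. exact: reprK. Qed.

Definition coset_act (g : G) (c : coset) : coset := coset_of (g * repr c)%g.

Lemma coset_actE g x : coset_act g (coset_of x) = coset_of (g * x)%g.
Proof.
apply/coset_ofP; rewrite invgM -!mulgA (mulgA g^-1%g) mulVg mul1g.
by apply/coset_ofP; rewrite coset_ofK.
Qed.

Lemma coset_act1 c : coset_act 1%g c = c.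
Proof. by rewrite -[c]coset_ofK coset_actE mul1g. Qed.

Lemma coset_actM g h c : coset_act (g * h)%g c = coset_act g (coset_act h c).
Proof. by rewrite -[c]coset_ofK !coset_actE mulgA. Qed.

Lemma coset_act_continuous g : continuous (coset_act g).
Proof.
apply/quotient_continuous.
rewrite (_ : _ \o _ = coset_of \o (fun x => (g * x)%g)); last first.
  by apply/funext => x /=; exact: coset_actE.
have cg : continuous (fun x : G => (g * x)%g).
  move=> x; apply: (@continuous_comp _ _ _ (fun y : G => (g, y)) (fun p : G * G => (p.1 * p.2)%g)).
    by apply: pair_continuous => y; [exact: cvg_cst|exact: cvg_id].
  exact: mulg_continuous.
by move=> x; apply: (@continuous_comp _ _ _ _ coset_of); [exact: cg|exact: pi_continuous].
Qed.

Definition coset_space : gspace G :=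
  GSpace coset_act1 coset_actM coset_act_continuous.

End Cosets.
Arguments coset_of {G} H x.

(* The one-point G-space, realised as G/G. *)
Lemma coset_full (G : topologicalGroupType) (c d : coset_space (full_subgroup G)) :
  c = d.
Proof. by rewrite -[c]coset_ofK -[d]coset_ofK; apply/coset_ofP. Qed.

Definition point_space (G : topologicalGroupType) : pgspace G :=
  @PGSpace _ (coset_space (full_subgroup G)) (coset_of _ 1%g)
    (fun g => coset_full _ _).

(* T/A: the quotient of T collapsing A to a point. *)
Section Collapse.
Variables (T : topologicalType) (A : set T).

Definition collapse_rel (a b : T) : bool := (a == b) || `[< A a /\ A b >].

Lemma collapse_rel_refl : reflexive collapse_rel.
Proof. by move=> a; rewrite /collapse_rel eqxx. Qed.

Lemma collapse_rel_sym : symmetric collapse_rel.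
Proof.
move=> a b; rewrite /collapse_rel eq_sym; congr (_ || _).
by apply/asboolP/asboolP => -[].
Qed.

Lemma collapse_rel_trans : transitive collapse_rel.
Proof.
move=> b a c /predU1P[-> //|/asboolP[Aa Ab]] /predU1P[<-|/asboolP[_ Ac]];
  by apply/orP; right; apply/asboolP.
Qed.

Definition collapse_equiv :=
  EquivRel _ collapse_rel_refl collapse_rel_sym collapse_rel_trans.

Definition collapse := {eq_quot collapse_equiv}.
HB.instance Definition _ := Topological.copy collapse (quotient_topology collapse).
HB.instance Definition _ := Quotient.on collapse.

Definition collapse_of (x : T) : collapse := \pi_collapse x.

Lemma collapse_ofP x y : collapse_of x = collapse_of y <-> x = y \/ (A x /\ A y).
Proof.
split=> [/eqmodP/predU1P[->|/asboolP]|[->//|AA]]; [by left|by right|].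
by apply/eqmodP/orP; right; exact/asboolP.
Qed.

Lemma collapse_ofK c : collapse_of (repr c) = c.
Proof. exact: reprK. Qed.
End Collapse.
Arguments collapse_of {T} A x.

Section CollapseGSpace.
Variables (G : topologicalGroupType) (T : gspace G) (A : set T).
Hypothesis A_act : forall g x, A x -> A (act g x).

Definition collapse_act (g : G) (c : collapse A) : collapse A :=
  collapse_of A (act g (repr c)).

Lemma collapse_actE g x : collapse_act g (collapse_of A x) = collapse_of A (act g x).
Proof.
apply/collapse_ofP.
have /collapse_ofP[->|[Ax Ay]] := collapse_ofK (collapse_of A x); first by left.
by right; split; exact: A_act.
Qed.

Lemma collapse_act1 c : collapse_act 1%g c = c.
Proof. by rewrite -[c]collapse_ofK collapse_actE act1. Qed.

Lemma collapse_actM g h c :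
  collapse_act (g * h)%g c = collapse_act g (collapse_act h c).
Proof. by rewrite -[c]collapse_ofK !collapse_actE actM. Qed.

Lemma collapse_act_continuous g : continuous (collapse_act g).
Proof.
apply/quotient_continuous.
rewrite (_ : _ \o _ = collapse_of A \o act g); last first.
  by apply/funext => x /=; exact: collapse_actE.
move=> x; apply: (@continuous_comp _ _ _ _ (collapse_of A)).
  exact: act_continuous.
exact: pi_continuous.
Qed.

Definition collapse_gspace : gspace G :=
  GSpace collapse_act1 collapse_actM collapse_act_continuous.
End CollapseGSpace.

Section SpheresAndDiscs.
Variable R : realType.

Definition normsq n (v : 'rV[R]_n) : R := \sum_i v 0 i ^+ 2.

Definition disc n := set_type [set v : 'rV[R]_n | normsq v <= 1].
HB.instance Definition _ n := Topological.on (disc n).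

Definition sphere n := set_type [set v : 'rV[R]_n.+1 | normsq v = 1].
HB.instance Definition _ n := Topological.on (sphere n).
HB.instance Definition _ n := SubType.on (sphere n).

Definition disc_interior n (d : disc n) : Prop := normsq (set_val d) < 1.

Lemma normsq_e0 n : normsq (delta_mx 0 0 : 'rV[R]_n.+1) = 1.
Proof.
rewrite /normsq (bigD1 ord0)//= mxE !eqxx expr1n big1 ?addr0// => i i0.
by rewrite mxE eqxx (negPf i0) expr0n.
Qed.

Lemma normsqN n (v : 'rV[R]_n) : normsq (- v) = normsq v.
Proof. by apply: eq_bigr => i _; rewrite mxE sqrrN. Qed.

(* The base point 1 = (1,0,...,0) and the point -1 of the unit sphere. *)
Definition sphere_pt n : sphere n := exist _ (delta_mx 0 0) (mem_set (normsq_e0 n)).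

Lemma sphere_antipt_subproof n : normsq (- delta_mx 0 0 : 'rV[R]_n.+1) = 1.
Proof. by rewrite normsqN normsq_e0. Qed.

Definition sphere_antipt n : sphere n :=
  exist _ (- delta_mx 0 0) (mem_set (sphere_antipt_subproof n)).

(* The relative homeomorphism (D^n, S^{n-1}) -> (S^n, 1),
   d |-> (2|d|^2 - 1, 2 (1 - |d|^2)^{1/2} d), by which D^n/S^{n-1} is
   identified with S^n; the centre goes to -1.  For n = 0 it identifies D^0
   with the point -1 of S^0. *)
Definition wrap_mx n (d : disc n) : 'rV[R]_n.+1 :=
  row_mx (2 * normsq (set_val d) - 1)%:M
         ((2 * Num.sqrt (1 - normsq (set_val d))) *: set_val d) : 'rV_(1 + n).

Lemma wrap_subproof n (d : disc n) : normsq (wrap_mx d) = 1.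
Proof.
have d1 : normsq (set_val d) <= 1 by have := set_valP d.
rewrite {1}/normsq /wrap_mx [LHS](@big_split_ord _ _ _ 1 n) /= big_ord1.
rewrite (@row_mxEl _ 1 1 n) mxE eqxx mulr1n.
under eq_bigr do rewrite (@row_mxEr _ 1 1 n) mxE exprMn.
rewrite -mulr_sumr -/(normsq (set_val d)) exprMn sqr_sqrtr ?subr_ge0//.
by set r := normsq _; ring.
Qed.

Definition wrap n (d : disc n) : sphere n :=
  exist _ (wrap_mx d) (mem_set (wrap_subproof d)).

End SpheresAndDiscs.
Arguments sphere_pt {R n}.
Arguments sphere_antipt {R n}.

(* G/H_+ /\ S^n, as G/H * S^n with G/H * {1} collapsed to the base point. *)
Section HalfSmash.
Variables (R : realType) (G : topologicalGroupType) (H : closed_subgroup G) (n : nat).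

Definition coset_sphere_act (g : G) (p : coset H * sphere R n) := (coset_act g p.1, p.2).

Lemma coset_sphere_act1 p : coset_sphere_act 1%g p = p.
Proof. by case: p => c s; rewrite /coset_sphere_act coset_act1. Qed.

Lemma coset_sphere_actM g h p :
  coset_sphere_act (g * h)%g p = coset_sphere_act g (coset_sphere_act h p).
Proof. by rewrite /coset_sphere_act coset_actM. Qed.

Lemma coset_sphere_act_continuous g : continuous (coset_sphere_act g).
Proof.
apply: pair_continuous => p; last exact: cvg_snd.
apply: (@continuous_comp _ _ _ fst (coset_act g)); first exact: cvg_fst.
exact: coset_act_continuous.
Qed.

Definition coset_sphere : gspace G :=
  GSpace coset_sphere_act1 coset_sphere_actM coset_sphere_act_continuous.

Definition smash_base : set coset_sphere := [set p | p.2 = sphere_pt].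

Lemma smash_base_act g p : smash_base p -> smash_base (act g p).
Proof. by []. Qed.

Definition half_smash_gspace := collapse_gspace smash_base_act.

Definition smash_of (c : coset H) (s : sphere R n) : half_smash_gspace :=
  collapse_of smash_base (c, s).

Lemma smash_pt_act g : act g (smash_of (coset_of H 1%g) sphere_pt) =
  smash_of (coset_of H 1%g) sphere_pt.
Proof.
transitivity (collapse_of smash_base (coset_sphere_act g (coset_of H 1%g, sphere_pt))).
  exact: (collapse_actE smash_base_act).
by apply: (proj2 (collapse_ofP smash_base _ _)); right.
Qed.

Definition half_smash : pgspace G := PGSpace smash_pt_act.

(* The identification of (G/H_+ /\ S^n)/G with S^n, [c, s] |-> s. *)
Definition smash_sphere (z : half_smash) : sphere R n :=
  (repr (z : collapse smash_base)).2.

Lemma smash_sphereE c s : smash_sphere (smash_of c s) = s.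
Proof.
rewrite /smash_sphere.
have /collapse_ofP[->//|[]] := collapse_ofK (smash_of c s).
by rewrite /smash_base /= => -> ->.
Qed.
End HalfSmash.
Arguments half_smash R {G} H n.
Arguments smash_of {R G} H {n} c s.

(* The self map of S^n induced on G-quotients by a G-map
   k : G/H_+ /\ S^n -> G/K_+ /\ S^n. *)
Definition sphere_map (R : realType) (G : topologicalGroupType)
    (H K : closed_subgroup G) (n : nat)
    (k : half_smash R H n -> half_smash R K n) (s : sphere R n) : sphere R n :=
  smash_sphere (k (smash_of H (coset_of H 1%g) s)).

(* The wedge of pointed G-spaces.  An extra one-point summand is added so that
   the empty wedge is a point. *)
Section Wedge.
Variables (G : topologicalGroupType) (I : choiceType) (X : I -> pgspace G).

Definition summand (o : option I) : pgspace G := oapp X (point_space G) o.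

Definition wedge_carrier := wedge (fun o => pg_pt (summand o)).
HB.instance Definition _ := Topological.on wedge_carrier.
HB.instance Definition _ := Quotient.on wedge_carrier.

Definition wedge_in' o (x : summand o) : wedge_carrier :=
  @wedge_lift _ summand (fun o => pg_pt (summand o)) o x.

Lemma wedge_in'_pt o o' : wedge_in' (pg_pt (summand o)) = wedge_in' (pg_pt (summand o')).
Proof. exact: (@wedge_liftE _ summand _ o' (pg_pt _) o (pg_pt _)). Qed.

Definition wedge_act (g : G) : wedge_carrier -> wedge_carrier :=
  wedge_fun (fun o x => wedge_in' (act g x)).

Lemma wedge_act_compat g o o' :
  wedge_in' (act g (pg_pt (summand o))) = wedge_in' (act g (pg_pt (summand o'))).
Proof. by rewrite !act_pt; exact: wedge_in'_pt. Qed.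

Lemma wedge_actE g o x : wedge_act g (@wedge_in' o x) = wedge_in' (act g x).
Proof.
by rewrite /wedge_act /wedge_in' wedge_lift_funE// => *; exact: wedge_act_compat.
Qed.

Lemma wedge_surj w : exists o x, w = @wedge_in' o x.
Proof.
exists (projT1 (repr w)), (projT2 (repr w)).
by rewrite /wedge_in' /wedge_lift /= surjective_existT reprK.
Qed.

Lemma wedge_act1 w : wedge_act 1%g w = w.
Proof. by have [o [x ->]] := wedge_surj w; rewrite wedge_actE act1. Qed.

Lemma wedge_actM g h w : wedge_act (g * h)%g w = wedge_act g (wedge_act h w).
Proof. by have [o [x ->]] := wedge_surj w; rewrite !wedge_actE actM. Qed.

Lemma wedge_act_continuous g : continuous (wedge_act g).
Proof.
apply: wedge_fun_continuous => [o x|o o']; last exact: wedge_act_compat.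
apply: (@continuous_comp _ _ _ (act g) (@wedge_in' o)).
  exact: act_continuous.
exact: wedge_lift_continuous.
Qed.

Definition wedge_gspace : gspace G :=
  GSpace wedge_act1 wedge_actM wedge_act_continuous.

Lemma wedge_pt_act (g : G) : act g (wedge_in' (pg_pt (summand None)) : wedge_gspace) =
  wedge_in' (pg_pt (summand None)).
Proof. by rewrite /= wedge_actE act_pt. Qed.

Definition wedge_space : pgspace G := PGSpace wedge_pt_act.

Definition wedge_in (i : I) (x : X i) : wedge_space := @wedge_in' (Some i) x.

Definition summand_proj (i : I) (o : option I) : summand o -> X i :=
  match o with
  | Some j => fun x => if j =P i is ReflectT e then ecast k (X k) e x else pg_pt (X i)
  | None => fun=> pg_pt (X i)
  end.

Definition wedge_proj (i : I) : wedge_space -> X i := wedge_fun (summand_proj i).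

Lemma wedge_projE i j (x : X j) : wedge_proj i (wedge_in x) = summand_proj i (o := Some j) x.
Proof.
rewrite /wedge_proj /wedge_in /wedge_in' wedge_lift_funE// => o o'.
suff E o1 : summand_proj i (pg_pt (summand o1)) = pg_pt (X i) by rewrite !E.
by case: o1 => //= k; case: eqP => // e; case: i / e.
Qed.
End Wedge.

Section Homology.
Variables (R : realType) (Y : topologicalType).

Definition simplex n :=
  set_type [set v : 'rV[R]_n.+1 | (forall i, 0 <= v 0 i) /\ \sum_i v 0 i = 1].
HB.instance Definition _ n := Topological.on (simplex n).

Definition face_mx n (i : 'I_n.+2) (v : 'rV[R]_n.+1) : 'rV[R]_n.+2 :=
  \row_j oapp (v 0) 0 (unlift i j).

Lemma face_subproof n (i : 'I_n.+2) (v : simplex n) :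
  (forall j, 0 <= face_mx i (set_val v) 0 j) /\
  \sum_j face_mx i (set_val v) 0 j = 1.
Proof.
have [v0 v1] := set_valP v; split=> [j|].
  by rewrite mxE; case: unliftP => //= k _; exact: v0.
rewrite (bigD1_ord i)//= mxE unlift_none/= add0r -[RHS]v1.
by apply: eq_bigr => j _; rewrite mxE liftK.
Qed.

Definition face n (i : 'I_n.+2) (v : simplex n) : simplex n.+1 :=
  exist _ (face_mx i (set_val v)) (mem_set (face_subproof i v)).

(* Chains are formal combinations of arbitrary functions from the simplex;
   singular chains of B are those supported on continuous functions into B. *)
Definition chain n := {freeg (simplex n -> Y)}.

Definition boundary n : chain n.+1 -> chain n :=
  fglift (fun s : simplex n.+1 -> Y =>
    \sum_(i < n.+2) (-1) ^+ i *: << s \o face i >> : chain n).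

Definition chain_map (f : Y -> Y) n : chain n -> chain n :=
  fglift (fun s : simplex n -> Y => << f \o s >> : chain n).

Definition singular_chain (B : set Y) n (c : chain n) : Prop :=
  forall s, s \in dom c -> continuous s /\ forall v, B (s v).

Definition is_cycle (B : set Y) n : chain n -> Prop :=
  match n with
  | 0 => fun c => singular_chain B c
  | m.+1 => fun c => singular_chain B c /\ boundary c = 0
  end.

Definition is_boundary (B : set Y) n (c : chain n) : Prop :=
  exists b : chain n.+1, singular_chain B b /\ boundary b = c.

Definition torsion_class (B : set Y) n (c : chain n) : Prop :=
  exists m : int, m != 0 /\ is_boundary B (m *: c).

(* t is the trace of f on H_n(B; Z) modulo torsion: the classes of the cycles
   z i form a basis of that group, in which M is the matrix of f. *)
Definition is_homology_trace (B : set Y) (f : Y -> Y) n (t : int) : Prop :=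
  exists (d : nat) (z : 'I_d -> chain n) (M : 'M[int]_d),
    [/\ forall i, is_cycle B (z i),
        forall c, is_cycle B c ->
          exists! a : 'rV[int]_d, torsion_class B (c - \sum_i a 0 i *: z i),
        forall j, torsion_class B (chain_map f (z j) - \sum_i M i j *: z i) &
        t = \tr M].

Definition homology_trace (B : set Y) (f : Y -> Y) n : int :=
  xget 0 [set t | is_homology_trace B f n t].

Definition lefschetz (B : set Y) (f : Y -> Y) : int :=
  \sum_(n \in [set: nat]) (-1) ^+ n * homology_trace B f n.

Definition reduced_lefschetz (B : set Y) (f : Y -> Y) : int := lefschetz B f - 1.

End Homology.
Arguments lefschetz R {Y} B f.
Arguments reduced_lefschetz R {Y} B f.

Section FixedPointIndex.
Variable R : realType.

Definition C1_at n (f : 'rV[R]_n -> 'rV[R]_n) (x : 'rV[R]_n) : Prop :=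
  (\forall y \near x, differentiable f y) /\ {for x, continuous (jacobian f)}.

Definition jacobian_sign n (f : 'rV[R]_n -> 'rV[R]_n) (x : 'rV[R]_n) : int :=
  sgz (\det (jacobian f x)).

(* z is the fixed point index of the self map g of B: after embedding B in R^N
   as a neighbourhood retract (iota, rho), z is the Brouwer degree over 0 of
   id - iota g rho on a bounded open neighbourhood W of B, computed from a
   uniform approximation h that is C^1 on W and has 0 as a regular value.  Such
   embeddings exist for the finite-dimensional compact ANRs, in particular for
   finite CW complexes. *)
Definition is_fixed_point_index (Y : topologicalType) (B : set Y) (g : Y -> Y)
    (z : int) : Prop :=
  exists (N : nat) (iota : Y -> 'rV[R]_N) (rho : 'rV[R]_N -> Y)
         (W : set 'rV[R]_N) (h : 'rV[R]_N -> 'rV[R]_N) (e : R) (s : seq 'rV[R]_N),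
    let F := fun x => x - iota (g (rho x)) in
    [/\ [/\ {within B, continuous iota},
            {within closure W, continuous rho},
            forall y, B y -> W (iota y) /\ rho (iota y) = y &
            forall x, closure W x -> B (rho x)],
        [/\ open W, bounded_set W, 0 < e &
            forall x, closure W x -> ~ W x -> e <= `|F x|],
        [/\ {within closure W, continuous h},
            forall x, closure W x -> `|h x - F x| < e &
            forall x, W x -> C1_at h x] &
        [/\ uniq s,
            forall x, x \in s <-> W x /\ h x = 0,
            forall x, x \in s -> \det (jacobian h x) != 0 &
            z = \sum_(x <- s) jacobian_sign h x]].

Definition fixed_point_index (Y : topologicalType) (B : set Y) (g : Y -> Y) : int :=
  xget 0 [set z | is_fixed_point_index B g z].

End FixedPointIndex.
Arguments fixed_point_index R {Y} B g.

Section FixedOrbitIndex.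
Variables (R : realType) (G : topologicalGroupType).

Section OrbitSpace.
Variable X : gspace G.

Definition orbit_rel (x y : X) : bool := `[< exists g, act g x = y >].

Lemma orbit_rel_refl : reflexive orbit_rel.
Proof. by move=> x; apply/asboolP; exists 1%g; rewrite act1. Qed.

Lemma orbit_rel_sym : symmetric orbit_rel.
Proof.
by move=> x y; apply/asboolP/asboolP => -[g <-]; exists g^-1%g;
  rewrite -actM mulVg act1.
Qed.

Lemma orbit_rel_trans : transitive orbit_rel.
Proof.
move=> y x z /asboolP[g <-] /asboolP[h <-]; apply/asboolP.
by exists (h * g)%g; rewrite actM.
Qed.

Definition orbit_equiv := EquivRel _ orbit_rel_refl orbit_rel_sym orbit_rel_trans.

Definition orbit_space := {eq_quot orbit_equiv}.
HB.instance Definition _ := Topological.copy orbit_space (quotient_topology orbit_space).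
HB.instance Definition _ := Quotient.on orbit_space.

Definition orbit_of (x : X) : orbit_space := \pi_orbit_space x.

Definition orbit_map (f : X -> X) (q : orbit_space) : orbit_space :=
  orbit_of (f (repr q)).

Definition stratum_ge (H : closed_subgroup G) : set X :=
  [set x | subconj (subgroup_set H) (isotropy x)].

Definition stratum_gt (H : closed_subgroup G) : set X :=
  [set x | stratum_ge H x /\ ~ conjugate (subgroup_set H) (isotropy x)].

Definition orbit_types : set (conj_class G) :=
  [set c | exists x : X, conjugate (subgroup_set (repr c)) (isotropy x)].

Definition fixed_orbit_index (f : X -> X) : Ugroup G :=
  \sum_(c \in orbit_types)
    << fixed_point_index R (orbit_of @` stratum_ge (repr c)) (orbit_map f)
     - fixed_point_index R (orbit_of @` stratum_gt (repr c)) (orbit_map f) *g c >>.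

Definition reduced_fixed_orbit_index (f : X -> X) : Ugroup G :=
  fixed_orbit_index f - class_of (full_subgroup G).

End OrbitSpace.
End FixedOrbitIndex.
Arguments reduced_fixed_orbit_index R {G X} f.

Section GCW.
Variables (R : realType) (G : topologicalGroupType).

(* A family of n-cells s, n >= 0, of types H = cell_type s, with characteristic
   maps G/H * D^n -> X. *)
Record cell_family (X : pgspace G) := CellFamily {
  cell : nat -> finType;
  cell_type : forall n, cell n -> closed_subgroup G;
  cell_char : forall n (s : cell n), coset (cell_type s) * disc R n -> X }.

Arguments cell_type {X c n} s.
Arguments cell_char {X c n} s _.

Definition skeleton (X : pgspace G) (C : cell_family X) (n : nat) : set X :=
  [set x | exists m (s : cell C m) p, (m <= n)%N /\ cell_char s p = x].

(* A finite pointed G-CW structure.  gcw_part says that X is the disjoint union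
   of the open cells, on which the characteristic maps are injective, and
   gcw_top that X_n, as a subspace of X, has the quotient topology from its
   cells, i.e. that X_n is obtained from X_{n-1} by attaching the n-cells along
   their boundaries. *)
Record gcw (X : pgspace G) := GCW {
  gcw_cells :> cell_family X;
  gcw_dim : nat;
  gcw_finite : forall n, (gcw_dim < n)%N -> cell gcw_cells n -> False;
  gcw_continuous : forall n (s : cell gcw_cells n), continuous (cell_char s);
  gcw_act : forall n (s : cell gcw_cells n) g c d,
    cell_char s (coset_act g c, d) = act g (cell_char s (c, d));
  gcw_part : forall x : X,
    exists! p : {n : nat & {s : cell gcw_cells n & (coset (cell_type s) * disc R n)%type}},
      let q := tagged (tagged p) in disc_interior q.2 /\ cell_char _ q = x;
  gcw_boundary : forall n (s : cell gcw_cells n) c d, ~ disc_interior d ->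
    exists2 m, (m < n)%N & skeleton gcw_cells m (cell_char s (c, d));
  gcw_top : forall n (A : set X), A `<=` skeleton gcw_cells n ->
    (closed A <-> forall m (s : cell gcw_cells m), (m <= n)%N ->
       closed (cell_char s @^-1` A));
  gcw_base : exists s : cell gcw_cells 0,
    cell_type s = full_subgroup G /\ forall p, cell_char s p = pg_pt X }.

Definition cellular (X : pgspace G) (C : gcw X) (f : X -> X) : Prop :=
  forall n x, skeleton C n x -> skeleton C n (f x).

Section CellMaps.
Variables (X : pgspace G) (C : gcw X) (n : nat).

(* The projection X_n -> X_n/X_{n-1} -> G/K_+ /\ S^n to the n-cell t of type K. *)
Definition cell_proj (t : cell C n) (x : X) : half_smash R (cell_type t) n :=
  xget (pg_pt (half_smash R (cell_type t) n)) [set z | exists c d, [/\ disc_interior d,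
    cell_char t (c, d) = x & z = smash_of (cell_type t) c (wrap d)]].

(* The composite k of inclusion of the cell s, f and projection to the cell t.
   When f is cellular the value does not depend on (c, d); for n = 0 the base
   point is not of the form [c, wrap d] and goes to the base point. *)
Definition cell_map (f : X -> X) (s t : cell C n)
    (z : half_smash R (cell_type s) n) : half_smash R (cell_type t) n :=
  xget (pg_pt (half_smash R (cell_type t) n)) [set w | exists c d,
    z = smash_of (cell_type s) c (wrap d) /\ w = cell_proj t (f (cell_char s (c, d)))].

End CellMaps.
End GCW.
Arguments gcw R {G} X.
Arguments skeleton {R G X} C n.
Arguments cell_type {R G X c n} s.
Arguments cell_char {R G X c n} s _.

Section LocalDegree.
Variables (R : realType) (n : nat).

Definition radial_extension (k : sphere R n -> sphere R n) (y : 'rV[R]_n.+1) : 'rV[R]_n.+1 :=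
  let r := Num.sqrt (normsq y) in
  r *: set_val (k (insubd sphere_pt (r^-1 *: y))).

(* The self map k of S^n is C^1 near x and its differential
   T_x S^n -> T_{k x} S^n is invertible if and only if the radial extension
   y |-> |y| k(y/|y|) has these properties.  It sends x to k x, so its
   determinant at x has the sign of that of the differential of k in oriented
   bases of the tangent spaces; this sign is the local degree. *)
Definition regular_at (k : sphere R n -> sphere R n) (x : sphere R n) : Prop :=
  C1_at (radial_extension k) (set_val x) /\
  \det (jacobian (radial_extension k) (set_val x)) != 0.

Definition local_degree (k : sphere R n -> sphere R n) (x : sphere R n) : int :=
  jacobian_sign (radial_extension k) (set_val x).

End LocalDegree.

Section OrbitMaps.
Variables (R : realType) (G : topologicalGroupType).
Implicit Types H K L : closed_subgroup G.

Definition orbit_gmap H K :=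
  {f : coset_space H -> coset_space K | `[< is_gmap f >]}.
HB.instance Definition _ H K := SubChoice.on (orbit_gmap H K).

Lemma orbit_gmapP H K (f : orbit_gmap H K) : is_gmap (val f).
Proof. exact/asboolP/(valP f). Qed.

Lemma orbit_id_subproof H : `[< @is_gmap _ (coset_space H) (coset_space H) idfun >].
Proof. by apply/asboolP; split => // x; exact: cvg_id. Qed.

Definition orbit_id H : orbit_gmap H H := exist _ idfun (orbit_id_subproof H).

Lemma orbit_comp_subproof H K L (k : orbit_gmap K L) (f : orbit_gmap H K) :
  `[< @is_gmap _ (coset_space H) (coset_space L) (val k \o val f) >].
Proof.
have [[ck kE] [cf fE]] := (orbit_gmapP k, orbit_gmapP f).
apply/asboolP; split => [x|g x /=]; last by rewrite fE kE.
by apply: (@continuous_comp _ _ _ (val f) (val k)); [exact: cf|exact: ck].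
Qed.

Definition orbit_comp H K L (k : orbit_gmap K L) (f : orbit_gmap H K) :
  orbit_gmap H L := exist _ (val k \o val f) (orbit_comp_subproof k f).

Section Classes.
Variables H K : closed_subgroup G.

Definition orbit_htpy_rel (f f' : orbit_gmap H K) : bool :=
  `[< ghomotopic R (val f) (val f') >].

Lemma orbit_htpy_rel_refl : reflexive orbit_htpy_rel.
Proof. by move=> f; apply/asboolP; exact/ghomotopic_refl/orbit_gmapP. Qed.

Lemma orbit_htpy_rel_sym : symmetric orbit_htpy_rel.
Proof. by move=> f f'; apply/asboolP/asboolP; exact: ghomotopic_sym. Qed.

Lemma orbit_htpy_rel_trans : transitive orbit_htpy_rel.
Proof.
move=> f2 f1 f3 /asboolP h /asboolP k; apply/asboolP.
exact: ghomotopic_trans h k.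
Qed.

Definition orbit_htpy_equiv :=
  EquivRel _ orbit_htpy_rel_refl orbit_htpy_rel_sym orbit_htpy_rel_trans.

Definition orbit_hom := {eq_quot orbit_htpy_equiv}.
HB.instance Definition _ := Quotient.on orbit_hom.
HB.instance Definition _ := Choice.on orbit_hom.

Definition hom_of (f : orbit_gmap H K) : orbit_hom := \pi_orbit_hom f.

Lemma hom_ofP f f' : hom_of f = hom_of f' <-> ghomotopic R (val f) (val f').
Proof. by split=> [/eqmodP/asboolP//|ff']; apply/eqmodP/asboolP. Qed.

Lemma hom_ofK a : hom_of (repr a) = a.
Proof. exact: reprK. Qed.
End Classes.

Definition hom_id H : orbit_hom H H := hom_of (orbit_id H).

Definition hom_comp H K L (b : orbit_hom K L) (a : orbit_hom H K) : orbit_hom H L :=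
  hom_of (orbit_comp (repr b) (repr a)).

Lemma hom_compE H K L (k : orbit_gmap K L) (f : orbit_gmap H K) :
  hom_comp (hom_of k) (hom_of f) = hom_of (orbit_comp k f).
Proof.
apply/hom_ofP; apply: ghomotopic_comp; try exact: orbit_gmapP.
  by apply/hom_ofP; exact: hom_ofK.
by apply/hom_ofP; exact: hom_ofK.
Qed.

Lemma hom_compA H K L M (c : orbit_hom L M) (b : orbit_hom K L) (a : orbit_hom H K) :
  hom_comp c (hom_comp b a) = hom_comp (hom_comp c b) a.
Proof.
rewrite -[a]hom_ofK -[b]hom_ofK -[c]hom_ofK !hom_compE.
by congr hom_of; exact/val_inj.
Qed.

Lemma hom_comp1 H K (a : orbit_hom H K) : hom_comp a (hom_id H) = a.
Proof. by rewrite -[a]hom_ofK hom_compE; congr hom_of; exact/val_inj. Qed.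

Lemma hom_1comp H K (a : orbit_hom H K) : hom_comp (hom_id K) a = a.
Proof. by rewrite -[a]hom_ofK hom_compE; congr hom_of; exact/val_inj. Qed.

End OrbitMaps.

(* The isotropy ring of the full subcategory of the (homotopy) orbit category
   on the orbits G/H, H in O. *)
Section IsotropyRing.
Variables (R : realType) (G : topologicalGroupType) (O : {fset closed_subgroup G}).

Definition hom_family (p : O * O) : choiceType :=
  orbit_hom R (fsval p.1) (fsval p.2).

Definition orbit_mor := {p : O * O & hom_family p}.
HB.instance Definition _ := Choice.on orbit_mor.

Definition mor_src (m : orbit_mor) : O := (tag m).1.
Definition mor_tgt (m : orbit_mor) : O := (tag m).2.

Definition mor (H K : O) (a : orbit_hom R (fsval H) (fsval K)) : orbit_mor :=
  Tagged hom_family (a : hom_family (H, K)).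

Definition mor_hom (m : orbit_mor) :
  orbit_hom R (fsval (mor_src m)) (fsval (mor_tgt m)) := tagged m.

Lemma morK m : mor (mor_hom m) = m.
Proof. by case: m => -[]. Qed.

Definition isotropy_ring := {freeg orbit_mor}.
HB.instance Definition _ := GRing.Zmodule.on isotropy_ring.
HB.instance Definition _ := GRing.Lmodule.on isotropy_ring.

Definition mor_comp (b a : orbit_mor) : isotropy_ring :=
  if mor_tgt a =P mor_src b is ReflectT e then
    << mor (hom_comp (mor_hom b)
             (ecast K (orbit_hom R (fsval (mor_src a)) (fsval K)) e (mor_hom a))) >>
  else 0.

Definition isotropy_mul (x y : isotropy_ring) : isotropy_ring :=
  fglift (fun b => fglift (mor_comp b) y : isotropy_ring) x.

Definition isotropy_one : isotropy_ring :=
  \sum_(H : O) << mor (hom_id R (fsval H)) >>.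

Lemma mor_compE (H K L : O) (b : orbit_hom R (fsval K) (fsval L))
    (a : orbit_hom R (fsval H) (fsval K)) :
  mor_comp (mor b) (mor a) = << mor (hom_comp b a) >>.
Proof.
rewrite /mor_comp; case: eqP => // e.
by rewrite (eq_irrelevance e (erefl K)).
Qed.

Lemma mor_comp0 (b a : orbit_mor) : mor_tgt a <> mor_src b -> mor_comp b a = 0.
Proof. by rewrite /mor_comp; case: eqP. Qed.

Lemma isotropy_ind (P : isotropy_ring -> Prop) :
  P 0 -> (forall x y, P x -> P y -> P (x + y)) -> (forall x, P x -> P (- x)) ->
  (forall H K (a : orbit_hom R (fsval H) (fsval K)), P << @mor H K a >>) ->
  forall x, P x.
Proof.
move=> P0 PD PN PU; apply: freeg_ind_dom0 => // k m x _ _ Px.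
apply: (PD) => //.
have Pm : P << m >> by have := PU _ _ (mor_hom m); rewrite morK.
have Pn n : P (<< m >> *+ n).
  elim: n => [|n IH]; first by rewrite mulr0n.
  by rewrite mulrS; apply: (PD).
have -> : << k *g m >> = << m >> *~ k :> isotropy_ring by rewrite freegU_mulz intz.
case: k => n; first exact: Pn.
by rewrite NegzE mulrNz; apply: PN; exact: Pn.
Qed.

Lemma fglift_isoB (f : orbit_mor -> isotropy_ring) (x y : isotropy_ring) :
  fglift f (x - y) = fglift f x - fglift f y.
Proof. exact: (lift_is_additive f x y). Qed.

Lemma fglift_isoN (f : orbit_mor -> isotropy_ring) (x : isotropy_ring) :
  fglift f (- x) = - fglift f x.
Proof. by rewrite -[- x]sub0r -(subrr x) !fglift_isoB subrr sub0r. Qed.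

Lemma fglift_isoD (f : orbit_mor -> isotropy_ring) (x y : isotropy_ring) :
  fglift f (x + y) = fglift f x + fglift f y.
Proof. by rewrite -[y]opprK fglift_isoB (fglift_isoN _ (- y)). Qed.

Lemma isotropy_mulDl : left_distributive isotropy_mul +%R.
Proof. by move=> x y z; exact: fglift_isoD. Qed.

Lemma isotropy_mulNl x y : isotropy_mul (- x) y = - isotropy_mul x y.
Proof. exact: fglift_isoN. Qed.

Lemma isotropy_mul0l y : isotropy_mul 0 y = 0.
Proof. by apply: (addrI (isotropy_mul 0 y)); rewrite -isotropy_mulDl !addr0. Qed.

Lemma isotropy_mulU b y : isotropy_mul << b >> y = fglift (mor_comp b) y.
Proof. by rewrite /isotropy_mul liftU scale1r. Qed.

Lemma isotropy_mulUU b a : isotropy_mul << b >> << a >> = mor_comp b a.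
Proof. by rewrite isotropy_mulU liftU scale1r. Qed.

Lemma isotropy_mulDr : right_distributive isotropy_mul +%R.
Proof.
move=> x y z; elim/isotropy_ind: x => [|x x' IH IH'|x IH|H K a].
- by rewrite !isotropy_mul0l addr0.
- by rewrite !isotropy_mulDl IH IH' addrACA.
- by rewrite !isotropy_mulNl IH opprD.
- by rewrite !isotropy_mulU fglift_isoD.
Qed.

Lemma isotropy_mul0r x : isotropy_mul x 0 = 0.
Proof. by apply: (addrI (isotropy_mul x 0)); rewrite -isotropy_mulDr !addr0. Qed.

Lemma isotropy_mulNr x y : isotropy_mul x (- y) = - isotropy_mul x y.
Proof.
by apply: (addrI (isotropy_mul x y)); rewrite -isotropy_mulDr !subrr isotropy_mul0r.
Qed.

Lemma isotropy_mulA : associative isotropy_mul.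
Proof.
move=> x y z; elim/isotropy_ind: x => [|x x' IH IH'|x IH|K3 K4 c].
- by rewrite !isotropy_mul0l.
- by rewrite !isotropy_mulDl IH IH'.
- by rewrite !isotropy_mulNl IH.
elim/isotropy_ind: y => [|y y' IH IH'|y IH|K2 K3' b].
- by rewrite isotropy_mul0r !isotropy_mul0l isotropy_mul0r.
- by rewrite isotropy_mulDl !isotropy_mulDr IH IH' isotropy_mulDl.
- by rewrite isotropy_mulNl !isotropy_mulNr IH isotropy_mulNl.
elim/isotropy_ind: z => [|z z' IH IH'|z IH|K1 K2' a].
- by rewrite !isotropy_mul0r.
- by rewrite !isotropy_mulDr IH IH'.
- by rewrite !isotropy_mulNr IH.
rewrite !isotropy_mulUU.
have [e1|ne1] := pselect (K2' = K2); have [e2|ne2] := pselect (K3' = K3).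
- by subst K2' K3'; rewrite !mor_compE !isotropy_mulUU !mor_compE hom_compA.
- subst K2'; rewrite mor_compE (@mor_comp0 _ (mor b))// isotropy_mul0l.
  by rewrite isotropy_mulUU mor_comp0.
- subst K3'; rewrite mor_compE (@mor_comp0 (mor b))// isotropy_mul0r.
  by rewrite isotropy_mulUU mor_comp0.
- by rewrite !mor_comp0// isotropy_mul0l isotropy_mul0r.
Qed.

Lemma isotropy_mul_suml (F : O -> isotropy_ring) y :
  isotropy_mul (\sum_H F H) y = \sum_H isotropy_mul (F H) y.
Proof.
by apply: (big_morph (isotropy_mul^~ y)) => [u v|]; rewrite ?isotropy_mulDl ?isotropy_mul0l.
Qed.

Lemma isotropy_mul_sumr (F : O -> isotropy_ring) x :
  isotropy_mul x (\sum_H F H) = \sum_H isotropy_mul x (F H).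
Proof.
by apply: (big_morph (isotropy_mul x)) => [u v|]; rewrite ?isotropy_mulDr ?isotropy_mul0r.
Qed.

Lemma isotropy_mul1l : left_id isotropy_one isotropy_mul.
Proof.
move=> y; elim/isotropy_ind: y => [|y y' IH IH'|y IH|H K a].
- by rewrite isotropy_mul0r.
- by rewrite isotropy_mulDr IH IH'.
- by rewrite isotropy_mulNr IH.
rewrite /isotropy_one isotropy_mul_suml (bigD1 K)//= isotropy_mulUU mor_compE hom_1comp.
rewrite big1 ?addr0// => L /eqP LK; rewrite isotropy_mulUU mor_comp0//.
by move=> e; apply: LK; exact: esym e.
Qed.

Lemma isotropy_mul1r : right_id isotropy_one isotropy_mul.
Proof.
move=> y; elim/isotropy_ind: y => [|y y' IH IH'|y IH|H K a].
- by rewrite isotropy_mul0l.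
- by rewrite isotropy_mulDl IH IH'.
- by rewrite isotropy_mulNl IH.
rewrite /isotropy_one isotropy_mul_sumr (bigD1 H)//= isotropy_mulUU mor_compE hom_comp1.
by rewrite big1 ?addr0// => L /eqP LH; rewrite isotropy_mulUU mor_comp0.
Qed.

HB.instance Definition _ := GRing.Zmodule_isPzRing.Build isotropy_ring
  isotropy_mulA isotropy_mul1l isotropy_mul1r isotropy_mulDl isotropy_mulDr.

Definition orbit_idem (H : O) : isotropy_ring := << mor (hom_id R (fsval H)) >>.

Lemma orbit_idemE (H : O) : orbit_idem H * orbit_idem H = orbit_idem H.
Proof. by rewrite [LHS]isotropy_mulUU mor_compE hom_1comp. Qed.

Lemma orbit_idem_mor (H K : O) (a : orbit_hom R (fsval H) (fsval K)) :
  orbit_idem K * << mor a >> = << mor a >>.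
Proof. by rewrite [LHS]isotropy_mulUU mor_compE hom_1comp. Qed.

Definition isotropy_eps : isotropy_ring -> Ugroup G :=
  fglift (fun m : orbit_mor =>
    if mor_src m == mor_tgt m then class_of (fsval (mor_src m)) else 0).

End IsotropyRing.

(* Right S-modules are left modules over the opposite ring S^c. *)
Section HattoriStallings.
Variable S : pzRingType.

(* The additive subgroup [S, S]. *)
Definition commutators : set S :=
  [set u | exists m (a b : 'I_m -> S), u = \sum_j (a j * b j - b j * a j)].

(* Tr(phi), as a coset of [S, S]: write phi as the image under theta of
   sum_j (x_j tensor xi_j) and take the class of sum_j xi_j(x_j). *)
Definition hs_trace (P : lmodType S^c) (phi : P -> P) : set S :=
  [set t | exists m (x : 'I_m -> P) (xi : 'I_m -> {linear P -> (S^c)^o}),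
    (forall y, phi y = \sum_j (xi j y : S^c) *: x j) /\
    commutators (t - \sum_j (xi j (x j) : S))].

(* The direct sum over s in J of the right ideals e_s S, for a family of idempotents e. *)
Variables (J : finType) (e : J -> S).

Definition idem_sum : {pred {ffun J -> (S^c)^o}} :=
  [pred v : {ffun J -> (S^c)^o} | [forall s, (e s * (v s : S) == v s :> S)]].

Lemma idem_sumP (v : {ffun J -> (S^c)^o}) :
  reflect (forall s, e s * (v s : S) = (v s : S)) (v \in idem_sum).
Proof.
apply: (iffP forallP) => H s; first exact/eqP/H.
by apply/eqP/H.
Qed.

Lemma idem_sum_submod : submod_closed idem_sum.
Proof.
split=> [|a u v /idem_sumP Hu /idem_sumP Hv].
  by apply/idem_sumP => s; rewrite ffunE; exact: mulr0.
apply/idem_sumP => s; rewrite !ffunE.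
transitivity (e s * ((u s : S) * (a : S) + (v s : S))); first by [].
by rewrite mulrDr mulrA Hu Hv.
Qed.

HB.instance Definition _ := GRing.isSubmodClosed.Build _ _ idem_sum idem_sum_submod.

Definition idem_module := {v : {ffun J -> (S^c)^o} | v \in idem_sum}.
HB.instance Definition _ := SubChoice.on idem_module.
HB.instance Definition _ := [SubChoice_isSubLmodule of idem_module by <:].

(* The endomorphism with matrix A acting from the left; A t s is a morphism
   from the s-th to the t-th summand. *)
Section MatrixMap.
Variable A : J -> J -> S.
Hypothesis eA : forall t s, e t * A t s = A t s.

Definition mx_apply (v : {ffun J -> (S^c)^o}) : {ffun J -> (S^c)^o} :=
  [ffun t => \sum_s A t s * (v s : S)].

Lemma mx_apply_subproof (v : idem_module) : mx_apply (val v) \in idem_sum.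
Proof.
apply/idem_sumP => t; rewrite ffunE.
transitivity (e t * (\sum_s A t s * (val v s : S))) => //.
by rewrite mulr_sumr; apply: eq_bigr => s _; rewrite mulrA eA.
Qed.

Definition mx_map (v : idem_module) : idem_module :=
  exist (fun w => w \in idem_sum) _ (mx_apply_subproof v).
End MatrixMap.
End HattoriStallings.

Section HomologicalLefschetz.
Variables (R : realType) (G : topologicalGroupType).

(* A pointed G-homotopy from k to a map k' whose induced self map of S^n is
   transverse to -1, with the points x of the preimage of -1 and the G-maps psi
   given by k'([g], x) = (psi [g], -1). *)
Record transverse_deformation (H K : closed_subgroup G) (n : nat)
    (k : half_smash R H n -> half_smash R K n) := TransverseDeformation {
  td_map : half_smash R H n -> half_smash R K n;
  td_gmap : is_pgmap td_map;
  td_homotopic : pghomotopic R k td_map;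
  td_points : seq (sphere R n * orbit_gmap H K);
  td_uniq : uniq (unzip1 td_points);
  td_preimage : forall x,
    x \in unzip1 td_points <-> sphere_map td_map x = sphere_antipt;
  td_regular : forall p, p \in td_points -> regular_at (sphere_map td_map) p.1;
  td_psi : forall p, p \in td_points -> forall c,
    td_map (smash_of H c p.1) = smash_of K (val p.2 c) sphere_antipt }.

Variables (X : pgspace G) (C : gcw R X) (f : X -> X).
Variables (O : {fset closed_subgroup G}).
Hypothesis CO : forall n (s : cell C n), cell_type s \in O.

Definition cell_orbit n (s : cell C n) : O := [` CO s]%fset.

Definition cell_deformations : Type :=
  forall n (s t : cell C n), transverse_deformation (@cell_map R G X C n f s t).

Variable D : cell_deformations.

Definition chain_coeff n (t s : cell C n) : isotropy_ring R O :=
  \sum_(p <- td_points (D s t))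
    << local_degree (sphere_map (td_map (D s t))) p.1 *g
       mor (H := cell_orbit s) (K := cell_orbit t) (hom_of R p.2) >>.

Definition cell_idem n (s : cell C n) : isotropy_ring R O :=
  orbit_idem R (cell_orbit s).

Lemma chain_coeff_idem n (t s : cell C n) :
  cell_idem t * chain_coeff t s = chain_coeff t s.
Proof.
rewrite /chain_coeff mulr_sumr; apply: eq_bigr => p _.
set k := local_degree _ _; set m := mor _.
have -> : << k *g m >> = << m >> *~ k :> isotropy_ring R O.
  by rewrite freegU_mulz intz.
by rewrite mulrzAr orbit_idem_mor.
Qed.

(* C_n^G(X; I) and C_n^G(f; I). *)
Definition cell_module n := idem_module (@cell_idem n).

Definition cell_chain_map n : cell_module n -> cell_module n :=
  mx_map (@chain_coeff_idem n).

(* epsilon on I^ab, whose elements are the cosets of [I, I]. *)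
Definition eps_ab (u : set (isotropy_ring R O)) : Ugroup G :=
  xget 0 (@isotropy_eps R G O @` u).

Definition hom_lefschetz : Ugroup G :=
  \sum_(n < (gcw_dim C).+1) (-1) ^+ n *: eps_ab (hs_trace (@cell_chain_map n)).

Definition reduced_hom_lefschetz : Ugroup G :=
  hom_lefschetz - class_of (full_subgroup G).

End HomologicalLefschetz.

(* Main.v *)
(* The fixed point index of a self map g of a finite CW complex is a sum over
   cells: an n-cell s contributes (-1)^n times the degree of the self map of
   S^n obtained from g by including s and projecting to s.  Applied to the orbit
   spaces X_{>=(H)}/G and X_{>(H)}/G, this makes the reduced fixed orbit index
   a sum over the cells of X, weighted by their orbit types; the local degrees
   of the diagonal of the cellular matrix add up to the same degrees, and the
   Hattori-Stallings trace is the sum of that diagonal.  For a wedge of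
   1-spheres the degree on the circle is the winding number, which lifting
   singular simplices to the line identifies with the trace on H_1.

   The degree counts zeros on a fine triangulated grid, as the cup product of
   the coboundaries of the sign functions of the coordinates; it is computed
   through the linear parts at the zeros of a regular approximation. *)

(* The property that carries the argument is commutativity: [x - psi (phi x)] and [y - phi (psi y)]
   have the same degree, since suspensions of both deform to [(x - psi y, y - phi x)]. It makes the
   index independent of the embedding, and it moves local contributions between a cell, a sphere and
   the ambient space. The obstacle to a sum over cells is that fixed points need not keep away from
   the boundaries of the cells. The map is therefore composed with a radial expansion of the n-cells
   that sends the outer half of each into the lower skeleton; the fixed points then split into those
   near the lower skeleton and those in the inner halves. Sard's theorem is replaced by an
   approximation made of bump functions on translated lattices, whose Jacobian at a zero is a
   monomial matrix. The index is computed without homology. Singular homology is needed for the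
   circle alone, where it comes from the covering by the line: on chains of the line, translation by
   one turn minus the identity is injective, and it can be inverted on the chains that project to
   0. *)
Require Import Defs.
From HB Require Import structures.
From mathcomp Require Import all_boot all_order all_algebra all_fingroup finmap generic_quotient.
From mathcomp Require Import all_classical all_reals.
From mathcomp Require Import topology normedtype derive realfun trigo wedge_sigT.
From mathcomp Require Import freeg ring lra zify.
From mathcomp Require landau.

Set Implicit Arguments.
Unset Strict Implicit.
Unset Printing Implicit Defensive.

Import Defs.
Import Order.TTheory GRing.Theory Num.Theory numFieldNormedType.Exports.

Local Open Scope classical_set_scope.
Local Open Scope ring_scope.
Local Open Scope quotient_scope.

(** * Counting zeros on a grid *)
Section CupProduct.
Variable T : Type.
Implicit Types (u w : T -> int) (us : seq (T -> int)) (ps : seq T).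

(* The evaluation of [du_1 \cup ... \cup du_n] on the ordered simplex [ps]. *)
Fixpoint cup us ps : int :=
  match us, ps with
  | [::], _ => 1
  | u :: us', p :: ((q :: _) as ps') => (u q - u p) * cup us' ps'
  | _, _ => 0
  end.

(* The evaluation of [du_1 \cup ... \cup w \cup ... \cup du_n]. *)
Fixpoint cupw us w vs ps : int :=
  match us, ps with
  | [::], p :: _ => w p * cup vs ps
  | u :: us', p :: ((q :: _) as ps') => (u q - u p) * cupw us' w vs ps'
  | _, _ => 0
  end.

Definition omit k ps := take k ps ++ drop k.+1 ps.

(** The simplicial coboundary of the cochain [c], that is, [c] evaluated on the boundary of [ps]. *)
Definition alt (c : seq T -> int) ps : int := \sum_(k < size ps) (-1) ^+ k * c (omit k ps).

Lemma alt_cons c p ps : alt c (p :: ps) = c ps - alt (fun qs => c (p :: qs)) ps.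
Proof.
rewrite /alt /= big_ord_recl /= expr0 mul1r /omit /= drop0; congr (_ + _).
by rewrite -sumrN; apply: eq_bigr => k _; rewrite /= /bump /= add1n exprS mulN1r mulNr.
Qed.

Lemma altZ (x : int) c ps : alt (fun qs => x * c qs) ps = x * alt c ps.
Proof. by rewrite /alt mulr_sumr; apply: eq_bigr => k _; rewrite mulrCA. Qed.

(** A cup product of coboundaries is a cocycle; the induction peels off the first two vertices. *)
Lemma alt_cup us ps : size ps = (size us).+2 -> alt (cup us) ps = 0.
Proof.
elim: us ps => [|u us IH] [|p [|q ps]]//= => [|[sps]].
  by case: ps => // _; rewrite !alt_cons /alt big_ord0 /= subr0 subrr.
case: ps sps => // r ps [sps].
have := IH [:: q, r & ps]; rewrite /= sps => /(_ erefl); rewrite alt_cons => /subr0_eq e.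
by rewrite alt_cons [alt _ (q :: _)]alt_cons /= altZ -e; ring.
Qed.

(** Leibniz rule: [w] is the only factor that is not closed, and the sign counts the factors before
    it. *)
Lemma alt_cupw us w vs ps : size ps = (size us + size vs).+2 ->
  alt (cupw us w vs) ps = (-1) ^+ size us * cup (us ++ w :: vs) ps.
Proof.
elim: us ps => [|u us IH] [|p [|q ps]]//= => [|[sps]].
  rewrite add0n => -[sps]; rewrite alt_cons /= expr0 mul1r altZ.
  have := @alt_cup vs [:: p, q & ps]; rewrite /= sps => /(_ erefl).
  by rewrite alt_cons => /subr0_eq <-; ring.
rewrite addSn in sps; case: ps sps => // r ps [sps].
have := IH [:: q, r & ps]; rewrite /= sps => /(_ erefl); rewrite alt_cons => /(canRL (subrK _)) e.
rewrite alt_cons [alt _ (q :: _)]alt_cons /= altZ exprS; move: e; set A := alt _ _ => /= e.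
have -> : A = cupw us w vs (r :: ps) - (-1) ^+ size us * cup (us ++ w :: vs) [:: q, r & ps].
  by rewrite e; ring.
by ring.
Qed.

(** Membership is [List.In] because [T] has no decidable equality here. *)
Definition const_on u ps := forall p q, List.In p ps -> List.In q ps -> u p = u q.

Lemma cup_const u us ps : List.In u us -> const_on u ps -> cup us ps = 0.
Proof.
elim: us ps => //= v us IH [|p [|q ps]]// [->|uus] cu.
  by rewrite (cu q p) /= ?subrr ?mul0r//; [right; left|left].
by rewrite IH ?mulr0// => x y xps yps; apply: cu => /=; right.
Qed.

Lemma cupw_const u us w vs ps : List.In u (us ++ vs) -> const_on u ps ->
  cupw us w vs ps = 0.
Proof.
elim: us ps => /= [|v us IH] [|p ps]//.
  by move=> uv cu; rewrite (cup_const uv cu) mulr0.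
case: ps => [|q ps]// [->|uus] cu.
  by rewrite (cu q p) /= ?subrr ?mul0r//; [right; left|left].
by rewrite IH ?mulr0// => x y xps yps; apply: cu => /=; right.
Qed.

Lemma cupw_zero us w vs ps : (forall p, List.In p ps -> w p = 0) ->
  cupw us w vs ps = 0.
Proof.
elim: us ps => /= [|v us IH] [|p ps]//.
  by move=> w0; rewrite w0 ?mul0r//=; left.
by case: ps => [|q ps]// w0; rewrite IH ?mulr0// => x xps; apply: w0; right.
Qed.

Lemma cup_lin us u v vs ps :
  cup (us ++ (fun p => u p - v p) :: vs) ps = cup (us ++ u :: vs) ps - cup (us ++ v :: vs) ps.
Proof.
elim: us ps => [|x us IH] [|p [|q ps]]//=; try by rewrite ?subr0 ?subrr.
  by ring.
by rewrite IH; ring.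
Qed.
End CupProduct.

Section Grid.
Variable N : nat.
Local Notation Z := 'rV[int]_N.
Implicit Types (a b : Z) (s : 'S_N) (u v : 'I_N -> Z -> int) (c : seq Z -> int).

Definition vertex a s (k : nat) : Z := a + \sum_(l < N | (l < k)%N) delta_mx 0 (s l).

Definition simplex_path a s : seq Z := [seq vertex a s k | k <- iota 0 N.+1].

(* The sum over the simplices of the Freudenthal triangulation of the cube at [a]. *)
Definition cube_sum c a : int := \sum_(s : 'S_N) (-1) ^+ s * c (simplex_path a s).

(** The discrete counterpart of integrating the form [du_1 ... du_N] over the unit cube at [a]. *)
Definition grid_jac u a : int := cube_sum (cup [seq u i | i <- enum 'I_N]) a.

Lemma size_simplex_path a s : size (simplex_path a s) = N.+1.
Proof. by rewrite size_map size_iota. Qed.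

Lemma vertex0 a s : vertex a s 0 = a.
Proof. by rewrite /vertex big_pred0 ?addr0// => l; rewrite ltn0. Qed.

Lemma vertexS a s (k : 'I_N) : vertex a s k.+1 = vertex a s k + delta_mx 0 (s k).
Proof.
rewrite /vertex (bigD1 k) ?ltnSn//= -addrA; congr (_ + _); rewrite addrC; congr (_ + _).
by apply: eq_bigl => l; rewrite ltnS ltn_neqAle andbC.
Qed.

Lemma vertex_cube a s k i : vertex a s k 0 i = a 0 i \/ vertex a s k 0 i = a 0 i + 1.
Proof.
rewrite /vertex mxE summxE.
under eq_bigr do rewrite mxE eqxx /=.
have [lk|kl] := ltnP ((s^-1)%g i) k; [right|left].
  rewrite (bigD1 ((s^-1)%g i))//= permKV eqxx big1 ?addr0// => l /andP[_ ne].
  by case: eqP => // e; move: ne; rewrite e permK eqxx.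
rewrite big1 ?addr0// => l lk; case: eqP => // e.
by move: kl; rewrite e permK leqNgt lk.
Qed.

Lemma vertex_tperm a s (j k : 'I_N) (m : nat) : k = j.+1 :> nat -> m != k :> nat ->
  vertex a (tperm j k * s)%g m = vertex a s m.
Proof.
move=> kj mk; rewrite /vertex; congr (_ + _).
rewrite (reindex_inj (@perm_inj _ (tperm j k))) /=.
apply: eq_big => [l|l _]; last by rewrite permM tpermK.
by case: tpermP => [->|->|//]; apply/idP/idP; move/eqP: mk kj; lia.
Qed.

Lemma simplex_path_omit_tperm a s (j k : 'I_N) : k = j.+1 :> nat ->
  omit k (simplex_path a (tperm j k * s)%g) = omit k (simplex_path a s).
Proof.
move=> kj; rewrite /omit /simplex_path -!map_take -!map_drop; congr (_ ++ _).
  apply/eq_in_map => m; rewrite take_iota mem_iota => /andP[_ mk].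
  by apply: (vertex_tperm _ _ kj); move: mk; case: ltngtP => //; lia.
apply/eq_in_map => m; rewrite drop_iota mem_iota => /andP[mk _].
by apply: (vertex_tperm _ _ kj); move: mk; lia.
Qed.

(** The two simplices of a cube that share the face opposite an inner vertex differ by exchanging
    two consecutive steps, so they carry opposite signs. *)
Lemma sum_omit_inner c a (j k : 'I_N) : k = j.+1 :> nat ->
  \sum_(s : 'S_N) (-1) ^+ s * c (omit k (simplex_path a s)) = 0.
Proof.
move=> kj; set S := \sum_(s : 'S_N) _.
suff : S = - S by move=> /eqP; rewrite -addr_eq0 -mulr2n mulrn_eq0 => /eqP.
rewrite {1}/S (reindex_inj (mulgI (tperm j k))) /= /S -sumrN.
apply: eq_bigr => s _; rewrite simplex_path_omit_tperm// odd_permM odd_tperm.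
have -> : j != k by apply/eqP => e; move: kj; rewrite e; lia.
by rewrite signr_addb expr1 mulN1r mulNr.
Qed.
End Grid.

Section GridShift.
Variable n : nat.
Local Notation N := n.+1.
Local Notation Z := 'rV[int]_N.

(** The cycle [l -> l + 1], with the last index sent to 0. A lattice path of order [s], started one
    step later, has order [cyc * s]. *)
Definition cyc : 'S_N := lift_perm ord_max ord0 1.

Lemma odd_cyc : odd_perm cyc = odd n.
Proof. by rewrite odd_lift_perm odd_perm1 /= !addbF. Qed.

Lemma cycE (l : 'I_N) : (l < n)%N -> cyc l = l.+1 :> nat.
Proof.
move=> ln; have -> : l = fintype.lift ord_max (Ordinal ln).
  by apply/val_inj; rewrite /= /bump leqNgt ln.
by rewrite lift_perm_lift perm1 /= /bump /= leqNgt ln.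
Qed.

Lemma vertex_cyc (a : Z) (s : 'S_N) (k : nat) : (k <= n)%N ->
  vertex a s k.+1 = vertex (a + delta_mx 0 (s ord0)) (cyc * s)%g k.
Proof.
elim: k => [|k IH] kn.
  by rewrite (@vertexS _ _ _ ord0) !vertex0.
have kN : (k.+1 < N)%N by [].
rewrite (@vertexS _ _ _ (Ordinal kN)) IH 1?ltnW// (@vertexS _ _ _ (Ordinal (ltnW kN))).
congr (_ + delta_mx 0 _); rewrite permM; congr (s _).
by apply: ord_inj; rewrite cycE.
Qed.

(** The face opposite the first vertex lies on the upper boundary of its cube; seen from the
    neighbouring cube it is the face opposite the last vertex. *)
Lemma omit_first_last (a : Z) (s : 'S_N) :
  omit 0 (simplex_path a s) =
  omit N (simplex_path (a + delta_mx 0 (s ord0)) (cyc * s)%g).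
Proof.
rewrite /omit /simplex_path take0 cat0s -map_take -!map_drop drop_iota take_iota.
rewrite (drop_oversize (n := N.+1)) ?size_iota// cats0.
have -> : iota (0 + 1) (N.+1 - 1) = map (addn 1) (iota 0 N) by rewrite -iotaDl subn1.
have -> : minn N N.+1 = N by apply/minn_idPl.
rewrite -map_comp; apply/eq_in_map => k; rewrite mem_iota => /andP[_ kN].
by rewrite /= add1n vertex_cyc.
Qed.
End GridShift.

Section GridSums.
Variable N : nat.
Local Notation Z := 'rV[int]_N.
Implicit Types (f g : Z -> int) (Q : set Z).

Definition gsum f : int := \sum_(a \in [set: Z]) f a.
Definition gfin f : Prop := finite_set (f @^-1` [set~ 0]).

Lemma gfin_le f Q : finite_set Q -> (forall a, ~ Q a -> f a = 0) -> gfin f.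
Proof.
move=> fQ f0; apply: sub_finite_set fQ => a /= fa.
by apply: contrapT => /f0.
Qed.

Lemma gsumE f Q : (forall a, ~ Q a -> f a = 0) -> gsum f = \sum_(a \in Q) f a.
Proof. by move=> f0; rewrite /gsum -(@fsbig_widen _ _ _ _ Q)// => a [_ /f0]. Qed.

Lemma gsumD f g : gfin f -> gfin g -> gsum (fun a => f a + g a) = gsum f + gsum g.
Proof.
move=> ff fg; pose Q := (f @^-1` [set~ 0]) `|` (g @^-1` [set~ 0]).
have fQ : finite_set Q by rewrite finite_setU; split; [exact: ff|exact: fg].
by rewrite !(@gsumE _ Q) ?fsbig_split// => a /not_orP[/contrapT h1 /contrapT h2]; rewrite ?h1 ?h2 ?addr0.
Qed.

Lemma gsum_big (I : Type) (r : seq I) (F : I -> Z -> int) : (forall i, gfin (F i)) ->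
  gsum (fun a => \sum_(i <- r) F i a) = \sum_(i <- r) gsum (F i).
Proof.
move=> fF; elim: r => [|i r IH].
  by rewrite big_nil /gsum fsbig1// => a _; rewrite big_nil.
rewrite big_cons -IH -gsumD//.
  by rewrite /gsum; apply: eq_fsbigr => a _; rewrite big_cons.
elim: r {IH} => [|j r IH].
  by apply: (@gfin_le _ set0) => // a _; rewrite big_nil.
have fU : finite_set ((F j @^-1` [set~ 0]) `|` ((fun a => \sum_(i <- r) F i a) @^-1` [set~ 0])).
  by rewrite finite_setU; split; [exact: fF|exact: IH].
apply: (gfin_le fU) => a /not_orP[/= /contrapT a1 /contrapT a2].
by rewrite big_cons a1 a2 addr0.
Qed.

Lemma gsumZ (x : int) f : gsum (fun a => x * f a) = x * gsum f.
Proof. by rewrite /gsum mulr_fsumr. Qed.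

Lemma gsum_shift f (e : Z) : gsum (fun a => f (a + e)) = gsum f.
Proof.
rewrite /gsum [RHS](@reindex_fsbigT _ _ _ _ _ (fun a => a + e))//.
by exists (fun a => a - e) => a; rewrite ?addrK ?subrK.
Qed.

Lemma gfin_shift f (e : Z) : gfin f -> gfin (fun a => f (a + e)).
Proof.
move=> ff; apply: (@gfin_le _ ((fun a => a - e) @` (f @^-1` [set~ 0]))); first exact: finite_image.
move=> a na; apply: contrapT => fa; apply: na; exists (a + e) => //.
by rewrite addrK.
Qed.

Lemma eq_gsum f g : f =1 g -> gsum f = gsum g.
Proof. by move=> /funext ->. Qed.
End GridSums.

(** Discrete Stokes formula: inner faces cancel within each cube, outer faces between neighbouring
    cubes. *)
Lemma sum_alt_face (n : nat) (c : seq 'rV[int]_n.+1 -> int) (Q : set 'rV[int]_n.+1) :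
  finite_set Q -> (forall q qs, ~ Q q -> c (q :: qs) = 0) ->
  gsum (cube_sum (alt c)) = 0.
Proof.
move=> fQ cQ; set N := n.+1.
have fN (s : 'S_N) : gfin (fun a => c (omit N (simplex_path a s))).
  by apply: (gfin_le fQ) => a; rewrite /omit /= vertex0; exact: cQ.
have f0 (s : 'S_N) : gfin (fun a => c (omit 0 (simplex_path a s))).
  have := gfin_shift (delta_mx 0 (s ord0)) (fN (cyc n * s)%g).
  by congr gfin; apply/funext => a; rewrite omit_first_last.
have step a : cube_sum (alt c) a =
    \sum_(s : 'S_N) ((-1) ^+ s * c (omit 0 (simplex_path a s)) +
                    (-1) ^+ N * ((-1) ^+ s * c (omit N (simplex_path a s)))).
  transitivity (\sum_(k < N.+1) (-1) ^+ k * \sum_(s : 'S_N) (-1) ^+ s * c (omit k (simplex_path a s))).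
    rewrite /cube_sum /alt.
    under eq_bigr do rewrite size_simplex_path mulr_sumr.
    rewrite exchange_big /=; apply: eq_bigr => k _; rewrite mulr_sumr.
    by apply: eq_bigr => s _; rewrite mulrCA.
  rewrite big_split /= -mulr_sumr big_ord_recl /= mul1r; congr (_ + _).
  rewrite big_ord_recr /= big1 ?add0r// => k _.
  have kN : (k.+1 < N)%N by have := ltn_ord k; rewrite ltnS.
  rewrite /bump /= add1n.
  by rewrite (@sum_omit_inner _ c a (Ordinal (ltnW kN)) (Ordinal kN))// mulr0.
rewrite (eq_gsum step) gsum_big; last first.
  move=> s; apply: (@gfin_le _ _ ([set a | c (omit 0 (simplex_path a s)) <> 0] `|`
      [set a | c (omit N (simplex_path a s)) <> 0])).
    by rewrite finite_setU; split; [exact: f0|exact: fN].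
  by move=> a /not_orP[/contrapT -> /contrapT ->]; rewrite !mulr0 addr0.
have fZ (x : int) (f : 'rV[int]_N -> int) : gfin f -> gfin (fun a => x * f a).
  by move=> ff; apply: (gfin_le ff) => a /contrapT ->; rewrite mulr0.
under eq_bigr => s _.
  rewrite gsumD; [|exact/fZ/f0|exact/fZ/fZ/fN].
  rewrite !gsumZ (eq_gsum (fun a => congr1 c (omit_first_last a s))).
  rewrite (gsum_shift (fun a => c (omit N (simplex_path a (cyc n * s)%g)))).
  over.
rewrite big_split /= -mulr_sumr.
set S2 := \sum_(s : 'S_N) (-1) ^+ s * gsum _.
(* Reindexing by [cyc] costs its sign [(-1)^n], opposite to the [(-1)^N] carried by the last
   face. *)
rewrite (_ : \sum_(s : 'S_N) _ = (-1) ^+ n * S2); last first.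
  rewrite /S2 (reindex_inj (mulgI (cyc n))) /= mulr_sumr; apply: eq_bigr => s _.
  by rewrite odd_permM odd_cyc signr_addb signr_odd mulrA.
by rewrite /N mulrA -exprD addSn addnn -mul2n exprS exprM sqrrN !expr1n mulr1 mulN1r subrr.
Qed.

Lemma In_mapP (A B : Type) (f : A -> B) y (r : seq A) :
  List.In y (map f r) -> exists2 x, f x = y & List.In x r.
Proof.
elim: r => //= x r IH [<-|/IH[z ? ?]]; first by exists x => //; left.
by exists z => //; right.
Qed.

Lemma In_map (A B : Type) (f : A -> B) x (r : seq A) : List.In x r -> List.In (f x) (map f r).
Proof. by elim: r => //= y r IH [->|/IH]; [left|right]. Qed.

Lemma In_mem (T : eqType) (x : T) (r : seq T) : x \in r -> List.In x r.
Proof. by elim: r => //= y r IH; rewrite in_cons => /orP[/eqP->|/IH]; [left|right]. Qed.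

Section GridHomotopy.
Variable N : nat.
Local Notation Z := 'rV[int]_N.

Definition cube_of (a b : Z) : Prop := forall i, b 0 i = a 0 i \/ b 0 i = a 0 i + 1.

Lemma cube_of_path a s b : List.In b (simplex_path a s) -> cube_of a b.
Proof.
by rewrite /simplex_path => h; have [k <- _] := In_mapP h; move=> i; exact: vertex_cube.
Qed.

Lemma grid_jac0 (u : 'I_N -> Z -> int) i e a :
  (forall b, cube_of a b -> u i b = e) -> grid_jac u a = 0.
Proof.
move=> ue; rewrite /grid_jac /cube_sum big1// => s _; rewrite (@cup_const _ (u i)) ?mulr0//.
  by apply: In_map; apply: In_mem; rewrite mem_enum.
by move=> p q /cube_of_path pa /cube_of_path qa; rewrite !ue.
Qed.
End GridHomotopy.

Section GridHomotopyStep.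
Variable n : nat.
Local Notation N := n.+1.
Local Notation Z := 'rV[int]_N.

(** By the Leibniz rule the two integrands differ, up to sign, by the coboundary of
    [cupw us (u - v) vs]. Cut off outside [Q], this cochain has finite support and Stokes applies.
    The cut-off is felt only at simplices whose first step enters or leaves [Q], and there the
    hypothesis makes the product vanish. *)
Lemma cup_step_sum (us vs : seq (Z -> int)) (u v : Z -> int) (Q : set Z) :
  (size us + size vs)%N = n -> finite_set Q ->
  (forall a j, (Q a /\ ~ Q (a + delta_mx 0 j)) \/ (~ Q a /\ Q (a + delta_mx 0 j)) ->
     (forall b, cube_of a b -> u b = v b) \/
     exists2 x, List.In x (us ++ vs) & forall b b', cube_of a b -> cube_of a b' -> x b = x b') ->
  \sum_(a \in Q) cube_sum (cup (us ++ u :: vs)) a =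
  \sum_(a \in Q) cube_sum (cup (us ++ v :: vs)) a.
Proof.
move=> sz fQ QP; pose w := fun p => u p - v p.
(* The cut-off tests the first vertex only, so among the faces of a simplex just the one opposite
   the first vertex can disagree with the test at [a]. *)
pose c ps := if ps is q :: _ then (if `[< Q q >] then cupw us w vs ps else 0) else 0.
have c0 q qs : ~ Q q -> c (q :: qs) = 0 by move=> nq; rewrite /c; case: asboolP.
have altc a s : alt c (simplex_path a s) = if `[< Q a >] then alt (cupw us w vs) (simplex_path a s) else 0.
  have pE : simplex_path a s = a :: behead (simplex_path a s) by rewrite /simplex_path /= vertex0.
  set qs := behead _ in pE.
  have qE : qs = a + delta_mx 0 (s ord0) :: behead qs.
    by rewrite /qs /simplex_path /= (@vertexS _ _ _ ord0) vertex0.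
  have qcub b : List.In b qs -> cube_of a b.
    by move=> bq; apply: (@cube_of_path _ a s); rewrite pE; right.
  have cq : c qs = if `[< Q a >] then cupw us w vs qs else 0.
    rewrite qE /= -qE; case: asboolP => Q1; case: asboolP => Q0 //.
      have [uv|[x xin xc]] := QP _ _ (or_intror (conj Q0 Q1)).
        by rewrite cupw_zero// => b /qcub /uv; rewrite /w => ->; rewrite subrr.
      by rewrite (cupw_const _ xin)// => b b' /qcub ? /qcub ?; exact: xc.
    have [uv|[x xin xc]] := QP _ _ (or_introl (conj Q0 Q1)).
      by rewrite cupw_zero// => b /qcub /uv; rewrite /w => ->; rewrite subrr.
    by rewrite (cupw_const _ xin)// => b b' /qcub ? /qcub ?; exact: xc.
  clearbody qs; rewrite pE alt_cons cq; case: asboolP => Qa.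
    rewrite alt_cons; congr (_ - _); rewrite /alt; apply: eq_bigr => k _; rewrite /c; case: asboolP => //.
  rewrite sub0r /alt big1 ?oppr0// => k _; rewrite /c; case: asboolP => //; rewrite mulr0//.
have := sum_alt_face fQ c0.
have -> : gsum (cube_sum (alt c)) = \sum_(a \in Q) cube_sum (alt (cupw us w vs)) a.
  rewrite (@gsumE _ _ Q) => [|a nQ]; [apply: eq_fsbigr => a /set_mem Qa|].
    by apply: eq_bigr => s _; rewrite altc asboolT.
  by rewrite /cube_sum big1// => s _; rewrite altc asboolF// mulr0.
under eq_fsbigr => a _.
  rewrite (_ : cube_sum _ a = (-1) ^+ size us *
     (cube_sum (cup (us ++ u :: vs)) a - cube_sum (cup (us ++ v :: vs)) a)); last first.
    rewrite /cube_sum -sumrB mulr_sumr; apply: eq_bigr => s _.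
    rewrite alt_cupw ?size_simplex_path ?sz// cup_lin -mulrBr mulrCA //.
  over.
rewrite -mulr_fsumr => /eqP; rewrite mulf_eq0 signr_eq0 /= => /eqP.
rewrite !fsbig_finite//= sumrB => /eqP; rewrite subr_eq0 => /eqP; exact.
Qed.
End GridHomotopyStep.

(* The components of u are replaced one at a time by those of u'. *)
Lemma grid_jac_homotopy N (u u' : 'I_N -> 'rV[int]_N -> int) (Q : set 'rV[int]_N) :
  finite_set Q ->
  (forall a j, (Q a /\ ~ Q (a + delta_mx 0 j)) \/ (~ Q a /\ Q (a + delta_mx 0 j)) ->
     exists i e, forall b, cube_of a b -> u i b = e /\ u' i b = e) ->
  \sum_(a \in Q) grid_jac u a = \sum_(a \in Q) grid_jac u' a.
Proof.
case: N u u' Q => [|n] u u' Q fQ QP.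
  apply: eq_fsbigr => a _; rewrite /grid_jac; congr (cube_sum (cup _) a).
  by apply/eq_in_map => -[].
pose v k (i : 'I_n.+1) := if (i < k)%N then u' i else u i.
have -> : u = v 0 by apply/funext => i.
have -> : u' = v n.+1 by apply/funext => i; rewrite /v ltn_ord.
suff S k : (k <= n.+1)%N -> \sum_(a \in Q) grid_jac (v 0) a = \sum_(a \in Q) grid_jac (v k) a by exact: S.
elim: k => // k IH kn; rewrite IH 1?ltnW//.
pose K := Ordinal kn; pose us := [seq u' i | i <- take k (enum 'I_n.+1)].
pose vs := [seq u i | i <- drop k.+1 (enum 'I_n.+1)].
have szE : (k < size (enum 'I_n.+1))%N by rewrite size_enum_ord.
have enE : enum 'I_n.+1 = take k (enum 'I_n.+1) ++ K :: drop k.+1 (enum 'I_n.+1).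
  rewrite -{1}(cat_take_drop k (enum 'I_n.+1)) (drop_nth K szE); congr (_ ++ _ :: _).
  by apply: ord_inj; rewrite nth_enum_ord.
have take_lt i : i \in take k (enum 'I_n.+1) -> (i < k)%N.
  move=> iin; have : val i \in [seq val j | j <- take k (enum 'I_n.+1)] by apply: map_f.
  by rewrite map_take val_enum_ord take_iota mem_iota /= => h; lia.
have drop_gt i : i \in drop k.+1 (enum 'I_n.+1) -> (k < i)%N.
  move=> iin; have : val i \in [seq val j | j <- drop k.+1 (enum 'I_n.+1)] by apply: map_f.
  by rewrite map_drop val_enum_ord drop_iota mem_iota /= => h; lia.
have vE m w : (m = k /\ w = u K) \/ (m = k.+1 /\ w = u' K) ->
    [seq v m i | i <- enum 'I_n.+1] = us ++ w :: vs.
  move=> mw; rewrite enE map_cat /=; congr (_ ++ _ :: _).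
  - by apply/eq_in_map => i /take_lt ik; rewrite /v; case: ifPn => //; case: mw => -[-> _]; lia.
  - by rewrite /v; case: mw => -[-> ->] /=; case: ifPn => //; lia.
  - by apply/eq_in_map => i /drop_gt ik; rewrite /v; case: ifPn => //; case: mw => -[-> _]; lia.
rewrite /grid_jac (vE k (u K))//; last by left.
rewrite (vE k.+1 (u' K)); last by right.
apply: cup_step_sum => //.
  rewrite /us /vs !size_map size_takel ?size_enum_ord 1?ltnW//.
  by rewrite size_drop size_enum_ord; lia.
move=> a j /QP[i [e ie]].
(* If the common constant component is the one being replaced, old and new agree on the cube;
   otherwise it is one of the remaining factors and is constant there. *)
have [iK|iK] := eqVneq i K; first by left => b /ie[<- ]; rewrite -iK => ->.
right; have iin : i \in take k (enum 'I_n.+1) ++ K :: drop k.+1 (enum 'I_n.+1).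
  by rewrite -enE mem_enum.
rewrite mem_cat in_cons (negPf iK) /= in iin; case/orP: iin => iin.
  exists (u' i); last by move=> b b' /ie[_ ->] /ie[_ ->].
  by apply/List.in_app_iff; left; apply: In_map; exact: In_mem.
exists (u i); last by move=> b b' /ie[-> _] /ie[-> _].
by apply/List.in_app_iff; right; apply: In_map; exact: In_mem.
Qed.

Section GridDegree.
Variables (R : realType) (N : nat).
Local Notation V := 'rV[R]_N.
Local Notation Z := 'rV[int]_N.
Implicit Types (F : V -> V) (W : set V) (d : R).

Definition gpos d (a : Z) : V := d *: map_mx (fun z : int => z%:~R) a.

Definition step01 (x : R) : int := ((0 <= x)%R : nat)%:Z.

(** A cube is assigned to [W] by its lowest vertex. Near the frontier this is arbitrary, and
    harmless as long as the map has no zeros there. *)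
Definition grid_deg F W d : int :=
  \sum_(a \in [set a | W (gpos d a)]) grid_jac (fun i a => step01 (F (gpos d a) 0 i)) a.

Definition frontier W : set V := closure W `\` W.

Lemma coord_le_norm (x : V) i : `|x 0 i| <= `|x|.
Proof.
rewrite [leRHS]/Num.norm /= mx_normrE.
by apply: (@le_bigmax _ _ _ 0 (fun ij : 'I_1 * 'I_N => `|x ij.1 ij.2|) (0, i)).
Qed.

Lemma norm_coord (x : V) : x != 0 -> exists i, `|x| = `|x 0 i|.
Proof.
move=> x0; have : mx_norm x != 0 by apply: contra_neq x0; exact: mx_norm_eq0.
by move=> /mx_norm_neq0[[i j]] /= xE; exists j; rewrite [LHS]xE (ord1 i).
Qed.

Lemma norm_le_coord (x : V) (e : R) : 0 <= e -> (forall i, `|x 0 i| <= e) -> `|x| <= e.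
Proof.
move=> e0 xe; have [->|/norm_coord[i ->]] := eqVneq x 0; last exact: xe.
by rewrite normr0.
Qed.

Lemma norm_lt_coord (x : V) (e : R) : 0 < e -> (forall i, `|x 0 i| < e) -> `|x| < e.
Proof.
move=> e0 xe; have [->|/norm_coord[i ->]] := eqVneq x 0; last exact: xe.
by rewrite normr0.
Qed.

Lemma gposE d a i : gpos d a 0 i = d * (a 0 i)%:~R.
Proof. by rewrite !mxE. Qed.

Lemma gpos_cube d a b : 0 <= d -> cube_of a b -> `|gpos d b - gpos d a| <= d.
Proof.
move=> d0 ab; apply: norm_le_coord => // i; rewrite !mxE -mulrBr -intrB.
by have [->|->] := ab i; rewrite ?subrr ?mulr0 ?normr0// addrC addKr mulr1 ger0_norm.
Qed.

Lemma gposD1 d a j : gpos d (a + delta_mx 0 j) = gpos d a + d *: delta_mx 0 j.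
Proof. by apply/rowP => i; rewrite !mxE intrD mulrDr; congr (_ + _ * _); case: (_ && _). Qed.

Lemma norm_delta (j : 'I_N) : `|delta_mx 0 j : V| <= 1.
Proof.
by apply: norm_le_coord => // i; rewrite mxE; case: (_ && _); rewrite ?normr1 ?normr0.
Qed.

Lemma finite_grid_region W d : 0 < d -> bounded_set W -> finite_set [set a | W (gpos d a)].
Proof.
move=> d0 [M [Mr WM]].
have [n nM] : exists n : nat, (M + 1) / d < n%:R.
  by exists (Num.truncn ((M + 1) / d)).+1; rewrite truncnS_gt.
pose f (g : {ffun 'I_N -> 'I_(2 * n).+1}) : Z := \row_i ((g i)%:Z - n%:Z).
apply: (@sub_finite_set _ _ (f @` setT)); last exact/finite_image/finite_finset.
move=> a /= Wa.
have aM i : `|a 0 i| <= n%:Z.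
  have := WM (M + 1); rewrite ltrDl ltr01 => /(_ isT _ Wa) gM.
  have := le_trans (coord_le_norm _ i) gM.
  rewrite gposE normrM (gtr0_norm d0) mulrC -ler_pdivlMr// => h.
  have : `|a 0 i|%:~R <= n%:R :> R by rewrite intr_norm (le_trans h)// ltW.
  by rewrite -[n%:R]/(n%:Z%:~R) ler_int.
have aB i : (absz (a 0 i + n%:Z)%R < (2 * n).+1)%N by have := aM i; lia.
exists [ffun i => Ordinal (aB i)] => //; apply/rowP => i; rewrite !mxE ffunE /=.
by have := aM i; lia.
Qed.

(** Otherwise [W] and its closure would have the same trace on the segment, a subset both open and
    closed, against connectedness. *)
Lemma segment_frontier W (x v : V) : open W -> W x -> ~ W (x + v) ->
  exists t : R, 0 <= t <= 1 /\ frontier W (x + t *: v).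
Proof.
move=> oW Wx nW; apply: contrapT => nf.
pose g (t : R) := x + t *: v.
have cg : continuous g.
  by move=> t; apply: cvgD; [exact: cvg_cst|apply: cvgZr_tmp; exact: cvg_id].
have h : `[0, 1] `&` g @^-1` W = `[0, 1]%classic.
 apply: (@segment_connected R 0 1).
- by exists 0; rewrite /g /= in_itv/= lexx ler01 scale0r addr0.
- by exists (g @^-1` W) => //; apply: open_comp => // t _; exact: cg.
- exists (g @^-1` (closure W)).
    by apply: closed_comp => [t _|]; [exact: cg|exact: closed_closure].
  apply/seteqP; split => t [t01 /= h]; split => //=; first exact: subset_closure.
  apply: contrapT => nt; apply: nf; exists t; split => //.
have : `[0%R, 1%R]%classic (1 : R) by rewrite /= in_itv/= lexx ler01.
by rewrite -h => -[_]; rewrite /g /= scale1r.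
Qed.

Lemma step01_near (x y c : R) : `|x - c| < `|c| -> `|y - c| < `|c| -> step01 x = step01 y.
Proof.
rewrite /step01 => xc yc; congr (Posz (nat_of_bool _)).
have [c0|c0] := leP 0 c.
  rewrite (ger0_norm c0) in xc yc; move: xc yc; rewrite !ltr_norml.
  by move=> /andP[? _] /andP[? _]; apply/idP/idP => _; lra.
rewrite (ltr0_norm c0) in xc yc; move: xc yc; rewrite !ltr_norml.
by move=> /andP[_ ?] /andP[_ ?]; apply/idP/idP => ?; lra.
Qed.

(* [G] and [G'] are both so close to [c b <> 0] near the point [b] that one of
   their components has constant sign there. *)
Lemma close_step (G G' : V -> V) (c b : V) (r : R) : 0 < r ->
  (forall x, `|x - b| < r -> `|G x - c| < `|c| /\ `|G' x - c| < `|c|) ->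
  exists i e, forall x, `|x - b| < r -> step01 (G x 0 i) = e /\ step01 (G' x 0 i) = e.
Proof.
move=> r0 H; have c0 : c != 0.
  by apply/eqP => c0; have := H b; rewrite subrr normr0 c0 normr0 => /(_ r0)[]; rewrite normr_lt0.
have [i ci] := norm_coord c0; exists i, (step01 (c 0 i)) => x /H[h1 h2].
have crd y : `|y - c| < `|c| -> `|y 0 i - c 0 i| < `|c 0 i|.
  by rewrite -ci; apply: le_lt_trans; have := coord_le_norm (y - c) i; rewrite !mxE.
have cc : `|c 0 i - c 0 i| < `|c 0 i| by rewrite subrr normr0 -ci normr_gt0.
by split; apply: step01_near (crd _ _) cc.
Qed.

(** Every cube with an edge across the frontier lies within [2 * d] of a frontier point [b]: one [d]
    for the edge, one for the cube in the sup norm. There both maps keep close to [c b], so one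
    component has the same constant sign for both, as the discrete homotopy lemma requires. *)
Lemma grid_deg_close (G G' : V -> V) (c : V -> V) W (r d : R) :
  open W -> bounded_set W -> 0 < d -> 2 * d < r ->
  (forall b, frontier W b -> forall x, `|x - b| < r ->
     `|G x - c b| < `|c b| /\ `|G' x - c b| < `|c b|) ->
  grid_deg G W d = grid_deg G' W d.
Proof.
move=> oW bW d0 dr H; apply: grid_jac_homotopy; first exact: finite_grid_region.
move=> a j aj; have r0 : 0 < r by lra.
have [b fb ab] : exists2 b, frontier W b & `|gpos d a - b| <= d.
  have tv (t : R) : 0 <= t <= 1 -> `|t *: (d *: delta_mx 0 j : V)| <= d.
    move=> /andP[t0 t1]; rewrite !normrZ (ger0_norm t0) (gtr0_norm d0).
    rewrite mulrCA -[leRHS]mulr1 ler_pM2l//.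
    by rewrite (le_trans (ler_wpM2l t0 (norm_delta j)))// mulr1.
  case: aj => -[/=]; rewrite gposD1 => h1 h2.
    have [t [t01 ft]] := segment_frontier oW h1 h2; eexists; first exact: ft.
    by rewrite opprD addrA subrr add0r normrN; exact: tv.
  have h3 : ~ W (gpos d a + d *: delta_mx 0 j + - (d *: delta_mx 0 j)) by rewrite addrK.
  have [t [t01 ft]] := segment_frontier oW h2 h3; eexists; first exact: ft.
  rewrite scalerN; set x := gpos _ _; set v := d *: _.
  have -> : x - (x + v - t *: v) = - ((1 - t) *: v).
    by rewrite scalerBl scale1r -addrA opprD addrA subrr add0r.
  by rewrite normrN tv//; move: t01 => /andP[? ?]; apply/andP; split; lra.
have [i [e ie]] := close_step r0 (H b fb); exists i, e => b' ab'; apply: ie.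
have := gpos_cube (ltW d0) ab' => h.
rewrite -[_ - b](subrKA (gpos d a)) (le_lt_trans (ler_normD _ _))//.
by rewrite (le_lt_trans (lerD h ab))//; lra.
Qed.

Lemma grid_jac_close F (c : V) d r a : 0 < d -> d < r ->
  (forall x, `|x - gpos d a| < r -> `|F x - c| < `|c|) ->
  grid_jac (fun i a => step01 (F (gpos d a) 0 i)) a = 0.
Proof.
move=> d0 dr H.
have [|i [e ie]] := @close_step F F c (gpos d a) r (lt_trans d0 dr).
  by move=> x /H.
apply: (@grid_jac0 _ _ i e) => b ab; apply: (proj1 (ie _ _)).
exact: le_lt_trans (gpos_cube (ltW d0) ab) dr.
Qed.
End GridDegree.

(** Lebesgue number argument, phrased for an arbitrary relation so that it yields uniform continuity
    as well as uniform neighbourhoods of compact sets. *)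
Lemma compact_uniform (R : realType) (U : normedModType R) (C : set U) (P : U -> U -> Prop) :
  compact C -> (forall b, C b -> \forall p \near (b, b), P p.1 p.2) ->
  exists2 r : R, 0 < r & forall b, C b -> forall x, `|x - b| < r -> P b x.
Proof.
move=> /compact_near_coveringP cC H.
have := cC _ (0 : R)^'+ (fun r b => forall x, `|x - b| < r -> P b x) _.
case.
  move=> b Cb; have [[A B] [/= nA nB] AB] := H b Cb.
  have /nbhs_ballP[e /= e0 eB] := nB.
  exists (A `&` ball b (e / 2), [set r | r < e / 2]).
    split; first by apply: filterI => //; apply: nbhsx_ballx; rewrite divr_gt0.
    by apply: nbhs_right_lt; rewrite divr_gt0.
  move=> [b' r] /= [[Ab' bb'] re] x xb'; apply: (AB (b', x)); split => //=.
  apply: eB; rewrite (splitr e); apply: ball_triangle (bb') _; rewrite -ball_normE /= distrC.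
  exact: lt_trans xb' re.
move=> r /= r0 rP; exists (r / 2); first by rewrite divr_gt0.
by move=> b Cb; apply: (rP (r / 2)) => //=; rewrite ?sub0r ?normrN ?gtr0_norm ?divr_gt0//; lra.
Qed.

(** An explicit form of nearness to 0 from the right, for statements about all small meshes. *)
Definition ev (R : realType) (P : R -> Prop) := exists2 r : R, 0 < r & forall d : R, 0 < d < r -> P d.

Lemma ev_and (R : realType) (P Q : R -> Prop) : ev P -> ev Q -> ev (fun d => P d /\ Q d).
Proof.
move=> [r r0 rP] [s s0 sQ]; exists (Num.min r s); first by rewrite lt_min r0.
by move=> d /andP[d0]; rewrite lt_min => /andP[dr ds]; split; [apply: rP|apply: sQ]; apply/andP.
Qed.

Lemma ev_sub (R : realType) (P Q : R -> Prop) : (forall d : R, 0 < d -> P d -> Q d) -> ev P -> ev Q.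
Proof. by move=> PQ [r r0 rP]; exists r => // d /andP[d0 dr]; apply: PQ => //; apply: rP; apply/andP. Qed.

Lemma ev_ex (R : realType) (P : R -> Prop) : ev P -> exists2 d : R, 0 < d & P d.
Proof. by move=> [r r0 rP]; exists (r / 2); [|apply: rP; apply/andP; split]; lra. Qed.

(** * The Brouwer degree *)
Section DegreeInvariance.
Variables (R : realType) (N : nat).
Local Notation V := 'rV[R]_N.
Implicit Types (F G : V -> V) (W K : set V).

Definition jcont_at (H : R -> V -> V) (t : R) (x : V) : Prop :=
  {for (t, x), continuous (fun p : R * V => H p.1 p.2)}.

Lemma bounded_ex W : bounded_set W -> exists M : R, forall x, W x -> `|x| <= M.
Proof.
by move=> [M [Mr WM]]; exists (M + 1) => x Wx; apply: (WM (M + 1)) => //; rewrite ltrDl.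
Qed.

Lemma ex_bounded W (M : R) : (forall x, W x -> `|x| <= M) -> bounded_set W.
Proof.
move=> WM; exists M; split; first exact: num_real.
by move=> x Mx y /WM yM /=; rewrite (le_trans yM)// ltW.
Qed.

Lemma bounded_sub W1 W2 : W1 `<=` W2 -> bounded_set W2 -> bounded_set W1.
Proof. by move=> s /bounded_ex[M WM]; apply: (@ex_bounded _ M) => x /s /WM. Qed.

Lemma bounded_closure W : bounded_set W -> bounded_set (closure W).
Proof.
move=> /bounded_ex[M WM]; apply: (@ex_bounded _ (M + 1)) => y cy.
have [z [/WM zM]] := cy _ (nbhsx_ballx y 1 ltr01); rewrite -ball_normE /= => yz.
rewrite -[y](subrK z) (le_trans (ler_normD _ _))// addrC; apply: lerD => //; exact: ltW.
Qed.

Lemma compact_frontier W : open W -> bounded_set W -> compact (frontier W).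
Proof.
move=> oW bW; apply: bounded_closed_compact.
  by apply: bounded_sub (bounded_closure bW) => x [].
by apply: closedI; [exact: closed_closure|exact: open_closedC].
Qed.

Lemma compact_closure W : bounded_set W -> compact (closure W).
Proof. by move=> bW; apply: bounded_closed_compact; [exact: bounded_closure|exact: closed_closure]. Qed.

Lemma near_norm_close (T : topologicalType) (f : T -> V) (b : T) :
  {for b, continuous f} -> f b != 0 -> \forall p \near (b, b), `|f p.2 - f p.1| < `|f p.1|.
Proof.
move=> cf fb0; have e0 : 0 < `|f b| / 3 by rewrite divr_gt0 ?normr_gt0.
have h : \forall x \near b, `|f x - f b| < `|f b| / 3.
  have /cvgrPdist_lt/(_ _ e0) := cf; apply: filterS => x.
  by rewrite distrC.
exists ([set x | `|f x - f b| < `|f b| / 3], [set x | `|f x - f b| < `|f b| / 3]) => //.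
move=> [x y] /= [hx hy].
have h1 : `|f y - f x| <= `|f y - f b| + `|f x - f b| by rewrite -[_ - _](subrKA (f b)) (le_trans (ler_normD _ _))// lerD// distrC.
have h2 : `|f b| <= `|f x| + `|f x - f b|.
  by rewrite -{1}[f b](subKr (f x)) (le_trans (ler_normB _ _)).
lra.
Qed.

(** Time is cut into steps shorter than the modulus [r] given by compactness; on each step both maps
    are compared with the frontier values of the earlier one. *)
Lemma grid_deg_homotopy (H : R -> V -> V) W : open W -> bounded_set W ->
  (forall (t : R) b, 0 <= t <= 1 -> frontier W b -> jcont_at H t b /\ H t b != 0) ->
  ev (fun d => grid_deg (H 0) W d = grid_deg (H 1) W d).
Proof.
move=> oW bW HP.
have cC : compact (`[0 : R, 1]%classic `*` frontier W).
  by apply: compact_setX; [exact: segment_compact|exact: compact_frontier].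
have [|r r0 rP] := @compact_uniform _ (R * V)%type _
    (fun p q => `|H q.1 q.2 - H p.1 p.2| < `|H p.1 p.2|) cC.
  move=> [t b] [/= t01 fb]; have [cH H0] := HP t b t01 fb.
  exact: (@near_norm_close _ (fun p : R * V => H p.1 p.2) (t, b) cH).
have [n nr] : exists n : nat, r^-1 < n.+1%:R.
  by exists (Num.truncn r^-1); rewrite truncnS_gt.
exists (r / 2); first by rewrite divr_gt0.
move=> d /andP[d0 dr].
suff S k : (k <= n.+1)%N -> grid_deg (H 0) W d = grid_deg (H (k%:R / n.+1%:R)) W d.
  by rewrite (S n.+1)// divff// pnatr_eq0.
elim: k => [|k IH] kn; first by rewrite mul0r.
rewrite IH 1?ltnW//; apply: (@grid_deg_close _ _ _ _ (H (k%:R / n.+1%:R)) _ r) => //; first by lra.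
have n0 : 0 < n.+1%:R :> R by rewrite ltr0n.
have k01 : 0 <= (k%:R / n.+1%:R : R) <= 1.
  by rewrite divr_ge0 ?ler0n//= ler_pdivrMr// mul1r ler_nat ltnW.
move=> b fb x xb; have C : (`[0 : R, 1]%classic `*` frontier W) (k%:R / n.+1%:R, b) by [].
split; apply: (rP _ C (_, x)); rewrite prod_normE /= gt_max xb andbT.
  by rewrite subrr normr0.
rewrite -mulrBl -natrB// subSnn mul1r normfV ger0_norm ?ler0n//.
by rewrite -[ltRHS]invrK ltf_pV2 ?posrE ?invr_gt0.
Qed.

(** Cubes based in [W2] outside [W1] contribute nothing for small meshes, since [F] has no zero on
    the compact set [closure W2] minus [W1]. *)
Lemma grid_deg_excision F W1 W2 : open W1 -> bounded_set W2 -> W1 `<=` W2 ->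
  (forall b, closure W2 b -> ~ W1 b -> {for b, continuous F} /\ F b != 0) ->
  ev (fun d => grid_deg F W1 d = grid_deg F W2 d).
Proof.
move=> oW bW sW FP.
have cC : compact (closure W2 `\` W1).
  apply: (subclosed_compact _ (compact_closure bW)); last by move=> x [].
  by apply: closedI; [exact: closed_closure|exact: open_closedC].
have [|r r0 rP] := @compact_uniform _ V _
    (fun p q => `|F q - F p| < `|F p|) cC.
  by move=> b [b2 b1]; have [cF F0] := FP b b2 b1; exact: near_norm_close.
exists r => // d /andP[d0 dr].
rewrite /grid_deg; apply: fsbig_widen; first by move=> a /=; exact: sW.
move=> a [/= a2 a1].
have Ca : (closure W2 `\` W1) (gpos d a) by split => //; exact: subset_closure.
exact: (@grid_jac_close _ _ F (F (gpos d a)) d r a d0 dr (rP _ Ca)).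
Qed.

Lemma grid_degU F W1 W2 d : 0 < d -> bounded_set W1 -> bounded_set W2 ->
  W1 `&` W2 = set0 -> grid_deg F (W1 `|` W2) d = grid_deg F W1 d + grid_deg F W2 d.
Proof.
move=> d0 b1 b2 W12; rewrite /grid_deg -fsbigU//=; try exact: finite_grid_region.
move=> a [/= a1 a2]; have : (W1 `&` W2) (gpos d a) by [].
by rewrite W12.
Qed.

(** The data for which a degree is defined. [W] may be unbounded and [F] need not extend to its
    closure; what matters is that the zeros stay in the compact set [K]. *)
Definition adm F W K := [/\ open W, compact K, K `<=` W,
  (forall x, W x -> {for x, continuous F}) & forall x, W x -> F x = 0 -> K x].

Definition core F W W' := [/\ open W', bounded_set W', closure W' `<=` W &
  forall x, W x -> F x = 0 -> W' x].

(** A relation and not a function, so that invariance can be proved before existence. All bounded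
    cores are quantified over; by [core_excision] a single one decides. *)
Definition is_deg F W (z : int) :=
  forall W', core F W W' -> ev (fun d => grid_deg F W' d = z).

Lemma compact_core (K W : set V) : compact K -> open W -> K `<=` W ->
  exists W', [/\ open W', bounded_set W', closure W' `<=` W & K `<=` W'].
Proof.
move=> cK oW KW.
have [|r r0 rP] := @compact_uniform _ V K (fun _ x => W x) cK.
  move=> b Kb; exists (setT, W) => [|[x y] [] //]; split; first exact: filterT.
  by apply: open_nbhs_nbhs; split => //; exact: KW.
have r2 : 0 < r / 2 by rewrite divr_gt0.
exists (\bigcup_(b in K) ball b (r / 2)); split.
- by apply: bigcup_open => b Kb; exact: ball_open.
- have [M [Mr KM]] := compact_bounded cK.
  exists (M + r); split; first by rewrite realD// num_real.
  move=> x Mx y [b Kb]; rewrite -ball_normE /= => by_.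
  have bM : `|b| <= x - r by apply: (KM (x - r) _ b Kb); lra.
  rewrite -[y](subKr b) (le_trans (ler_normB _ _))//; lra.
- move=> x cx; have [y [[b Kb bb] xy]] := cx _ (nbhsx_ballx x _ r2).
  apply: (rP b Kb); rewrite distrC; have := ball_triangle bb (ball_sym xy).
  by rewrite -splitr -ball_normE.
- by move=> b Kb; exists b => //; exact: ballxx.
Qed.

Lemma adm_core F W K : adm F W K -> exists W', core F W W' /\ K `<=` W'.
Proof.
move=> [oW cK KW _ FK]; have [W' [oW' bW' cW' KW']] := compact_core cK oW KW.
by exists W'; split => //; split => // x Wx /(FK _ Wx); exact: KW'.
Qed.

Lemma core_sub F W W' : core F W W' -> W' `<=` W.
Proof. by move=> [_ _ h _] x /subset_closure; exact: h. Qed.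

Lemma coreI F W W1 W2 : core F W W1 -> core F W W2 -> core F W (W1 `&` W2).
Proof.
move=> [o1 b1 c1 F1] [o2 b2 c2 F2]; split.
- exact: openI.
- by apply: bounded_sub b1 => x [].
- by move=> x /closureI[/c1].
- by move=> x Wx Fx; split; [exact: F1|exact: F2].
Qed.

(** Two cores are compared through their intersection, which is again a core. *)
Lemma core_excision F W K W1 W2 : adm F W K -> core F W W1 -> core F W W2 ->
  ev (fun d => grid_deg F W1 d = grid_deg F W2 d).
Proof.
move=> aF; suff S W' W'' : core F W W' -> core F W W'' -> W' `<=` W'' ->
    ev (fun d => grid_deg F W' d = grid_deg F W'' d).
  move=> c1 c2; have c12 := coreI c1 c2.
  have := ev_and (S _ _ c12 c1 (@subIsetl _ _ _)) (S _ _ c12 c2 (@subIsetr _ _ _)).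
  by apply: ev_sub => d _ [-> ->].
move=> [o1 b1 c1 F1] [o2 b2 c2 F2] s12; apply: grid_deg_excision => // x cx nx.
have [_ _ _ cF _] := aF; have Wx := c2 _ cx; split; first exact: cF.
by apply/eqP => /(F1 _ Wx).
Qed.

Lemma is_degI F W K W' z : adm F W K -> core F W W' ->
  ev (fun d => grid_deg F W' d = z) -> is_deg F W z.
Proof.
move=> aF cW' ez W2 cW2; have := ev_and ez (core_excision aF cW' cW2).
by apply: ev_sub => d _ [<-].
Qed.

Lemma is_deg_uniq F W K z z' : adm F W K -> is_deg F W z -> is_deg F W z' -> z = z'.
Proof.
move=> /adm_core[W' [cW' _]] /(_ _ cW') h /(_ _ cW') h'.
by have [d _ [<- <-]] := ev_ex (ev_and h h').
Qed.

Lemma is_deg_excision F W K U z : adm F W K -> open U -> U `<=` W -> K `<=` U ->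
  is_deg F W z <-> is_deg F U z.
Proof.
move=> aF oU UW KU; have [oW cK KW cF FK] := aF.
have aU : adm F U K by split => // x /UW; [exact: cF|exact: FK].
have [W' [cW' KW']] := adm_core aU.
have cWW : core F W W'.
  by case: cW' => o' b' c' _; split => // [x /c' /UW//|x Wx /(FK _ Wx) /KW'].
split=> h; first by apply: (is_degI aU cW'); exact: h.
by apply: (is_degI aF cWW); exact: h.
Qed.

(** One core serves all times, because [K] contains the zeros of every [H t]. *)
Lemma is_deg_homotopy (H : R -> V -> V) W K z : open W -> compact K -> K `<=` W ->
  (forall (t : R) x, 0 <= t <= 1 -> W x -> jcont_at H t x) ->
  (forall (t : R) x, 0 <= t <= 1 -> W x -> H t x = 0 -> K x) ->
  is_deg (H 0) W z -> is_deg (H 1) W z.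
Proof.
move=> oW cK KW cH HK h0; have aH (t : R) : 0 <= t <= 1 -> adm (H t) W K.
  move=> t01; split => // x Wx; last exact: HK.
  move=> A /(cH t x t01 Wx)[[B C] [/= nB nC] BC]; apply: filterS nC => y Cy.
  by apply: (BC (t, y)); split => //=; exact: nbhs_singleton nB.
have [W' [oW' bW' cW' KW']] := compact_core cK oW KW.
have t00 : 0 <= (0 : R) <= 1 by rewrite lexx ler01.
have t11 : 0 <= (1 : R) <= 1 by rewrite lexx ler01.
have c (t : R) : 0 <= t <= 1 -> core (H t) W W'.
  by move=> t01; split => // x Wx /(HK _ _ t01 Wx) /KW'.
apply: (is_degI (aH _ t11) (c _ t11)).
have h : ev (fun d => grid_deg (H 0) W' d = grid_deg (H 1) W' d).
  apply: grid_deg_homotopy => // t b t01 [/cW' Wb nb]; split; first exact: cH.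
  by apply/eqP => /(HK _ _ t01 Wb) /KW'.
by have := ev_and h (h0 _ (c _ t00)); apply: ev_sub => d _ [<-].
Qed.

Lemma is_degU F W1 W2 K1 K2 z1 z2 : adm F W1 K1 -> adm F W2 K2 -> W1 `&` W2 = set0 ->
  is_deg F W1 z1 -> is_deg F W2 z2 ->
  adm F (W1 `|` W2) (K1 `|` K2) /\ is_deg F (W1 `|` W2) (z1 + z2).
Proof.
move=> a1 a2 W12 h1 h2; have [oW1 cK1 KW1 cF1 FK1] := a1; have [oW2 cK2 KW2 cF2 FK2] := a2.
have aU : adm F (W1 `|` W2) (K1 `|` K2).
  split; [exact: openU|exact: compactU|exact: setUSS| |].
    by move=> x [/cF1|/cF2].
  by move=> x [/FK1 h /h|/FK2 h /h]; [left|right].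
split => //; have [W1' [c1 _]] := adm_core a1; have [W2' [c2 _]] := adm_core a2.
have cU : core F (W1 `|` W2) (W1' `|` W2').
  have [o1 b1 s1 f1] := c1; have [o2 b2 s2 f2] := c2.
  split; [exact: openU| | |].
  - have [M1 M1P] := bounded_ex b1; have [M2 M2P] := bounded_ex b2.
  by apply: (@ex_bounded _ (Num.max M1 M2)) => x [/M1P|/M2P]; rewrite le_max => ->; rewrite ?orbT.
  - by rewrite closureU; exact: setUSS.
  - by move=> x [/f1 h /h|/f2 h /h]; [left|right].
apply: (is_degI aU cU); have := ev_and (h1 _ c1) (h2 _ c2).
apply: ev_sub => d d0 [<- <-]; apply: grid_degU => //; [by case: c1|by case: c2|].
by apply/seteqP; split => // x [/(core_sub c1) x1 /(core_sub c2) x2]; rewrite -W12.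
Qed.

Lemma eq_is_deg F G W z : open W -> (forall x, W x -> F x = G x) ->
  is_deg F W z -> is_deg G W z.
Proof.
move=> oW FG h W' [oW' bW' sW' GW'].
have cF : core F W W' by split => // x Wx; rewrite FG//; exact: GW'.
have [r0 r00 rP] := h _ cF.
(* The grid degree on [W'] also reads vertices just outside [W']; for small meshes these still lie
   in [W], where [F] and [G] agree. *)
have [|r r_0 rW] := @compact_uniform _ V (closure W') (fun _ x => W x) (compact_closure bW').
  move=> b Kb; exists (setT, W) => [|[x y] [] //]; split; first exact: filterT.
  by apply: open_nbhs_nbhs; split => //; exact: sW'.
exists (Num.min r0 r); first by rewrite lt_min r00.
move=> d /andP[d0]; rewrite lt_min => /andP[dr0 dr].
rewrite -(rP d) ?d0// /grid_deg; apply: eq_fsbigr => a /set_mem/= Wa.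
rewrite /grid_jac /cube_sum; apply: eq_bigr => s _; congr (_ * _).
have vW b : List.In b (simplex_path a s) -> W (gpos d b).
  move=> /cube_of_path ab; apply: (rW (gpos d a)); first exact: subset_closure.
  exact: le_lt_trans (gpos_cube (ltW d0) ab) dr.
elim: (enum 'I_N) (simplex_path a s) vW => // i us IH [|p [|q ps]]//= vW.
rewrite IH; last by move=> b bq; apply: vW; right.
by rewrite !FG//; apply: vW; [left|right; left].
Qed.

Lemma is_deg_set0 F : is_deg F set0 0.
Proof.
move=> W' [_ _ s _]; exists 1 => // d _; rewrite /grid_deg fsbig1// => a /subset_closure /s.
by [].
Qed.
End DegreeInvariance.

(** * Continuity at a point *)

Definition ctat {T U : topologicalType} (f : T -> U) (p : T) : Prop := f @ p --> f p.

Section PointContinuity.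
Context {T U : topologicalType}.
Implicit Type p : T.

Lemma eq_ctat (f g : T -> U) p : f =1 g -> ctat g p -> ctat f p.
Proof. by move=> /funext ->. Qed.

Lemma ctat_near (f g : T -> U) p : (\forall q \near p, f q = g q) -> ctat g p -> ctat f p.
Proof.
move=> fg cg A; rewrite (nbhs_singleton fg) => /cg gA.
by apply: filterS2 fg gA => q e; rewrite /= e.
Qed.

Lemma ctat_cst (c : U) p : ctat (fun=> c) p.
Proof. exact: cvg_cst. Qed.

Lemma ctat_id p : ctat (fun q : T => q) p.
Proof. by move=> A. Qed.

Lemma ctat_comp (W : topologicalType) (f : T -> U) (g : U -> W) p :
  ctat f p -> ctat g (f p) -> ctat (fun q => g (f q)) p.
Proof. by move=> cf cg A /cg /cf. Qed.

Lemma ctat_pair (W : topologicalType) (f : T -> U) (g : T -> W) p :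
  ctat f p -> ctat g p -> ctat (fun q => (f q, g q)) p.
Proof.
by move=> cf cg; exact: cvg_pair cf cg.
Qed.

Lemma ctat_fst (p : T * U) : ctat fst p.
Proof. by move=> A nA; exists (A, setT) => //=; [split => //; exact: filterT|move=> q []]. Qed.

Lemma ctat_snd (p : T * U) : ctat snd p.
Proof. by move=> A nA; exists (setT, A) => //=; [split => //; exact: filterT|move=> q []]. Qed.
End PointContinuity.

Section PointContinuityNum.
Context {T : topologicalType} {R : realType}.
Implicit Types (f g : T -> R) (p : T).

Lemma ctatD f g p : ctat f p -> ctat g p -> ctat (fun q => f q + g q) p.
Proof. exact: cvgD. Qed.

Lemma ctatB f g p : ctat f p -> ctat g p -> ctat (fun q => f q - g q) p.
Proof. exact: cvgB. Qed.

Lemma ctatM f g p : ctat f p -> ctat g p -> ctat (fun q => f q * g q) p.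
Proof. exact: cvgM. Qed.

Lemma ctatV f p : f p != 0 -> ctat f p -> ctat (fun q => (f q)^-1) p.
Proof. by move=> f0; exact: cvgV. Qed.

Lemma ctat_sum (I : Type) (r : seq I) (P : pred I) (f : I -> T -> R) p :
  (forall i, ctat (f i) p) -> ctat (fun q => \sum_(i <- r | P i) f i q) p.
Proof.
move=> cf; elim: r => [|i r IH].
  by apply: (@eq_ctat _ _ _ (fun=> 0 : R)); [move=> q; rewrite big_nil|exact: ctat_cst].
case Pi : (P i); last by apply: eq_ctat IH => q; rewrite big_cons Pi.
by apply: eq_ctat (ctatD (cf i) IH) => q; rewrite big_cons Pi.
Qed.

Section Vector.
Variable V : normedModType R.
Implicit Types u v : T -> V.

Lemma ctatDv u v p : ctat u p -> ctat v p -> ctat (fun q => u q + v q) p.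
Proof. exact: cvgD. Qed.

Lemma ctatBv u v p : ctat u p -> ctat v p -> ctat (fun q => u q - v q) p.
Proof. exact: cvgB. Qed.

Lemma ctatZ f u p : ctat f p -> ctat u p -> ctat (fun q => f q *: u q) p.
Proof. by move=> cf cu; exact: cvgZ. Qed.

Lemma ctat_norm u p : ctat u p -> ctat (fun q => `|u q|) p.
Proof. exact: cvg_norm. Qed.

Lemma ctatP u p : (forall e : R, 0 < e -> \forall q \near p, `|u q - u p| < e) <-> ctat u p.
Proof.
split=> [h|/cvgrPdist_lt h e /h]; last by apply: filterS => q; rewrite distrC.
by apply/cvgrPdist_lt => e /h; apply: filterS => q; rewrite distrC.
Qed.
End Vector.

Section Row.
Variable N : nat.
Local Notation V := 'rV[R]_N.

Lemma ctat_row (f : T -> V) p : (forall i, ctat (fun q => f q 0 i) p) -> ctat f p.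
Proof.
move=> cf; apply/ctatP => e e0.
have : \forall q \near p, forall i, `|f q 0 i - f p 0 i| < e.
  by apply: filter_forall => i; have /ctatP/(_ _ e0) := cf i.
by apply: filterS => q qi; apply: norm_lt_coord => // i; rewrite !mxE.
Qed.

Lemma ctat_coord (f : T -> V) p (i : 'I_N) : ctat f p -> ctat (fun q => f q 0 i) p.
Proof.
move=> /ctatP cf; apply/ctatP => e /cf; apply: filterS => q; apply: le_lt_trans.
by have := coord_le_norm (f q - f p) i; rewrite !mxE.
Qed.

Lemma ctat_mulmx M (f : T -> V) (A : T -> 'M[R]_(N, M)) p :
  ctat f p -> (forall i j, ctat (fun q => A q i j) p) -> ctat (fun q => f q *m A q) p.
Proof.
move=> cf cA; apply/ctatP => e e0.
have : \forall q \near p, forall j, `|(f q *m A q) 0 j - (f p *m A p) 0 j| < e.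
  apply: filter_forall => j; have : ctat (fun q => (f q *m A q) 0 j) p.
    apply: (@eq_ctat _ _ _ (fun q => \sum_i f q 0 i * A q i j)); first by move=> q; rewrite mxE.
    by apply: ctat_sum => i; apply: ctatM => //; exact: ctat_coord.
  by move=> /ctatP/(_ _ e0).
by apply: filterS => q qi; apply: norm_lt_coord => // i; rewrite !mxE; have := qi i; rewrite !mxE.
Qed.
End Row.
End PointContinuityNum.

(** * Degrees of linear maps and of maps with regular zeros *)

Section MatrixBounds.
Variables (R : realType) (N : nat).
Local Notation V := 'rV[R]_N.

Lemma mulmx_bound (A : 'M[R]_N) : exists2 c : R, 0 < c & forall v : V, `|v *m A| <= c * `|v|.
Proof.
exists (1 + \sum_i \sum_j `|A i j|).
  by rewrite ltr_pwDl// sumr_ge0// => i _; rewrite sumr_ge0.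
move=> v; have S0 : 0 <= 1 + \sum_i \sum_j `|A i j|.
  by rewrite addr_ge0// sumr_ge0// => i _; rewrite sumr_ge0.
apply: norm_le_coord; first exact: mulr_ge0.
move=> j; rewrite mxE (le_trans (ler_norm_sum _ _ _))//.
rewrite mulrDl mul1r mulr_suml ler_wpDl//; apply: ler_sum => i _.
rewrite normrM mulrC ler_pM//; last exact: coord_le_norm.
by rewrite (bigD1 j)//= lerDl sumr_ge0.
Qed.

Lemma mulmx_bound_below (A : 'M[R]_N) : \det A != 0 ->
  exists2 c : R, 0 < c & forall v : V, c * `|v| <= `|v *m A|.
Proof.
move=> A0; have uA : A \in unitmx by rewrite unitmxE unitfE.
have [c c0 cP] := mulmx_bound (invmx A); exists c^-1; first by rewrite invr_gt0.
by move=> v; rewrite mulrC ler_pdivrMr// mulrC -{1}[v](mulmxK uA).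
Qed.
Lemma cup_prod (T : Type) (us : seq (T -> int)) (f : nat -> T) k :
  cup us (map f (iota k (size us).+1)) =
  \prod_(i < size us) (nth (fun=> 0) us i (f (k + i.+1)%N) - nth (fun=> 0) us i (f (k + i)%N)).
Proof.
elim: us k => [|u us IH] k; first by rewrite big_ord0.
rewrite big_ord_recl /= addn0 addn1; congr (_ * _).
rewrite -[f k.+1 :: _]/(map f (iota k.+1 (size us).+1)) IH; apply: eq_bigr => i _.
by rewrite /bump /= !addnS.
Qed.

Lemma cup_simplex_path (u : 'I_N -> 'rV[int]_N -> int) a s :
  cup [seq u i | i <- enum 'I_N] (simplex_path a s) =
  \prod_(k < N) (u k (vertex a s k.+1) - u k (vertex a s k)).
Proof.
have sz : size [seq u i | i <- enum 'I_N] = N by rewrite size_map size_enum_ord.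
have := @cup_prod _ [seq u i | i <- enum 'I_N] (vertex a s) 0; rewrite sz => ->.
have -> : \prod_(k < N) (u k (vertex a s k.+1) - u k (vertex a s k)) =
  \prod_(k < N) (nth (fun=> 0) [seq u i | i <- enum 'I_N] k (vertex a s k.+1) -
   nth (fun=> 0) [seq u i | i <- enum 'I_N] k (vertex a s k)).
  apply: eq_bigr => k _; rewrite (nth_map k) ?size_enum_ord//.
  by rewrite (_ : nth k _ k = k)//; apply: ord_inj; rewrite nth_enum_ord.
by [].
Qed.

Lemma vertex_coord (a : 'rV[int]_N) (s : 'S_N) (k j : 'I_N) : s k != j ->
  vertex a s k.+1 0 j = vertex a s k 0 j.
Proof. by move=> kj; rewrite vertexS mxE [X in _ + X]mxE eqxx eq_sym (negPf kj) addr0. Qed.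

Lemma vertex_coord_id (a : 'rV[int]_N) s (k : 'I_N) : vertex a s k 0 (s k) = a 0 (s k).
Proof.
rewrite /vertex mxE summxE big1 ?addr0// => l lk.
rewrite mxE eqxx /=; case: eqP => // /perm_inj e.
by rewrite e ltnn in lk.
Qed.

Lemma vertexS_coord_id (a : 'rV[int]_N) (s : 'S_N) (k : 'I_N) :
  vertex a s k.+1 0 (s k) = a 0 (s k) + 1.
Proof.
rewrite vertexS mxE vertex_coord_id; congr (_ + _).
by rewrite mxE !eqxx.
Qed.

Lemma step_jump (c x e : R) : c != 0 -> 0 < e -> exists2 k : int, `|e * k%:~R - x| <= e &
  forall a : int, step01 (c * (e * (a + 1)%:~R - x)) - step01 (c * (e * a%:~R - x)) =
    if a == k then sgz c else 0.
Proof.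
move=> c0 e0; rewrite /step01; have [cp|cn|/eqP] := ltgtP 0 c; last by rewrite eq_sym (negPf c0).
  have key (b : int) : (0 <= c * (e * b%:~R - x)) = (Num.ceil (x / e) <= b).
    by rewrite pmulr_rge0// subr_ge0 ceil_le_int ler_pdivrMr// mulrC.
  (* Since 0 counts as nonnegative, the sign is that of [b >= ceil (x / e)], and the jump is on the
     edge that ends at the ceiling. *)
  exists (Num.ceil (x / e) - 1) => [|a].
    have h1 : x <= e * (Num.ceil (x / e))%:~R by rewrite mulrC -ler_pdivrMr// ceil_ge.
    have h2 : e * (Num.ceil (x / e) - 1)%:~R < x.
      by rewrite mulrC -ltr_pdivlMr//; have := ceilB1_lt (x / e).
    by rewrite ler_norml; move: h2; rewrite intrB mulrBr mulr1 => h2; apply/andP; split; lra.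
  rewrite !key gtr0_sgz//; set m := Num.ceil _.
  by case: eqP => [->|]; case: (leP m _) => h1; case: (leP m _) => h2; lia.
have key (b : int) : (0 <= c * (e * b%:~R - x)) = (b <= Num.floor (x / e)).
  by rewrite nmulr_rge0// subr_le0 floor_ge_int ler_pdivlMr// mulrC.
(* For negative [c] the values are nonnegative up to the floor, so the jump is on the edge that
   starts there. *)
exists (Num.floor (x / e)) => [|a].
  have h1 : e * (Num.floor (x / e))%:~R <= x by rewrite mulrC -ler_pdivlMr// floor_le.
  have h2 : x < e * (Num.floor (x / e) + 1)%:~R.
    by rewrite mulrC -ltr_pdivrMr//; have := floorD1_gt (x / e).
  by rewrite ler_norml; move: h2; rewrite intrD mulrDr mulr1 => h2; apply/andP; split; lra.
rewrite !key ltr0_sgz//; set m := Num.floor _.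
by case: eqP => [->|]; case: (leP _ m) => h1; case: (leP _ m) => h2; lia.
Qed.

(** Component [k] depends on coordinate [s k] alone. So in each cube only the simplex with edge
    order [s] contributes, and only in the cube [a0] do all components change sign. *)
Lemma monomial_deg (W : set V) (x0 : V) (c : 'I_N -> R) (s : 'S_N) :
  open W -> W x0 -> (forall j, c j != 0) ->
  is_deg (fun x => \row_j (c j * (x 0 (s j) - x0 0 (s j)))) W ((-1) ^+ s * \prod_j sgz (c j)).
Proof.
move=> oW Wx0 c0; set F := fun x : V => _.
have F0 x : F x = 0 -> x = x0.
  move=> Fx; apply/rowP => i; rewrite -[i](permKV s).
  have := congr1 (fun v : V => v 0 ((s^-1)%g i)) Fx; rewrite !mxE => /eqP.
  by rewrite mulf_eq0 (negPf (c0 _)) /= subr_eq0 => /eqP.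
have aF : adm F W [set x0].
  split => //; first exact: compact_set1.
  - by move=> _ ->.
  - move=> x _; apply: ctat_row => j.
    apply: (@eq_ctat _ _ _ (fun x : V => c j * (x 0 (s j) - x0 0 (s j)))) => [y|]; first by rewrite mxE.
    by apply: ctatM; [exact: ctat_cst|apply: ctatB; [apply: ctat_coord; exact: ctat_id|exact: ctat_cst]].
  - by move=> x _ /F0.
have [W' [cW' W'x0]] := adm_core aF; apply: (is_degI aF cW').
have {}W'x0 : W' x0 by exact: W'x0.
have [oW' bW' _ _] := cW'.
have /nbhs_ballP[r /= r0 rW'] : nbhs x0 W' by apply: open_nbhs_nbhs.
exists r => // d /andP[d0 dr].
have /(_ _)/cid2 J j := @step_jump (c j) (x0 0 (s j)) d (c0 j) d0.
pose a0 : 'rV[int]_N := \row_i sval (J ((s^-1)%g i)).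
have a0E j : a0 0 (s j) = sval (J j) by rewrite mxE permK.
have FE b k : F (gpos d b) 0 k = c k * (d * (b 0 (s k))%:~R - x0 0 (s k)).
  by rewrite mxE gposE.
have jac a : grid_jac (fun i a => step01 (F (gpos d a) 0 i)) a =
    if a == a0 then (-1) ^+ s * \prod_j sgz (c j) else 0.
  rewrite /grid_jac /cube_sum (bigD1 s)//= [X in _ + X]big1 ?addr0; last first.
    move=> s' ss'; rewrite cup_simplex_path.
    have [k sk] : exists k, s' k != s k.
      apply/existsP; apply: contraR ss'; rewrite negb_exists => /forallP h.
      by apply/eqP/permP => k; apply/eqP; rewrite -[_ == _]negbK h.
    by rewrite (bigD1 k)//= !FE vertex_coord// subrr mul0r mulr0.
  rewrite cup_simplex_path.
  have fE (k : 'I_N) : step01 (F (gpos d (vertex a s k.+1)) 0 k) - step01 (F (gpos d (vertex a s k)) 0 k) =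
      if a 0 (s k) == a0 0 (s k) then sgz (c k) else 0.
    rewrite a0E; case: (J k) => m /= _ <-; by rewrite !FE vertexS_coord_id vertex_coord_id.
  have -> : \prod_(k < N) (step01 (F (gpos d (vertex a s k.+1)) 0 k) -
      step01 (F (gpos d (vertex a s k)) 0 k)) =
      \prod_k (if a 0 (s k) == a0 0 (s k) then sgz (c k) else 0) by apply: eq_bigr.
  have [->|ne] := eqVneq a a0; first by congr (_ * _); apply: eq_bigr => k _; rewrite eqxx.
  have [k ak] : exists k, a 0 (s k) != a0 0 (s k).
    apply/existsP; apply: contraR ne; rewrite negb_exists => /forallP h.
    apply/eqP/rowP => i; apply/eqP; rewrite -[i](permKV s) -[_ == _]negbK; exact: h.
  by rewrite (bigD1 k)//= (negPf ak) mul0r mulr0.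
have Wa0 : W' (gpos d a0).
  apply: rW'; rewrite -ball_normE /= distrC; apply: le_lt_trans dr.
  apply: norm_le_coord; first exact: ltW.
  by move=> i; rewrite -[i](permKV s) mxE gposE a0E mxE; case: (J _).
rewrite /grid_deg (@fsbigD1 _ _ _ _ a0) /=; last 2 first.
- exact: sub_finite_set (finite_grid_region d0 bW').
- exact: Wa0.
rewrite jac eqxx fsbig1 ?addr0// => a [_ /eqP ne].
by rewrite jac (negPf ne).
Qed.
End MatrixBounds.

Section RegularDegree.
Variables (R : realType) (N : nat).
Local Notation V := 'rV[R]_N.
Implicit Types (F G : V -> V) (W : set V).

Lemma sgz_prod (I : finType) (c : I -> R) : sgz (\prod_i c i) = \prod_i sgz (c i).
Proof. by apply: (big_morph (@sgz R)) => [x y|]; rewrite ?sgzM ?sgz1. Qed.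

Lemma jcontP (H : R -> V -> V) (t : R) x :
  ctat (fun p : R * V => H p.1 p.2) (t, x) -> jcont_at H t x.
Proof. by []. Qed.

(** [A] is a permutation matrix times [L] times [U]. Scaling the off-diagonal entries of the two
    triangular factors to 0 keeps the determinant and ends at a monomial map. *)
Lemma lin_deg (A : 'M[R]_N) W x0 : open W -> W x0 -> \det A != 0 ->
  is_deg (fun x => (x - x0) *m A) W (sgz (\det A)).
Proof.
case: N A W x0 => [|n] A W x0 oW Wx0 A0.
  have := @monomial_deg R 0 W x0 (fun=> 1) 1 oW Wx0 (fun=> oner_neq0 _).
  rewrite odd_perm1 expr0 mul1r big_ord0 det_mx00 sgz1; apply: eq_is_deg => // x _.
  by rewrite thinmx0 [RHS]thinmx0.
have := cormen_lup_correct A; have := cormen_lup_perm A; have := @cormen_lup_lower _ _ A.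
have := @cormen_lup_upper _ _ A.
case: (cormen_lup A) => [[P L] U] /= Uu Ll /is_perm_mxP[s0 ->]; set s := (s0^-1)%g => PLU.
have AE : A = perm_mx s *m (L *m U).
  have -> : L *m U = perm_mx s0 *m A by exact: esym PLU.
  by rewrite mulmxA -perm_mxM mulVg perm_mx1 mul1mx.
pose Lt (t : R) := \matrix_(i, j) if i == j then 1 else t * L i j.
pose Ut (t : R) := \matrix_(i, j) if i == j then U i i else t * U i j.
have detL t : \det (Lt t) = 1.
  rewrite det_trig; first by rewrite big1// => i _; rewrite mxE eqxx.
  apply/is_trig_mxP => i j ij.
  have ne : (i == j) = false by rewrite -val_eqE /= ltn_eqF.
  by rewrite mxE ne Ll ?(ltnW ij)// ne mulr0.
have detU t : \det (Ut t) = \prod_i U i i.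
  rewrite -det_tr det_trig; first by apply: eq_bigr => i _; rewrite !mxE eqxx.
  apply/is_trig_mxP => i j ij.
  have ne : (j == i) = false by rewrite -val_eqE /= gtn_eqF.
  by rewrite !mxE ne Uu// mulr0.
have detA : \det A = (-1) ^+ s * \prod_i U i i.
  have -> : A = perm_mx s *m (Lt 1 *m Ut 1).
    rewrite AE; congr (_ *m (_ *m _)); apply/matrixP => i j; rewrite !mxE mul1r.
      by case: eqP => // ->; rewrite Ll ?eqxx.
    by case: eqP => // ->.
  by rewrite !det_mulmx det_perm detL mul1r detU.
have U0 j : U j j != 0.
  by move: A0; rewrite detA mulf_eq0 signr_eq0 /= => /prodf_neq0 ->.
pose H (t : R) (x : 'rV[R]_n.+1) := (x - x0) *m perm_mx s *m Lt t *m Ut t.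
have h0 : is_deg (H 0) W (sgz (\det A)).
  have := @monomial_deg R _ W x0 (fun j => U j j) (s^-1)%g oW Wx0 U0.
  rewrite odd_permV detA sgzM sgz_prod sgzX sgzN1; apply: eq_is_deg => // x _.
  have -> : H 0 x = (x - x0) *m perm_mx s *m diag_mx (\row_j U j j).
    rewrite /H (_ : Lt 0 = 1%:M) ?mulmx1; last first.
      by apply/matrixP => i j; rewrite !mxE mul0r; case: eqP.
    congr (_ *m _); apply/matrixP => i j; rewrite !mxE mul0r.
    by case: eqP => [->|]; rewrite ?mulr1n ?mulr0n.
  have -> : (x - x0) *m perm_mx s = col_perm (s^-1)%g (x - x0) by rewrite col_permE invgK.
  by apply/rowP => j; rewrite mul_mx_diag !mxE mulrC.
have -> : (fun x => (x - x0) *m A) = H 1.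
  apply/funext => x; rewrite /H AE -!mulmxA; congr (_ *m (_ *m _)).
  have -> : L = Lt 1 by apply/matrixP => i j; rewrite !mxE mul1r; case: eqP => // ->; rewrite Ll ?eqxx.
  by congr (_ *m _); apply/matrixP => i j; rewrite !mxE mul1r; case: eqP => // ->.
apply: (@is_deg_homotopy _ _ H W [set x0] _ oW) h0.
- exact: compact_set1.
- by move=> _ ->.
- move=> t x _ _; change (ctat (fun p : R * 'rV[R]_n.+1 => H p.1 p.2) (t, x)).
  rewrite /H /=; apply: ctat_mulmx; [apply: ctat_mulmx; [apply: ctat_mulmx|]|].
  + by apply: ctatBv; [exact: ctat_snd|exact: ctat_cst].
  + by move=> i j; exact: ctat_cst.
  + move=> i j; apply: (@eq_ctat _ _ _ (fun p : R * 'rV[R]_n.+1 => if i == j then 1 else p.1 * L i j)).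
      by move=> p; rewrite mxE.
    by case: (i == j); [exact: ctat_cst|apply: ctatM; [exact: ctat_fst|exact: ctat_cst]].
  + move=> i j; apply: (@eq_ctat _ _ _ (fun p : R * 'rV[R]_n.+1 => if i == j then U i i else p.1 * U i j)).
      by move=> p; rewrite mxE.
    by case: (i == j); [exact: ctat_cst|apply: ctatM; [exact: ctat_fst|exact: ctat_cst]].
- move=> t x _ _ /eqP; rewrite /H -!mulmxA => /eqP e.
  have uM : perm_mx s *m (Lt t *m Ut t) \in unitmx.
    by rewrite unitmxE unitfE !det_mulmx det_perm detL mul1r detU -detA.
  apply/eqP; rewrite -subr_eq0; apply/eqP.
  by rewrite -[LHS](mulmxK uM) e mul0mx.
Qed.

(** Differentiability with derivative [A], stated directly: for suspensions and complex powers the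
    matrix is known and [jacobian] need not be computed. *)
Definition lin_at F x (A : 'M[R]_N) := forall e : R, 0 < e ->
  \forall y \near x, `|F y - F x - (y - x) *m A| <= e * `|y - x|.

Lemma diff_lin_at F x : differentiable F x -> lin_at F x (jacobian F x).
Proof.
move=> dF e e0; have /landau.eqaddoP/(_ _ e0) := diff_locally dF.
move=> /nbhs_ballP[r /= r0 rP]; apply/nbhs_ballP; exists r => // y.
rewrite -ball_normE /= => xy.
have h : ball (0 : V) r (y - x) by rewrite -ball_normE /= sub0r normrN distrC.
have := rP _ h; rewrite /= !fctE /= subrK.
by rewrite mul_rV_lin1 /= opprD addrA.
Qed.

(** Where [c * |v|] bounds the linear part from below and the remainder is at most
    [c / 2 * |y - x|], the segment from the linear part to [F] vanishes at [x] only. *)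
Lemma local_deg F W x (A : 'M[R]_N) : open W -> W x -> (forall y, W y -> ctat F y) ->
  F x = 0 -> lin_at F x A -> \det A != 0 ->
  exists2 r : R, 0 < r & forall s : R, 0 < s < r ->
    [/\ ball x s `<=` W, adm F (ball x s) [set x] &
        is_deg F (ball x s) (sgz (\det A))].
Proof.
move=> oW Wx cF Fx dF J0.
have [c c0 cP] := mulmx_bound_below J0.
have c2 : 0 < c / 2 by rewrite divr_gt0.
have nW : nbhs x W by apply: open_nbhs_nbhs.
have [r /= r0 rP] := proj1 (nbhs_ballP _ _) (filterI (dF _ c2) nW).
exists r => // s /andP[s0 sr].
have sB : ball x s `<=` ball x r by apply: le_ball; exact: ltW.
pose H (t : R) (y : V) := (1 - t) *: ((y - x) *m A) + t *: F y.
have H0 (t : R) y : 0 <= t <= 1 -> ball x s y -> H t y = 0 -> y = x.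
  move=> /andP[t0 t1] /sB /rP[]; rewrite Fx subr0 => h _ Hy.
  apply/eqP; rewrite -subr_eq0; apply/eqP/normr0_eq0/eqP; rewrite eq_le normr_ge0 andbT.
  have : (y - x) *m A = - (t *: (F y - (y - x) *m A)).
    have : (y - x) *m A + t *: (F y - (y - x) *m A) = 0.
      by rewrite -Hy /H scalerBl scale1r scalerBr addrA addrAC.
    by move=> /eqP; rewrite addr_eq0 => /eqP.
  move=> /(congr1 Num.norm); rewrite normrN normrZ (ger0_norm t0) => e.
  have := cP (y - x); rewrite e => h1.
  have h2 : t * `|F y - (y - x) *m A| <= c / 2 * `|y - x|.
    by rewrite (le_trans _ h)// ler_piMl.
  have h3 : c * `|y - x| <= c / 2 * `|y - x| by exact: le_trans h1 h2.
  have h4 : (c / 2) * `|y - x| <= 0 by lra.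
  by move: h4; rewrite pmulr_rle0.
have bW : ball x s `<=` W by move=> y /sB /rP[].
have H1 : H 1 = F by apply/funext => y; rewrite /H subrr scale0r add0r scale1r.
have oB : open (ball x s) by exact: ball_open.
have xB : ball x s x by exact: ballxx.
split => //.
  split => //; first exact: compact_set1.
  - by move=> _ ->.
  - by move=> y /bW; exact: cF.
  - by move=> y yB Fy; apply: (H0 1) => //; rewrite ?ler01 ?lexx// H1.
rewrite -H1; apply: (@is_deg_homotopy _ _ H (ball x s) [set x]) => //.
- exact: compact_set1.
- by move=> _ ->.
- move=> t y _ yB; apply: jcontP; apply: ctatDv; apply: ctatZ => /=.
  + by apply: ctatB; [exact: ctat_cst|exact: ctat_fst].
  + by apply: ctat_mulmx => [|i j]; [apply: ctatBv; [exact: ctat_snd|]|]; exact: ctat_cst.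
  + exact: ctat_fst.
  + by apply: (ctat_comp (f := snd)); [exact: ctat_snd|exact/cF/bW].
have -> : H 0 = fun y => (y - x) *m A.
  by apply/funext => y; rewrite /H subr0 scale1r scale0r addr0.
exact: lin_deg.
Qed.

(** Induction on the zeros: a small ball about the first is separated from the open set of points
    farther than [r] from it, which contains all others. *)
Lemma regular_lin_deg F W (s : seq V) (A : V -> 'M[R]_N) : uniq s -> open W -> (forall x, W x -> ctat F x) ->
  (forall x, x \in s <-> W x /\ F x = 0) ->
  (forall x, x \in s -> lin_at F x (A x) /\ \det (A x) != 0) ->
  adm F W [set x | x \in s] /\ is_deg F W (\sum_(x <- s) sgz (\det (A x))).
Proof.
elim: s W => [|x s IH] W us oW cF sP dP.
  have aF : adm F W [set x | x \in [::]].
    split => //; first exact: finite_compact (finite_seq _).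
    by move=> x Wx Fx; exact/sP.
  split => //; have e0 : [set x : V | x \in [::]] `<=` set0 by [].
  rewrite big_nil; apply/(is_deg_excision _ aF open0 (@sub0set _ _) e0).
  exact: is_deg_set0.
move: us => /= /andP[xs us].
have [Wx Fx] : W x /\ F x = 0 by apply/sP; rewrite mem_head.
have [dx Jx] := dP x (mem_head _ _).
have [r1 r10 r1P] := local_deg oW Wx cF Fx dx Jx.
have clo : closed [set y | y \in s].
  by apply: compact_closed; [exact: norm_hausdorff|exact: finite_compact (finite_seq s)].
have nx : nbhs x (~` [set y | y \in s]).
  by apply: open_nbhs_nbhs; split; [exact: closed_openC|exact/negP].
have /nbhs_ballP[r2 /= r20 r2P] := nx.
pose r := Num.min r1 r2 / 2.
have rm : 0 < Num.min r1 r2 by rewrite lt_min r10.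
have r0 : 0 < r by rewrite divr_gt0.
have [rr1 rr2] : r < r1 /\ r < r2.
  have : r < Num.min r1 r2 by rewrite /r; lra.
  by rewrite lt_min => /andP.
have [|bW aB dB] := r1P r; first by rewrite r0.
pose W2 := W `&` [set y | r < `|y - x|].
have oW2 : open W2.
  apply: openI => //; apply: (@open_comp _ _ (fun y : V => `|y - x|) [set t : R | r < t]).
    move=> y _; apply: (ctat_norm (u := fun y : V => y - x)).
    by apply: ctatBv; [exact: ctat_id|exact: ctat_cst].
  exact: open_gt.
have sW2 y : y \in s <-> W2 y /\ F y = 0.
  split=> [ys|[[Wy yr] Fy]].
    have [Wy Fy] : W y /\ F y = 0 by apply/sP; rewrite in_cons ys orbT.
    split => //; split => //=; rewrite ltNge; apply/negP => h.
    by apply: (r2P y) ys; rewrite -ball_normE /= distrC (le_lt_trans h).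
  have /sP := conj Wy Fy; rewrite in_cons => /orP[/eqP yx|//].
  by move: yr; rewrite /= yx subrr normr0 ltNge (ltW r0).
have [a2 d2] := IH W2 us oW2 (fun y h => cF y (proj1 h)) sW2
  (fun y ys => dP y (mem_behead (s := x :: s) ys)).
have B2 : ball x r `&` W2 = set0.
  apply/seteqP; split => // y [+ [_ /=]]; rewrite -ball_normE /= distrC => h1 h2.
  by have := lt_trans h1 h2; rewrite ltxx.
have [aU dU] := is_degU aB a2 B2 dB d2.
have eqK : [set x] `|` [set y | y \in s] = [set y | y \in x :: s].
  apply/seteqP; split => y /=; rewrite in_cons; first by case=> [->|->]; rewrite ?eqxx ?orbT.
  by move=> /orP[/eqP|]; [left|right].
have aW : adm F W [set y | y \in x :: s].
  split => //; first exact: finite_compact (finite_seq (x :: s)).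
    by move=> y /sP[].
  by move=> y Wy Fy; exact/sP.
split => //; rewrite big_cons; apply: (proj2 (is_deg_excision _ aW _ _ _)) dU.
- by apply: openU => //; exact: ball_open.
- by move=> y [/bW|[]].
- by rewrite -eqK; case: aU.
Qed.
Lemma regular_deg F W (s : seq V) : uniq s -> open W -> (forall x, W x -> ctat F x) ->
  (forall x, x \in s <-> W x /\ F x = 0) ->
  (forall x, x \in s -> differentiable F x /\ \det (jacobian F x) != 0) ->
  adm F W [set x | x \in s] /\ is_deg F W (\sum_(x <- s) sgz (\det (jacobian F x))).
Proof.
move=> us oW cF sP dP; apply: (regular_lin_deg (A := jacobian F)) => // x /dP[dx J0].
by split => //; exact: diff_lin_at.
Qed.
End RegularDegree.

(** * C1 maps and approximation with regular zeros *)

Section ContinuouslyDifferentiable.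
Variables (R : realType) (N : nat).
Local Notation V := 'rV[R]_N.

Lemma mx_norm_lt m n (x : 'M[R]_(m, n)) (e : R) : 0 < e -> (forall i j, `|x i j| < e) -> `|x| < e.
Proof.
move=> e0 xe; have [x0|/mx_norm_neq0[[i j] xE]] := eqVneq (mx_norm x) 0.
  by rewrite [X in X < _]x0.
by rewrite [X in X < _]xE.
Qed.

Lemma ctat_mx (T : topologicalType) m n (f : T -> 'M[R]_(m, n)) p :
  (forall i j, ctat (fun q => f q i j) p) -> ctat f p.
Proof.
move=> cf; apply/ctatP => e e0.
have : \forall q \near p, forall i j, `|f q i j - f p i j| < e.
  apply: filter_forall => i; apply: filter_forall => j.
  by have /ctatP/(_ _ e0) := cf i j.
by apply: filterS => q qi; apply: mx_norm_lt => // i j; rewrite !mxE.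
Qed.

(** C1 functions together with their gradient as a row. Carrying the gradient along makes continuity
    of the derivative of sums and products immediate. *)
Definition grad (f : V -> R) (g : V -> V) : Prop := forall x,
  [/\ differentiable f x, forall v, 'd f x v = \sum_j v 0 j * g x 0 j & ctat g x].

Lemma grad_cst (c : R) : grad (fun=> c) (fun=> 0).
Proof.
move=> x; split; [exact: differentiable_cst| |exact: ctat_cst].
move=> v; rewrite (_ : (fun=> c) = cst c)// diff_cst big1// => j _.
by rewrite mxE mulr0.
Qed.

Lemma gradD f1 f2 g1 g2 : grad f1 g1 -> grad f2 g2 ->
  grad (fun x => f1 x + f2 x) (fun x => g1 x + g2 x).
Proof.
move=> h1 h2 x; have [d1 e1 c1] := h1 x; have [d2 e2 c2] := h2 x.
split; [exact: differentiableD| |exact: ctatDv].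
move=> v; have -> : 'd (fun y => f1 y + f2 y) x v = 'd f1 x v + 'd f2 x v.
  exact: (congr1 (fun F : V -> R => F v) (diffD d1 d2)).
rewrite e1 e2 -big_split /=; by apply: eq_bigr => j _; rewrite mxE mulrDr.
Qed.

Lemma gradM f1 f2 g1 g2 : grad f1 g1 -> grad f2 g2 ->
  grad (fun x => f1 x * f2 x) (fun x => f1 x *: g2 x + f2 x *: g1 x).
Proof.
move=> h1 h2 x; have [d1 e1 c1] := h1 x; have [d2 e2 c2] := h2 x.
have k1 : ctat f1 x by exact: differentiable_continuous.
have k2 : ctat f2 x by exact: differentiable_continuous.
split; [exact: differentiableM| |by apply: ctatDv; apply: ctatZ].
move=> v; have -> : 'd (fun y => f1 y * f2 y) x v = f1 x * 'd f2 x v + f2 x * 'd f1 x v.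
  exact: (congr1 (fun F : V -> R => F v) (diffM d1 d2)).
rewrite e1 e2 !mulr_sumr -big_split /=; apply: eq_bigr => j _.
by rewrite !mxE /= mulrDr !mulrA ![v 0 j * _]mulrC.
Qed.

Lemma diff_coord x (j : 'I_N) v : 'd (fun y : V => y 0 j) x v = v 0 j.
Proof.
have @f : {linear V -> R}.
  by exists (fun M : V => M 0 j); do 2![eexists]; do ?[constructor];
     rewrite ?mxE// => ? *; rewrite ?mxE//; move=> ?; rewrite !mxE.
by rewrite (_ : (fun _ => _) = f) // diff_lin//; exact: coord_continuous.
Qed.

Lemma grad_coord (phi dphi : R -> R) (c o : R) (j : 'I_N) :
  (forall t : R, is_derive t 1 phi (dphi t)) -> continuous dphi ->
  grad (fun x => phi (c * x 0 j - o)) (fun x => (c * dphi (c * x 0 j - o)) *: delta_mx 0 j).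
Proof.
move=> dp cp x; pose l (y : V) := c * y 0 j - o.
have dl : differentiable l x.
  apply: differentiableB => //; apply: differentiableZ; exact: differentiable_coord.
have dphi1 t : differentiable phi t by apply/derivable1_diffP; exact: (@ex_derive _ _ _ _ _ _ _ (dp t)).
split.
- exact: (@differentiable_comp _ _ _ _ l phi).
- move=> v.
  have -> : 'd (fun y => phi (c * y 0 j - o)) x v = 'd phi (l x) ('d l x v).
    exact: (congr1 (fun F : V -> R => F v) (diff_comp dl (dphi1 (l x)))).
  have -> : 'd l x v = c * v 0 j.
    have dc : differentiable (fun y : V => y 0 j) x by exact: differentiable_coord.
    have dcc := differentiableZ c dc.
    have e1 := congr1 (fun F : V -> R => F v) (diffB dcc (differentiable_cst o x)).
    have e2 := congr1 (fun F : V -> R => F v) (diffZ c dc).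
    rewrite diff_cst /= subr0 in e1; rewrite /= diff_coord in e2.
    by rewrite -[RHS]e2 -[RHS]e1.
  rewrite deriv1E; last by apply/derivable1_diffP.
  rewrite derive1E (@derive_val _ _ _ _ _ _ _ (dp (l x))) /=.
  rewrite (bigD1 j)//= [X in _ + X]big1 ?addr0; last first.
    by move=> i ij; rewrite !mxE eqxx (negPf ij) !mulr0.
  rewrite !mxE !eqxx mulr1; change ((c * v 0 j) * dphi (l x) = v 0 j * (c * dphi (l x))).
  by rewrite [RHS]mulrCA mulrA.
- apply: ctatZ; last exact: ctat_cst.
  apply: ctatM; first exact: ctat_cst.
  apply: (ctat_comp (f := l)); last exact: cp.
  by apply: ctatB; [apply: ctatM; [exact: ctat_cst|apply: ctat_coord; exact: ctat_id]|exact: ctat_cst].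
Qed.

Definition C1s (f : V -> R) := exists g, grad f g.

Lemma C1s_sum (I : Type) (r : seq I) (P : pred I) (f : I -> V -> R) :
  (forall i, C1s (f i)) -> C1s (fun x => \sum_(i <- r | P i) f i x).
Proof.
move=> cf; elim: r => [|i r [g IH]].
  rewrite (_ : (fun x => _) = fun=> 0); last by apply/funext => x; rewrite big_nil.
  by eexists; exact: grad_cst.
have [gi hi] := cf i; case Pi : (P i).
  rewrite (_ : (fun x => _) = fun x => f i x + \sum_(j <- r | P j) f j x); last first.
    by apply/funext => x; rewrite big_cons Pi.
  by eexists; exact: gradD hi IH.
rewrite (_ : (fun x => _) = fun x => \sum_(j <- r | P j) f j x); first by exists g.
by apply/funext => x; rewrite big_cons Pi.
Qed.

Lemma C1s_prod (I : Type) (r : seq I) (P : pred I) (f : I -> V -> R) :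
  (forall i, C1s (f i)) -> C1s (fun x => \prod_(i <- r | P i) f i x).
Proof.
move=> cf; elim: r => [|i r [g IH]].
  rewrite (_ : (fun x => _) = fun=> 1); last by apply/funext => x; rewrite big_nil.
  by eexists; exact: grad_cst.
have [gi hi] := cf i; case Pi : (P i).
  rewrite (_ : (fun x => _) = fun x => f i x * \prod_(j <- r | P j) f j x); last first.
    by apply/funext => x; rewrite big_cons Pi.
  by eexists; exact: gradM hi IH.
rewrite (_ : (fun x => _) = fun x => \prod_(j <- r | P j) f j x); first by exists g.
by apply/funext => x; rewrite big_cons Pi.
Qed.

Lemma C1sZ (c : R) (f : V -> R) : C1s f -> C1s (fun x => c * f x).
Proof. by move=> [g hg]; eexists; exact: gradM (grad_cst c) hg. Qed.

Lemma row_jacobian (G : 'I_N -> V -> R) x : (forall i, differentiable (G i) x) ->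
  differentiable (fun y => \row_i G i y : V) x /\
  forall l i, jacobian (fun y => \row_i G i y : V) x l i = 'd (G i) x (delta_mx 0 l).
Proof.
move=> dG; set h := fun y => _.
have hE : h = \sum_(i < N) (fun y => G i y *: (delta_mx 0 i : V)).
  apply/funext => y; rewrite fct_sumE /h; apply/rowP => j; rewrite mxE summxE.
  rewrite (bigD1 j)//= big1 ?addr0 => [|i ij]; rewrite !mxE ?eqxx ?mulr1//.
  by rewrite eq_sym (negPf ij) mulr0.
have dh : differentiable h x.
  by rewrite hE; apply: differentiable_sum => i; exact: differentiableZl.
split => // l i; rewrite /jacobian mxE /=.
have GE : G i = (fun v : V => v 0 i) \o h by apply/funext => y; rewrite /= mxE.
have dc : differentiable (fun v : V => v 0 i) (h x) by exact: differentiable_coord.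
have e := congr1 (fun F : V -> R => F (delta_mx 0 l)) (diff_comp dh dc).
transitivity ('d (fun v : V => v 0 i) (h x) ('d h x (delta_mx 0 l))); first by rewrite diff_coord.
by rewrite GE; exact: esym e.
Qed.
End ContinuouslyDifferentiable.

Section SmoothStep.
Variable R : realType.
Implicit Types t h w tau : R.

Definition pospart t : R := Num.max 0 t.
Definition sqpos t : R := pospart t ^+ 2.

(** A quadratic error bound survives linear combinations and products with constants, and
    [is_derive_approx] turns it into a derivative at the very end. *)
Lemma sqpos_approx t h : `|sqpos (t + h) - sqpos t - 2 * pospart t * h| <= h ^+ 2.
Proof.
rewrite /sqpos /pospart; have [t0|t0] := leP 0 t; have [h0|h0] := leP 0 (t + h).
- have -> : (t + h) ^+ 2 - t ^+ 2 - 2 * t * h = h ^+ 2 by ring.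
  by rewrite ger0_norm ?sqr_ge0.
- by rewrite ler_norml; apply/andP; split; nra.
- by rewrite ler_norml; apply/andP; split; nra.
- by rewrite expr0n /= subrr mulr0 mul0r subrr normr0 sqr_ge0.
Qed.

Lemma is_derive_approx (U : normedModType R) (f : U -> R) (x v : U) (d K : R) :
  (forall h : R, `|f (h *: v + x) - f x - d * h| <= K * h ^+ 2) -> is_derive x v f d.
Proof.
move=> fK; have cv : (fun h : R => h^-1 *: ((f \o shift x) (h *: v) - f x)) @ 0^' --> d.
  apply/cvgrPdist_lt => e e0; have K1 : 0 < `|K| + 1 by rewrite ltr_wpDl.
  have /nbhs_ballP : nbhs (0 : R) (ball 0 (e / (`|K| + 1))).
    by apply: nbhsx_ballx; rewrite divr_gt0.
  move=> [r r0 rP]; apply/nbhs_ballP; exists r => // h /rP; rewrite -ball_normE /= sub0r normrN => hr h0.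
  rewrite distrC.
  have -> : h^-1 *: (f (h *: v + x) - f x) - d = h^-1 * (f (h *: v + x) - f x - d * h).
    by rewrite [_ *: _]/(_ * _) mulrBr; congr (_ - _); rewrite mulrCA mulVf ?mulr1.
  rewrite normrM normfV mulrC ltr_pdivrMr ?normr_gt0// (le_lt_trans (fK h))//.
  rewrite -real_normK ?num_real// expr2 mulrA ltr_pM2r ?normr_gt0//.
  move: hr; rewrite ltr_pdivlMr// mulrC => hr; apply: le_lt_trans hr.
  rewrite ler_wpM2r//; have := ler_norm K; lra.
by split; [apply/cvg_ex; exists d|exact/cvg_lim].
Qed.

Lemma diff_approx_eq (U : normedModType R) (f : U -> R) (x v : U) (d K : R) :
  differentiable f x ->
  (forall h : R, `|f (h *: v + x) - f x - d * h| <= K * h ^+ 2) -> 'd f x v = d.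
Proof. by move=> df /is_derive_approx h; rewrite -deriveE//; exact: derive_val. Qed.

(** A C1 step from 0 at [- w] to 1 at [w]: the normalised second difference of the squared positive
    part. Its derivative [dsmooth] is a hat function, positive exactly between [- w] and [w]. *)
Definition smooth w tau : R := (sqpos (tau + w) - 2 * sqpos tau + sqpos (tau - w)) / (2 * w ^+ 2).
Definition dsmooth w tau : R := (pospart (tau + w) - 2 * pospart tau + pospart (tau - w)) / w ^+ 2.

Lemma smooth_approx w tau h : 0 < w ->
  `|smooth w (tau + h) - smooth w tau - dsmooth w tau * h| <= 2 / w ^+ 2 * h ^+ 2.
Proof.
move=> w0; have w2 : 0 < w ^+ 2 by rewrite exprn_gt0.
rewrite /smooth /dsmooth.
have h1 := sqpos_approx (tau + w) h; have h2 := sqpos_approx tau h.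
have h3 := sqpos_approx (tau - w) h.
rewrite (addrAC tau h) (addrAC tau h (- w)).
set a := sqpos (tau + w + h) in h1 *; set b := sqpos (tau + h) in h2 *.
set c := sqpos (tau - w + h) in h3 *.
set a' := sqpos (tau + w) in h1 *; set b' := sqpos tau in h2 *.
set c' := sqpos (tau - w) in h3 *.
set p := pospart (tau + w) in h1 *; set q := pospart tau in h2 *.
set r := pospart (tau - w) in h3 *.
have -> : (a - 2 * b + c) / (2 * w ^+ 2) - (a' - 2 * b' + c') / (2 * w ^+ 2) -
    (p - 2 * q + r) / w ^+ 2 * h = ((a - a' - 2 * p * h) - 2 * (b - b' - 2 * q * h) +
      (c - c' - 2 * r * h)) / (2 * w ^+ 2).
  by field; rewrite gt_eqF.
rewrite normrM (@gtr0_norm _ (2 * w ^+ 2)^-1); last by rewrite invr_gt0 mulr_gt0.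
rewrite ler_pdivrMr; last by rewrite mulr_gt0.
have -> : 2 / w ^+ 2 * h ^+ 2 * (2 * w ^+ 2) = 4 * h ^+ 2 by field; rewrite gt_eqF.
by move: h1 h2 h3; rewrite !ler_norml => /andP[? ?] /andP[? ?] /andP[? ?]; apply/andP; split; lra.
Qed.

Lemma dsmooth_continuous w tau : ctat (dsmooth w) tau.
Proof.
have cp (o : R) : ctat (fun t : R => pospart (t + o)) tau.
  rewrite (_ : (fun t => _) = fun t => (`|t + o| + (t + o)) / 2); last first.
    by apply/funext => t; rewrite /pospart; case: (leP 0 (t + o)) => h; [rewrite ger0_norm|rewrite ltr0_norm]; lra.
  apply: ctatM; last exact: ctat_cst.
  have h : ctat (fun t : R => t + o) tau by apply: ctatD; [exact: ctat_id|exact: ctat_cst].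
  by apply: ctatD => //; exact: (ctat_norm (V := R^o)).
rewrite /dsmooth; apply: ctatM; last exact: ctat_cst.
apply: ctatD; last exact: cp; apply: ctatB; first exact: cp.
apply: ctatM; first exact: ctat_cst.
by have := cp 0; rewrite (_ : (fun t => _) = pospart)//; apply/funext => t; rewrite addr0.
Qed.

Lemma smooth_lo w tau : tau <= - w -> 0 < w -> smooth w tau = 0 /\ dsmooth w tau = 0.
Proof.
move=> tw w0; rewrite /smooth /dsmooth /sqpos /pospart !max_l; [|lra..].
by rewrite expr0n /= mulr0 subrr add0r !mul0r.
Qed.

Lemma smooth_hi w tau : w <= tau -> 0 < w -> smooth w tau = 1 /\ dsmooth w tau = 0.
Proof.
move=> tw w0; rewrite /smooth /dsmooth /sqpos /pospart !max_r; [|lra..].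
split; last first.
  have -> : tau + w - 2 * tau + (tau - w) = 0 by ring.
  by rewrite mul0r.
by field; rewrite gt_eqF.
Qed.

Lemma smooth_mid w tau : - w < tau < w -> 0 < w -> 0 < smooth w tau < 1 /\ 0 < dsmooth w tau.
Proof.
move=> /andP[t1 t2] w0; rewrite /smooth /dsmooth /sqpos /pospart.
have w2 : 0 < w ^+ 2 by rewrite exprn_gt0.
rewrite (max_r (_ : 0 <= tau + w)); last by lra.
rewrite (max_l (_ : tau - w <= 0)); last by lra.
set X := (_ + _ ^+ 2); set Y := (_ + 0).
suff [[X0 X1] Y0] : (0 < X /\ X < 2 * w ^+ 2) /\ 0 < Y.
  by split; [apply/andP; split|]; rewrite ?divr_gt0 ?mulr_gt0// ltr_pdivrMr ?mul1r ?mulr_gt0.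
rewrite /X /Y; have [t0|t0] := leP 0 tau; rewrite ?expr0n /=.
  by do ! split; nra.
by do ! split; nra.
Qed.

Lemma smooth01 w tau : 0 < w -> 0 <= smooth w tau <= 1.
Proof.
move=> w0; have [h|h] := leP tau (- w); first by rewrite (proj1 (smooth_lo h w0)) lexx ler01.
have [k|k] := leP w tau; first by rewrite (proj1 (smooth_hi k w0)) lexx ler01.
by have [/andP[/ltW -> /ltW ->]] := smooth_mid (introT andP (conj h k)) w0.
Qed.
End SmoothStep.

Section Bumps.
Variables (R : realType) (w : R) (L : nat).
Hypotheses (w0 : 0 < w) (w4 : w <= 4^-1).
Implicit Types (t h : R) (k : 'I_(2 * L)).

(** A smoothed indicator of the interval from [k - L] to [k - L + 1]. These functions form a
    partition of unity on [|t| <= L - 2], and neighbours overlap only within [w] of an integer. *)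
Definition bump_fn k t : R := smooth w (t + (L%:R - k%:R)) - smooth w (t + (L%:R - k%:R - 1)).
Definition dbump k t : R := dsmooth w (t + (L%:R - k%:R)) - dsmooth w (t + (L%:R - k%:R - 1)).

Lemma bump_approx k t h :
  `|bump_fn k (t + h) - bump_fn k t - dbump k t * h| <= 4 / w ^+ 2 * h ^+ 2.
Proof.
rewrite /bump_fn /dbump !(addrAC t h).
have h1 := smooth_approx (t + (L%:R - k%:R)) h w0.
have h2 := smooth_approx (t + (L%:R - k%:R - 1)) h w0.
move: h1 h2; set a := smooth w _; set b := smooth w _; set c := dsmooth w _.
set a' := smooth w _; set b' := smooth w _; set c' := dsmooth w _ => h1 h2.
have -> : a - a' - (b - b') - (c - c') * h = (a - b - c * h) - (a' - b' - c' * h) by ring.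
rewrite (le_trans (ler_normB _ _))//; apply: le_trans (lerD h1 h2) _.
rewrite -!mulrDl (_ : 2 + 2 = 4 :> R)//; ring.
Qed.

Lemma dbump_continuous k t : ctat (dbump k) t.
Proof.
apply: ctatB; apply: (ctat_comp (g := dsmooth w)); try exact: dsmooth_continuous.
- by apply: ctatD; [exact: ctat_id|exact: ctat_cst].
- by apply: ctatD; [exact: ctat_id|exact: ctat_cst].
Qed.

Lemma nearest t : `|t| <= L%:R - 2 ->
  exists z : nat, [/\ (0 < z)%N, (z < 2 * L)%N & `|t + L%:R - z%:R| <= 2^-1].
Proof.
move=> tL; have {}tL : 2 <= t + L%:R <= 2 * L%:R - 2 by move: tL; rewrite ler_norml; lra.
pose y : R := t + L%:R + 2^-1; have y0 : 0 <= y by rewrite /y; lra.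
have /andP[z1 z2] := truncn_itv y0; set z := Num.truncn y in z1 z2.
exists z; split.
- by rewrite -(ltr_nat R); move: z2; rewrite -(natr1 z) /y; lra.
- by rewrite -(ltr_nat R) natrM; move: z1; rewrite /y; lra.
- by move: z1 z2; rewrite -(natr1 z) /y ler_norml; lra.
Qed.

Lemma bumpE t (z : nat) : `|t + L%:R - z%:R| <= 2^-1 -> forall k,
  bump_fn k t = (if k == z :> nat then smooth w (t + L%:R - z%:R)
              else if k.+1 == z then 1 - smooth w (t + L%:R - z%:R) else 0) /\
  dbump k t = (if k == z :> nat then dsmooth w (t + L%:R - z%:R)
              else if k.+1 == z then - dsmooth w (t + L%:R - z%:R) else 0).
Proof.
move=> zt k; set g := t + L%:R - z%:R in zt *.
have hi (m : nat) : (m < z)%N -> smooth w (t + L%:R - m%:R) = 1 /\ dsmooth w (t + L%:R - m%:R) = 0.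
  move=> mz; apply: smooth_hi => //; have : m.+1%:R <= z%:R :> R by rewrite ler_nat.
  by rewrite -(natr1 m); move: zt w4; rewrite ler_norml /g; lra.
have lo (m : nat) : (z < m)%N -> smooth w (t + L%:R - m%:R) = 0 /\ dsmooth w (t + L%:R - m%:R) = 0.
  move=> mz; apply: smooth_lo => //; have : z.+1%:R <= m%:R :> R by rewrite ler_nat.
  by rewrite -(natr1 z); move: zt w4; rewrite ler_norml /g; lra.
rewrite /bump_fn /dbump !addrA.
have -> : t + L%:R - k%:R - 1 = t + L%:R - k.+1%:R by rewrite -(natr1 k); ring.
have [kz|kz|kz] := ltngtP k z.
- have [h1 h2] := hi _ kz; rewrite h1 h2; have [e|e] := eqVneq k.+1 z.
    by rewrite e -/g; rewrite sub0r.
  have [h3 h4] : smooth w (t + L%:R - k.+1%:R) = 1 /\ dsmooth w (t + L%:R - k.+1%:R) = 0.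
    by apply: hi; lia.
  by rewrite h3 h4 !subrr.
- have [h1 h2] := lo _ kz; have [h3 h4] := lo k.+1 (ltnW kz).
  by rewrite h1 h2 h3 h4 subrr; case: eqP => //; lia.
- have zk : (z < k.+1)%N by rewrite kz.
  have [h3 h4] := lo _ zk.
  by rewrite h3 h4 kz -/g !subr0.
Qed.

Lemma bump_ge0 k t : `|t| <= L%:R - 2 -> 0 <= bump_fn k t.
Proof.
move=> /nearest[z [_ _ /bumpE/(_ k)[-> _]]]; have := smooth01 (t + L%:R - z%:R) w0.
by case: ifP => _; [lra|case: ifP => _; lra].
Qed.

Lemma bump_near k t : `|t| <= L%:R - 2 -> bump_fn k t != 0 -> `|t + L%:R - k%:R| <= 2.
Proof.
move=> /nearest[z [_ _ zt]]; have [-> _] := bumpE zt k.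
case: ifP => [/eqP -> _|_]; first by lra.
case: ifP => [/eqP e _|]; last by rewrite eqxx.
by move: zt; rewrite -e -(natr1 k) !ler_norml; lra.
Qed.

Lemma bump_sum t : `|t| <= L%:R - 2 -> \sum_k bump_fn k t = 1.
Proof.
move=> /nearest[z [z0 z1 zt]].
have zp : (z.-1 < 2 * L)%N by lia.
rewrite (bigD1 (Ordinal z1))//= (bigD1 (Ordinal zp))/=; last first.
  by rewrite -val_eqE /=; lia.
rewrite big1 => [|k /andP[k1 k2]].
  rewrite !(proj1 (bumpE zt _)) /= eqxx prednK// eqxx; case: eqP => [|_]; [lia|by rewrite addr0 addrCA subrr addr0].
rewrite (proj1 (bumpE zt _)); move: k1 k2; rewrite -!val_eqE /=.
by move=> /negPf -> k2; case: eqP => // e; move: k2; rewrite -e /= eqxx.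
Qed.

(* Away from the integers exactly one bump_fn is nonzero; near an integer two
   consecutive ones are. *)
Lemma bump_cases t : `|t| <= L%:R - 2 ->
  (exists c, forall k, bump_fn k t = (k == c)%:R /\ dbump k t = 0) \/
  (exists c c1 (s D : R) (z : int), [/\ c != c1, 0 < D, `|t - z%:~R| < w &
    forall k, bump_fn k t = (if k == c1 then s else if k == c then 1 - s else 0) /\
      dbump k t = (if k == c1 then D else if k == c then - D else 0)]).
Proof.
move=> /nearest[z [z0 z1 zt]]; have zp : (z.-1 < 2 * L)%N by lia.
have E k : (k.+1 == z) = (k == Ordinal zp) by rewrite -val_eqE /=; lia.
have E' k : (k == z :> nat) = (k == Ordinal z1) by rewrite -val_eqE.
have ne : Ordinal zp != Ordinal z1 by rewrite -val_eqE /=; lia.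
have {}bE := bumpE zt; set g := t + L%:R - z%:R in zt bE.
have [h|h] := leP g (- w).
  left; exists (Ordinal zp) => k; have [-> ->] := bE k.
  have [-> ->] := smooth_lo h w0; rewrite E E' subr0 oppr0.
  by case: eqP => [->|_]; [rewrite eq_sym (negPf ne)|case: eqP].
have [h'|h'] := leP w g.
  left; exists (Ordinal z1) => k; have [-> ->] := bE k.
  have [-> ->] := smooth_hi h' w0; rewrite E E' subrr oppr0.
  by case: eqP => [_|_]//; case: eqP.
right; have [s01 D0] := smooth_mid (introT andP (conj h h')) w0.
exists (Ordinal zp), (Ordinal z1), (smooth w g), (dsmooth w g), (z%:Z - L%:Z); split => //.
  by rewrite intrB -!pmulrn ltr_norml /g in h h' *; lra.
by move=> k; have [-> ->] := bE k; rewrite E E'.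
Qed.
End Bumps.

Section RegularApproximation.
Variables (R : realType) (N : nat).
Local Notation V := 'rV[R]_N.

(** In every coordinate but [j] a single bump survives, so the sum over multi-indices collapses to
    one over the [j]-th index. *)
Lemma ffun_prod_sum (L : nat) (b : 'I_N -> 'I_L -> R) (s : {ffun 'I_N -> 'I_L} -> R)
    (j : 'I_N) (c : 'I_N -> 'I_L) :
  (forall i k, i != j -> b i k = (k == c i)%:R) ->
  \sum_a s a * \prod_i b i (a i) =
  \sum_k s [ffun i => if i == j then k else c i] * b j k.
Proof.
move=> bc; pose e k : {ffun 'I_N -> 'I_L} := [ffun i => if i == j then k else c i].
rewrite (partition_big (fun a : {ffun 'I_N -> 'I_L} => a j) xpredT)//=.
apply: eq_bigr => k _; rewrite (bigD1 (e k)) /=; last by rewrite ffunE eqxx.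
rewrite (bigD1 j)//= ffunE eqxx [X in _ * (_ * X)]big1 => [|i ij]; last first.
  by rewrite bc// ffunE (negPf ij) eqxx.
rewrite mulr1 big1 ?addr0// => a /andP[/eqP ajk ne].
have [i /andP[ij ai]] : exists i, (i != j) && (a i != c i).
  apply/existsP; apply: contraR ne; rewrite negb_exists => /forallP h.
  apply/eqP/ffunP => i; rewrite ffunE; have [->//|ij] := eqVneq i j.
  by have := h i; rewrite ij /= negbK => /eqP.
by rewrite (bigD1 i)//= bc// (negPf ai) mul0r mulr0.
Qed.

Lemma sum_avg (I : finType) (s p : I -> R) (v e : R) : (forall a, 0 <= p a) ->
  \sum_a p a = 1 -> (forall a, p a != 0 -> `|s a - v| <= e) ->
  `|\sum_a s a * p a - v| <= e.
Proof.
move=> p0 p1 ps; rewrite -[v]mulr1 -p1 mulr_sumr -sumrB.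
rewrite (le_trans (ler_norm_sum _ _ _))// -[leRHS]mulr1 -p1 mulr_sumr.
apply: ler_sum => a _; rewrite -mulrBl normrM (ger0_norm (p0 a)).
by have [->|pa] := eqVneq (p a) 0; rewrite ?mulr0// ler_wpM2r// ps.
Qed.

Lemma unif_cont (U W : normedModType R) (F : U -> W) (C : set U) (e : R) : compact C ->
  (forall x, C x -> ctat F x) -> 0 < e ->
  exists2 r : R, 0 < r & forall b, C b -> forall x, `|x - b| < r -> `|F x - F b| < e.
Proof.
move=> cC cF e0; apply: (@compact_uniform _ U C (fun p q => `|F q - F p| < e) cC).
move=> b Cb; have /ctatP/(_ (e / 2)) := cF _ Cb; rewrite divr_gt0// => /(_ isT) nb.
exists ([set q | `|F q - F b| < e / 2], [set q | `|F q - F b| < e / 2]) => //.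
move=> [p q] /= [hp hq]; rewrite -(subrKA (F b)) (le_lt_trans (ler_normD _ _))//.
by rewrite (splitr e) ltrD// distrC.
Qed.

Lemma int_close (n i i' : nat) (m : int) : (i < n)%N -> (i' < n)%N ->
  `|(i'%:Z - i%:Z) - n.+1%:Z * m| < 1 -> i = i'.
Proof.
move=> l1 l2 l3; have m0 : m = 0 by nia.
by move: l3; rewrite m0 mulr0 subr0; lia.
Qed.

Lemma bump_C1s (w c o : R) (L : nat) (k : 'I_(2 * L)) (j : 'I_N) : 0 < w ->
  C1s (fun x : V => bump_fn w k (c * x 0 j - o)).
Proof.
move=> w0; eexists; apply: (@grad_coord _ _ (bump_fn w k) (dbump w k)) => t.
  apply: (@is_derive_approx _ _ _ _ _ _ (4 / w ^+ 2)) => h.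
  by rewrite [_ *: 1]mulr1 [h + t]addrC; apply: bump_approx.
exact: dbump_continuous.
Qed.

Lemma monomial_det (J : 'M[R]_N) (p : 'I_N -> 'I_N) : injective p ->
  (forall l i, (J l i == 0) = (l != p i)) -> \det J != 0.
Proof.
move=> pI JP; apply/negP => /det0P[v v0 vJ]; move/negP: v0; apply; apply/eqP/rowP => l.
have [q pq qp] : bijective p by exact: injF_bij.
rewrite mxE -[l]qp; have := congr1 (fun u : V => u 0 (q l)) vJ; rewrite !mxE.
rewrite (bigD1 (p (q l)))//= big1 ?addr0 => [|m mq]; last first.
  by have := JP m (q l); rewrite mq => /eqP ->; rewrite mulr0.
by move=> /eqP; rewrite mulf_eq0 JP eqxx orbF => /eqP.
Qed.

(* The component [G i] is nearly constant on the cubes of its own translate of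
   the lattice; as the translates are different, at a common zero each component
   depends on a single coordinate, and different components on different ones. *)
Lemma regular_approx (F : V -> V) (C : set V) (e : R) : compact C ->
  (forall x, C x -> ctat F x) -> 0 < e ->
  exists h : V -> V, [/\ forall x, C1_at h x, forall x, C x -> `|h x - F x| < e &
    forall x, C x -> h x = 0 -> \det (jacobian h x) != 0].
Proof.
move=> cC cF e0; have e4 : 0 < e / 4 by rewrite divr_gt0.
have [r r0 rP] := unif_cont cC cF e4.
have [M MP] := bounded_ex (compact_bounded cC).
(* Where a product of bumps is nonzero, its node [pos i a] is within [2 * d] of the point, hence
   within the modulus [r]. *)
pose d := r / 4; have d0 : 0 < d by rewrite divr_gt0.
pose n1 : R := N.+1%:R; have n10 : 1 <= n1 by rewrite /n1 ler1n.
have n1p : 0 < n1 by lra.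
(* The lattice of component [i] is shifted by [i / n1]. Walls of different lattices are then at
   least [1 / n1 = 4 * w] apart in the scaled coordinate, so the bands of half-width [w] about them
   are disjoint. *)
pose w := (4 * n1)^-1; have w0 : 0 < w by rewrite invr_gt0; lra.
have w4 : w <= 4^-1 by rewrite lef_pV2 ?posrE; lra.
have [L LM] : exists L : nat, `|M| / d + 3 <= L%:R.
  by exists (Num.truncn (`|M| / d + 3)).+1; rewrite ltW// truncnS_gt.
pose o (i : 'I_N) : R := i%:R / n1.
have o01 i : 0 <= o i <= 1.
  by rewrite divr_ge0 ?ler0n ?(ltW n1p)//= ler_pdivrMr// mul1r ler_nat ltnW// ltnS ltnW.
pose tau (i j : 'I_N) (x : V) := d^-1 * x 0 j - o i.
have tauL i j x : C x -> `|tau i j x| <= L%:R - 2.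
  move=> /MP xM; have h1 := coord_le_norm x j; have h2 := ler_norm M.
  have h3 : `|d^-1 * x 0 j| <= `|M| / d.
    by rewrite normrM gtr0_norm ?invr_gt0// mulrC ler_pM2r ?invr_gt0//; lra.
  have /andP[p0 p1] := o01 i; rewrite (le_trans (ler_normB _ _))//.
  by rewrite (ger0_norm p0); lra.
pose T : finType := {ffun 'I_N -> 'I_(2 * L)}.
pose pos i (a : T) : V := \row_j (d * ((a j)%:R - L%:R + o i)).
(* Zero values are replaced by [e / 4], within the allowed error: a component that is locally a
   single value can then not vanish. *)
pose sv i a := if F (pos i a) 0 i == 0 then e / 4 else F (pos i a) 0 i.
have sv0 i a : sv i a != 0 by rewrite /sv; case: ifPn => // _; rewrite gt_eqF.
pose B i j k x := bump_fn w (L := L) k (tau i j x).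
pose G i x := \sum_(a : T) sv i a * \prod_j B i j (a j) x.
have cG i : C1s (G i).
  by apply: C1s_sum => a; apply: C1sZ; apply: C1s_prod => j; exact: bump_C1s.
have /choice[g gP] := cG.
have dG i x : differentiable (G i) x by case: (gP i x).
pose h x : V := \row_i G i x.
have hJ x l i : jacobian h x l i = g i x 0 l.
  have [_ ->] := row_jacobian (fun i => dG i x).
  have [_ -> _] := gP i x; rewrite (bigD1 l)//= big1 ?addr0 => [|m ml].
    by rewrite mxE !eqxx mul1r.
  by rewrite mxE eqxx (negPf ml) mul0r.
exists h; split.
- move=> x; split.
    by apply: filterS filterT => y _; have [] := row_jacobian (fun i => dG i y).
  apply: ctat_mx => l i; apply: (@eq_ctat _ _ _ (fun y => g i y 0 l)) => [y|]; first exact: hJ.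
  by apply: ctat_coord; have [] := gP i x.
- move=> x Cx; apply: norm_lt_coord => // i; rewrite !mxE.
  apply: (@le_lt_trans _ _ (e / 2)); last by lra.
  apply: sum_avg => [a||a].
  + by apply: prodr_ge0 => j _; apply: bump_ge0 => //; exact: tauL.
  + rewrite -(bigA_distr_bigA (fun j k => B i j k x)) big1// => j _.
    by apply: bump_sum => //; exact: tauL.
  + move=> /prodf_neq0 pa; have xp : `|pos i a - x| < r.
      apply: (@le_lt_trans _ _ (2 * d)); last by rewrite /d; lra.
      apply: norm_le_coord => [|j]; first by lra.
      have := bump_near w0 w4 (tauL i j x Cx) (pa j isT).
      rewrite !mxE => hb; have -> : d * ((a j)%:R - L%:R + o i) - x 0 j =
          - (d * (tau i j x + L%:R - (a j)%:R)).
        by rewrite /tau; field; rewrite gt_eqF.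
      by rewrite normrN normrM (gtr0_norm d0) mulrC ler_pM2r.
    have Fp : `|F (pos i a) 0 i - F x 0 i| <= e / 4.
      by apply: ltW; apply: le_lt_trans (rP _ Cx _ xp); have := coord_le_norm (F (pos i a) - F x) i; rewrite !mxE.
    rewrite /sv; case: eqP Fp => [-> |_] Fp; last by lra.
    by move: Fp; rewrite sub0r normrN !ler_norml; lra.
move=> x Cx hx; have Gx i : G i x = 0.
  by have := congr1 (fun u : V => u 0 i) hx; rewrite !mxE.
pose isB i j := exists z : int, `|tau i j x - z%:~R| < w.
have caseA i j : ~ isB i j -> exists c, forall k, B i j k x = (k == c)%:R /\ dbump w k (tau i j x) = 0.
  move=> nb; have [//|[c [c1 [s [D [z [_ _ zt _]]]]]]] := bump_cases w0 w4 (tauL i j x Cx).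
  by exfalso; apply: nb; exists z.
(* Away from its walls a component equals one nonzero value, so at a zero each component is near
   some wall. *)
have exB i : exists j, isB i j.
  apply: contrapT => nB; have /choice[c cP] j : exists c, forall k, B i j k x = (k == c)%:R.
    have [c cP] := caseA i j (fun b => nB (ex_intro _ j b)).
    by exists c => k; have [] := cP k.
  have := Gx i; rewrite /G; have aE (a : T) : \prod_j B i j (a j) x = (a == [ffun j => c j])%:R.
    have [->|ne] := eqVneq; first by rewrite big1// => j _; rewrite cP ffunE eqxx.
    have [j aj] : exists j, a j != c j.
      apply/existsP; apply: contraR ne; rewrite negb_exists => /forallP hh.
      by apply/eqP/ffunP => j; rewrite ffunE; apply/eqP; have := hh j; rewrite negbK.
    by rewrite (bigD1 j)//= cP (negPf aj) mul0r.
  rewrite (bigD1 [ffun j => c j])//= aE eqxx mulr1 big1 ?addr0 => [/eqP|a ne].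
    by rewrite (negPf (sv0 _ _)).
  by rewrite aE (negPf ne) mulr0.
have /choice[p pB] := exB.
(* Bands of different lattices are disjoint in every coordinate, so the coordinate whose wall is
   near determines the component. *)
have injB i i' j : isB i j -> isB i' j -> i = i'.
  move=> [z zt] [z' zt']; apply: ord_inj.
  have : `|(i'%:R - i%:R) - n1 * (z - z')%:~R| < 2^-1.
    have -> : (i'%:R - i%:R) - n1 * (z - z')%:~R =
        n1 * ((tau i j x - z%:~R) - (tau i' j x - z'%:~R)).
      rewrite /tau /o intrB; set u := d^-1 * _; clearbody u.
      by move: (n1) n1p => q q0; field; rewrite gt_eqF.
    rewrite normrM (gtr0_norm n1p) -ltr_pdivlMl//.
    have -> : n1^-1 / 2 = w + w by rewrite /w; move: (n1) n1p => q q0; field; rewrite gt_eqF.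
    by rewrite (le_lt_trans (ler_normB _ _))// ltrD.
  have -> : (i'%:R - i%:R) - n1 * (z - z')%:~R = ((i'%:Z - i%:Z) - N.+1%:Z * (z - z'))%:~R :> R.
    by rewrite [RHS]intrB [X in _ = X - _]intrB intrM.
  rewrite -intr_norm => hlt.
  have : `|(i'%:Z - i%:Z) - N.+1%:Z * (z - z')| < 1 :> int.
    by rewrite -(ltr_int R); apply: lt_trans hlt _; lra.
  exact: int_close (ltn_ord i) (ltn_ord i').
have pI : injective p by move=> i i' e1; apply: (injB _ _ (p i)); [exact: pB|rewrite e1; exact: pB].
have notB i j : j != p i -> ~ isB i j.
  move=> jp bij; have [q pq qp] : bijective p by exact: injF_bij.
  have := pB (q j); rewrite qp => bqj; have := injB _ _ _ bij bqj => e1.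
  by move: jp; rewrite e1 qp eqxx.
apply: (monomial_det pI) => l i; rewrite hJ.
pose B' j k := if j == l then d^-1 * dbump w k (tau i l x) else B i j k x.
have -> : g i x 0 l = \sum_(a : T) sv i a * \prod_j B' j (a j).
  rewrite -hJ; have [_ ->] := row_jacobian (fun i => dG i x).
  pose Q (a : T) := \prod_(j | j != l) B i j (a j) x.
  apply: (@diff_approx_eq _ _ _ _ _ _ (\sum_(a : T) `|sv i a * Q a| * (4 / w ^+ 2 * d^-1 ^+ 2))) => // t.
  rewrite /G mulr_suml -!sumrB mulr_suml (le_trans (ler_norm_sum _ _ _))//; apply: ler_sum => a _.
  have -> : \prod_j B i j (a j) (t *: delta_mx 0 l + x) = bump_fn w (a l) (tau i l x + d^-1 * t) * Q a.
    rewrite (bigD1 l)//=; congr (_ * _).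
      by rewrite /B /tau !mxE !eqxx mulr1; congr (bump_fn w _ _); ring.
    by apply: eq_bigr => j jl; rewrite /B /tau !mxE eqxx (negPf jl) mulr0 add0r.
  have -> : \prod_j B i j (a j) x = B i l (a l) x * Q a by rewrite (bigD1 l).
  have -> : \prod_j B' j (a j) = d^-1 * dbump w (a l) (tau i l x) * Q a.
    rewrite (bigD1 l)//= /B' eqxx; congr (_ * _).
    by apply: eq_bigr => j /negPf ->.
  have := bump_approx w0 (a l) (tau i l x) (d^-1 * t).
  rewrite -[bump_fn _ _ (tau i l x)]/(B i l (a l) x).
  set b1 := bump_fn _ _ _; set b0 := B _ _ _ _; set db := dbump _ _ _ => hb.
  have -> : sv i a * (b1 * Q a) - sv i a * (b0 * Q a) - sv i a * (d^-1 * db * Q a) * t =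
    (sv i a * Q a) * (b1 - b0 - db * (d^-1 * t)) by ring.
  by rewrite normrM -!mulrA ler_wpM2l// (le_trans hb)// exprMn !mulrA.
have [lp|lp] := eqVneq l (p i); last first.
  have [c cP] := caseA i l (notB i l lp).
  rewrite big1 ?eqxx// => a _; rewrite (bigD1 l)//= /B' eqxx.
  by have [_ ->] := cP (a l); rewrite mulr0 mul0r mulr0.
have [c cP] : exists c : 'I_N -> 'I_(2 * L), forall j k, j != p i -> B i j k x = (k == c j)%:R.
  have hc j : exists c, j != p i -> forall k, B i j k x = (k == c)%:R.
    have [->|jp] := eqVneq j (p i).
      by have [[c _]|[c _]] := bump_cases w0 w4 (tauL i (p i) x Cx); exists c.
    by have [c cP] := caseA i j (notB i j jp); exists c => _ k; have [] := cP k.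
  by have /choice[c cP] := hc; exists c => j k jp; exact: cP.
have E1 := Gx i; rewrite /G (ffun_prod_sum _ cP) in E1.
have cP' j k : j != p i -> B' j k = (k == c j)%:R.
  by move=> jp; rewrite /B' lp (negPf jp) cP.
rewrite (ffun_prod_sum _ cP') /B' lp eqxx.
(* Across its own wall the component is [s * v1 + (1 - s) * v0], with derivative
   [D * (v1 - v0) / d]. If that were 0, the component would be equal to [v1 = v0], which is
   nonzero. *)
have [[c0 c0P]|[c0 [c1 [s [D [z [ne D0 _ bP]]]]]]] := bump_cases w0 w4 (tauL i (p i) x Cx).
  move: E1; rewrite (bigD1 c0)//= big1 => [|k kc].
    by rewrite /B (proj1 (c0P c0)) eqxx mulr1 addr0 => /eqP; rewrite (negPf (sv0 _ _)).
  by rewrite /B (proj1 (c0P k)) (negPf kc) mulr0.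
set s0 : 'I_(2 * L) -> R := fun k => sv i [ffun j => if j == p i then k else c j].
have two (b : 'I_(2 * L) -> R) : (forall k, k != c1 -> k != c0 -> b k = 0) ->
    \sum_k s0 k * b k = s0 c1 * b c1 + s0 c0 * b c0.
  move=> b0; rewrite (bigD1 c1)//= (bigD1 c0)//= big1 ?addr0// => k /andP[k1 k2].
  by rewrite b0// mulr0.
have bz k : k != c1 -> k != c0 -> B i (p i) k x = 0 /\ dbump w k (tau i (p i) x) = 0.
  by move=> k1 k2; have := bP k; rewrite (negPf k1) (negPf k2).
rewrite (two (fun k => B i (p i) k x)) in E1; last by move=> k k1 k2; have [] := bz k k1 k2.
rewrite (two (fun k => d^-1 * dbump w k (tau i (p i) x))); last first.
  by move=> k k1 k2; have [_ ->] := bz k k1 k2; rewrite mulr0.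
have [b1 d1] := bP c1; have [b0 d0'] := bP c0.
rewrite eqxx in b1 d1; rewrite (negPf ne) eqxx in b0 d0'.
rewrite /B b1 b0 in E1; rewrite d1 d0'.
apply/negbTE/negP => /eqP E2; have : s0 c1 = s0 c0.
  have : (d^-1 * D) * (s0 c1 - s0 c0) = 0 by rewrite -E2; ring.
  move=> /eqP; rewrite mulf_eq0 subr_eq0 => /orP[|/eqP//].
  by rewrite gt_eqF// mulr_gt0// invr_gt0.
move=> e1; move: E1; rewrite e1 -mulrDr addrC subrK mulr1 => /eqP.
by rewrite (negPf (sv0 _ _)).
Qed.
End RegularApproximation.

(** * Existence of the degree *)

Section DegreeExistence.
Variables (R : realType) (N : nat).
Local Notation V := 'rV[R]_N.
Implicit Types (F h : V -> V) (W C K : set V).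

Lemma norm_min (T : topologicalType) (C : set T) (f : T -> R) : compact C ->
  (forall x, C x -> ctat f x) -> (forall x, C x -> 0 < f x) ->
  exists2 e : R, 0 < e & forall x, C x -> e <= f x.
Proof.
move=> /compact_near_coveringP cC cf f0.
have := cC _ (0 : R)^'+ (fun r b => r <= f b) _; case.
  move=> b Cb; have fb := f0 _ Cb; have fb2 : 0 < f b / 2 by rewrite divr_gt0.
  have /(@ctatP T R R^o)/(_ _ fb2) nb := cf _ Cb.
  exists ([set q | `|f q - f b| < f b / 2], [set r | r < f b / 2]) => [|[q r] /= [qb rb]].
    by split => //; exact: nbhs_right_lt.
  by move: qb; rewrite ltr_norml => /andP[+ _]; lra.
move=> r /= r0 rP; exists (r / 2); first by rewrite divr_gt0.
by move=> b Cb; apply: (rP (r / 2)) => //=; rewrite ?sub0r ?normrN ?gtr0_norm ?divr_gt0//; lra.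
Qed.

(** Regular zeros are isolated by [local_deg], and the zeros in [C] form a compact set. *)
Lemma finite_zeros h C : compact C -> (forall x, differentiable h x) ->
  (forall x, C x -> h x = 0 -> \det (jacobian h x) != 0) ->
  exists2 s : seq V, uniq s & forall x, x \in s <-> C x /\ h x = 0.
Proof.
move=> cC dh hP; pose Z := [set x | C x /\ h x = 0].
have ch x : ctat h x by exact: differentiable_continuous.
have cZ : compact Z.
  have -> : Z = C `&` h @^-1` [set 0] by [].
  apply: (subclosed_compact _ cC); last by move=> x [].
  apply: closedI; first by apply: compact_closed => //; exact: norm_hausdorff.
  apply: closed_comp => [x _|]; first exact: ch.
  by apply: compact_closed; [exact: norm_hausdorff|exact: compact_set1].
have loc x : exists r : R, Z x -> 0 < r /\ forall y, ball x r y -> h y = 0 -> y = x.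
  have [[Cx hx]|nZ] := pselect (Z x); last by exists 0.
  have [r r0 rP] := @local_deg _ _ h setT x _ openT I (fun y _ => ch y) hx
    (diff_lin_at (dh x)) (hP _ Cx hx).
  have [|_ [_ _ _ _ a] _] := rP (r / 2); first by lra.
  by exists (r / 2) => _; split; [lra|move=> y xy hy; exact: a].
have [r rP] := choice loc.
move: cZ; rewrite compact_cover => /(_ V Z (fun x => ball x (r x)))[].
- by move=> x _; exact: ball_open.
- by move=> x Zx; exists x => //; apply: ballxx; case: (rP _ Zx).
move=> D DZ ZD; exists D; first exact: fset_uniq.
move=> x; split=> [xD|[Cx hx]]; first by have /set_mem := DZ _ xD.
have [y yD yx] := ZD x (conj Cx hx); have Zy : Z y by have /set_mem := DZ _ yD.
by have [_ /(_ _ yx hx) ->] := rP _ Zy.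
Qed.

Lemma closed_within W (f : V -> R) : {within closure W, continuous f} ->
  closed [set x | closure W x /\ f x <= 0].
Proof.
move=> /subspace_continuousP cf x cx.
have Wx : closure W x by apply: closed_closure; apply: closure_subset cx => y [].
split => //; rewrite leNgt; apply/negP => fx.
have /cvgrPdist_lt/(_ _ fx) := cf x Wx; rewrite near_withinE => nx.
have [y [[Wy fy] /(_ Wy)]] := cx _ nx.
by rewrite /from_subspace /= ltr_norml => /andP[_]; move: fy; lra.
Qed.

Lemma interior_within W (T : topologicalType) (f : V -> T) x : open W -> W x ->
  {within closure W, continuous f} -> ctat f x.
Proof.
move=> oW Wx /subspace_continuousP cf A nA.
have := cf x (subset_closure Wx) A nA; rewrite /nbhs /= /within /=.
have nW : nbhs x W by exact: open_nbhs_nbhs.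
by apply: filterS2 nW => y Wy; apply; exact: subset_closure.
Qed.

Definition lin_homotopy h F (t : R) (x : V) : V := (1 - t) *: h x + t *: F x.

Lemma lin_homotopy_deg F h W K z : adm F W K -> adm h W K ->
  (forall (t : R) x, 0 <= t <= 1 -> W x -> lin_homotopy h F t x = 0 -> K x) ->
  is_deg h W z -> is_deg F W z.
Proof.
move=> [oW cK KW cF _] [_ _ _ ch _] HK.
have {1}<- : lin_homotopy h F 0 = h.
  by apply/funext => x; rewrite /lin_homotopy subr0 scale1r scale0r addr0.
have {2}<- : lin_homotopy h F 1 = F.
  by apply/funext => x; rewrite /lin_homotopy subrr scale0r add0r scale1r.
apply: (@is_deg_homotopy _ _ _ W K) => // t x _ Wx.
change (ctat (fun p : R * V => lin_homotopy h F p.1 p.2) (t, x)).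
apply: ctatDv; apply: ctatZ => /=.
- by apply: ctatB; [exact: ctat_cst|exact: ctat_fst].
- by apply: (ctat_comp (f := snd)); [exact: ctat_snd|exact: ch].
- exact: ctat_fst.
- by apply: (ctat_comp (f := snd)); [exact: ctat_snd|exact: cF].
Qed.

(** A zero of the segment at time [t] satisfies [F x = - (1 - t) (h x - F x)], so it lies where
    [|F| <= |h - F|]. This set is closed in the compact closure of [W] and avoids the frontier. *)
Lemma deg_close F h W : open W -> bounded_set W ->
  {within closure W, continuous F} -> {within closure W, continuous h} ->
  (forall x, frontier W x -> `|h x - F x| < `|F x|) ->
  exists K, [/\ adm F W K, adm h W K &
    forall (t : R) x, 0 <= t <= 1 -> W x -> lin_homotopy h F t x = 0 -> K x].
Proof.
move=> oW bW cF ch hF.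
pose K := [set x | closure W x /\ `|F x| - `|h x - F x| <= 0].
have cf : {within closure W, continuous (fun x => `|F x| - `|h x - F x|)}.
  move=> x; apply: cvgB; apply: cvg_norm; first exact: cF.
  by apply: cvgB; [exact: ch|exact: cF].
have cK : compact K.
  by apply: (subclosed_compact (closed_within cf) (compact_closure bW)) => x [].
have KW : K `<=` W.
  move=> x [cx hx]; apply: contrapT => nx; have := hF x (conj cx nx).
  by move: hx; rewrite subr_le0; case: leP.
pose H := lin_homotopy h F.
have HK (t : R) x : 0 <= t <= 1 -> W x -> H t x = 0 -> K x.
  move=> /andP[t0 t1] Wx Hx; split; first exact: subset_closure.
  have FE : F x = - ((1 - t) *: (h x - F x)).
    apply/eqP; rewrite -addr_eq0 -Hx /H /lin_homotopy scalerBr addrC; apply/eqP.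
    by rewrite -addrA; congr (_ + _); rewrite scalerBl scale1r opprB subrK.
  rewrite subr_le0 {1}FE normrN normrZ ger0_norm; last by lra.
  by apply: ler_piMl => //; lra.
have H1 : H 1 = F by apply/funext => x; rewrite /H /lin_homotopy subrr scale0r add0r scale1r.
have H0 : H 0 = h by apply/funext => x; rewrite /H /lin_homotopy subr0 scale1r scale0r addr0.
exists K; split.
- split => //; first by move=> x Wx; exact: interior_within Wx cF.
  by move=> x Wx; rewrite -H1; apply: HK => //; rewrite ler01 lexx.
- split => //; first by move=> x Wx; exact: interior_within Wx ch.
  by move=> x Wx; rewrite -H0; apply: HK => //; rewrite ler01 lexx.
- exact: HK.
Qed.

(** The tool for computing degrees: a C1 map with finitely many regular zeros, linearly homotopic to
    [F] on a bounded core. The last clause, an error below the minimum of [|F|] on the frontier, is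
    what the definition of the fixed point index asks for. *)
Lemma regular_core F W K : adm F W K ->
  exists h W' (s : seq V), [/\ core F W W', K `<=` W',
    [/\ forall x, C1_at h x, uniq s & forall x, x \in s <-> W' x /\ h x = 0],
    forall x, x \in s -> \det (jacobian h x) != 0 &
    (exists K', [/\ adm F W' K', adm h W' K' &
      forall (t : R) x, 0 <= t <= 1 -> W' x -> lin_homotopy h F t x = 0 -> K' x]) /\
    exists e : R, [/\ 0 < e, forall x, frontier W' x -> e <= `|F x| &
      forall x, closure W' x -> `|h x - F x| < e]].
Proof.
move=> aF; have [W' [cW' KW']] := adm_core aF; have [oW' bW' sW' FW'] := cW'.
have [_ _ _ cF _] := aF.
have [e e0 eP] : exists2 e : R, 0 < e & forall x, frontier W' x -> e <= `|F x|.
  apply: (@norm_min V (frontier W') (fun x => `|F x|)).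
  - exact: compact_frontier.
  - by move=> x [/sW' Wx _]; apply: ctat_norm; exact: cF.
  - move=> x [/sW' Wx nx]; rewrite normr_gt0; apply/eqP => Fx; apply: nx; exact: FW'.
have cC := compact_closure bW'.
have [h [hC hF hJ]] := regular_approx cC (fun x Cx => cF x (sW' x Cx)) e0.
have dh x : differentiable h x by have [/nbhs_singleton] := hC x.
have [s us sP] := finite_zeros cC dh hJ.
have nfr x : closure W' x -> h x = 0 -> W' x.
  move=> cx hx; apply: contrapT => nx; have := hF x cx; rewrite hx sub0r normrN.
  by rewrite ltNge eP.
exists h, W', s; split => //.
- split => // x; split=> [/sP[cx hx]|[Wx hx]]; first by split => //; exact: nfr.
  by apply/sP; split => //; exact: subset_closure.
- by move=> x /sP[cx hx]; exact: hJ.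
split; last by exists e.
apply: deg_close => //.
- apply/subspace_continuousP => x cx; apply: cvg_within_filter.
  exact: cF (sW' _ cx).
- apply/subspace_continuousP => x cx; apply: cvg_within_filter.
  exact: differentiable_continuous.
- by move=> x fx; apply: lt_le_trans (eP _ fx); apply: hF; case: fx.
Qed.

Lemma is_deg_exists F W K : adm F W K -> exists z, is_deg F W z.
Proof.
move=> aF; have [h [W' [s [cW' KW' [hC us sP] hJ [[K' [aF' ah hz]] _]]]]] := regular_core aF.
have [oW' bW' sW' FW'] := cW'.
have dh x : differentiable h x by have [/nbhs_singleton] := hC x.
have [_ dd] := regular_deg us oW' (fun x _ => differentiable_continuous (dh x)) sP
  (fun x xs => conj (dh x) (hJ x xs)).
exists (\sum_(x <- s) sgz (\det (jacobian h x))).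
exact: (proj2 (is_deg_excision _ aF oW' (core_sub cW') KW') (lin_homotopy_deg aF' ah hz dd)).
Qed.
End DegreeExistence.

(** * Suspension and commutativity of the degree *)

Section Suspension.
Variables (R : realType) (m n : nat).
Local Notation V := 'rV[R]_m.

Lemma norm_row_mx (x : 'rV[R]_m) (y : 'rV[R]_n) : `|row_mx x y| = Num.max `|x| `|y|.
Proof.
apply/eqP; rewrite eq_le; apply/andP; split.
  apply: norm_le_coord => [|i]; first by rewrite le_max normr_ge0.
  rewrite mxE; case: splitP => j _; rewrite le_max; first by rewrite coord_le_norm.
  by rewrite coord_le_norm orbT.
rewrite ge_max; apply/andP; split; apply: norm_le_coord => // i.
  by have := coord_le_norm (row_mx x y) (lshift n i); rewrite row_mxEl.
by have := coord_le_norm (row_mx x y) (rshift m i); rewrite row_mxEr.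
Qed.

Lemma ctat_row_mx (T : topologicalType) (f : T -> 'rV[R]_m) (g : T -> 'rV[R]_n) p :
  ctat f p -> ctat g p -> ctat (fun q => row_mx (f q) (g q)) p.
Proof.
move=> /ctatP cf /ctatP cg; apply/ctatP => e e0; apply: filterS2 (cf e e0) (cg e e0) => q.
by rewrite opp_row_mx add_row_mx norm_row_mx gt_max => -> ->.
Qed.

Lemma ctat_lsubmx (T : topologicalType) (f : T -> 'rV[R]_(m + n)) p :
  ctat f p -> ctat (fun q => lsubmx (f q)) p.
Proof.
move=> cf; apply: ctat_row => i.
apply: (@eq_ctat _ _ _ (fun q => f q 0 (lshift n i))); first by move=> q; rewrite mxE.
exact: ctat_coord.
Qed.

Lemma ctat_rsubmx (T : topologicalType) (f : T -> 'rV[R]_(m + n)) p :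
  ctat f p -> ctat (fun q => rsubmx (f q)) p.
Proof.
move=> cf; apply: ctat_row => i.
apply: (@eq_ctat _ _ _ (fun q => f q 0 (rshift m i))); first by move=> q; rewrite mxE.
exact: ctat_coord.
Qed.
End Suspension.

Lemma conv_lt (R : realFieldType) (t a b r : R) :
  0 <= t -> t <= 1 -> a < r -> b < r -> (1 - t) * a + t * b < r.
Proof.
move=> t0; rewrite le_eqVlt => /predU1P[->|t1] ar br; first by rewrite subrr mul0r add0r mul1r.
have h1 : (1 - t) * a < (1 - t) * r by rewrite ltr_pM2l// subr_gt0.
have h2 : t * b <= t * r by rewrite ler_wpM2l// ltW.
lra.
Qed.

Section Suspension2.
(** The splitting of the ambient space is abstract because commutativity uses it in both orders: the
    first factor is [lsubmx] for one composite and [rsubmx] for the other. *)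
Variables (R : realType) (m n M : nat).
Variables (p1 : 'rV[R]_M -> 'rV[R]_m) (p2 : 'rV[R]_M -> 'rV[R]_n).
Variable pr : 'rV[R]_m -> 'rV[R]_n -> 'rV[R]_M.
Hypotheses (p1K : forall a b, p1 (pr a b) = a) (p2K : forall a b, p2 (pr a b) = b).
Hypothesis prK : forall u, pr (p1 u) (p2 u) = u.
Hypothesis prB : forall a b c d, pr a b - pr c d = pr (a - c) (b - d).
Hypothesis prD : forall a b c d, pr a b + pr c d = pr (a + c) (b + d).
Hypothesis pr_norm : forall a b, `|pr a b| = Num.max `|a| `|b|.
Hypothesis prZ : forall (t : R) a b, t *: pr a b = pr (t *: a) (t *: b).
Hypothesis pr_mx : forall J : 'M[R]_m,
  exists2 A : 'M[R]_M, (forall u, u *m A = pr (p1 u *m J) (p2 u)) & \det A = \det J.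

Lemma pr0 : pr 0 0 = 0.
Proof. by have := prB 0 0 0 0; rewrite !subrr => <-. Qed.

Lemma pr_eq0 a b : pr a b = 0 -> a = 0 /\ b = 0.
Proof.
by move=> h; have := congr1 p1 h; have := congr1 p2 h; rewrite p1K p2K -pr0 p1K p2K.
Qed.

Lemma p1B u v : p1 (u - v) = p1 u - p1 v.
Proof. by rewrite -{1}(prK u) -{1}(prK v) prB p1K. Qed.

Lemma p2B u v : p2 (u - v) = p2 u - p2 v.
Proof. by rewrite -{1}(prK u) -{1}(prK v) prB p2K. Qed.

Lemma p1_norm u : `|p1 u| <= `|u|.
Proof. by rewrite -{2}(prK u) pr_norm le_max lexx. Qed.

Lemma p2_norm u : `|p2 u| <= `|u|.
Proof. by rewrite -{2}(prK u) pr_norm le_max lexx orbT. Qed.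

Lemma ctat_p1 (T : topologicalType) (f : T -> 'rV[R]_M) p : ctat f p -> ctat (fun q => p1 (f q)) p.
Proof.
move=> /ctatP cf; apply/ctatP => e /cf; apply: filterS => q.
by apply: le_lt_trans; rewrite -p1B p1_norm.
Qed.

Lemma ctat_p2 (T : topologicalType) (f : T -> 'rV[R]_M) p : ctat f p -> ctat (fun q => p2 (f q)) p.
Proof.
move=> /ctatP cf; apply/ctatP => e /cf; apply: filterS => q.
by apply: le_lt_trans; rewrite -p2B p2_norm.
Qed.

Lemma ctat_pr (T : topologicalType) (f : T -> 'rV[R]_m) (g : T -> 'rV[R]_n) p :
  ctat f p -> ctat g p -> ctat (fun q => pr (f q) (g q)) p.
Proof.
move=> /ctatP cf /ctatP cg; apply/ctatP => e e0; apply: filterS2 (cf e e0) (cg e e0) => q.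
by rewrite prB pr_norm gt_max => -> ->.
Qed.

Lemma open_preim (T U : topologicalType) (f : T -> U) (A : set T) (B : set U) :
  open A -> (forall x, A x -> ctat f x) -> open B -> open (A `&` f @^-1` B).
Proof.
move=> oA cf oB; rewrite openE => x [Ax Bx].
have nA : nbhs x A by exact: open_nbhs_nbhs.
have nB : nbhs x (f @^-1` B) by apply: cf => //; exact: open_nbhs_nbhs.
exact: filterI.
Qed.

Lemma open_p1 (W : set 'rV[R]_m) : open W -> open (p1 @^-1` W).
Proof.
move=> oW; rewrite -[p1 @^-1` W]setTI; apply: open_preim => //; first exact: openT.
by move=> u _; apply: (ctat_p1 (f := fun q => q)); exact: ctat_id.
Qed.

Lemma open_p2 (W : set 'rV[R]_n) : open W -> open (p2 @^-1` W).
Proof.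
move=> oW; rewrite -[p2 @^-1` W]setTI; apply: open_preim => //; first exact: openT.
by move=> u _; apply: (ctat_p2 (f := fun q => q)); exact: ctat_id.
Qed.

Lemma image_compact (T U : topologicalType) (f : T -> U) (A : set T) :
  compact A -> (forall x, A x -> ctat f x) -> compact (f @` A).
Proof.
move=> cA cf; apply: continuous_compact => //; apply/subspace_continuousP => x Ax.
by apply: cvg_within_filter; exact: cf.
Qed.

Definition susp (F : 'rV[R]_m -> 'rV[R]_m) u := pr (F (p1 u)) (p2 u).

Lemma susp_adm F W K : adm F W K -> adm (susp F) (p1 @^-1` W) ((fun x => pr x 0) @` K).
Proof.
move=> [oW cK KW cF FK]; split.
- exact: open_p1.
- apply: image_compact => // x _; apply: ctat_pr; [exact: ctat_id|exact: ctat_cst].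
- by move=> _ [x Kx <-] /=; rewrite p1K; exact: KW.
- move=> u Wu; apply: ctat_pr; last by apply: ctat_p2; exact: ctat_id.
  by apply: (ctat_comp (f := p1)); [apply: ctat_p1; exact: ctat_id|exact: cF].
- move=> u Wu /pr_eq0[F0 y0]; exists (p1 u); first exact: FK.
  by rewrite -y0 prK.
Qed.

(** The suspension of a regular approximation has the same zeros, and its linear part is the
    Jacobian bordered by an identity block, with the same determinant. *)
Lemma susp_deg F W K z : adm F W K -> is_deg F W z -> is_deg (susp F) (p1 @^-1` W) z.
Proof.
move=> aF dF; have [h [W' [s [cW' KW' [hC us sP] hJ [[K' [aF' ah hz]] _]]]]] := regular_core aF.
have [oW' bW' sW' FW'] := cW'.
have dh x : differentiable h x by have [/nbhs_singleton] := hC x.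
have [_ dd] := regular_deg us oW' (fun x _ => differentiable_continuous (dh x)) sP
  (fun x xs => conj (dh x) (hJ x xs)).
have dF' := lin_homotopy_deg aF' ah hz dd.
have zE : z = \sum_(x <- s) sgz (\det (jacobian h x)).
  by apply: (is_deg_uniq aF' _ dF'); apply/(is_deg_excision _ aF oW' (core_sub cW') KW').
have /choice[A AP] : forall u, exists A : 'M[R]_M,
    (forall v, v *m A = pr (p1 v *m jacobian h (p1 u)) (p2 v)) /\ \det A = \det (jacobian h (p1 u)).
  by move=> u; have [A A1 A2] := pr_mx (jacobian h (p1 u)); exists A.
have uss : uniq [seq pr x 0 | x <- s].
  by rewrite map_inj_uniq// => x y e; rewrite -[x](p1K _ 0) e p1K.
have [|||_ dX] := @regular_lin_deg _ _ (susp h) (p1 @^-1` W') _ A uss (open_p1 oW').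
- move=> u _; apply: ctat_pr; last by apply: ctat_p2; exact: ctat_id.
  apply: (ctat_comp (f := p1)); [apply: ctat_p1; exact: ctat_id|exact: differentiable_continuous].
- move=> u; split=> [/mapP[x xs ->]|[Wu]].
    have [Wx hx] : W' x /\ h x = 0 by exact/sP.
    by rewrite /susp /= p1K p2K hx pr0.
  move=> /pr_eq0[h0 y0]; apply/mapP; exists (p1 u); first exact/sP.
  by rewrite -y0 prK.
- move=> u /mapP[x xs uE]; have [A1 A2] := AP u; split; last first.
    by rewrite A2 uE p1K; exact: hJ.
  move=> e e0.
  have cp : ctat p1 u by apply: (ctat_p1 (f := fun q => q)); exact: ctat_id.
  apply: (@filterS _ (nbhs u) _ _ _ _ (cp _ (diff_lin_at (dh (p1 u)) e0))) => v /= hv.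
  rewrite A1 /susp !prB p1B p2B subrr pr_norm normr0 max_l//.
  by rewrite (le_trans hv)// ler_wpM2l ?(ltW e0)// -p1B p1_norm.
have sE : \sum_(u <- [seq pr x 0 | x <- s]) sgz (\det (A u)) = z.
  rewrite zE big_map; apply: eq_bigr => x _; have [_ ->] := AP (pr x 0).
  by rewrite p1K.
rewrite sE in dX.
have aX := susp_adm aF.
apply: (proj2 (is_deg_excision _ aX (open_p1 oW') _ _)).
- by move=> u /(core_sub cW').
- by move=> _ [x /KW' Kx <-] /=; rewrite p1K.
apply: (lin_homotopy_deg (susp_adm aF') (susp_adm ah)) dX => t u t01 Wu.
have -> : lin_homotopy (susp h) (susp F) t u = pr (lin_homotopy h F t (p1 u)) (p2 u).
  by rewrite /lin_homotopy /susp !prZ prD -scalerDl subrK scale1r.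
move=> /pr_eq0[l0 y0]; exists (p1 u); first exact: hz l0.
by rewrite -y0 prK.
Qed.

Variables (phi : 'rV[R]_m -> 'rV[R]_n) (psi : 'rV[R]_n -> 'rV[R]_m).
Variables (U : set 'rV[R]_m) (W : set 'rV[R]_n) (K : set 'rV[R]_m).
Hypotheses (oU : open U) (oW : open W).
Hypotheses (cphi : forall x, U x -> ctat phi x) (cpsi : forall y, W y -> ctat psi y).
Hypothesis cK : compact K.
Hypothesis KE : forall x, K x <-> [/\ U x, W (phi x) & psi (phi x) = x].

Definition fix_dom := U `&` phi @^-1` W.
(** The two composites play symmetric roles here: eliminating either variable from the zero equation
    leaves the fixed point equation of one of them. *)
Definition comm_map u := pr (p1 u - psi (p2 u)) (p2 u - phi (p1 u)).
Definition fix_graph := (fun x => pr x (phi x)) @` K.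

Lemma comm_adm1 : adm (fun x => x - psi (phi x)) fix_dom K.
Proof.
split; [exact: open_preim|exact: cK|by move=> x /KE[]|..].
- move=> x [Ux Wx]; apply: ctatBv; first exact: ctat_id.
  by apply: (ctat_comp (f := phi)); [exact: cphi|exact: cpsi].
- by move=> x [Ux Wx] /subr0_eq xE; apply/KE.
Qed.

(* The homotopies (x - psi((1-t) y + t phi x), y - phi x) and
   (x - psi(phi x), y - t phi x). *)
Lemma comm_deg1 z : is_deg (fun x => x - psi (phi x)) fix_dom z ->
  exists O, [/\ adm comm_map O fix_graph & is_deg comm_map O z].
Proof.
move=> dz; have dX := susp_deg comm_adm1 dz.
have cphiK x : K x -> ctat phi x by move=> /KE[Ux _ _]; exact: cphi.
have cG : compact fix_graph.
  by apply: image_compact => // x Kx; apply: ctat_pr; [exact: ctat_id|exact: cphiK].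
have oD : open (p1 @^-1` fix_dom) by apply: open_p1; exact: open_preim.
pose Th u := pr (p1 u - psi (phi (p1 u))) (p2 u - phi (p1 u)).
have cp1 (T : topologicalType) (f : T -> 'rV[R]_M) p := @ctat_p1 T f p.
have aTh : adm Th (p1 @^-1` fix_dom) fix_graph.
  split => //.
  - by move=> _ [x /KE[Ux Wx _] <-] /=; rewrite p1K.
  - move=> u [Uu Wu]; have c1 : ctat p1 u by apply: (ctat_p1 (f := fun q => q)); exact: ctat_id.
    have cf : ctat (fun u => phi (p1 u)) u by apply: (ctat_comp c1); exact: cphi.
    change (ctat Th u); apply: ctat_pr; apply: ctatBv => //.
      by apply: (ctat_comp cf); exact: cpsi.
    by apply: ctat_p2; exact: ctat_id.
  - move=> u [Uu Wu] /pr_eq0[/subr0_eq e1 /subr0_eq e2]; exists (p1 u).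
      by apply/KE; split.
    by rewrite -e2 prK.
have d1 : is_deg Th (p1 @^-1` fix_dom) z.
  pose H (t : R) u := pr (p1 u - psi (phi (p1 u))) (p2 u - t *: phi (p1 u)).
  have HE : H 1 = Th by apply/funext => u; rewrite /H scale1r.
  rewrite -HE; apply: (@is_deg_homotopy _ _ H _ ((fun p : R * 'rV[R]_m => pr p.2 (p.1 *: phi p.2)) @`
      (`[0 : R, 1]%classic `*` K))) => //.
  - apply: image_compact; first by apply: compact_setX => //; exact: segment_compact.
    move=> [t x] [_ /= Kx]; apply: ctat_pr; first exact: ctat_snd.
    apply: ctatZ; first exact: ctat_fst.
    by apply: (ctat_comp (f := snd)); [exact: ctat_snd|exact: cphiK].
  - by move=> _ [[t x] [_ /= /KE[Ux Wx _]] <-] /=; rewrite p1K.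
  - move=> t u _ [Uu Wu]; change (ctat (fun p : R * 'rV[R]_M => H p.1 p.2) (t, u)).
    have c1 : ctat (fun p : R * 'rV[R]_M => p1 p.2) (t, u) by apply: ctat_p1; exact: ctat_snd.
    have cf : ctat (fun p : R * 'rV[R]_M => phi (p1 p.2)) (t, u) by apply: (ctat_comp c1); exact: cphi.
    apply: ctat_pr; apply: ctatBv => //.
    + by apply: (ctat_comp cf); exact: cpsi.
    + by apply: ctat_p2; exact: ctat_snd.
    + by apply: ctatZ => //; exact: ctat_fst.
  - move=> t u t01 [Uu Wu] /pr_eq0[/subr0_eq e1 /subr0_eq e2]; exists (t, p1 u).
      by split; [rewrite /= in_itv|apply/KE; split].
    by rewrite /= -e2 prK.
  - apply: eq_is_deg dX => // u _; rewrite /susp /H scale0r subr0 //.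
have cL : compact (phi @` K) by exact: image_compact.
(* The second homotopy evaluates [psi] between [phi x] and [y]. The set [O] requires both to lie in
   one ball inside [W], so that the segment does. *)
have [|r r0 rP] := @compact_uniform _ _ (phi @` K) (fun b y => W y) cL.
  move=> _ [x /KE[Ux Wx _] <-]; exists (setT, W) => [|[? ?] [] //]; split; first exact: filterT.
  exact: open_nbhs_nbhs.
pose O := (p1 @^-1` fix_dom) `&` \bigcup_(b in phi @` K)
   (((p1 @^-1` U) `&` (fun u => phi (p1 u)) @^-1` (ball b r)) `&` (p2 @^-1` (ball b r))).
have oO : open O.
  apply: openI => //; apply: bigcup_open => b _; apply: openI.
    apply: open_preim; [exact: open_p1| |exact: ball_open].
    move=> u Uu; have c1 : ctat p1 u by apply: (ctat_p1 (f := fun q => q)); exact: ctat_id.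
    by apply: (ctat_comp c1); exact: cphi.
  by apply: open_p2; exact: ball_open.
have OD : O `<=` p1 @^-1` fix_dom by move=> u [].
have GO : fix_graph `<=` O.
  move=> _ [x Kx <-]; have [Ux Wx _] := proj1 (KE x) Kx; split; first by rewrite /= p1K.
  exists (phi x); first by exists x.
  by split; [split|]; rewrite /= ?p1K ?p2K //; exact: ballxx.
have d2 := proj1 (is_deg_excision z aTh oO OD GO) d1.
pose H (t : R) u := pr (p1 u - psi ((1 - t) *: phi (p1 u) + t *: p2 u)) (p2 u - phi (p1 u)).
have HW (t : R) u : 0 <= t <= 1 -> O u -> W ((1 - t) *: phi (p1 u) + t *: p2 u).
  move=> /andP[t0 t1] [_ [b Lb [[_ b1] b2]]]; apply: (rP b Lb).
  have {}b1 : `|phi (p1 u) - b| < r by move: b1; rewrite -ball_normE /= distrC.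
  have {}b2 : `|p2 u - b| < r by move: b2; rewrite -ball_normE /= distrC.
  have -> : (1 - t) *: phi (p1 u) + t *: p2 u - b =
      (1 - t) *: (phi (p1 u) - b) + t *: (p2 u - b).
    rewrite !scalerBr addrACA; congr (_ + _); rewrite -opprD -scalerDl subrK scale1r //.
  rewrite (le_lt_trans (ler_normD _ _))// !normrZ (ger0_norm t0) ger0_norm; last by lra.
  exact: conv_lt.
have H0 : H 0 = Th by apply/funext => u; rewrite /H subr0 scale1r scale0r addr0.
have H1 : H 1 = comm_map by apply/funext => u; rewrite /H subrr scale0r add0r scale1r.
have HK (t : R) u : O u -> H t u = 0 -> fix_graph u.
  move=> [[Uu Wu] _] /pr_eq0[e1 /subr0_eq e2]; exists (p1 u); last by rewrite -e2 prK.
  move: e1; rewrite e2 -scalerDl subrK scale1r => /subr0_eq e1.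
  by apply/KE; split.
have cH (t : R) u : 0 <= t <= 1 -> O u -> ctat (fun p : R * 'rV[R]_M => H p.1 p.2) (t, u).
  move=> t01 Ou; have [[Uu Wu] _] := Ou.
  have c1 : ctat (fun p : R * 'rV[R]_M => p1 p.2) (t, u) by apply: ctat_p1; exact: ctat_snd.
  have c2 : ctat (fun p : R * 'rV[R]_M => p2 p.2) (t, u) by apply: ctat_p2; exact: ctat_snd.
  have cf : ctat (fun p : R * 'rV[R]_M => phi (p1 p.2)) (t, u) by apply: (ctat_comp c1); exact: cphi.
  apply: ctat_pr; apply: ctatBv => //.
  apply: (@ctat_comp _ _ _ (fun p : R * 'rV[R]_M => (1 - p.1) *: phi (p1 p.2) + p.1 *: p2 p.2) psi); last first.
    by apply: cpsi; exact: HW.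
  apply: ctatDv; apply: ctatZ => //; last exact: ctat_fst.
  by apply: ctatB; [exact: ctat_cst|exact: ctat_fst].
exists O; split.
  split => //; last by move=> u Ou; rewrite -H1; exact: HK.
  move=> u Ou; rewrite -H1 => A nA.
  have [|[B1 B2] [/= n1 n2] BA] := cH 1 u _ Ou A nA; first by rewrite ler01 lexx.
  by apply: filterS n2 => v Bv; apply: (BA (1, v)); split => //=; exact: nbhs_singleton n1.
rewrite -H1; apply: (@is_deg_homotopy _ _ H _ fix_graph) => //.
- by move=> t u _; exact: HK.
- by rewrite H0.
Qed.
End Suspension2.

Section Commutativity.
Variables (R : realType) (m n : nat).
Variables (phi : 'rV[R]_m -> 'rV[R]_n) (psi : 'rV[R]_n -> 'rV[R]_m).
Variables (U : set 'rV[R]_m) (W : set 'rV[R]_n).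
Hypotheses (oU : open U) (oW : open W).
Hypotheses (cphi : forall x, U x -> ctat phi x) (cpsi : forall y, W y -> ctat psi y).

Definition comm_fix : set 'rV[R]_m := [set x | [/\ U x, W (phi x) & psi (phi x) = x]].
Definition comm_fix' : set 'rV[R]_n := [set y | [/\ W y, U (psi y) & phi (psi y) = y]].

Lemma comm_fixE : comm_fix' = phi @` comm_fix.
Proof.
apply/seteqP; split=> y.
  by move=> [Wy Uy e]; exists (psi y) => //; split => //; rewrite e.
by move=> [x [Ux Wx e] <-]; split; rewrite ?e.
Qed.

(** For the two orders of the factors [comm_map] is the same function, and the graphs of [phi] and
    [psi] over the fixed points are the same set; both degrees equal the degree of this function
    near that set. *)
Lemma comm_deg z : compact comm_fix ->
  is_deg (fun x => x - psi (phi x)) (fix_dom phi U W) z ->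
  is_deg (fun y => y - phi (psi y)) (fix_dom psi W U) z.
Proof.
move=> cK dz.
have cL : compact comm_fix'.
  by rewrite comm_fixE; apply: image_compact => // x [Ux _ _]; exact: cphi.
have [z' dz'] := is_deg_exists (comm_adm1 oW oU cpsi cphi cL (fun y => iff_refl _)).
have [||||||||O [aO dO]] := @comm_deg1 R m n (m + n) lsubmx rsubmx (fun a b => row_mx a b)
  _ _ _ _ _ _ _ _ phi psi U W comm_fix oU oW cphi cpsi cK (fun y => iff_refl _) z dz.
- by move=> a b; rewrite row_mxKl.
- by move=> a b; rewrite row_mxKr.
- by move=> u; rewrite hsubmxK.
- by move=> a b c d; rewrite opp_row_mx add_row_mx.
- by move=> a b c d; rewrite add_row_mx.
- exact: norm_row_mx.
- by move=> t a b; rewrite scale_row_mx.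
- move=> J; exists (block_mx J 0 0 1%:M); last by rewrite det_ublock det1 mulr1.
  by move=> u; rewrite -{1}[u]hsubmxK mul_row_block !mulmx0 mulmx1 addr0 add0r.
have [||||||||O' [aO' dO']] := @comm_deg1 R n m (m + n) rsubmx lsubmx (fun a b => row_mx b a)
  _ _ _ _ _ _ _ _ psi phi W U comm_fix' oW oU cpsi cphi cL (fun y => iff_refl _) z' dz'.
- by move=> a b; rewrite row_mxKr.
- by move=> a b; rewrite row_mxKl.
- by move=> u; rewrite hsubmxK.
- by move=> a b c d; rewrite opp_row_mx add_row_mx.
- by move=> a b c d; rewrite add_row_mx.
- by move=> a b; rewrite norm_row_mx maxC.
- by move=> t a b; rewrite scale_row_mx.
- move=> J; exists (block_mx 1%:M 0 0 J); last by rewrite det_ublock det1 mul1r.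
  by move=> u; rewrite -{1}[u]hsubmxK mul_row_block !mulmx0 mulmx1 addr0 add0r.
have gE : fix_graph (fun a b => row_mx b a) psi comm_fix' =
    fix_graph (fun a b => row_mx a b) phi comm_fix.
  apply/seteqP; split=> u.
    by move=> [y [Wy Uy e] <-]; exists (psi y); [split; rewrite ?e|rewrite e].
  by move=> [x [Ux Wx e] <-]; exists (phi x); [split; rewrite ?e|rewrite e].
rewrite gE in aO'.
have [oO _ GO _ _] := aO; have [oO' _ GO' _ _] := aO'.
have oI : open (O `&` O') by exact: openI.
have GI : fix_graph (fun a b => row_mx a b) phi comm_fix `<=` O `&` O'.
  by move=> u gu; split; [exact: GO|exact: GO'].
have d1 := proj1 (is_deg_excision z aO oI (@subIsetl _ _ _) GI) dO.
have d2 := proj1 (is_deg_excision z' aO' oI (@subIsetr _ _ _) GI) dO'.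
have zz : z = z' := is_deg_uniq (proj1 (conj aO aO)) dO (proj2 (is_deg_excision z' aO oI (@subIsetl _ _ _) GI) d2).
by rewrite zz.
Qed.
End Commutativity.

Section WithinContinuity.
Context {T U V : topologicalType}.

Lemma ctat_within (f : T -> U) (g : U -> V) (B : set U) p :
  {within B, continuous g} -> (\forall q \near p, B (f q)) -> ctat f p ->
  ctat (fun q => g (f q)) p.
Proof.
move=> /subspace_continuousP cg nB cf A nA.
have nb := cf _ (cg _ (nbhs_singleton nB) A nA).
by apply: filterS2 nB nb => q Bq /(_ Bq).
Qed.

Lemma within_ctat (f : T -> U) (A : set T) :
  (forall x, A x -> ctat f x) -> {within A, continuous f}.
Proof.
by move=> cf; apply/subspace_continuousP => x Ax; apply: cvg_within_filter; exact: cf.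
Qed.

Lemma open_ctat (f : T -> U) (A : set T) :
  open A -> {within A, continuous f} -> forall x, A x -> ctat f x.
Proof.
move=> oA /subspace_continuousP cf x Ax B nB.
have nA : nbhs x A by exact: open_nbhs_nbhs.
by apply: filterS2 nA (cf x Ax B nB) => q Aq /(_ Aq).
Qed.

Lemma within_sub (f : T -> U) (A B : set T) : A `<=` B ->
  {within B, continuous f} -> {within A, continuous f}.
Proof. exact: continuous_subspaceW. Qed.

Lemma within_image (f : T -> U) (A : set T) : compact A -> {within A, continuous f} ->
  compact (f @` A).
Proof. by move=> cA cf; exact: continuous_compact. Qed.
End WithinContinuity.

(** * The fixed point index as a degree *)
Section IndexDegree.
Context {R : realType} {Y : topologicalType}.
Implicit Types (B : set Y) (g : Y -> Y).

Definition enr B N (iota : Y -> 'rV[R]_N) (rho : 'rV[R]_N -> Y) (O : set 'rV[R]_N) :=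
  [/\ open O, {within B, continuous iota}, forall x, O x -> ctat rho x,
      forall y, B y -> O (iota y) /\ rho (iota y) = y & forall x, O x -> B (rho x)].

Definition fix_map N (iota : Y -> 'rV[R]_N) (rho : 'rV[R]_N -> Y) g x :=
  x - iota (g (rho x)).

(** The index without the approximation step; it is proved equivalent to [is_fixed_point_index] in
    the two lemmas before [fixed_point_indexE]. *)
Definition deg_index B g (z : int) := exists N iota rho O,
  @enr B N iota rho O /\ is_deg (fix_map iota rho g) O z.

Variables (B : set Y) (g : Y -> Y).
Hypotheses (cB : compact B) (cg : {within B, continuous g}) (gB : forall y, B y -> B (g y)).

Lemma enr_ctat (T : topologicalType) N (iota : Y -> 'rV[R]_N) (f : T -> Y) p :
  {within B, continuous iota} -> (\forall q \near p, B (f q)) -> ctat f p ->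
  ctat (fun q => iota (g (f q))) p.
Proof.
move=> ci nB cf; apply: (ctat_within (f := fun q => g (f q)) ci).
  by apply: filterS nB => q; exact: gB.
exact: (ctat_within cg).
Qed.

Lemma fix_map_ctat N iota rho O x : @enr B N iota rho O -> O x ->
  ctat (fix_map iota rho g) x.
Proof.
move=> [oO ci cr _ rB] Ox; apply: ctatBv; first exact: ctat_id.
apply: enr_ctat => //; last exact: cr.
by have := open_nbhs_nbhs (conj oO Ox); apply: filterS => q; exact: rB.
Qed.

Lemma fix_map_zero N iota rho O x : @enr B N iota rho O -> O x ->
  fix_map iota rho g x = 0 -> exists2 y, B y & iota y = x /\ g y = y.
Proof.
move=> [oO ci cr ir rB] Ox /subr0_eq e; exists (rho x); first exact: rB.
have Br := gB (rB _ Ox); have [_ rr] := ir _ Br.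
have gr : g (rho x) = rho x by rewrite -{1}rr -e.
by rewrite [RHS]e gr.
Qed.

Lemma fix_adm N iota rho O : @enr B N iota rho O -> adm (fix_map iota rho g) O (iota @` B).
Proof.
move=> E; have [oO ci cr ir rB] := E; split; first exact: oO.
- exact: within_image.
- by move=> _ [y By <-]; have [] := ir y By.
- by move=> x Ox; apply: fix_map_ctat E Ox.
- by move=> x Ox /(fix_map_zero E Ox)[y By [<- _]]; exists y.
Qed.

(** Commutativity with [phi = i2 r1] and [psi = i1 g r2]: one composite is [i1 g r1], the other
    [i2 g r2]. *)
Lemma deg_index_uniq z z' : deg_index B g z -> deg_index B g z' -> z = z'.
Proof.
move=> [N1 [i1 [r1 [P1 [E1 d1]]]]] [N2 [i2 [r2 [P2 [E2 d2]]]]].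
have [oP1 ci1 cr1 ir1 rB1] := E1; have [oP2 ci2 cr2 ir2 rB2] := E2.
pose phi x := i2 (r1 x); pose psi y := i1 (g (r2 y)).
have nB1 x : P1 x -> \forall q \near x, B (r1 q).
  by move=> Ox; have := open_nbhs_nbhs (conj oP1 Ox); apply: filterS => q; exact: rB1.
have nB2 x : P2 x -> \forall q \near x, B (r2 q).
  by move=> Ox; have := open_nbhs_nbhs (conj oP2 Ox); apply: filterS => q; exact: rB2.
have cphi x : P1 x -> ctat phi x.
  by move=> Ox; apply: (ctat_within (f := r1) ci2); [exact: nB1|exact: cr1].
have cpsi y : P2 y -> ctat psi y.
  by move=> Oy; apply: enr_ctat => //; [exact: nB2|exact: cr2].
have pE x : P1 x -> psi (phi x) = i1 (g (r1 x)).
  by move=> /rB1 Bx; rewrite /psi /phi (ir2 _ Bx).2.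
have qE y : P2 y -> phi (psi y) = i2 (g (r2 y)).
  by move=> /rB2/gB Bx; rewrite /psi /phi (ir1 _ Bx).2.
have D1 : fix_dom phi P1 P2 = P1.
  apply/seteqP; split=> x; first by case.
  by move=> Ox; split => //; exact: (ir2 _ (rB1 _ Ox)).1.
have D2 : fix_dom psi P2 P1 = P2.
  apply/seteqP; split=> x; first by case.
  by move=> Ox; split => //; exact: (ir1 _ (gB (rB2 _ Ox))).1.
have cF : compact (comm_fix phi psi P1 P2).
  have -> : comm_fix phi psi P1 P2 =
      (i1 @` B) `&` [set x | P1 x /\ fix_map i1 r1 g x = 0].
    apply/seteqP; split=> x.
      move=> [Ox _ e]; have z0 : fix_map i1 r1 g x = 0 by rewrite /fix_map -pE// e subrr.
      by split => //; have [y By [<- _]] := fix_map_zero E1 Ox z0; exists y.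
    move=> [_ [Ox /subr0_eq e]]; split; [exact: Ox|exact: (ir2 _ (rB1 _ Ox)).1|by rewrite pE// -e].
  have cI : compact (i1 @` B) by exact: within_image.
  have cl : closed (i1 @` B) by apply: compact_closed cI; exact: norm_hausdorff.
  apply: (subclosed_compact _ cI); last exact: subIsetl.
  move=> x cx; have Bx : (i1 @` B) x.
    by apply: cl; apply: closure_subset cx; exact: subIsetl.
  have Ox : P1 x by case: Bx => y By <-; have [] := ir1 y By.
  split => //; split => //; apply: contrapT => n0.
  have cx0 := fix_map_ctat E1 Ox.
  have op : open (~` [set (0 : 'rV[R]_N1)]).
    by apply: closed_openC; apply: compact_closed; [exact: norm_hausdorff|exact: compact_set1].
  have nb : nbhs (fix_map i1 r1 g x) (~` [set 0]) by exact: open_nbhs_nbhs.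
  by have [y [[_ [_ y0]] /=]] := cx _ (cx0 _ nb).
have d1' : is_deg (fun x => x - psi (phi x)) (fix_dom phi P1 P2) z.
  by rewrite D1; apply: eq_is_deg d1 => // x Ox; rewrite pE.
have := comm_deg oP1 oP2 cphi cpsi cF d1'; rewrite D2 => d3.
apply: (is_deg_uniq (fix_adm E2)) d2.
by apply: eq_is_deg d3 => // y Oy; rewrite qE.
Qed.

(** The lower bound [e] on the frontier and the error below [e] are the hypotheses of
    [deg_close]. *)
Lemma index_deg z : is_fixed_point_index R B g z -> deg_index B g z.
Proof.
move=> [N [iota [rho [W [h [e [s /= [[ci cr ir rB] [oW bW e0 eF] [ch hF hC] [us sP hJ ->]]]]]]]]].
have E : enr B iota rho W.
  split => //; [|by move=> x Wx; apply: rB; exact: subset_closure].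
  by move=> x Wx; apply: interior_within cr.
exists N, iota, rho, W; split => //.
have cF : {within closure W, continuous (fix_map iota rho g)}.
  apply/subspace_continuousP => x cx; apply: cvgB; first exact: cvg_within.
  have /subspace_continuousP c3 : {within closure W, continuous (iota \o (g \o rho))}.
    apply: (within_precomp (B := B)) => //; last by move=> y cy; apply: gB; exact: rB.
    by apply: (within_precomp (B := B)) => // y cy; exact: rB.
  exact: c3.
have [|K [aF ah hz]] := deg_close oW bW cF ch.
  by move=> x [cx nx]; apply: lt_le_trans (eF x cx nx); exact: hF.
have [||_ dd] := @regular_deg R N h W s us oW _ sP.
- by move=> x Wx; apply: interior_within ch.
- move=> x xs; split; last exact: hJ.
  by have [/nbhs_singleton] := hC x (proj1 (proj1 (sP x) xs)).
exact: (lin_homotopy_deg aF ah hz dd).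
Qed.

(** A regular core of the displacement map supplies data for the definition; that they give [z] and
    no other number is the uniqueness just proved. *)
Lemma deg_index_def z : deg_index B g z -> is_fixed_point_index R B g z.
Proof.
move=> dz; have [N [iota [rho [P [E _]]]]] := dz.
have [oO ci cr ir rB] := E.
have [h [W [s [[oW bW sW FW] KW [hC us sP] hJ [_ [e [e0 eP hF]]]]]]] := regular_core (fix_adm E).
suff H : is_fixed_point_index R B g (\sum_(x <- s) jacobian_sign h x).
  by rewrite (deg_index_uniq dz (index_deg H)).
exists N, iota, rho, W, h, e, s; split.
- split => //.
  + by apply: within_ctat => x /sW; exact: cr.
  + by move=> y By; have [_ ?] := ir y By; split => //; apply: KW; exists y.
  + by move=> x /sW; exact: rB.
- by split => // x cx nx; exact: eP.
- split; [|exact: hF|by move=> x _; exact: hC].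
  by apply: within_ctat => x _; have [/nbhs_singleton dh _] := hC x; exact: differentiable_continuous.
- by split.
Qed.

Lemma fixed_point_indexE z : deg_index B g z -> fixed_point_index R B g = z.
Proof.
move=> dz; rewrite /fixed_point_index.
have h : [set z' | is_fixed_point_index R B g z'] z by exact: deg_index_def.
have := xgetPex 0 (ex_intro _ z h) => /index_deg d; exact: deg_index_uniq d dz.
Qed.
End IndexDegree.

(** * Discs and the Euclidean norm *)

Section Discs.
Context {R : realType}.

Lemma ctat_max (T : topologicalType) (f g : T -> R) p :
  ctat f p -> ctat g p -> ctat (fun q => Num.max (f q) (g q)) p.
Proof. by move=> cf cg; exact: (@continuous_max _ _ f g). Qed.

Lemma ctat_min (T : topologicalType) (f g : T -> R) p :
  ctat f p -> ctat g p -> ctat (fun q => Num.min (f q) (g q)) p.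
Proof. by move=> cf cg; exact: (@continuous_min _ _ f g). Qed.

(** Homotopies are given on the unit interval, while joint continuity at its ends looks at times on
    both sides; clamping the time extends them. *)
Definition clamp (t : R) : R := Num.min 1 (Num.max 0 t).

Lemma clamp_itv t : 0 <= clamp t <= 1.
Proof. by rewrite le_min ler01 le_max lexx /= ge_min lexx. Qed.

Lemma clampE t : 0 <= t <= 1 -> clamp t = t.
Proof. by move=> /andP[t0 t1]; rewrite /clamp max_r ?min_r. Qed.

Lemma ctat_clamp (T : topologicalType) (f : T -> R) p : ctat f p -> ctat (fun q => clamp (f q)) p.
Proof. by move=> cf; apply: ctat_min; [|apply: ctat_max => //]; exact: ctat_cst. Qed.

Lemma ctat_sqrt (T : topologicalType) (f : T -> R) p :
  ctat f p -> ctat (fun q => Num.sqrt (f q)) p.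
Proof. by move=> cf; apply: (ctat_comp (g := @Num.sqrt R) cf); exact: sqrt_continuous. Qed.

Lemma ctat_normsq (T : topologicalType) n (f : T -> 'rV[R]_n) p :
  ctat f p -> ctat (fun q => normsq (f q)) p.
Proof.
move=> cf; apply: ctat_sum => i; rewrite /=.
apply: (eq_ctat (g := fun q => f q 0 i * f q 0 i)) => [q|]; first by rewrite expr2.
by apply: ctatM; exact: ctat_coord.
Qed.

Lemma ctat_small (T : topologicalType) (V : normedModType R) (f : T -> V) (b : T -> R) p :
  (\forall q \near p, `|f q - f p| <= b q) -> b p = 0 -> ctat b p -> ctat f p.
Proof.
move=> nb b0 /(ctatP (V := R^o)) cb; apply/ctatP => e e0.
apply: filterS2 nb (cb e e0) => q h1; rewrite b0 subr0 => h2.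
by apply: le_lt_trans h1 _; apply: le_lt_trans h2; exact: ler_norm.
Qed.

(** This handles polar formulas at the origin, where the direction jumps but stays bounded. *)
Lemma ctat_scale0 (T : topologicalType) (V : normedModType R) (f : T -> R) (v : T -> V) (M : R) p :
  ctat f p -> f p = 0 -> (\forall q \near p, f q = 0 \/ `|v q| <= M) -> ctat (fun q => f q *: v q) p.
Proof.
move=> cf f0 nv; apply: (@ctat_small _ _ _ (fun q => `|f q| * Num.max M 0)).
- apply: filterS nv => q [->|vM]; first by rewrite !scale0r f0 scale0r subrr !normr0 mul0r.
  by rewrite f0 scale0r subr0 normrZ ler_wpM2l// le_max vM.
- by rewrite f0 normr0 mul0r.
- by apply: ctatM; [apply: (ctat_norm (V := R^o))|exact: ctat_cst].
Qed.

Variable n : nat.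
Implicit Types (y : 'rV[R]_n).

Lemma normsq_ge0 y : 0 <= normsq y.
Proof. by apply: sumr_ge0 => i _; exact: sqr_ge0. Qed.

Lemma normsqZ (a : R) y : normsq (a *: y) = a ^+ 2 * normsq y.
Proof. by rewrite /normsq mulr_sumr; apply: eq_bigr => i _; rewrite mxE exprMn. Qed.

Lemma normsq0 : normsq (0 : 'rV[R]_n) = 0.
Proof. by rewrite /normsq big1// => i _; rewrite mxE expr0n. Qed.

Lemma normsq_eq0 y : (normsq y == 0) = (y == 0).
Proof.
apply/eqP/eqP => [|->]; last exact: normsq0.
move=> h; apply/rowP => i; rewrite mxE; apply/eqP; rewrite -sqrf_eq0; apply/eqP.
by apply: (psumr_eq0P _ h) => // j _; exact: sqr_ge0.
Qed.

Definition enorm y := Num.sqrt (normsq y).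

Lemma enorm_ge0 y : 0 <= enorm y.
Proof. exact: sqrtr_ge0. Qed.

Lemma enorm_sq y : enorm y ^+ 2 = normsq y.
Proof. by rewrite sqr_sqrtr ?normsq_ge0. Qed.

Lemma enorm_eq0 y : (enorm y == 0) = (y == 0).
Proof. by rewrite sqrtr_eq0 -normsq_eq0 eq_le normsq_ge0 andbT. Qed.

Lemma enormZ (a : R) y : enorm (a *: y) = `|a| * enorm y.
Proof. by rewrite /enorm normsqZ sqrtrM ?sqr_ge0// sqrtr_sqr. Qed.

Lemma norm_le_enorm y : `|y| <= enorm y.
Proof.
apply: norm_le_coord => [|i]; first exact: enorm_ge0.
rewrite -sqrtr_sqr ler_wsqrtr// /normsq (bigD1 i)//= lerDl; apply: sumr_ge0 => j _.
exact: sqr_ge0.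
Qed.

(** At the origin the value is 0, as the inverse of 0 is 0. *)
Definition direction y := (enorm y)^-1 *: y.

Lemma normsq_direction y : y != 0 -> normsq (direction y) = 1.
Proof. by move=> y0; rewrite normsqZ -enorm_sq -exprMn mulVf ?expr1n// enorm_eq0. Qed.

Lemma direction_norm y : `|direction y| <= 1.
Proof.
apply: (le_trans (norm_le_enorm _)); rewrite enormZ normfV ger0_norm ?enorm_ge0//.
by have [->|y0] := eqVneq (enorm y) 0; rewrite ?mulr0// mulVf.
Qed.

Lemma directionZ (a : R) y : 0 < a -> direction (a *: y) = direction y.
Proof.
move=> a0; rewrite /direction enormZ gtr0_norm// invfM scalerA mulrAC.
by rewrite mulVf ?mul1r// gt_eqF.
Qed.

Lemma directionK y : enorm y *: direction y = y.
Proof.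
rewrite scalerA; have [->|y0] := eqVneq y 0; first by rewrite scaler0.
by rewrite divff ?scale1r// enorm_eq0.
Qed.

Lemma direction_id y : normsq y = 1 -> direction y = y.
Proof. by move=> y1; rewrite /direction /enorm y1 sqrtr1 invr1 scale1r. Qed.

Definition cdisc : set 'rV[R]_n := [set d | normsq d <= 1].
Definition odisc : set 'rV[R]_n := [set d | normsq d < 1].

Lemma odisc_sub : odisc `<=` cdisc.
Proof. by move=> d; exact: ltW. Qed.

Lemma closed_cdisc : closed cdisc.
Proof.
have -> : cdisc = (@normsq R n) @^-1` [set x | x <= 1] by [].
apply: closed_comp; last exact: closed_le.
by move=> y _; apply: (ctat_normsq (f := id)); exact: ctat_id.
Qed.

Lemma compact_cdisc : compact cdisc.
Proof.
apply: bounded_closed_compact closed_cdisc.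
apply: (@ex_bounded _ _ _ 1) => d d1; apply: le_trans (norm_le_enorm d) _.
by rewrite -sqrtr1 ler_wsqrtr.
Qed.

Lemma enorm_le1 y : (enorm y <= 1) = (normsq y <= 1).
Proof. by rewrite -[X in _ <= X]sqrtr1 ler_sqrt ?ler01. Qed.

Lemma ctat_enorm (T : topologicalType) (f : T -> 'rV[R]_n) p :
  ctat f p -> ctat (fun q => enorm (f q)) p.
Proof. by move=> cf; apply: ctat_sqrt; exact: ctat_normsq. Qed.

Lemma ctat_direction (T : topologicalType) (f : T -> 'rV[R]_n) p :
  ctat f p -> f p != 0 -> ctat (fun q => direction (f q)) p.
Proof.
move=> cf f0; apply: ctatZ => //; apply: ctatV; first by rewrite enorm_eq0.
exact: ctat_enorm.
Qed.
End Discs.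
Arguments cdisc {R n}.
Arguments odisc {R n}.

Section ClosedTests.
Context {T U : topologicalType}.

Lemma within_closedP (f : T -> U) (A : set T) :
  (forall C, closed C -> closed (A `&` f @^-1` C)) -> {within A, continuous f}.
Proof.
move=> h; apply/subspace_continuousP => x Ax V nV.
have [V' [oV' Vx] V'V] : exists2 V', open V' /\ V' (f x) & V' `<=` V.
  by move: nV; rewrite nbhsE => -[V' [] ? ? ?]; exists V'.
have cl : closed (A `&` f @^-1` (~` V')) by apply: h; exact: open_closedC.
have op : open (~` (A `&` f @^-1` (~` V'))) by exact: closed_openC.
have nb : nbhs x (~` (A `&` f @^-1` (~` V'))) by apply: open_nbhs_nbhs; split => // -[_]; apply.
apply: (@filterS _ (nbhs x) _ _ _ _ nb) => q /= nq Aq; apply: V'V; apply: contrapT => nV'.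
by apply: nq.
Qed.

Lemma closed_within_preim (f : T -> U) (A : set T) (C : set U) : closed A -> closed C ->
  {within A, continuous f} -> closed (A `&` f @^-1` C).
Proof.
move=> cA cC /subspace_continuousP cf x cx.
have Ax : A x by apply: cA; apply: closure_subset cx; exact: subIsetl.
split => //; apply: contrapT => nC.
have nb : nbhs (f x) (~` C) by apply: open_nbhs_nbhs; split => //; exact: closed_openC.
have [y [[Ay Cy] /(_ Ay)]] := cx _ (cf x Ax _ nb).
by apply.
Qed.

(** A continuous injection of a compact set into a Hausdorff space is closed, so continuity may be
    tested after it. *)
Lemma ctat_embedding (S : topologicalType) (iota : T -> U) (B : set T) (f : S -> T) p :
  hausdorff_space U -> compact B -> {within B, continuous iota} ->
  (forall x y, B x -> B y -> iota x = iota y -> x = y) ->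
  (\forall q \near p, B (f q)) -> ctat (fun q => iota (f q)) p -> ctat f p.
Proof.
move=> hU cB ci inj nB cf A; rewrite nbhsE => -[A' [oA' A'p] A'A].
have cl : closed (iota @` (B `&` ~` A')).
  apply: compact_closed => //; apply: within_image; last by apply: within_sub ci; exact: subIsetl.
  by apply: compact_closedI => //; exact: open_closedC.
have nb : nbhs (iota (f p)) (~` (iota @` (B `&` ~` A'))).
  apply: open_nbhs_nbhs; split; first exact: closed_openC.
  by move=> [y [By ny] e]; apply: ny; rewrite (inj _ _ By (nbhs_singleton nB) e).
apply: filterS2 nB (cf _ nb) => q Bq nq; apply: A'A; apply: contrapT => nA; apply: nq.
by exists (f q).
Qed.
End ClosedTests.

(** * Attaching a cell to a Euclidean neighbourhood retract *)

Section Attach.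
Context {R : realType} {Y : topologicalType}.
Variables (A : set Y) (N n : nat) (iota : Y -> 'rV[R]_N) (rho : 'rV[R]_N -> Y) (O : set 'rV[R]_N).
Variable c : 'rV[R]_n -> Y.
Local Notation M := (N + (n + 1))%N.
Local Notation B := (A `|` c @` cdisc).
Hypotheses (cA : compact A) (clA : closed A) (E : enr A iota rho O).
Hypotheses (cc : {within cdisc, continuous c}) (cbd : forall d, normsq d = 1 -> A (c d)).
Hypothesis cint : forall d, odisc d -> ~ A (c d).
Hypothesis cinj : forall d d', odisc d -> odisc d' -> c d = c d' -> d = d'.
Hypothesis top : forall C, C `<=` B -> closed (C `&` A) -> closed (cdisc `&` c @^-1` C) -> closed C.

Definition join3 (x : 'rV[R]_N) (y : 'rV[R]_n) (t : R) : 'rV[R]_M := row_mx x (row_mx y t%:M).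
Definition px (u : 'rV[R]_M) : 'rV[R]_N := lsubmx u.
Definition py (u : 'rV[R]_M) : 'rV[R]_n := lsubmx (rsubmx u).
Definition pt (u : 'rV[R]_M) : R := rsubmx (rsubmx u) 0 0.

Lemma px_join x y t : px (join3 x y t) = x. Proof. exact: row_mxKl. Qed.
Lemma py_join x y t : py (join3 x y t) = y. Proof. by rewrite /py row_mxKr row_mxKl. Qed.
Lemma pt_join x y t : pt (join3 x y t) = t.
Proof. by rewrite /pt !row_mxKr mxE eqxx mulr1n. Qed.

Lemma ctat_join (T : topologicalType) (f : T -> 'rV[R]_N) (g : T -> 'rV[R]_n) (h : T -> R) p :
  ctat f p -> ctat g p -> ctat h p -> ctat (fun q => join3 (f q) (g q) (h q)) p.
Proof.
move=> cf cg ch; apply: ctat_row_mx => //; apply: ctat_row_mx => //.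
apply: (eq_ctat (g := fun q => h q *: (1%:M : 'rV[R]_1))) => [q|].
  by rewrite scale_scalar_mx mulr1.
by apply: ctatZ => //; exact: ctat_cst.
Qed.

Lemma ctat_px u : ctat px u. Proof. by apply: ctat_lsubmx; exact: ctat_id. Qed.
Lemma ctat_py u : ctat py u.
Proof. by apply: ctat_lsubmx; apply: ctat_rsubmx; exact: ctat_id. Qed.
Lemma ctat_pt u : ctat pt u.
Proof. by apply: ctat_coord; apply: ctat_rsubmx; apply: ctat_rsubmx; exact: ctat_id. Qed.

Definition att y := iota (c (direction y)).

Lemma attE (y : 'rV[R]_n) : y != 0 -> [/\ A (c (direction y)), O (att y) & rho (att y) = c (direction y)].
Proof.
move=> /normsq_direction/cbd Ac; have [_ _ _ ir _] := E.
by split => //; have [] := ir _ Ac.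
Qed.

Lemma ctat_att y : y != 0 -> ctat att y.
Proof.
move=> y0; have [_ ci _ _ _] := E; have n1 := normsq_direction y0.
have nd : \forall q \near y, q != 0.
  have : ctat (fun q : 'rV[R]_n => enorm q) y by apply: ctat_enorm; exact: ctat_id.
  move=> /(_ [set x | x != 0]); case.
    by apply: (@open_nbhs_nbhs R^o); split; [exact: open_neq|rewrite /= enorm_eq0].
  by move=> e e0 h; exists e => // q /h /=; rewrite enorm_eq0.
apply: (ctat_within (f := fun q => c (direction q)) ci).
  by apply: filterS nd => q /attE[].
apply: (@ctat_within _ _ _ (@direction R n) c cdisc y cc).
  by apply: filterS nd => q q0; rewrite /cdisc /= normsq_direction.
by apply: ctat_direction => //; exact: ctat_id.
Qed.

Lemma att_bound : exists K : R, forall y, y != 0 -> `|att y| <= K.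
Proof.
have [_ ci _ _ _] := E.
have cI : compact (iota @` A) by exact: within_image.
have [K KP] := bounded_ex (compact_bounded cI).
by exists K => y /attE[Ac _ _]; apply: KP; exists (c (direction y)).
Qed.

(** The last coordinate is [t = 1 - |d|^2]: the cell meets [A] at [t = 0], and elsewhere the middle
    part divided by [t] recovers [d]. The factor [|d|^2] makes the first part continuous at the
    centre, where [att] is merely bounded. *)
Definition cell_emb d := join3 (normsq d *: att d) ((1 - normsq d) *: d) (1 - normsq d).

Lemma cell_emb_within d : ctat cell_emb d.
Proof.
have cn : ctat (@normsq R n) d by apply: (ctat_normsq (f := id)); exact: ctat_id.
have c1 : ctat (fun d : 'rV[R]_n => 1 - normsq d) d by apply: ctatB; [exact: ctat_cst|].
apply: ctat_join => //; last by apply: ctatZ => //; exact: ctat_id.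
have [d0|d0] := eqVneq d 0; last by apply: ctatZ => //; exact: ctat_att.
have [K KP] := att_bound.
apply: (ctat_scale0 (M := K)); [by apply: (ctat_normsq (f := id)); exact: ctat_id|by rewrite d0 normsq0|].
apply: (@filterS _ (nbhs d) _ setT) => [q _|]; last exact: filterT.
have [->|q0] := eqVneq q 0; first by left; exact: normsq0.
by right; exact: KP.
Qed.

Definition att_iota y := if `[< A y >] then join3 (iota y) 0 0
  else cell_emb (xget 0 [set d | odisc d /\ c d = y]).

Lemma att_iotaA y : A y -> att_iota y = join3 (iota y) 0 0.
Proof. by move=> Ay; rewrite /att_iota; case: asboolP. Qed.

Lemma att_iotac d : cdisc d -> att_iota (c d) = cell_emb d.
Proof.
rewrite /cdisc /= le_eqVlt => /predU1P[d1|d1].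
  rewrite att_iotaA; last exact: cbd.
  by rewrite /cell_emb d1 subrr scale0r scale1r /att direction_id.
rewrite /att_iota; case: asboolP => [/cint//|_].
have h : [set d' | odisc d' /\ c d' = c d] d by [].
have [od cd] := xgetPex 0 (ex_intro _ d h).
by rewrite (cinj od d1 cd).
Qed.

Lemma att_iota_within : {within B, continuous att_iota}.
Proof.
have [_ ci _ _ _] := E.
apply: within_closedP => C clC; apply: top; first exact: subIsetl.
  have -> : B `&` att_iota @^-1` C `&` A = A `&` (fun y => join3 (iota y) 0 0) @^-1` C.
    apply/seteqP; split => y; first by move=> [[_ /= Cy] Ay]; split => //=; rewrite -att_iotaA.
    by move=> [Ay Cy]; split => //; split; [left|rewrite /= att_iotaA].
  apply: closed_within_preim => //.
  apply/subspace_continuousP => x Ax.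
  have /subspace_continuousP/(_ x Ax) ci' := ci.
  apply: (@cvg_comp _ _ _ iota (fun v => join3 v 0 0) _ (nbhs (iota x))); first exact: ci'.
  apply: (ctat_join (f := id)); [exact: ctat_id|exact: ctat_cst|exact: ctat_cst].
have -> : cdisc `&` c @^-1` (B `&` att_iota @^-1` C) = cdisc `&` cell_emb @^-1` C.
  apply/seteqP; split => d.
    by move=> [d1 [_ /= Cd]]; split => //=; rewrite -att_iotac.
  by move=> [d1 /= Cd]; split => //; split; [right; exists d|rewrite /= att_iotac].
apply: closed_within_preim => //; first exact: closed_cdisc.
by apply: within_ctat => d _; exact: cell_emb_within.
Qed.

(* Off the cell, a point near A is moved first radially onto A within the cell
   structure and then by [rho]; [mismatch] vanishes on the embedded cell and
   decides between the two. *)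
Definition cutoff (t : R) := Num.max 0 (Num.min 1 (2 - 4 * t)).
(** On the embedded cell [x / (1 - t) = att y] and [|y|^2 / t^2 = |d|^2 = 1 - t]. Division by [t]
    turns a bound on the mismatch into a deviation of order [t], which gives continuity as [t] tends
    to 0. The cutoff is 1 for [t <= 1/4] and 0 for [t >= 1/2], the region that contains the centre
    of the cell. *)
Definition mismatch u := cutoff (pt u) * ((`|(1 - pt u)^-1 *: px u - att (py u)|
   + `|normsq (py u) / pt u ^+ 2 - (1 - pt u)|) / pt u).
(** Two stages. While the mismatch grows from 0 to 1, [blend 0] moves the radius out to 1; while it
    grows from 1 to 2, [blend 1] moves the base from [att y] to [x / (1 - t)]. So at the switch in
    [att_rho] the radius is 1 and the base is still [att y], and both formulas give
    [c (direction y)]. *)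
Definition blend k u : R := if pt u <= 0 then 1 else clamp (mismatch u - k).
Definition radius u := (1 - blend 0 u) * Num.min 1 (enorm (py u) / pt u) + blend 0 u.
Definition base u := (1 - pt u)^-1 *: px u + (1 - blend 1 u) *: (att (py u) - (1 - pt u)^-1 *: px u).
Definition att_rho u := if blend 0 u < 1 then c (radius u *: direction (py u)) else rho (base u).
(** The composite of [att_rho] and [att_iota] in closed form. Its continuity can be checked by
    formula, and [ctat_embedding] transfers it to [att_rho]. *)
Definition att_map u := join3 (radius u ^+ 2 *: iota (rho (base u)))
  ((1 - radius u ^+ 2) *: (radius u *: direction (py u))) (1 - radius u ^+ 2).

Definition far : set 'rV[R]_M := [set u | 1/2 < pt u].
Definition near_base : set 'rV[R]_M := [set u | pt u < 1/4].
Definition side : set 'rV[R]_M := [set u | [/\ 0 < pt u, pt u < 1 & py u != 0]].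
(** The first piece contains the centre of the embedded cell, the second contains the image of [A],
    and the third the remaining part of the cell. *)
Definition att_dom := far `|` (near_base `&` base @^-1` O) `|` (side `&` base @^-1` O).

Lemma blend01 k u : 0 <= blend k u <= 1.
Proof.
rewrite /blend; case: ifP => _; first by rewrite ler01 lexx.
by rewrite le_min ler01 le_max lexx /= ge_min lexx.
Qed.

Lemma blend_pos u : blend 0 u < 1 -> 0 < pt u /\ blend 1 u = 0.
Proof.
rewrite /blend; case: (lerP (pt u) 0) => t0; first by rewrite ltxx.
rewrite subr0 gt_min ltxx /= gt_max => /andP[_ m1]; split => //.
by rewrite /clamp max_l ?min_r// subr_le0 ltW.
Qed.

Lemma blend_far k u : 0 <= k -> far u -> blend k u = 0.
Proof.
move=> k0; rewrite /far /= => t2; rewrite /blend leNgt (lt_trans _ t2) ?divr_gt0//=.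
rewrite /mismatch /cutoff; have -> : Num.max 0 (Num.min 1 (2 - 4 * pt u)) = 0.
  by apply: max_l; rewrite ge_min; apply/orP; right; lra.
by rewrite mul0r sub0r /clamp max_l ?oppr_le0// min_r.
Qed.

Lemma clamp01 (b m : R) : 0 <= b <= 1 -> 0 <= m -> 0 <= (1 - b) * Num.min 1 m + b <= 1.
Proof.
move=> /andP[b0 b1] m0.
have h0 : 0 <= Num.min 1 m by rewrite le_min ler01.
have h1 : Num.min 1 m <= 1 by rewrite ge_min lexx.
by move: (Num.min 1 m) h0 h1 => k k0 k1; apply/andP; split; nra.
Qed.

Lemma radius01 u : 0 <= radius u <= 1.
Proof.
have [t0|t0] := lerP (pt u) 0; last first.
  by apply: clamp01; [exact: blend01|rewrite divr_ge0 ?enorm_ge0// ltW].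
by rewrite /radius /blend t0 subrr mul0r add0r ler01 lexx.
Qed.

Lemma radius_ge1 u : 1 <= blend 0 u -> radius u = 1.
Proof.
move=> b1; have [_ b2] := andP (blend01 0 u).
by rewrite /radius (le_anti (introT andP (conj b2 b1))) subrr mul0r add0r.
Qed.

Lemma base_lt1 u : blend 0 u < 1 -> base u = att (py u).
Proof. by move=> /blend_pos[_ b]; rewrite /base b subr0 scale1r addrC subrK. Qed.

Lemma base_dom u : att_dom u -> O (base u) \/ far u.
Proof. by move=> [[|[]]|[]]; [right|left|left]. Qed.

(** The direction of 0 is meaningless, but where the cell formula applies with [py u = 0] the point
    is far from [A]: near [A], points of the axis have mismatch above 1. *)
Lemma radius_y0 u : att_dom u -> blend 0 u < 1 -> py u = 0 -> radius u = 0.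
Proof.
move=> Du b1 y0; have [t0 _] := blend_pos b1.
have tf : far u.
  case: Du => [[//|[nu _]]|[[_ _ /eqP]]//]; exfalso; move: b1; apply/negP; rewrite -leNgt.
  rewrite /blend (leNgt (pt u)) t0 /= subr0 le_min lexx /= le_max; apply/orP; right.
  rewrite /mismatch y0 normsq0 mul0r /cutoff.
  have -> : Num.max 0 (Num.min 1 (2 - 4 * pt u)) = 1.
    rewrite min_l ?max_r ?ler01//; move: nu; rewrite /near_base /=; lra.
  rewrite mul1r ler_pdivlMr// mul1r.
  move: nu; rewrite /near_base /= => nu; rewrite sub0r normrN (ger0_norm (x := 1 - pt u)); last by lra.
  have := normr_ge0 ((1 - pt u)^-1 *: px u - att 0); lra.
rewrite /radius blend_far// y0 /enorm normsq0 sqrtr0 mul0r.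
by rewrite min_r ?ler01// mulr0 addr0.
Qed.

Lemma cdisc_radius u : cdisc (radius u *: direction (py u)).
Proof.
have /andP[r0 r1] := radius01 u; rewrite /cdisc /= normsqZ.
have [->|y0] := eqVneq (py u) 0; first by rewrite /direction scaler0 normsq0 mulr0.
by rewrite normsq_direction// mulr1 expr_le1.
Qed.

Lemma att_rho_dom u : att_dom u -> B (att_rho u).
Proof.
move=> Du; rewrite /att_rho; case: ifPn => [b1|]; rewrite -?leNgt.
  by right; exists (radius u *: direction (py u)) => //; exact: cdisc_radius.
move=> b1; left; have [_ _ _ _ rA] := E; apply: rA.
case: (base_dom Du) => // /(blend_far (lexx 0)) b0; exfalso.
by move: b1; rewrite b0 ler10.
Qed.

Lemma att_mapE u : att_dom u -> att_iota (att_rho u) = att_map u.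
Proof.
move=> Du; rewrite /att_rho /att_map; case: ifPn => [b1|]; rewrite -?leNgt.
  rewrite att_iotac; last exact: cdisc_radius.
  have /andP[r0 r1] := radius01 u.
  rewrite /cell_emb; have [y0|y0] := eqVneq (py u) 0.
    rewrite (radius_y0 Du b1 y0) scale0r normsq0 expr0n /= !scale0r //.
  have [Ac Oa ra] := attE y0.
  rewrite normsqZ normsq_direction// mulr1 base_lt1// ra.
  congr (join3 _ _ _); have [->|rn0] := eqVneq (radius u) 0; first by rewrite expr0n !scale0r.
  rewrite /att directionZ ?lt0r ?rn0//.
  by rewrite direction_id ?normsq_direction.
move=> b1; rewrite radius_ge1// expr1n subrr !scale0r scale1r att_iotaA//.
have [_ _ _ _ rA] := E; apply: rA.
case: (base_dom Du) => // /(blend_far (lexx 0)) b0; exfalso.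
by move: b1; rewrite b0 ler10.
Qed.

Lemma att_rhoK y : B y -> att_dom (att_iota y) /\ att_rho (att_iota y) = y.
Proof.
have [_ _ _ ir _] := E.
have inA z : A z -> att_dom (att_iota z) /\ att_rho (att_iota z) = z.
  move=> Az; have [Oz rz] := ir z Az.
  have tE : pt (att_iota z) = 0 by rewrite att_iotaA// pt_join.
  have bE k : blend k (att_iota z) = 1 by rewrite /blend tE lexx.
  have wE : base (att_iota z) = iota z.
    by rewrite /base bE tE att_iotaA// px_join !subr0 invr1 subrr scale0r scale1r addr0.
  split; first by left; right; split; rewrite /near_base /= ?wE// tE divr_gt0.
  by rewrite /att_rho bE ltxx wE.
move=> [/inA//|[d]]; rewrite /cdisc /= le_eqVlt => /predU1P[/cbd Ac <-|d1 <-]; first exact: inA.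
rewrite att_iotac; last exact: ltW.
set u := cell_emb d.
have q0 := normsq_ge0 d.
have uy : py u = (1 - normsq d) *: d by rewrite py_join.
have ut : pt u = 1 - normsq d by rewrite pt_join.
have t0 : 0 < pt u by rewrite ut subr_gt0.
have uth : direction (py u) = direction d by rewrite uy directionZ// -ut.
have uatt : att (py u) = att d by rewrite /att uth.
have mE : mismatch u = 0.
  rewrite /mismatch; have [q2|q2] := lerP (normsq d) (1/2).
    have -> : cutoff (pt u) = 0.
      by rewrite /cutoff max_l// ge_min ut; apply/orP; right; lra.
    by rewrite mul0r.
  rewrite uatt px_join ut uy normsqZ subKr scalerA mulVf; last by rewrite gt_eqF//; lra.
  rewrite scale1r subrr normr0 add0r mulrAC divff; last by rewrite expf_neq0// gt_eqF// -ut.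
  by rewrite mul1r subrr normr0 mul0r mulr0.
have bE k : 0 <= k -> blend k u = 0.
  move=> k0; rewrite /blend leNgt t0 /= mE sub0r /clamp max_l ?oppr_le0// min_r//.
have rE : radius u = enorm d.
  rewrite /radius bE// subr0 mul1r addr0 uy enormZ gtr0_norm -?ut// mulrAC divff ?gt_eqF// mul1r.
  by rewrite min_r// enorm_le1 ltW.
split; last by rewrite /att_rho bE// ltr01 rE uth directionK.
have [q2|q2] := ltrP (normsq d) (1/2).
  by left; left; rewrite /far /= ut; lra.
have d0 : d != 0 by apply: contraTneq q2 => ->; rewrite normsq0 -ltNge divr_gt0.
have [_ Oa _] := attE d0.
right; split; last by rewrite /= base_lt1 ?bE ?ltr01// uatt.
split => //; first by rewrite ut; lra.
by rewrite uy scaler_eq0 negb_or d0 andbT -ut gt_eqF.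
Qed.

Lemma open_gt_ctat (T : topologicalType) (f : T -> R) a :
  (forall u, ctat f u) -> open [set u | a < f u].
Proof.
by move=> cf; apply: (@open_comp _ _ f [set x | a < x]) => [u _|]; [exact: cf|exact: open_gt].
Qed.

Lemma open_lt_ctat (T : topologicalType) (f : T -> R) a :
  (forall u, ctat f u) -> open [set u | f u < a].
Proof.
by move=> cf; apply: (@open_comp _ _ f [set x | x < a]) => [u _|]; [exact: cf|exact: open_lt].
Qed.

Lemma open_far : open far.
Proof. exact: (open_gt_ctat _ ctat_pt). Qed.

Lemma open_near_base : open near_base.
Proof. exact: (open_lt_ctat _ ctat_pt). Qed.

Lemma open_side : open side.
Proof.
have -> : side = [set u | 0 < pt u] `&` [set u | pt u < 1] `&` [set u | 0 < enorm (py u)].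
  apply/seteqP; split=> u; first by move=> [? ? y0]; split => //=; rewrite lt0r enorm_eq0 y0 enorm_ge0.
  by move=> [[? ?] /=]; rewrite lt0r enorm_eq0 => /andP[].
apply: openI; first apply: openI.
- exact: (open_gt_ctat _ ctat_pt).
- exact: (open_lt_ctat _ ctat_pt).
- by apply: open_gt_ctat => u; apply: ctat_enorm; exact: ctat_py.
Qed.

Lemma near_open (T : topologicalType) (P : set T) x : open P -> P x -> \forall q \near x, P q.
Proof. by move=> oP Px; exact: open_nbhs_nbhs. Qed.

Lemma ctat_scaled_px u : pt u != 1 -> ctat (fun q => (1 - pt q)^-1 *: px q) u.
Proof.
move=> t1; apply: ctatZ; last exact: ctat_px.
apply: ctatV; first by rewrite subr_eq0 eq_sym.
by apply: ctatB; [exact: ctat_cst|exact: ctat_pt].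
Qed.

Lemma ctat_mismatch u : side u -> ctat mismatch u.
Proof.
move=> [t0 t1 y0]; have t0' : pt u != 0 by rewrite gt_eqF.
have ct := @ctat_pt u.
have c1t : ctat (fun q => 1 - pt q) u by apply: ctatB; [exact: ctat_cst|].
have iv : ctat (fun q => (pt q)^-1) u by exact: ctatV.
apply: ctatM.
  apply: ctat_max; first exact: ctat_cst.
  apply: ctat_min; first exact: ctat_cst.
  by apply: ctatB; [exact: ctat_cst|apply: ctatM => //; exact: ctat_cst].
apply: ctatM => //; apply: ctatD.
  apply: ctat_norm; apply: ctatBv; first by apply: ctat_scaled_px; rewrite lt_eqF.
  by apply: (ctat_comp (f := py)); [exact: ctat_py|exact: ctat_att].
apply: (ctat_norm (V := R^o)); apply: ctatB => //; apply: ctatM.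
  by apply: ctat_normsq; exact: ctat_py.
apply: ctatV; first by rewrite expf_neq0.
by apply: (eq_ctat (g := fun q => pt q * pt q)) => [q|]; [rewrite expr2|exact: ctatM].
Qed.

Lemma ctat_blend k u : side u -> ctat (blend k) u.
Proof.
move=> su; have cm : ctat (fun q => mismatch q - k) u.
  by apply: ctatB; [exact: ctat_mismatch|exact: ctat_cst].
apply: ctat_near (ctat_clamp cm); apply: filterS (near_open open_side su) => q [t0 _ _].
by rewrite /blend leNgt t0.
Qed.

Lemma ctat_radius_side u : side u -> ctat radius u.
Proof.
move=> su; have cb := ctat_blend (k := 0) su; have [t0 _ _] := su.
apply: ctatD => //; apply: ctatM; first by apply: ctatB => //; exact: ctat_cst.
apply: ctat_min; first exact: ctat_cst.
apply: ctatM; first by apply: ctat_enorm; exact: ctat_py.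
by apply: ctatV; [rewrite gt_eqF|exact: ctat_pt].
Qed.

Lemma ctat_base_side u : side u -> ctat base u.
Proof.
move=> su; have cb := ctat_blend (k := 1) su; have [t0 t1 y0] := su.
have cx : ctat (fun q => (1 - pt q)^-1 *: px q) u by apply: ctat_scaled_px; rewrite lt_eqF.
apply: ctatDv => //; apply: ctatZ; first by apply: ctatB => //; exact: ctat_cst.
apply: ctatBv => //.
by apply: (ctat_comp (f := py)); [exact: ctat_py|exact: ctat_att].
Qed.

Lemma blend_mismatch2 k u : k <= 1 -> 0 < pt u -> 2 <= mismatch u -> blend k u = 1.
Proof.
move=> k1 t0 m2; rewrite /blend leNgt t0 /= /clamp min_l// le_max; apply/orP; right; lra.
Qed.

Lemma near_base_mismatch u : near_base u -> 0 < pt u ->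
  [/\ `|(1 - pt u)^-1 *: px u - att (py u)| <= pt u * mismatch u &
      `|normsq (py u) / pt u ^+ 2 - (1 - pt u)| <= pt u * mismatch u].
Proof.
rewrite /near_base /= => t4 t0.
have -> : pt u * mismatch u = `|(1 - pt u)^-1 *: px u - att (py u)|
   + `|normsq (py u) / pt u ^+ 2 - (1 - pt u)|.
  rewrite /mismatch; have -> : cutoff (pt u) = 1.
    rewrite /cutoff min_l ?max_r ?ler01//; lra.
  by rewrite mul1r mulrC divfK// gt_eqF.
by rewrite lerDl lerDr !normr_ge0.
Qed.

Lemma near_base_axis u : near_base u -> 0 < pt u -> py u = 0 ->
  \forall q \near u, 0 < pt q /\ 2 <= mismatch q.
Proof.
move=> nu t0 y0.
have ct := @ctat_pt u.
pose f q := `|normsq (py q) / pt q ^+ 2 - (1 - pt q)|.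
have cf : ctat f u.
  apply: (ctat_norm (V := R^o)); apply: ctatB; last by apply: ctatB => //; exact: ctat_cst.
  apply: ctatM; first by apply: ctat_normsq; exact: ctat_py.
  apply: ctatV; first by rewrite expf_neq0// gt_eqF.
  by apply: (eq_ctat (g := fun q => pt q * pt q)) => [q|]; [rewrite expr2|exact: ctatM].
have fu : 1/2 < f u.
  rewrite /f y0 normsq0 mul0r sub0r normrN ger0_norm; move: nu; rewrite /near_base /=; lra.
have n1 : \forall q \near u, 1/2 < f q.
  by apply: (cf [set x | 1/2 < x]); apply: (@open_nbhs_nbhs R^o); split; [exact: open_gt|].
have n2 : \forall q \near u, near_base q /\ 0 < pt q.
  apply: filterI; first exact: near_open open_near_base nu.
  by apply: (ct [set x | 0 < x]); apply: (@open_nbhs_nbhs R^o); split; [exact: open_gt|].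
apply: filterS2 n1 n2 => q f1 [nq q0]; split => //.
have [_] := near_base_mismatch nq q0; rewrite -/(f q) => h.
move: nq; rewrite /near_base /= => nq.
by move: (mismatch q) h => m h; nra.
Qed.

Lemma ctat_pt0 u : ctat (fun q => Num.max (pt q) 0) u.
Proof. by apply: ctat_max; [exact: ctat_pt|exact: ctat_cst]. Qed.

(** Near [A] the base differs from [x / (1 - t)], and the radius from 1, by at most [2 * t] for
    positive [t] and not at all otherwise; this settles [t <= 0]. On the axis with positive [t] the
    mismatch is at least 2 nearby, and both are given by the outer formulas. *)
Lemma ctat_axis u : near_base u -> pt u <= 0 \/ py u = 0 ->
  [/\ ctat base u, ctat radius u & radius u = 1].
Proof.
move=> nu h; have nu' := near_open open_near_base nu.
have t1 : pt u != 1 by rewrite lt_eqF//; move: nu; rewrite /near_base /=; lra.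
have cx := ctat_scaled_px t1.
have [t0|t0] := ltrP 0 (pt u).
  have nm : \forall q \near u, 0 < pt q /\ 2 <= mismatch q.
    by apply: near_base_axis => //; case: h => //; rewrite leNgt t0.
  have r1 q : 0 < pt q /\ 2 <= mismatch q -> radius q = 1.
    by move=> [q0 m2]; rewrite radius_ge1// blend_mismatch2.
  split; last exact: r1 (nbhs_singleton nm).
    apply: ctat_near cx; apply: filterS nm => q [q0 m2].
    by rewrite /base blend_mismatch2// subrr scale0r addr0.
  by apply: (@ctat_near _ _ radius (fun=> (1 : R))); [apply: filterS nm|exact: ctat_cst].
have b1 k : blend k u = 1 by rewrite /blend t0.
have r1 : radius u = 1 by rewrite radius_ge1 ?b1.
have m0 : Num.max (pt u) 0 = 0 by rewrite max_r.
split; last exact: r1.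
  have cd : ctat (fun q => base q - (1 - pt q)^-1 *: px q) u.
    apply: (@ctat_small _ _ _ _ (fun q => Num.max (pt q) 0 * 2)); last first.
    - by apply: ctatM; [exact: ctat_pt0|exact: ctat_cst].
    - by rewrite m0 mul0r.
    apply: filterS nu' => q nq.
    rewrite /base b1 subrr scale0r addr0 addrAC !subrr subr0 addrAC subrr add0r normrZ.
    have [q0|q0] := ltrP 0 (pt q); last by rewrite /blend q0 subrr normr0 mul0r mulr_ge0// le_max lexx orbT.
    have [m2|m2] := lerP 2 (mismatch q); first by rewrite blend_mismatch2// subrr normr0 mul0r mulr_ge0// ltW.
    have [h1 _] := near_base_mismatch nq q0.
    have /andP[c0 c1] := blend01 1 q.
    rewrite distrC in h1; rewrite ger0_norm ?subr_ge0//.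
    apply: (le_trans (y := 1 * `|att (py q) - (1 - pt q)^-1 *: px q|)).
      by rewrite ler_wpM2r// lerBlDr lerDl.
    by rewrite mul1r (le_trans h1)// ler_wpM2l ?ltW.
  apply: (eq_ctat (g := fun q => (base q - (1 - pt q)^-1 *: px q) + (1 - pt q)^-1 *: px q)) => [q|].
    by rewrite subrK.
  exact: ctatDv.
apply: (@ctat_small R _ R^o radius (fun q => Num.max (pt q) 0 * 2) u); last first.
- by apply: ctatM; [exact: ctat_pt0|exact: ctat_cst].
- by rewrite m0 mul0r.
apply: filterS nu' => q nq; rewrite r1.
have [q0|q0] := ltrP 0 (pt q); last first.
  by rewrite radius_ge1 ?subrr ?normr0 ?mulr_ge0 ?le_max ?lexx ?orbT// /blend q0.
have /andP[p0 p1] := radius01 q.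
have [m1|m1] := lerP 1 (mismatch q).
  rewrite radius_ge1 ?subrr ?normr0 ?mulr_ge0 ?(ltW q0)//.
  by rewrite /blend (leNgt (pt q)) q0 /= subr0 le_min lexx le_max m1 orbT.
have [_ h2] := near_base_mismatch nq q0.
rewrite distrC ger0_norm ?subr_ge0//.
move: nq; rewrite /near_base /= => nq.
(* A mismatch below 1 bounds the deviation of [|y|^2 / t^2] from [1 - t] by [t]. *)
have h3 : 1 - 2 * pt q <= (enorm (py q) / pt q) ^+ 2.
  rewrite expr_div_n enorm_sq; move: h2; rewrite ler_norml => /andP[h2 _].
  by move: (mismatch q) m1 h2 => m m1 h2; nra.
have e0 : 0 <= enorm (py q) / pt q by rewrite divr_ge0 ?enorm_ge0// ltW.
have h4 : 1 - 2 * pt q <= Num.min 1 (enorm (py q) / pt q).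
  rewrite le_min; apply/andP; split; first by lra.
  rewrite leNgt; apply/negP => h5; move: h3; apply/negP; rewrite -ltNge.
  by move: (enorm (py q) / pt q) e0 h5 => x x0 h5; nra.
have h5 : Num.min 1 (enorm (py q) / pt q) <= 1 by rewrite ge_min lexx.
have /andP[c0 c1] := blend01 0 q.
rewrite /radius; move: (blend 0 q) c0 c1 => b b0 b1'.
move: (Num.min 1 _) h4 h5 => k k0 k1; nra.
Qed.

Lemma iota_rho_ctat v : O v -> ctat (fun v => iota (rho v)) v.
Proof.
have [oO ci cr _ rA] := E => Ov; apply: (ctat_within (f := rho) ci); last exact: cr.
by apply: filterS (near_open oO Ov); exact: rA.
Qed.

Lemma iota_rho_bound : exists K : R, forall v, O v -> `|iota (rho v)| <= K.
Proof.
have [_ ci _ _ rA] := E.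
have cI : compact (iota @` A) by exact: within_image.
have [K KP] := bounded_ex (compact_bounded cI).
by exists K => v /rA Ar; apply: KP; exists (rho v).
Qed.

Lemma open_att_dom : open att_dom.
Proof.
have [oO _ _ _ _] := E.
apply: openU; first apply: openU; first exact: open_far.
- apply: open_preim => //; first exact: open_near_base.
  move=> u nu; have [t0|t0] := lerP (pt u) 0; first by have [|] := ctat_axis nu; [left|].
  have [y0|y0] := eqVneq (py u) 0; first by have [|] := ctat_axis nu; [right|].
  apply: ctat_base_side; split => //; move: nu; rewrite /near_base /=; lra.
- apply: open_preim => //; first exact: open_side.
  exact: ctat_base_side.
Qed.

Lemma ctat_att_map_core u : ctat radius u -> ctat base u -> O (base u) ->
  py u != 0 \/ radius u = 1 -> ctat att_map u.
Proof.
move=> cr cb Ob h.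
have cr2 : ctat (fun q => radius q ^+ 2) u.
  by apply: (eq_ctat (g := fun q => radius q * radius q)) => [q|]; [rewrite expr2|exact: ctatM].
have c1 : ctat (fun q => 1 - radius q ^+ 2) u by apply: ctatB => //; exact: ctat_cst.
apply: ctat_join; last exact: c1.
  apply: ctatZ; first exact: cr2.
  exact: (@ctat_comp _ _ _ base (fun v => iota (rho v)) u cb (iota_rho_ctat Ob)).
case: h => [y0|r1].
  by apply: ctatZ => //; apply: ctatZ => //; apply: ctat_direction => //; exact: ctat_py.
apply: (ctat_scale0 (M := 1)) => //; first by rewrite r1 expr1n subrr.
apply: (@filterS _ (nbhs u) _ setT) => [q _|]; last exact: filterT.
right; rewrite normrZ; have /andP[r0 r1'] := radius01 q.
by rewrite ger0_norm// mulr_ile1// direction_norm.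
Qed.

Lemma ctat_att_map u : att_dom u -> ctat att_map u.
Proof.
move=> [[fu|[nu Ou]]|[su Ou]]; last first.
- apply: ctat_att_map_core => //; [exact: ctat_radius_side|exact: ctat_base_side|].
  by left; case: su.
- have [t0|t0] := lerP (pt u) 0.
    by have [|? ? ?] := ctat_axis nu; [left|apply: ctat_att_map_core => //; right].
  have [y0|y0] := eqVneq (py u) 0.
    by have [|? ? ?] := ctat_axis nu; [right|apply: ctat_att_map_core => //; right].
  have su : side u by split => //; move: nu; rewrite /near_base /=; lra.
  by apply: ctat_att_map_core => //; [exact: ctat_radius_side|exact: ctat_base_side|left].
have nf := near_open open_far fu.
have t0 : 0 < pt u by move: fu; rewrite /far /=; lra.
have cr : ctat radius u.
  apply: (ctat_near (g := fun q => Num.min 1 (enorm (py q) / pt q))).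
    by apply: filterS nf => q fq; rewrite /radius blend_far// subr0 mul1r addr0.
  apply: ctat_min; first exact: ctat_cst.
  apply: ctatM; first by apply: ctat_enorm; exact: ctat_py.
  by apply: ctatV; [rewrite gt_eqF|exact: ctat_pt].
have bE q : far q -> base q = att (py q).
  by move=> fq; apply: base_lt1; rewrite blend_far// ltr01.
have [y0|y0] := eqVneq (py u) 0; last first.
  apply: ctat_att_map_core => //; last by left.
    apply: (ctat_near (g := fun q => att (py q))); first exact: filterS nf.
    by apply: (ctat_comp (f := py)); [exact: ctat_py|exact: ctat_att].
  by rewrite bE//; have [] := attE y0.
have ry q : far q -> py q = 0 -> radius q = 0.
  by move=> fq q0; apply: radius_y0 => //; [left; left|rewrite blend_far// ltr01].
have r0 : radius u = 0 by exact: ry.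
have cr2 : ctat (fun q => radius q ^+ 2) u.
  by apply: (eq_ctat (g := fun q => radius q * radius q)) => [q|]; [rewrite expr2|exact: ctatM].
have c1 : ctat (fun q => 1 - radius q ^+ 2) u by apply: ctatB => //; exact: ctat_cst.
apply: ctat_join => //.
  have [K KP] := iota_rho_bound.
  apply: (ctat_scale0 (M := K)) => //; first by rewrite r0 expr0n.
  apply: filterS nf => q fq; have [q0|q0] := eqVneq (py q) 0; first by left; rewrite ry// expr0n.
  by right; apply: KP; rewrite bE//; have [] := attE q0.
apply: ctatZ => //; apply: (ctat_scale0 (M := 1)) => //.
apply: (@filterS _ (nbhs u) _ setT) => [q _|]; last exact: filterT.
by right; exact: direction_norm.
Qed.

Lemma compact_attach : compact B.
Proof. by apply: compactU => //; apply: within_image => //; exact: compact_cdisc. Qed.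

Lemma enr_attach : enr B att_iota att_rho att_dom.
Proof.
split; [exact: open_att_dom|exact: att_iota_within| |exact: att_rhoK|exact: att_rho_dom].
move=> u Du; have nD := near_open open_att_dom Du.
apply: (ctat_embedding (@norm_hausdorff _ _) compact_attach att_iota_within).
- move=> x y /att_rhoK[_ {2}<-] /att_rhoK[_ {2}<-] -> //.
- by apply: filterS nD; exact: att_rho_dom.
- apply: ctat_near (ctat_att_map Du).
  by apply: filterS nD; exact: att_mapE.
Qed.
End Attach.

(** * Additivity of the degree and maps of spheres *)

Section DegreeAlgebra.
Context {R : realType} {N : nat}.
Local Notation V := 'rV[R]_N.
Implicit Types (F : V -> V) (W K U : set V).

Lemma adm_zeros F W K : adm F W K -> adm F W [set x | W x /\ F x = 0].
Proof.
move=> [oW cK KW cF FK]; have cl : closed K by apply: compact_closed cK; exact: norm_hausdorff.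
split => //; last by move=> x [].
apply: (subclosed_compact _ cK); last by move=> x [Wx /FK]; exact.
move=> x cx; have Wx : W x by apply/KW/cl; apply: closure_subset cx => y [Wy /FK]; exact.
split => //; apply: contrapT => n0.
have op : open (~` [set (0 : V)]).
  by apply: closed_openC; apply: compact_closed; [exact: norm_hausdorff|exact: compact_set1].
have nb : nbhs (F x) (~` [set 0]) by exact: open_nbhs_nbhs.
by have [y [[_ y0] /=]] := cx _ (cF x Wx _ nb).
Qed.

Lemma adm_sub F W K U K' : adm F W K -> open U -> U `<=` W -> compact K' -> K' `<=` U ->
  (forall x, U x -> F x = 0 -> K' x) -> adm F U K'.
Proof.
move=> [_ _ _ cF _] oU UW cK' KU FK.
by split; [exact: oU|exact: cK'|exact: KU|move=> x /UW; exact: cF|exact: FK].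
Qed.

Lemma is_deg_sum (I : eqType) F W K (U : I -> set V) (z : I -> int) (r : seq I) : adm F W K ->
  (forall i, open (U i)) -> (forall i, U i `<=` W) ->
  (forall i j x, U i x -> U j x -> i = j) -> uniq r ->
  (forall x, W x -> F x = 0 -> exists2 i, i \in r & U i x) ->
  (forall i, i \in r -> is_deg F (U i) (z i)) ->
  is_deg F W (\sum_(i <- r) z i).
Proof.
move=> aF oU UW dU ur cov dz.
pose Z := [set x | W x /\ F x = 0].
have aZ : adm F W Z := adm_zeros aF.
have [oW cZ ZW cF ZF] := aZ.
pose UU (P : set I) := \bigcup_(i in P) U i.
have oUU P : open (UU P) by exact: bigcup_open.
have UUW P : UU P `<=` W by move=> x [i _ /UW].
have aU P : adm F (UU P) (Z `&` UU P).
  apply: (adm_sub aZ) => //.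
  (* Within the zero set, the pieces in [P] are also the complement of the other pieces; being
     closed there, they are compact. *)
  - have -> : Z `&` UU P = Z `&` ~` UU (~` P).
      apply/seteqP; split => x [Zx Ux]; split => //.
        by move=> [j nj Uj]; case: Ux => i Pi Ui; apply: nj; rewrite -(dU _ _ _ Ui Uj).
      have [i _ Ui] := cov x Zx.1 Zx.2; exists i => //; apply: contrapT => nP; apply: Ux.
      by exists i.
    by apply: compact_closedI => //; exact: open_closedC.
  - by move=> x Ux F0; split => //; split => //; exact: UUW Ux.
suff H s : {subset s <= r} -> uniq s -> is_deg F (UU [set i | i \in s]) (\sum_(i <- s) z i).
  apply: (proj2 (is_deg_excision _ aZ (oUU [set i | i \in r]) (UUW _) _)).
    by move=> x [Wx F0]; have [i ir Ui] := cov x Wx F0; exists i.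
  exact: H.
elim: s => [_ _|i s IH sr /= /andP[nis us]].
  rewrite big_nil; have -> : UU [set i | i \in [::]] = set0.
    by apply/seteqP; split => x // [].
  exact: is_deg_set0.
rewrite big_cons.
have E1 : UU [set i] = U i by exact: bigcup_set1.
have -> : UU [set j | j \in i :: s] = UU [set i] `|` UU [set i | i \in s].
  apply/seteqP; split => x.
    by move=> [j /=]; rewrite inE => /predU1P[-> Ui|js Uj]; [left; exists i|right; exists j].
  by move=> [[j /= -> Uj]|[j js Uj]]; [exists i|exists j] => //=; rewrite inE ?eqxx// js orbT.
have h2 : is_deg F (UU [set i | i \in s]) (\sum_(j <- s) z j).
  by apply: IH => // j js; apply: sr; rewrite inE js orbT.
have h1 : is_deg F (UU [set i]) (z i) by rewrite E1; apply: dz; apply: sr; rewrite inE eqxx.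
have dis : UU [set i] `&` UU [set i | i \in s] = set0.
  apply/seteqP; split => x // [[j /= ->]] Ui [k /= ks Uk].
  by move: nis; rewrite (dU _ _ _ Ui Uk) ks.
exact: (is_degU (aU _) (aU _) dis h1 h2).2.
Qed.

(** Composing a regular approximation with [A] keeps its zeros and multiplies the sign at each of
    them by that of [det A]. *)
Lemma linear_deg F W K (A : 'M[R]_N) z : adm F W K -> \det A != 0 ->
  is_deg F W z -> is_deg (fun x => F x *m A) W (sgz (\det A) * z).
Proof.
move=> aF A0 dF.
have uA : A \in unitmx by rewrite unitmxE unitfE.
have inj (v : V) : v *m A = 0 -> v = 0 by move=> e; rewrite -[v](mulmxK uA) e mul0mx.
have cA (G : V -> V) x : ctat G x -> ctat (fun x => G x *m A) x.
  by move=> cG; apply: ctat_mulmx => // i j; exact: ctat_cst.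
have aA G W1 K1 : adm G W1 K1 -> adm (fun x => G x *m A) W1 K1.
  move=> [h1 h2 h3 cG GK]; split; [exact: h1|exact: h2|exact: h3| |].
    by move=> x Wx; apply: cA; exact: cG.
  by move=> x Wx /inj; exact: GK.
have [h [W' [s [cW' KW' [hC us sP] hJ [[K' [aF' ah hz]] _]]]]] := regular_core aF.
have [oW' bW' sW' FW'] := cW'.
have dh x : differentiable h x by have [/nbhs_singleton] := hC x.
have ch x : ctat h x by exact: differentiable_continuous.
have [_ dd] := regular_deg us oW' (fun x _ => ch x) sP (fun x xs => conj (dh x) (hJ x xs)).
have zE : z = \sum_(x <- s) sgz (\det (jacobian h x)).
  apply: (is_deg_uniq aF' _ (lin_homotopy_deg aF' ah hz dd)).
  by apply/(is_deg_excision _ aF oW' (core_sub cW') KW').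
have [|||_ dX] := @regular_lin_deg _ _ (fun x => h x *m A) W' s (fun x => jacobian h x *m A) us oW'.
- by move=> x _; exact: cA.
- move=> x; split=> [/sP[Wx ->]|[Wx /inj hx]]; [by rewrite mul0mx|exact/sP].
- move=> x xs; split; last by rewrite det_mulmx mulf_neq0//; exact: hJ.
  move=> e e0; have [c [c0 cP]] := mulmx_bound A.
  have ec : 0 < e / c by rewrite divr_gt0.
  apply: filterS (diff_lin_at (dh x) ec) => y hy.
  rewrite mulmxA -!mulmxBl; apply: (le_trans (cP _)).
  apply: (le_trans (ler_wpM2l (ltW c0) hy)).
  by rewrite mulrA (mulrC c) divfK ?gt_eqF.
have sE : \sum_(x <- s) sgz (\det (jacobian h x *m A)) = sgz (\det A) * z.
  by rewrite zE mulr_sumr; apply: eq_bigr => x _; rewrite det_mulmx sgzM mulrC.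
rewrite sE in dX.
apply: (proj2 (is_deg_excision _ (aA _ _ _ aF) oW' (core_sub cW') KW')).
apply: (lin_homotopy_deg (aA _ _ _ aF') (aA _ _ _ ah)) dX => t u t01 Wu.
have -> : lin_homotopy (fun x => h x *m A) (fun x => F x *m A) t u = lin_homotopy h F t u *m A.
  by rewrite /lin_homotopy mulmxDl -!scalemxAl.
by move=> /inj; exact: hz.
Qed.

Lemma opp_deg F W K z : adm F W K -> is_deg F W z -> is_deg (fun x => - F x) W ((-1) ^+ N * z).
Proof.
move=> aF dF.
have dE : \det ((-1)%:M : 'M[R]_N) = (-1) ^+ N by rewrite det_scalar.
have d0 : \det ((-1)%:M : 'M[R]_N) != 0 by rewrite dE signr_eq0.
have := linear_deg aF d0 dF; rewrite dE sgzX sgzN sgz1 => h.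
have [oW _ _ _ _] := aF.
by apply: eq_is_deg h => // x _; rewrite mul_mx_scalar scaleN1r.
Qed.
End DegreeAlgebra.

Section SphereMap.
Context {R : realType} {n : nat}.
Local Notation V := 'rV[R]_n.+1.
Variable k : V -> V.
Hypothesis ck : forall y : V, y != 0 -> ctat (fun y => k (direction y)) y.
Hypothesis k1 : forall v, normsq v = 1 -> normsq (k v) = 1.

Definition radial (y : V) : V := enorm y *: k (direction y).

Lemma enorm_kdir y : y != 0 -> enorm (k (direction y)) = 1.
Proof. by move=> y0; rewrite /enorm k1 ?sqrtr1// normsq_direction. Qed.

Lemma enorm_radial y : enorm (radial y) = enorm y.
Proof.
have [->|y0] := eqVneq y 0; first by rewrite /radial enormZ /enorm normsq0 sqrtr0 normr0 mul0r.
by rewrite enormZ enorm_kdir// mulr1 ger0_norm ?enorm_ge0.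
Qed.

Lemma kdir_bound y : y != 0 -> `|k (direction y)| <= 1.
Proof. by move=> y0; rewrite -(enorm_kdir y0) norm_le_enorm. Qed.

Lemma ctat_scaled_kdir (T : topologicalType) (c : T -> R) (f : T -> V) p :
  ctat c p -> ctat f p -> (forall q, f q = 0 -> c q = 0) ->
  ctat (fun q => c q *: k (direction (f q))) p.
Proof.
move=> cc cf c0; have [f0|f0] := eqVneq (f p) 0; last first.
  by apply: ctatZ => //; exact: (ctat_comp (g := fun y => k (direction y)) cf (ck f0)).
apply: (ctat_scale0 (M := 1)) => //; first exact: c0.
apply: (@filterS _ (nbhs p) _ setT) => [q _|]; last exact: filterT.
by have [/c0|/kdir_bound] := eqVneq (f q) 0; [left|right].
Qed.

Lemma ctat_radial y : ctat radial y.
Proof.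
apply: (ctat_scaled_kdir (f := id)); [apply: ctat_enorm; exact: ctat_id|exact: ctat_id|].
by move=> q ->; apply/eqP; rewrite enorm_eq0.
Qed.

Lemma radial_adm : adm radial setT [set 0].
Proof.
split; [exact: openT|exact: compact_set1|by []|by move=> x _; exact: ctat_radial|].
move=> x _ /eqP; rewrite -enorm_eq0 enorm_radial enorm_eq0 => /eqP ->.
by [].
Qed.

Definition punctured : set V := [set y | y != 0].

Lemma open_punctured : open punctured.
Proof.
have -> : punctured = [set y | 0 < enorm y].
  by apply/seteqP; split=> y; rewrite /punctured /= lt0r enorm_eq0 enorm_ge0 andbT.
by apply: open_gt_ctat => y; apply: ctat_enorm; exact: ctat_id.
Qed.

Definition radial_clip (r : R) := Num.min (2 * r) 1.

Let Z := [set y : V | y != 0 /\ y = k (direction y)].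

Lemma sphere_adm : adm (fun y => y - k (direction y)) punctured Z.
Proof.
split.
- exact: open_punctured.
- have cS : closed [set y : V | 1 <= enorm y <= 1].
    have -> : [set y : V | 1 <= enorm y <= 1] = ~` [set y | 1 < enorm y] `&` ~` [set y | enorm y < 1].
      apply/seteqP; split=> y /=.
        by move=> /andP[h1 h2]; split; apply/negP; rewrite -leNgt.
      by move=> [/negP + /negP]; rewrite -!leNgt => -> ->.
    apply: closedI; apply: open_closedC.
      by apply: open_gt_ctat => y; apply: ctat_enorm; exact: ctat_id.
    by apply: open_lt_ctat => y; apply: ctat_enorm; exact: ctat_id.
  have cZ : closed Z.
    have -> : Z = [set y : V | 1 <= enorm y <= 1] `&` (fun y => y - k (direction y)) @^-1` [set 0].
      apply/seteqP; split=> y.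
        by move=> [y0 e]; split => /=; [rewrite e enorm_kdir// lexx|rewrite -e subrr].
      move=> [/= y1 /subr0_eq e]; split => //; apply: contraTneq y1 => ->.
      by rewrite /enorm normsq0 sqrtr0 ler10.
    apply: closed_within_preim => //; first by apply: compact_closed; [exact: norm_hausdorff|exact: compact_set1].
    apply: within_ctat => y y1; apply: ctatBv; first exact: ctat_id.
    by apply: ck; apply: contraTneq y1 => ->; rewrite /enorm normsq0 sqrtr0 ler10.
  apply: bounded_closed_compact cZ; apply: (@ex_bounded _ _ _ 1) => y [y0 ->].
  by exact: kdir_bound.
- by move=> y [].
- by move=> y y0; apply: ctatBv; [exact: ctat_id|exact: ck].
- by move=> y y0 /subr0_eq.
Qed.

Lemma compact_ball_enorm (r : R) : compact [set y : V | enorm y <= r].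
Proof.
have cl : closed [set y : V | enorm y <= r].
  have -> : [set y : V | enorm y <= r] = ~` [set y | r < enorm y].
    by apply/seteqP; split=> y /= => [h|/negP]; [apply/negP|]; rewrite -leNgt.
  by apply: open_closedC; apply: open_gt_ctat => y; apply: ctat_enorm; exact: ctat_id.
apply: bounded_closed_compact cl; apply: (@ex_bounded _ _ _ r) => y; apply: le_trans.
exact: norm_le_enorm.
Qed.

(** The Lefschetz number of a sphere map, read off [y - min(2|y|, 1) k(y/|y|)] on the whole space.
    This map deforms to the identity, of degree 1. Its zeros with [|y| < 1/2] give the degree of
    minus the radial extension; those beyond give the index sought. *)
Lemma sphere_lefschetz z : is_deg radial setT z ->
  is_deg (fun y => y - k (direction y)) punctured (1 + (-1) ^+ n * z).
Proof.
move=> dz.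
have clip0 (r : R) : r = 0 -> radial_clip r = 0 by move=> ->; rewrite /radial_clip mulr0 min_l ?ler01.
have ccl (T : topologicalType) (f : T -> V) p : ctat f p -> ctat (fun q => radial_clip (enorm (f q))) p.
  move=> cf; apply: ctat_min; last exact: ctat_cst.
  by apply: ctatM; [exact: ctat_cst|exact: ctat_enorm].
have clip01 (y : V) : 0 <= radial_clip (enorm y) <= 1.
  by rewrite /radial_clip le_min ler01 andbT ge_min lexx orbT andbT mulr_ge0// enorm_ge0.
pose H (t : R) y := y - (t * radial_clip (enorm y)) *: k (direction y).
have cH (t : R) y : ctat (fun p : R * V => H p.1 p.2) (t, y).
  apply: ctatBv; first exact: ctat_snd.
  apply: (ctat_scaled_kdir (f := snd)); [|exact: ctat_snd|].
    by apply: ctatM; [exact: ctat_fst|apply: ccl; exact: ctat_snd].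
  by move=> q q0; rewrite clip0 ?mulr0//; apply/eqP; rewrite enorm_eq0; apply/eqP.
have H0 (t : R) y : 0 <= t <= 1 -> H t y = 0 -> enorm y <= 1.
  move=> /andP[t0 t1] /subr0_eq e; have [->|y0] := eqVneq y 0; first by rewrite /enorm normsq0 sqrtr0 ler01.
  rewrite e enormZ enorm_kdir// mulr1; have /andP[c0 c1] := clip01 y.
  by rewrite ger0_norm ?mulr_ge0// mulr_ile1.
have cB := @compact_ball_enorm (1 : R).
have cH1 y : ctat (H 1) y.
  apply: (@ctat_comp _ _ _ (fun y : V => (1 : R, y)) (fun p : R * V => H p.1 p.2)); last exact: cH.
  by apply: ctat_pair; [exact: ctat_cst|exact: ctat_id].
have dI : is_deg (H 0) setT 1.
  have := @lin_deg R n.+1 1%:M setT 0 openT I; rewrite det1 sgz1 oner_eq0 => /(_ isT) h.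
  by apply: eq_is_deg h => [|y _]; [exact: openT|rewrite /H mul0r scale0r !subr0 mulmx1].
have dH : is_deg (H 1) setT 1.
  apply: (@is_deg_homotopy _ _ H setT [set y | enorm y <= 1]).
  - exact: openT.
  - exact: cB.
  - by [].
  - by move=> t y _ _; exact: cH.
  - by move=> t y t01 _; exact: H0.
  - exact: dI.
have aH : adm (H 1) setT [set y | enorm y <= 1].
  split; [exact: openT|exact: cB|by []|by move=> y _; exact: cH1|].
  by move=> y _; apply: H0; rewrite ler01 lexx.
(* From minus the radial extension to [y - 2|y| k(y/|y|)]. The two terms have norms [t|y|] and
   [(1 + t)|y|], so the origin is the only zero. *)
pose L (t : R) y := t *: y - ((1 + t) * enorm y) *: k (direction y).
have cL (t : R) y : ctat (fun p : R * V => L p.1 p.2) (t, y).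
  apply: ctatBv; first by apply: ctatZ; [exact: ctat_fst|exact: ctat_snd].
  apply: (ctat_scaled_kdir (f := snd)); [|exact: ctat_snd|].
    apply: ctatM; last by apply: ctat_enorm; exact: ctat_snd.
    by apply: ctatD; [exact: ctat_cst|exact: ctat_fst].
  by move=> q /eqP q0; rewrite [enorm _](_ : _ = 0) ?mulr0//; apply/eqP; rewrite enorm_eq0.
have L0 (t : R) y : 0 <= t <= 1 -> L t y = 0 -> y = 0.
  move=> /andP[t0 t1] /subr0_eq e; apply/eqP; apply: contraT => y0.
  have := congr1 (fun v : V => enorm v) e; rewrite /= !enormZ enorm_kdir// mulr1.
  have e0 : 0 < enorm y by rewrite lt0r enorm_eq0 y0 enorm_ge0.
  by rewrite ger0_norm// ger0_norm ?mulr_ge0 ?addr_ge0 ?ler01 ?enorm_ge0// => /(mulIf (lt0r_neq0 e0)); lra.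
have dL : is_deg (L 1) setT ((-1) ^+ n.+1 * z).
  apply: (@is_deg_homotopy _ _ L setT [set 0]).
  - exact: openT.
  - exact: compact_set1.
  - by [].
  - by move=> t y _ _; exact: cL.
  - by move=> t y t01 _; exact: L0.
  - apply: eq_is_deg (opp_deg radial_adm dz) => [|y _]; first exact: openT.
    by rewrite /L scale0r addr0 mul1r sub0r.
have aL : adm (L 1) setT [set 0].
  split; [exact: openT|exact: compact_set1|by []| |].
    move=> y _; apply: (@ctat_comp _ _ _ (fun y : V => (1 : R, y)) (fun p : R * V => L p.1 p.2)); last exact: cL.
    by apply: ctat_pair; [exact: ctat_cst|exact: ctat_id].
  by move=> y _; apply: L0; rewrite ler01 lexx.
pose U b := if b then [set y : V | enorm y < 1/2] else [set y : V | 1/2 < enorm y].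
have oU b : open (U b).
  by case: b; [apply: open_lt_ctat|apply: open_gt_ctat] => y; apply: ctat_enorm; exact: ctat_id.
have d1 : is_deg (H 1) (U true) ((-1) ^+ n.+1 * z).
  have := proj1 (is_deg_excision _ aL (oU true) (fun _ _ => I) _) dL.
  move=> /(_ _)/=h; apply: eq_is_deg (h _) => [|y /= y2|]; first exact: (oU true).
    by rewrite /L /H mul1r scale1r /radial_clip min_l//; lra.
  by move=> _ ->; rewrite /= /enorm normsq0 sqrtr0 divr_gt0.
have [z2 dz2] := is_deg_exists sphere_adm.
have d2 : is_deg (H 1) (U false) z2.
  have sU : U false `<=` punctured.
    by move=> y /=; apply: contraTneq => ->; rewrite /enorm normsq0 sqrtr0 -leNgt divr_ge0.
  have ZU : Z `<=` U false.
    by move=> y [y0 e] /=; rewrite e enorm_kdir//; lra.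
  have := proj1 (is_deg_excision _ sphere_adm (oU false) sU ZU) dz2.
  apply: eq_is_deg => [|y /= y2]; first exact: (oU false).
  by rewrite /H mul1r /radial_clip min_r ?scale1r//; lra.
have dis (i j : bool) y : U i y -> U j y -> i = j by case: i; case: j => //=; lra.
have cov y : setT y -> H 1 y = 0 -> exists2 i, i \in [:: true; false] & U i y.
  move=> _ /subr0_eq e; have [y2|y2] := ltrP (enorm y) (1/2); first by exists true.
  exists false => //=; rewrite lt_neqAle y2 andbT; apply/eqP => y3.
  have y0 : y != 0.
    by apply: contraTneq y2 => ->; rewrite /enorm normsq0 sqrtr0 -ltNge divr_gt0.
  have := congr1 (fun v : V => enorm v) e; rewrite /= enormZ enorm_kdir// /radial_clip -y3 min_r; last by lra.
  by rewrite !mulr1 normr1; lra.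
have dU (i : bool) : i \in [:: true; false] ->
    is_deg (H 1) (U i) (if i then (-1) ^+ n.+1 * z else z2) by case: i.
have u2 : uniq [:: true; false] by [].
have := @is_deg_sum R n.+1 bool (H 1) setT _ U (fun i => if i then (-1) ^+ n.+1 * z else z2)
  [:: true; false] aH oU (fun _ _ _ => I) dis u2 cov dU.
rewrite big_cons big_seq1 => dS; have zE := is_deg_uniq aH dH dS.
suff -> : 1 + (-1) ^+ n * z = z2 by [].
by rewrite [X in X + _]zE exprS mulN1r mulNr addrAC addNr add0r.
Qed.
End SphereMap.

(** * The index of a self map of a finite CW complex *)
Section CWStructures.
Context {R : realType}.

(* A finite CW structure on Y.  The characteristic map of the cell s is defined
   on all of R^n but only matters on the closed unit disc. *)
Record cw_structure (Y : topologicalType) := CWStructure {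
  cw_cell :> finType;
  dm : cw_cell -> nat;
  ch : forall s : cw_cell, 'rV[R]_(dm s) -> Y;
  cw_cont : forall s, {within cdisc, continuous (@ch s)};
  cw_disj : forall s t (d : 'rV_(dm s)) (e : 'rV_(dm t)), odisc d -> odisc e -> ch d = ch e -> s = t;
  cw_inj : forall s (d e : 'rV_(dm s)), odisc d -> odisc e -> ch d = ch e -> d = e;
  cw_bd : forall s (d : 'rV_(dm s)), normsq d = 1 ->
    exists t (e : 'rV_(dm t)), [/\ (dm t < dm s)%N, odisc e & ch e = ch d];
  cw_cover : forall y, exists s (d : 'rV_(dm s)), odisc d /\ ch d = y;
  cw_top : forall n (A : set Y),
    (forall y, A y -> exists s (d : 'rV_(dm s)), [/\ (dm s <= n)%N, odisc d & ch d = y]) ->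
    (forall s, (dm s <= n)%N -> closed (cdisc `&` @ch s @^-1` A)) -> closed A }.
End CWStructures.
Arguments dm {R Y c} s.
Arguments ch {R Y c} s _.

Section Subcomplexes.
Context {R : realType} {Y : topologicalType} (X : cw_structure (R := R) Y).
Implicit Types (S : {set X}) (s t : X).

Definition body S : set Y := [set y | exists s (d : 'rV_(dm s)), [/\ s \in S, odisc d & ch s d = y]].

Definition subcomplex S := forall s (d : 'rV_(dm s)), s \in S -> normsq d = 1 ->
  exists t (e : 'rV_(dm t)), [/\ t \in S, (dm t < dm s)%N, odisc e & ch t e = ch s d].

(** Dimensions strictly below [n], that is the skeleton of dimension [n - 1]: [skel S 0] is empty
    and starts the induction. *)
Definition skel S n : {set X} := finset (fun s => (s \in S) && (dm s < n)%N).

Lemma skelE S n s : (s \in skel S n) = (s \in S) && (dm s < n)%N.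
Proof. by rewrite inE. Qed.

Lemma body_cell S s (d : 'rV_(dm s)) : odisc d -> body S (ch s d) -> s \in S.
Proof. by move=> od [t [e [tS oe /cw_disj <-]]]. Qed.

Lemma bodyS S S' : S \subset S' -> body S `<=` body S'.
Proof. by move=> SS' y [s [d [sS od e]]]; exists s, d; split => //; exact: (fintype.subsetP SS'). Qed.

Lemma subcomplex_skel S n : subcomplex S -> subcomplex (skel S n).
Proof.
move=> cS s d; rewrite skelE => /andP[sS sn] d1; have [t [e [tS ts oe E]]] := cS s d sS d1.
by exists t, e; split => //; rewrite skelE tS (ltn_trans ts).
Qed.

Lemma subcomplexT : subcomplex [set: X]%SET.
Proof.
by move=> s d _ d1; have [t [e [ts oe E]]] := cw_bd d1; exists t, e; split => //; rewrite inE.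
Qed.

Lemma bodyT : body [set: X]%SET = setT.
Proof.
apply/seteqP; split => // y _; have [s [d [od e]]] := cw_cover X y.
by exists s, d; split => //; rewrite inE.
Qed.

Lemma skel_dim S n s (d : 'rV_(dm s)) : subcomplex S -> s \in S -> (dm s < n)%N -> cdisc d ->
  body (skel S n) (ch s d).
Proof.
rewrite /cdisc /= => cS sS sn; rewrite le_eqVlt => /predU1P[d1|od].
  have [t [e [tS ts oe E]]] := cS s d sS d1; exists t, e; split => //.
  by rewrite skelE tS (ltn_trans ts).
by exists s, d; split => //; rewrite skelE sS.
Qed.

Lemma body_cdisc S s (d : 'rV_(dm s)) : subcomplex S -> s \in S -> cdisc d -> body S (ch s d).
Proof.
move=> cS sS cd; apply: (bodyS _ (skel_dim cS sS (ltnSn _) cd)).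
by apply/fintype.subsetP => t; rewrite skelE => /andP[].
Qed.

Definition below S n : set Y := [set y | exists s (d : 'rV_(dm s)),
  [/\ s \in S, (dm s < n)%N, odisc d & ch s d = y]].

(** The topology of [Y] tests all cells. For a cell outside [S] only its boundary can meet [body S],
    and that meets it in a smaller skeleton, where closedness is known by induction on the
    dimension. *)
Lemma closed_test S (C : set Y) : subcomplex S -> C `<=` body S ->
  (forall s, s \in S -> closed (cdisc `&` ch s @^-1` C)) -> closed C.
Proof.
move=> cS CS h.
suff H n : closed (C `&` below S n).
  have -> : C = C `&` below S (\max_(s : X) dm s).+1; last exact: H.
  apply/seteqP; split => y; last by case.
  move=> Cy; split => //; have [s [d [sS od e]]] := CS y Cy.
  by exists s, d; split => //; rewrite ltnS leq_bigmax.
elim/ltn_ind: n => -[_|n IH].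
  have -> : C `&` below S 0 = set0 by apply/seteqP; split => y // [_ [s [d []]]].
  exact: closed0.
apply: (@cw_top _ _ X n) => [y [_ [s [d [_ sn od e]]]]|s sn]; first by exists s, d.
have [sS|sS] := boolP (s \in S).
  have -> : cdisc `&` ch s @^-1` (C `&` below S n.+1) = cdisc `&` ch s @^-1` C; last exact: h.
  apply/seteqP; split => d; first by move=> [? []].
  move=> [cd Cd]; split => //; split => //.
  have [t [e [tS oe E]]] := skel_dim cS sS (ltnSn _) cd.
  by move: tS; rewrite skelE => /andP[tS ts]; exists t, e; split => //; exact: (leq_trans ts).
have -> : cdisc `&` ch s @^-1` (C `&` below S n.+1) =
    cdisc `&` ch s @^-1` (C `&` below S (dm s)).
  apply/seteqP; split => d [cd [Cd [t [e [tS tn oe E]]]]]; split => //; split => //.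
    move: cd; rewrite /cdisc /= le_eqVlt => /predU1P[d1|od].
      have [t' [e' [ts' oe' E']]] := cw_bd d1.
      have tt' : t = t' by apply: (cw_disj oe oe'); rewrite E.
      by exists t, e; split => //; rewrite tt'.
    by exfalso; move: sS; rewrite -(cw_disj oe od E) tS.
  by exists t, e; split => //; rewrite ltnS (leq_trans (ltnW tn)).
apply: closed_within_preim; [exact: closed_cdisc| |exact: cw_cont].
by apply: IH; rewrite ltnS.
Qed.

Lemma cw_within S (Z : topologicalType) (f : Y -> Z) : subcomplex S ->
  (forall s, s \in S -> {within cdisc, continuous (f \o ch s)}) -> {within body S, continuous f}.
Proof.
move=> cS cf; apply: within_closedP => C clC; apply: (closed_test cS); first exact: subIsetl.
move=> s sS; have -> : cdisc `&` ch s @^-1` (body S `&` f @^-1` C) = cdisc `&` (f \o ch s) @^-1` C.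
  apply/seteqP; split => d; first by move=> [? []].
  by move=> [cd Cd]; split => //; split => //; exact: body_cdisc.
by apply: closed_within_preim => //; [exact: closed_cdisc|exact: cf].
Qed.

Lemma closed_body S : subcomplex S -> closed (body S).
Proof.
move=> cS; apply: (closed_test cS) => // s sS.
have -> : cdisc `&` ch s @^-1` body S = cdisc; last exact: closed_cdisc.
by apply/seteqP; split => d; [case|move=> cd; split => //; exact: body_cdisc].
Qed.

Lemma bodyD1 S s : subcomplex S -> s \in S ->
  body S = body (S :\ s)%SET `|` ch s @` cdisc.
Proof.
move=> cS sS; apply/seteqP; split => y.
  move=> [t [d [tS od <-]]]; have [ts|ts] := eqVneq t s.
    by right; rewrite -ts; exists d => //; exact: odisc_sub.
  by left; exists t, d; split => //; rewrite in_setD1 ts.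
move=> [|[d cd <-]]; last exact: body_cdisc.
by apply: bodyS; exact: subD1set.
Qed.

Variable y0 : Y.

(** A cell of maximal dimension is removed, which leaves a subcomplex, and attached again by
    [enr_attach]. *)
Lemma body_enr S : subcomplex S ->
  compact (body S) /\ exists N (iota : Y -> 'rV[R]_N) rho O, enr (body S) iota rho O.
Proof.
have [n] := ubnP #|S|; elim: n S => // n IH S Sn cS.
have [->|[s0 s0S]] := set_0Vmem S.
  have -> : body finset.set0 = set0 by apply/seteqP; split => y // [s [d []]]; rewrite inE.
  split; first exact: compact0.
  exists 0%N, (fun=> 0), (fun=> y0), set0; split; [exact: open0|by apply: within_ctat => y []|by move=> x []|by move=> x []|by move=> x []].
case: (@arg_maxnP _ s0 (mem S) dm s0S) => s s_S smax.
have sS : s \in S := s_S.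
have cS' : subcomplex (S :\ s)%SET.
  move=> t d; rewrite in_setD1 => /andP[ts tS] d1; have [u [e [uS ut oe E]]] := cS t d tS d1.
  exists u, e; split => //; rewrite in_setD1 uS andbT; apply: contraTneq ut => ->.
  by rewrite -leqNgt; exact: smax.
have [|cB [N [iota [rho [P E]]]]] := IH _ _ cS'.
  by rewrite -ltnS (leq_trans _ Sn)// ltnS [X in (_ < X)%N](cardsD1 s) sS.
have cbd d : normsq d = 1 -> body (S :\ s)%SET (ch s d).
  move=> d1; have [u [e [uS us oe Eu]]] := cS s d sS d1; exists u, e; split => //.
  by rewrite in_setD1 uS andbT; apply: contraTneq us => ->; rewrite ltnn.
have top C : C `<=` body (S :\ s)%SET `|` ch s @` cdisc -> closed (C `&` body (S :\ s)%SET) ->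
    closed (cdisc `&` ch s @^-1` C) -> closed C.
  rewrite -bodyD1// => CS c1 c2; apply: (closed_test cS CS) => t tS.
  have [->//|ts] := eqVneq t s.
  have -> : cdisc `&` ch t @^-1` C = cdisc `&` ch t @^-1` (C `&` body (S :\ s)%SET).
    apply/seteqP; split => d; last by move=> [? []].
    by move=> [cd Cd]; split => //; split => //; apply: body_cdisc => //; rewrite in_setD1 ts.
  by apply: closed_within_preim => //; [exact: closed_cdisc|exact: cw_cont].
rewrite (bodyD1 cS sS).
have cl := closed_body cS'.
split; first by apply: compactU => //; apply: within_image; [exact: compact_cdisc|exact: cw_cont].
exists (N + (dm s + 1))%N, (att_iota (body (S :\ s)%SET) iota (ch s)), (att_rho iota rho (ch s)),
  (att_dom iota P (ch s)).
apply: (enr_attach cB cl E) => //.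
- exact: cw_cont.
- by move=> d od /(body_cell od); rewrite in_setD1 eqxx.
- by move=> d d'; exact: cw_inj.
Qed.

Lemma compact_body S : subcomplex S -> compact (body S).
Proof. by case/body_enr. Qed.

(** Not a clause of [cw_structure]: it follows from the embedding into a Euclidean space. *)
Lemma cw_hausdorff : hausdorff_space Y.
Proof.
have [_ [N [iota [rho [P [_ ci _ ir _]]]]]] := body_enr subcomplexT.
rewrite bodyT in ci ir.
have inj x y : iota x = iota y -> x = y.
  by move=> e; rewrite -(ir x I).2 -(ir y I).2 e.
have civ x : ctat iota x by apply: (open_ctat openT ci).
move=> x y xy; apply: inj.
apply: (@norm_hausdorff _ 'rV[R]_N) => A B nA nB.
by have [z [Az Bz]] := xy _ _ (civ x _ nA) (civ y _ nB); exists (iota z).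
Qed.
End Subcomplexes.

Lemma hausdorff_prod (T U : topologicalType) :
  hausdorff_space T -> hausdorff_space U -> hausdorff_space (T * U)%type.
Proof.
move=> hT hU [a b] [c d] cl; congr pair.
  by apply: hT => A B nA nB; have [[u v] [/= ? ?]] := cl _ _ (@ctat_fst T U (a, b) _ nA) (@ctat_fst T U (c, d) _ nB); exists u.
by apply: hU => A B nA nB; have [[u v] [/= ? ?]] := cl _ _ (@ctat_snd T U (a, b) _ nA) (@ctat_snd T U (c, d) _ nB); exists v.
Qed.

(** * Cylinders and homotopy invariance of the index *)

Section Cylinders.
Context {R : realType}.

Definition icyl {T : topologicalType} (A : set T) : set (R * T) := [set p | 0 <= p.1 <= 1 /\ A p.2].

Lemma icylE (T : topologicalType) (A : set T) : icyl A = (`[0, 1]%classic `*` A).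
Proof. by apply/seteqP; split => -[t a]; rewrite /icyl /= in_itv. Qed.

Lemma compact_icyl (T : topologicalType) (A : set T) : compact A -> compact (icyl A).
Proof. by move=> cA; rewrite icylE; apply: compact_setX => //; exact: segment_compact. Qed.

Lemma closed_icyl (T : topologicalType) (A : set T) : closed A -> closed (icyl A).
Proof.
move=> cA; have -> : icyl A = (fst @^-1` `[0, 1]%classic) `&` (snd @^-1` A).
  by apply/seteqP; split => -[t a]; rewrite /icyl /= in_itv.
apply: closedI; first by apply: closed_comp => [p _|]; [exact: ctat_fst|exact: interval_closed].
by apply: closed_comp => // p _; exact: ctat_snd.
Qed.

Lemma icyl_within (T U : topologicalType) (A : set T) (p : T -> U) :
  {within A, continuous p} -> {within icyl A, continuous (fun q => (q.1, p q.2))}.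
Proof.
move=> /subspace_continuousP cp; apply/subspace_continuousP => -[t a] [t01 /= Aa].
move=> B [[B1 B2] [/= n1 n2] BB].
have nA := cp a Aa _ n2.
exists ([set s | B1 s], [set a' | A a' -> B2 (p a')]) => [|[s a'] [/= h1 h2] [_ /= /h2 h3]].
  by split.
by apply: BB; split.
Qed.

(** Continuous maps from a compact set to a Hausdorff space are closed, hence quotient maps onto
    their image. *)
Lemma quotient_within (T U Z : topologicalType) (K : set T) (w : T -> U) (f : U -> Z) :
  hausdorff_space U -> compact K -> closed K -> {within K, continuous w} ->
  {within K, continuous (f \o w)} -> {within w @` K, continuous f}.
Proof.
move=> hU cK clK cw cf; apply: within_closedP => C clC.
have -> : w @` K `&` f @^-1` C = w @` (K `&` (f \o w) @^-1` C).
  apply/seteqP; split=> [_ [[x Kx <-] Cx]|_ [x [Kx Cx] <-]]; first by exists x.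
  by split => //; exists x.
apply: compact_closed => //; apply: within_image; last exact: within_sub cw.
by apply: (subclosed_compact _ cK); [exact: closed_within_preim|exact: subIsetl].
Qed.

Lemma quotient_within_icyl (T U Z : topologicalType) (K : set T) (w : T -> U) (f : R * U -> Z) :
  hausdorff_space U -> compact K -> closed K -> {within K, continuous w} ->
  {within icyl K, continuous (fun q => f (q.1, w q.2))} -> {within icyl (w @` K), continuous f}.
Proof.
move=> hU cK clK cw cf.
have -> : icyl (w @` K) = (fun q => (q.1, w q.2)) @` icyl K.
  apply/seteqP; split=> [[t u] [/= t01 [x Kx <-]]|_ [[t x] [t01 Kx] <-]]; first by exists (t, x).
  by split => //; exists x.
apply: quotient_within cf; [|exact: compact_icyl|exact: closed_icyl|exact: icyl_within].
by apply: hausdorff_prod => //; exact: (@norm_hausdorff _ R^o).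
Qed.
End Cylinders.

Section CylinderContinuity.
Context {R : realType} {Y : topologicalType} (X : cw_structure (R := R) Y).
Variable y0 : Y.

(** The product with the interval has no cells of its own here; closed sets are recognised as finite
    unions of images of compact sets. *)
Lemma cw_within_icyl (S : {set X}) (Z : topologicalType) (f : R * Y -> Z) : subcomplex S ->
  (forall s, s \in S -> {within icyl cdisc, continuous (fun q => f (q.1, ch s q.2))}) ->
  {within icyl (body S), continuous f}.
Proof.
move=> cS cf; apply: within_closedP => C clC.
pose g (s : X) (q : R * 'rV[R]_(dm s)) := (q.1, ch s q.2).
pose D (s : X) := icyl cdisc `&` (f \o @g s) @^-1` C.
have -> : icyl (body S) `&` f @^-1` C = \bigcup_(s in [set s | s \in S]) (@g s @` D s).
  apply/seteqP; split => [[t y] [[/= t01 [s [d [sS od <-]]]] Cf]|_ [s /= sS [[t d] [[t01 /= cd] Cf] <-]]].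
    by exists s => //; exists (t, d) => //; split => //; split => //; exact: odisc_sub.
  by split => //; split => //=; exact: body_cdisc.
apply: closed_bigcup; first exact: finite_finset.
move=> s sS; apply: compact_closed.
  by apply: hausdorff_prod; [exact: (@norm_hausdorff _ R^o)|exact: (@cw_hausdorff R Y X y0)].
apply: within_image.
  have cD : closed (D s).
    by apply: closed_within_preim => //; [apply: closed_icyl; exact: closed_cdisc|exact: cf].
  apply: (subclosed_compact cD (compact_icyl (@compact_cdisc R (dm s)))).
  exact: subIsetl.
exact: (@within_sub _ _ (@g s) (D s) (icyl cdisc) (@subIsetl _ _ _) (icyl_within (@cw_cont _ _ X s))).
Qed.
End CylinderContinuity.

Section IndexHomotopy.
Context {R : realType} {Y : topologicalType}.
Variables (B : set Y) (H : R -> Y -> Y).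
Hypotheses (cB : compact B) (cH : {within icyl B, continuous (fun p => H p.1 p.2)}).
Hypothesis HB : forall (t : R) y, 0 <= t <= 1 -> B y -> B (H t y).

Lemma icyl_slice (t : R) : 0 <= t <= 1 -> {within B, continuous (H t)}.
Proof.
move=> t01; apply: (@within_precomp _ _ _ (fun y => (t, y)) (fun p => H p.1 p.2) B (icyl B)) => //.
by apply: within_ctat => y _; apply: ctat_pair; [exact: ctat_cst|exact: ctat_id].
Qed.

Lemma deg_index_homotopy z : deg_index (R := R) B (H 0) z -> deg_index (R := R) B (H 1) z.
Proof.
move=> [N [iota [rho [P [E d0]]]]]; exists N, iota, rho, P; split => //.
have [oP ci cr ir rB] := E.
pose L (t : R) x := fix_map iota rho (H (clamp t)) x.
have HE (t : R) : 0 <= t <= 1 -> L t = fix_map iota rho (H t) by move=> t01; rewrite /L clampE.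
rewrite -HE ?ler01 ?lexx//.
apply: (@is_deg_homotopy _ _ L P (iota @` B)).
- exact: oP.
- exact: within_image.
- by move=> _ [y By <-]; have [] := ir y By.
- move=> t x t01 Px; change (ctat (fun p : R * 'rV[R]_N => L p.1 p.2) (t, x)).
  have nP : \forall q \near (t, x), P q.2.
    by apply: (@ctat_snd R^o _ (t, x)); exact: open_nbhs_nbhs.
  apply: ctatBv; first exact: ctat_snd.
  apply: (@ctat_within _ _ _ (fun q : R * 'rV[R]_N => H (clamp q.1) (rho q.2)) iota B) => //.
    by apply: filterS nP => q /rB; apply: HB; exact: clamp_itv.
  apply: (@ctat_within _ _ _ (fun q : R * 'rV[R]_N => (clamp q.1, rho q.2)) (fun p => H p.1 p.2) (icyl B)) => //.
    by apply: filterS nP => q /rB Bq; split; [exact: clamp_itv|].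
  apply: ctat_pair.
    by apply: ctat_clamp; exact: ctat_fst.
  by apply: (ctat_comp (f := snd)); [exact: ctat_snd|exact: cr].
- move=> t x t01 Px; rewrite HE// => z0.
  have hB y : B y -> B (H t y) by exact: HB.
  by have [y By [<- _]] := fix_map_zero hB E Px z0; exists y.
- by rewrite HE ?lexx ?ler01.
Qed.
End IndexHomotopy.

(** * Collapsing cells to spheres and expanding them *)

Section SphereWrap.
Context {R : realType} {n : nat}.
Local Notation V := 'rV[R]_n.+1.
Implicit Types (d : 'rV[R]_n) (v y : V).

Definition wrapv d : V :=
  (row_mx (2 * normsq d - 1)%:M ((2 * Num.sqrt (1 - normsq d)) *: d) : 'rV_(1 + n)).
Definition pole : V := delta_mx 0 0.
(** The inverse of [wrapv] off the pole: for [v = wrapv d] one has [1 - v 0 0 = 2 (1 - |d|^2)], so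
    the root equals the factor of [d] in [wrapv]. *)
Definition unwrapv v : 'rV[R]_n := (Num.sqrt (2 * (1 - v 0 0)))^-1 *: rsubmx (v : 'rV_(1 + n)).
Definition usphere : set V := [set v | normsq v = 1].

Lemma normsq_split v : normsq v = v 0 0 ^+ 2 + normsq (rsubmx (v : 'rV_(1 + n))).
Proof.
rewrite /normsq big_ord_recl; congr (_ + _); apply: eq_bigr => i _.
by rewrite mxE; congr (v _ _ ^+ 2); apply: val_inj.
Qed.

Lemma wrapv0 d : wrapv d 0 0 = 2 * normsq d - 1.
Proof.
have -> : (0 : 'I_n.+1) = lshift n (0 : 'I_1) by apply: val_inj.
by rewrite /wrapv (@row_mxEl _ 1 1 n) mxE eqxx mulr1n.
Qed.

Lemma wrapvr d : rsubmx (wrapv d : 'rV_(1 + n)) = (2 * Num.sqrt (1 - normsq d)) *: d.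
Proof. exact: row_mxKr. Qed.

Lemma wrapv_sphere d : cdisc d -> usphere (wrapv d).
Proof. by move=> d1; exact: (@wrap_subproof R n (exist _ d (mem_set d1))). Qed.

Lemma pole_sphere : usphere pole. Proof. exact: normsq_e0. Qed.

Lemma pole0 : pole 0 0 = 1. Proof. by rewrite mxE !eqxx. Qed.

Lemma row_eq v (w : V) : v 0 0 = w 0 0 -> rsubmx (v : 'rV_(1 + n)) = rsubmx (w : 'rV_(1 + n)) -> v = w.
Proof.
move=> e0 e1; apply/rowP => i; case: (unliftP 0 i) => [j ->|->//].
move/rowP: e1 => /(_ j); rewrite !mxE.
have -> : rshift 1 j = fintype.lift 0 j by apply: val_inj.
by [].
Qed.

Lemma sphere_eq_pole v : usphere v -> v 0 0 = 1 -> v = pole.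
Proof.
rewrite /usphere /= normsq_split => h v1; apply: row_eq; first by rewrite pole0.
have z (w : V) : w 0 0 = 1 -> normsq w = 1 -> rsubmx (w : 'rV_(1 + n)) = 0.
  move=> w1; rewrite normsq_split w1 expr1n => /eqP; rewrite -subr_eq0 addrAC subrr add0r.
  by rewrite normsq_eq0 => /eqP.
rewrite !z ?pole0//; last by rewrite normsq_split.
exact: pole_sphere.
Qed.

Lemma sphere_lt1 v : usphere v -> v <> pole -> v 0 0 < 1.
Proof.
move=> v1 vp; rewrite lt_neqAle; apply/andP; split; first by apply/eqP => /(sphere_eq_pole v1).
move: v1; rewrite /usphere /= normsq_split => h.
have := normsq_ge0 (rsubmx (v : 'rV_(1 + n))).
by move: (normsq _) h => q; nra.
Qed.

Lemma wrapv_pole d : normsq d = 1 -> wrapv d = pole.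
Proof.
move=> d1; apply: sphere_eq_pole; first by apply: wrapv_sphere; rewrite /cdisc /= d1.
by rewrite wrapv0 d1; ring.
Qed.

Lemma wrapvK d : odisc d -> unwrapv (wrapv d) = d.
Proof.
rewrite /odisc /= => d1; rewrite /unwrapv wrapv0 wrapvr scalerA.
have -> : 2 * (1 - (2 * normsq d - 1)) = 2 ^+ 2 * (1 - normsq d) by ring.
rewrite sqrtrM ?sqr_ge0// sqrtr_sqr ger0_norm// mulVf ?scale1r//.
by rewrite mulf_neq0// gt_eqF// sqrtr_gt0 subr_gt0.
Qed.

Lemma unwrapvK v : usphere v -> v <> pole -> odisc (unwrapv v) /\ wrapv (unwrapv v) = v.
Proof.
move=> v1 vp; have v0 := sphere_lt1 v1 vp.
have c0 : 0 < 2 * (1 - v 0 0) by rewrite mulr_gt0// subr_gt0.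
have s0 : 0 < Num.sqrt (2 * (1 - v 0 0)) by rewrite sqrtr_gt0.
have sE : Num.sqrt (2 * (1 - v 0 0)) ^+ 2 = 2 * (1 - v 0 0) by rewrite sqr_sqrtr// ltW.
have qE : normsq (unwrapv v) = (1 + v 0 0) / 2.
  rewrite normsqZ exprVn sE.
  have -> : normsq (rsubmx (v : 'rV_(1 + n))) = 1 - v 0 0 ^+ 2.
    by move: v1; rewrite /usphere /= normsq_split => <-; rewrite addrAC subrr add0r.
  rewrite invfM; have n0 : 1 - v 0 0 != 0 by rewrite gt_eqF// subr_gt0.
  by move: (v 0 0) n0 => x n0; field.
have od : odisc (unwrapv v) by rewrite /odisc /= qE; lra.
split => //; apply: row_eq; first by rewrite wrapv0 qE; lra.
rewrite wrapvr qE /unwrapv scalerA.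
have -> : 1 - (1 + v 0 0) / 2 = (2^-1) ^+ 2 * (2 * (1 - v 0 0)) by field.
rewrite sqrtrM ?sqr_ge0// sqrtr_sqr ger0_norm ?invr_ge0//.
by rewrite mulVKf ?pnatr_eq0// divff ?scale1r// gt_eqF.
Qed.

Lemma wrapv_not_pole d : odisc d -> wrapv d <> pole.
Proof.
move=> od /(congr1 (fun v : V => v 0 0)); rewrite /= wrapv0 pole0.
by move: od; rewrite /odisc /=; lra.
Qed.

Lemma wrapv_inj d e : odisc d -> odisc e -> wrapv d = wrapv e -> d = e.
Proof. by move=> od oe E; rewrite -(wrapvK od) E wrapvK. Qed.

Lemma ctat_wrapv (T : topologicalType) (f : T -> 'rV[R]_n) p : ctat f p -> ctat (fun q => wrapv (f q)) p.
Proof.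
move=> cf; have cn := ctat_normsq cf.
apply: (@ctat_row_mx R 1 n T (fun q => (2 * normsq (f q) - 1)%:M)
  (fun q => (2 * Num.sqrt (1 - normsq (f q))) *: f q)).
  apply: (eq_ctat (g := fun q => (2 * normsq (f q) - 1) *: (1%:M : 'rV[R]_1))) => [q|].
    by rewrite scale_scalar_mx mulr1.
  apply: ctatZ; last exact: ctat_cst.
  by apply: ctatB; [apply: ctatM => //|]; exact: ctat_cst.
apply: ctatZ => //; apply: ctatM; first exact: ctat_cst.
by apply: ctat_sqrt; apply: ctatB => //; exact: ctat_cst.
Qed.

Lemma ctat_unwrapv (T : topologicalType) (f : T -> V) p : f p 0 0 < 1 -> ctat f p ->
  ctat (fun q => unwrapv (f q)) p.
Proof.
move=> p1 cf; apply: ctatZ; last by apply: (@ctat_rsubmx R 1 n T).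
apply: ctatV; first by rewrite gt_eqF// sqrtr_gt0 mulr_gt0// subr_gt0.
apply: ctat_sqrt; apply: ctatM; first exact: ctat_cst.
by apply: ctatB; [exact: ctat_cst|exact: ctat_coord].
Qed.

Lemma usphere_cover v : usphere v -> v = pole \/ exists2 d, odisc d & v = wrapv d.
Proof.
move=> v1; have [->|vp] := pselect (v = pole); first by left.
by right; have [od e] := unwrapvK v1 vp; exists (unwrapv v).
Qed.

Lemma closed_usphere : closed usphere.
Proof.
have -> : usphere = @normsq R n.+1 @^-1` [set 1] by [].
apply: closed_comp; last by apply: (@compact_closed R^o); [exact: norm_hausdorff|exact: compact_set1].
by move=> y _; apply: (ctat_normsq (f := id)); exact: ctat_id.
Qed.

Lemma compact_usphere : compact usphere.
Proof.
apply: bounded_closed_compact closed_usphere.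
apply: (@ex_bounded _ _ _ 1) => v v1; apply: le_trans (norm_le_enorm v) _.
by rewrite /enorm v1 sqrtr1.
Qed.

(** The pole is covered by a piece of its own since for [n = 0] the wrapped disc misses it; this is
    why [f] has to be constant along the pole. *)
Lemma sphere_within_icyl (Z : topologicalType) (f : R * V -> Z) z :
  (forall t, f (t, pole) = z) ->
  {within icyl cdisc, continuous (fun q => f (q.1, wrapv q.2))} ->
  {within icyl usphere, continuous f}.
Proof.
move=> fz cf; have cl (A : set V) : compact A -> closed (@icyl R V A).
  by move=> cA; apply: closed_icyl; apply: compact_closed cA; exact: norm_hausdorff.
have ww : {within @cdisc R n, continuous wrapv} by apply: within_ctat => d _; apply: ctat_wrapv; exact: ctat_id.
have -> : icyl usphere = @icyl R V (wrapv @` cdisc) `|` icyl [set pole].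
  apply/seteqP; split=> [[t v] [/= t01 v1]|[t v] [[/= t01 [d cd <-]]|[/= t01 ->]]].
  - have [->|[d od ->]] := usphere_cover v1; [by right|left; split => //; exists d => //].
    exact: odisc_sub.
  - by split => //; exact: wrapv_sphere.
  - by split => //; exact: pole_sphere.
apply: withinU_continuous.
- by apply: cl; apply: within_image => //; exact: compact_cdisc.
- by apply: cl; exact: compact_set1.
- apply: quotient_within_icyl ww cf; [exact: norm_hausdorff|exact: compact_cdisc|exact: closed_cdisc].
apply: (@subspace_eq_continuous _ _ _ (cst z)).
  by move=> [t v]; rewrite inE => -[_ /= ->]; rewrite /from_subspace fz.
by apply: continuous_subspaceT; exact: cst_continuous.
Qed.

Lemma sphere_within (Z : topologicalType) (f : V -> Z) :
  {within cdisc, continuous (f \o wrapv)} -> {within usphere, continuous f}.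
Proof.
move=> cf; apply: (@within_precomp _ _ _ (fun v => (0 : R, v)) (f \o snd) _ (icyl usphere)).
- by apply: within_ctat => v _; apply: ctat_pair; [exact: ctat_cst|exact: ctat_id].
- by move=> v v1; split => //=; rewrite lexx ler01.
apply: (sphere_within_icyl (z := f pole)) => //.
apply: (@within_precomp _ _ _ snd (f \o wrapv) _ cdisc) => // [|p []//].
by apply: within_ctat => p _; exact: ctat_snd.
Qed.

(** Expansion by the factor [1 + t], stopped at the boundary. At [t = 1] all points of norm at least
    1/2 reach the boundary, which is the origin of the constant 1/2 in the domains below. *)
Definition expandv (t : R) d : 'rV[R]_n := Num.min ((1 + t) * enorm d) 1 *: direction d.

Lemma normsq_expand (t : R) d : 0 <= t -> d != 0 ->
  normsq (expandv t d) = Num.min ((1 + t) * enorm d) 1 ^+ 2.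
Proof. by move=> t0 d0; rewrite normsqZ normsq_direction// mulr1. Qed.

Lemma cdisc_expand (t : R) d : 0 <= t -> cdisc (expandv t d).
Proof.
move=> t0; rewrite /cdisc /=; have [->|d0] := eqVneq d 0.
  by rewrite /expandv /direction scaler0 scaler0 normsq0.
rewrite normsq_expand// expr_le1// ?ge_min ?lexx ?orbT//.
by rewrite le_min ler01 mulr_ge0 ?enorm_ge0// addr_ge0.
Qed.

Lemma expand_bd (t : R) d : 0 <= t -> 1 <= (1 + t) * enorm d -> expandv t d = direction d.
Proof. by move=> t0 h; rewrite /expandv min_r// scale1r. Qed.

Lemma expandv1 (t : R) d : 0 <= t -> normsq d = 1 -> expandv t d = d.
Proof.
move=> t0 d1; rewrite expand_bd ?direction_id// /enorm d1 sqrtr1 mulr1 lerDl //.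
Qed.

Lemma expandv0 d : cdisc d -> expandv 0 d = d.
Proof.
by move=> cd; rewrite /expandv addr0 mul1r min_l ?directionK// enorm_le1.
Qed.

Lemma ctat_expand (t : R) d : ctat (fun q : R * 'rV[R]_n => expandv q.1 q.2) (t, d).
Proof.
have cm : ctat (fun q : R * 'rV[R]_n => Num.min ((1 + q.1) * enorm q.2) 1) (t, d).
  apply: ctat_min; last exact: ctat_cst.
  apply: ctatM; first by apply: ctatD; [exact: ctat_cst|exact: ctat_fst].
  by apply: ctat_enorm; exact: ctat_snd.
have [d0|d0] := eqVneq d 0; last by apply: ctatZ => //; apply: ctat_direction => //; exact: ctat_snd.
apply: (ctat_scale0 (M := 1)) => //.
  by rewrite /= d0 /enorm normsq0 sqrtr0 mulr0 min_l// ler01.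
apply: (@filterS _ (nbhs (t, d)) _ setT) => [q _|]; last exact: filterT.
by right; exact: direction_norm.
Qed.

Definition expand_sphere (t : R) v : V :=
  if v == pole then pole else wrapv (expandv t (unwrapv v)).

Lemma expand_sphereE (t : R) d : 0 <= t -> cdisc d -> expand_sphere t (wrapv d) = wrapv (expandv t d).
Proof.
move=> t0; rewrite /cdisc /= le_eqVlt => /predU1P[d1|od].
  by rewrite (wrapv_pole d1) /expand_sphere eqxx (expandv1 t0 d1) (wrapv_pole d1).
by rewrite /expand_sphere ifN ?wrapvK//; apply/eqP; exact: wrapv_not_pole.
Qed.
End SphereWrap.

Lemma xget_eq (T : choiceType) (x0 z : T) (P : set T) : P z -> (forall z', P z' -> z' = z) -> xget x0 P = z.
Proof. by move=> Pz uz; apply: uz; exact: xgetPex (ex_intro _ z Pz). Qed.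

Section CellSphere.
Context {R : realType} {Y : topologicalType} (X : cw_structure (R := R) Y).
Implicit Types (s t : X).

(** The collapse of everything but the open cell [s], with the quotient identified with a sphere. It
    is continuous on the skeleton of the dimension of [s]. *)
Definition cell_sph s (y : Y) : 'rV[R]_(dm s).+1 :=
  xget pole [set v | exists d, [/\ odisc d, ch s d = y & v = wrapv d]].

Lemma cell_sph_odisc s d : odisc d -> cell_sph s (ch s d) = wrapv d.
Proof.
by move=> od; apply: xget_eq => [|v [e [oe E ->]]]; [exists d|rewrite (cw_inj oe od E)].
Qed.

Lemma cell_sph_out s y : (forall d, odisc d -> ch s d <> y) -> cell_sph s y = pole.
Proof. by move=> h; rewrite /cell_sph; case: xgetP => // v _ [d [od /h]]. Qed.

Lemma bd_other s t (d : 'rV_(dm t)) : normsq d = 1 -> (dm t <= dm s)%N ->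
  forall e, odisc e -> ch s e <> ch t d.
Proof.
move=> d1 ts e oe E; have [u [e' [us oe' Eu]]] := cw_bd d1.
have su : s = u by apply: (cw_disj oe oe'); rewrite E.
by move: us; rewrite -su ltnNge ts.
Qed.

Lemma cell_sph_cell s d : cdisc d -> cell_sph s (ch s d) = wrapv d.
Proof.
rewrite /cdisc /= le_eqVlt => /predU1P[d1|]; last exact: cell_sph_odisc.
rewrite wrapv_pole//; apply: cell_sph_out => e oe; exact: bd_other d1 (leqnn _) e oe.
Qed.

Lemma cell_sph_other s t d : cdisc d -> (dm t <= dm s)%N -> t <> s -> cell_sph s (ch t d) = pole.
Proof.
move=> cd ts nts; apply: cell_sph_out => e oe E.
move: cd; rewrite /cdisc /= le_eqVlt => /predU1P[d1|od]; first exact: (bd_other d1 ts oe).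
by apply: nts; rewrite (cw_disj oe od E).
Qed.

Lemma cell_sph_sphere s y : usphere (cell_sph s y).
Proof.
rewrite /cell_sph; case: xgetP => [v _ [d [od _ ->]]|_]; last exact: pole_sphere.
by apply: wrapv_sphere; exact: odisc_sub.
Qed.

Lemma cell_sph_not_pole s y : cell_sph s y <> pole -> exists2 d, odisc d & ch s d = y.
Proof.
move=> h; apply: contrapT => nd; apply: h; apply: cell_sph_out => d od e; apply: nd.
by exists d.
Qed.

Lemma cell_sph_within (S : {set X}) s n : subcomplex S -> dm s = n ->
  {within body (skel S n.+1), continuous (cell_sph s)}.
Proof.
move=> cS sn; apply: cw_within; first exact: subcomplex_skel.
move=> t; rewrite skelE ltnS => /andP[tS tn].
have [<-|ts] := pselect (t = s).
  apply: (@subspace_eq_continuous _ _ _ (@wrapv R (dm t))).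
    by move=> d; rewrite inE /from_subspace /= => cd; rewrite cell_sph_cell.
  by apply: within_ctat => d _; apply: ctat_wrapv; exact: ctat_id.
apply: (@subspace_eq_continuous _ _ _ (fun=> pole)).
  by move=> d; rewrite inE /from_subspace /= => cd; rewrite cell_sph_other// sn.
by apply: within_ctat => d _; exact: ctat_cst.
Qed.

Variable n : nat.

(** All [n]-cells are expanded at once, and the other points stay. At [t = 1] the outer half of each
    [n]-cell lands in the lower skeleton. *)
Definition push (t : R) y : Y := xget y
  [set z | exists s d, [/\ dm s = n, odisc d, ch s d = y & z = ch s (expandv t d)]].

Definition height y : R := xget (1 : R)
  [set h : R | exists s (d : 'rV_(dm s)), [/\ dm s = n, odisc d, ch s d = y & h = enorm d]].

Lemma push_odisc (t : R) s d : dm s = n -> odisc d -> push t (ch s d) = ch s (expandv t d).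
Proof.
move=> sn od; apply: xget_eq => [|z [s' [d' [sn' od' E ->]]]]; first by exists s, d.
have ss := cw_disj od' od E; subst s'.
by rewrite (cw_inj od' od E).
Qed.

Lemma height_odisc s d : dm s = n -> odisc d -> height (ch s d) = enorm d.
Proof.
move=> sn od; apply: (xget_eq (T := R)) => [|z [s' [d' [sn' od' E ->]]]]; first by exists s, d.
have ss := cw_disj od' od E; subst s'.
by rewrite (cw_inj od' od E).
Qed.

Lemma push_out (t : R) y : (forall s d, dm s = n -> odisc d -> ch s d <> y) -> push t y = y.
Proof. by move=> h; rewrite /push; case: xgetP => // z _ [s [d [sn od /h]]]; case. Qed.

Lemma height_out y : (forall s d, dm s = n -> odisc d -> ch s d <> y) -> height y = 1.
Proof. by move=> h; rewrite /height; case: xgetP => // z _ [s [d [sn od /h]]]; case. Qed.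

Lemma low_out t (d : 'rV_(dm t)) : cdisc d -> (dm t < n)%N ->
  forall s e, dm s = n -> odisc e -> ch s e <> ch t d.
Proof.
move=> cd tn s e sn oe E; move: cd; rewrite /cdisc /= le_eqVlt => /predU1P[d1|od].
  by apply: (bd_other d1 _ oe) E; rewrite sn ltnW.
by move: tn; rewrite -(cw_disj oe od E) sn ltnn.
Qed.

Lemma bd_out t (d : 'rV_(dm t)) : normsq d = 1 -> dm t = n ->
  forall s e, dm s = n -> odisc e -> ch s e <> ch t d.
Proof. by move=> d1 tn s e sn oe; apply: bd_other => //; rewrite sn tn. Qed.

Lemma push_cell (t : R) s d : 0 <= t -> dm s = n -> cdisc d -> push t (ch s d) = ch s (expandv t d).
Proof.
move=> t0 sn; rewrite /cdisc /= le_eqVlt => /predU1P[d1|]; last exact: push_odisc.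
by rewrite expandv1// push_out//; exact: bd_out.
Qed.

Lemma height_cell s d : dm s = n -> cdisc d -> height (ch s d) = enorm d.
Proof.
move=> sn; rewrite /cdisc /= le_eqVlt => /predU1P[d1|]; last exact: height_odisc.
by rewrite /enorm d1 sqrtr1 height_out//; exact: bd_out.
Qed.

Lemma push_low (t : R) s d : (dm s < n)%N -> cdisc d -> push t (ch s d) = ch s d.
Proof. by move=> sn cd; apply: push_out; exact: low_out. Qed.

Lemma height_low s d : (dm s < n)%N -> cdisc d -> height (ch s d) = 1.
Proof. by move=> sn cd; apply: height_out; exact: low_out. Qed.

Variable S : {set X}.
Hypothesis cS : subcomplex S.
Local Notation A := (body (skel S n)).
Local Notation B := (body (skel S n.+1)).

Lemma skelS_cases s : s \in skel S n.+1 -> s \in S /\ ((dm s < n)%N \/ dm s = n).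
Proof. by rewrite skelE ltnS leq_eqVlt => /andP[sS /orP[/eqP|]] h; split => //; [right|left]. Qed.

Lemma skel_sub : A `<=` B.
Proof. by apply: bodyS; apply/fintype.subsetP => s; rewrite !skelE => /andP[-> /ltnW]. Qed.

Lemma push_body (t : R) y : 0 <= t -> B y -> B (push t y).
Proof.
move=> t0 [s [d [sS od <-]]]; have [sS' [sn|sn]] := skelS_cases sS.
  rewrite push_low//; last exact: odisc_sub.
  by exists s, d.
rewrite push_odisc//; apply: body_cdisc => //; first exact: subcomplex_skel.
exact: cdisc_expand.
Qed.

Lemma push_A (t : R) y : A y -> push t y = y.
Proof.
move=> [s [d [+ od <-]]]; rewrite skelE => /andP[sS sn].
by rewrite push_low//; exact: odisc_sub.
Qed.

Lemma height_A y : A y -> height y = 1.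
Proof.
move=> [s [d [+ od <-]]]; rewrite skelE => /andP[sS sn].
by rewrite height_low//; exact: odisc_sub.
Qed.

Lemma push0 y : B y -> push 0 y = y.
Proof.
move=> [s [d [sS od <-]]]; have [sS' [sn|sn]] := skelS_cases sS.
  by rewrite push_low//; exact: odisc_sub.
by rewrite push_odisc// expandv0//; exact: odisc_sub.
Qed.

Lemma push1_A y : B y -> 1/2 <= height y -> A (push 1 y).
Proof.
move=> [s [d [sS od <-]]]; have [sS' [sn|sn]] := skelS_cases sS.
  rewrite push_low//; last exact: odisc_sub.
  by move=> _; exists s, d; split => //; rewrite skelE sS'.
rewrite push_odisc// height_odisc// => h.
have e1 : 0 < enorm d by lra.
rewrite expand_bd ?ler01//; last by lra.
have d0 : d != 0 by rewrite -enorm_eq0 gt_eqF.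
have [t [e [tS ts oe E]]] := cS sS' (normsq_direction d0).
by exists t, e; split => //; rewrite skelE tS -sn.
Qed.

Lemma height_within : {within B, continuous height}.
Proof.
apply: (@cw_within _ _ _ _ R); first exact: subcomplex_skel.
move=> s /skelS_cases[sS [sn|sn]].
  apply: (@subspace_eq_continuous _ _ _ (fun=> (1 : R))).
    by move=> d; rewrite inE /from_subspace /= => cd; rewrite height_low.
  by apply: within_ctat => d _; exact: ctat_cst.
apply: (@subspace_eq_continuous _ _ _ (fun d => enorm d)).
  by move=> d; rewrite inE /from_subspace /= => cd; rewrite height_cell.
by apply: within_ctat => d _; apply: ctat_enorm; exact: ctat_id.
Qed.

Lemma push_within (y0 : Y) : {within icyl B, continuous (fun q : R * Y => push q.1 q.2)}.
Proof.
apply: (cw_within_icyl y0); first exact: subcomplex_skel.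
move=> s /skelS_cases[sS [sn|sn]].
  apply: (@subspace_eq_continuous _ _ _ (fun q : R * 'rV_(dm s) => ch s q.2)).
    by move=> [t d]; rewrite inE /from_subspace /= => -[_ cd]; rewrite push_low.
  apply: (@within_precomp _ _ _ (fun q : R * 'rV_(dm s) => q.2) (ch s) _ cdisc).
  - by apply: within_ctat => -[t d] _; exact: ctat_snd.
  - by move=> [t d] [].
  - exact: cw_cont.
apply: (@subspace_eq_continuous _ _ _ (fun q : R * 'rV_(dm s) => ch s (expandv q.1 q.2))).
  move=> [t d]; rewrite inE /from_subspace /= => -[/= /andP[t0 _] cd].
  by rewrite push_cell.
apply: (@within_precomp _ _ _ (fun q : R * 'rV_(dm s) => expandv q.1 q.2) (ch s) _ cdisc).
- by apply: within_ctat => -[t d] _; exact: ctat_expand.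
- by move=> [t d] [/= /andP[t0 _] _]; exact: cdisc_expand.
- exact: cw_cont.
Qed.
End CellSphere.

Section ExpandedSphereMap.
Context {R : realType} {n : nat}.
Local Notation V := 'rV[R]_n.+1.
Variable k : V -> V.
Hypotheses (ck : {within usphere, continuous k}) (k1 : forall v, usphere v -> usphere (k v)).
Hypothesis kp : k pole = pole.

Lemma near_usphere (y : V) : y != 0 -> \forall q \near y, usphere (direction q).
Proof.
move=> y0; have := near_open open_punctured y0; apply: filterS => q q0.
exact: normsq_direction.
Qed.

Lemma ctat_clamp_direction (Z : topologicalType) (f : R * V -> Z) (t : R) (y : V) :
  {within icyl usphere, continuous f} -> y != 0 ->
  ctat (fun q : R * V => f (clamp q.1, direction q.2)) (t, y).
Proof.
move=> cf y0; apply: (@ctat_within _ _ _ (fun q : R * V => (clamp q.1, direction q.2)) f (icyl usphere)) => //.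
  have nP : \forall q \near (t, y), usphere (direction q.2).
    by apply: (@ctat_snd R^o V (t, y) [set q | usphere (direction q)]); exact: near_usphere.
  by apply: filterS nP => q q1; split; [exact: clamp_itv|].
apply: ctat_pair; first by apply: ctat_clamp; exact: ctat_fst.
by apply: ctat_direction => //; exact: ctat_snd.
Qed.

Lemma ctat_kdir (y : V) : y != 0 -> ctat (fun y => k (direction y)) y.
Proof.
move=> y0; apply: (ctat_within (f := fun q => direction q) ck); first exact: near_usphere.
by apply: ctat_direction => //; exact: ctat_id.
Qed.

(** A cone about the antipode of the pole. On the unit sphere it is given by a first coordinate
    below [- 1/2]; as that coordinate is [2|d|^2 - 1] at [wrapv d], this is the disc [|d| < 1/2]. *)
Definition cap : set V := [set y : V | y 0 0 < - (enorm y / 2)].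

Lemma open_cap : open cap.
Proof.
have -> : cap = [set y : V | y 0 0 + enorm y / 2 < 0].
  by apply/seteqP; split => y; rewrite /cap /=; lra.
apply: open_lt_ctat => y; apply: ctatD; first by apply: ctat_coord; exact: ctat_id.
by apply: ctatM; [apply: ctat_enorm; exact: ctat_id|exact: ctat_cst].
Qed.

Lemma cap_neq0 (y : V) : cap y -> y != 0.
Proof.
by rewrite /cap /=; apply: contraTneq => ->; rewrite mxE /enorm normsq0 sqrtr0 mul0r oppr0 ltxx.
Qed.

Lemma cap_direction (y : V) : cap y -> usphere (direction y) /\ direction y 0 0 < - (1/2).
Proof.
move=> cy; have y0 := cap_neq0 cy; split; first exact: normsq_direction.
have e0 : 0 < enorm y by rewrite lt0r enorm_eq0 y0 enorm_ge0.
rewrite mxE -(ltr_pM2l e0) mulVKf ?gt_eqF//; move: cy; rewrite /cap /=; lra.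
Qed.

Lemma cap_usphere (v : V) : usphere v -> cap v <-> v 0 0 < - (1/2).
Proof. by rewrite /cap /= /enorm => ->; rewrite sqrtr1. Qed.

Lemma far_expand (v : V) : usphere v -> - (1/2) <= v 0 0 -> expand_sphere 1 v = pole.
Proof.
move=> v1 v2; have [->|[d od vd]] := usphere_cover v1; first by rewrite /expand_sphere eqxx.
rewrite vd expand_sphereE ?ler01//; last exact: odisc_sub.
move: v2; rewrite vd wrapv0 => v2.
have q2 : 1/4 <= normsq d by lra.
have d0 : d != 0 by apply: contraTneq q2 => ->; rewrite normsq0 -ltNge divr_gt0.
rewrite expand_bd ?ler01//; last first.
  have := enorm_sq d; have := enorm_ge0 d; move: (enorm d) => e e0 eE; nra.
by apply: wrapv_pole; exact: normsq_direction.
Qed.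

(** Expansion is a homotopy and leaves the total index [1 + (-1)^n z] unchanged. Outside the cap the
    expanded map is constantly the pole, a fixed point of index 1; the rest of the index is in the
    cap. *)
Lemma cap_deg z : is_deg (radial k) setT z ->
  let F := fun y => y - k (expand_sphere 1 (direction y)) in
  (exists K, adm F cap K) /\ is_deg F cap ((-1) ^+ n * z).
Proof.
move=> dz.
have ck' := ctat_kdir.
have d1 := sphere_lefschetz ck' k1 dz.
pose f (q : R * V) := k (expand_sphere q.1 q.2).
have cf : {within icyl usphere, continuous f}.
  apply: (@sphere_within_icyl R n V f pole).
    by move=> t; rewrite /f /expand_sphere eqxx.
  apply: (@subspace_eq_continuous _ _ _ (fun q : R * 'rV_n => k (wrapv (expandv q.1 q.2)))).
    move=> [t d]; rewrite inE /from_subspace /= => -[/= /andP[t0 _] cd].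
    by rewrite /f /= expand_sphereE.
  apply: (@within_precomp _ _ _ (fun q : R * 'rV_n => wrapv (expandv q.1 q.2)) k _ usphere) => //.
    by apply: within_ctat => -[t d] _; apply: ctat_wrapv; exact: ctat_expand.
  by move=> [t d] [/= /andP[t0 _] _]; apply: wrapv_sphere; exact: cdisc_expand.
have fS (t : R) v : 0 <= t <= 1 -> usphere v -> usphere (f (t, v)).
  move=> /andP[t0 t1] v1; rewrite /f /=; have [->|[d od ->]] := usphere_cover v1.
    by rewrite /expand_sphere eqxx kp; exact: pole_sphere.
  rewrite expand_sphereE//; last exact: odisc_sub.
  by apply: k1; apply: wrapv_sphere; exact: cdisc_expand.
pose L (t : R) y := y - f (clamp t, direction y).
have L1 : L 1 = fun y => y - k (expand_sphere 1 (direction y)).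
  by apply/funext => y; rewrite /L clampE ?ler01 ?lexx.
have cL (t : R) y : y != 0 -> ctat (fun p : R * V => L p.1 p.2) (t, y).
  move=> y0; apply: (@ctatBv _ R V snd (fun p : R * V => f (clamp p.1, direction p.2))); first exact: ctat_snd.
  exact: ctat_clamp_direction.
have LZ (t : R) y : y != 0 -> L t y = 0 -> usphere y.
  by move=> y0 /subr0_eq ->; apply: fS; [exact: clamp_itv|exact: normsq_direction].
have Sp : @usphere R n `<=` punctured.
  by move=> v v1; apply/eqP => v0; move: v1; rewrite v0 /usphere /= normsq0 => /esym/eqP; rewrite oner_eq0.
have d2 : is_deg (L 1) punctured (1 + (-1) ^+ n * z).
  apply: (@is_deg_homotopy _ _ L punctured usphere).
  - exact: open_punctured.
  - exact: compact_usphere.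
  - exact: Sp.
  - by move=> t y _; exact: cL.
  - by move=> t y _; exact: LZ.
  - apply: eq_is_deg d1 => [|y y0]; first exact: open_punctured.
    rewrite /L clampE ?ler01 ?lexx// /f /=; congr (_ - k _).
    have [->|[d od ->]] := usphere_cover (normsq_direction y0 : usphere _).
      by rewrite /expand_sphere eqxx.
    by rewrite expand_sphereE ?expandv0//; exact: odisc_sub.
have cL1 y : y != 0 -> ctat (L 1) y.
  move=> y0; apply: (@ctat_comp _ _ _ (fun y : V => (1 : R, y)) (fun p : R * V => L p.1 p.2)); last exact: cL.
  by apply: ctat_pair; [exact: ctat_cst|exact: ctat_id].
have aL : adm (L 1) punctured usphere.
  split; [exact: open_punctured|exact: compact_usphere|exact: Sp|exact: cL1|].
  by move=> y y0; exact: LZ.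
pose U b := if b then cap else [set y : V | 0 < y 0 0 + enorm y / 2].
have oU b : open (U b).
  case: b; first exact: open_cap.
  apply: open_gt_ctat => y; apply: ctatD; first by apply: ctat_coord; exact: ctat_id.
  by apply: ctatM; [apply: ctat_enorm; exact: ctat_id|exact: ctat_cst].
have UP b : U b `<=` punctured.
  case: b => y; first exact: cap_neq0.
  rewrite /punctured /=; apply: contraTneq => ->.
  by rewrite mxE /enorm normsq0 sqrtr0 mul0r addr0 ltxx.
have dis (i j : bool) y : U i y -> U j y -> i = j.
  by case: i; case: j => //; rewrite /U /cap /=; lra.
have farE y : y != 0 -> - (1/2) <= direction y 0 0 -> L 1 y = y - pole.
  by move=> y0 h; rewrite L1 far_expand ?kp//; exact: normsq_direction.
have cov y : punctured y -> L 1 y = 0 -> exists2 b, b \in [:: true; false] & U b y.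
  move=> y0 e; have y1 := LZ _ _ y0 e.
  have yd := direction_id y1; have e1 : enorm y = 1 by rewrite /enorm y1 sqrtr1.
  have [h|h] := ltrP (y 0 0) (- (1/2)); first by exists true => //; rewrite /U /cap /= e1; lra.
  exists false => //; move: e; rewrite farE ?yd// => /subr0_eq ->.
  by rewrite /U /= pole0; have := enorm_ge0 (pole : V); lra.
have d3 : is_deg (L 1) (U false) 1.
  have p0 : U false pole by rewrite /U /= pole0; have := enorm_ge0 (pole : V); lra.
  have := @lin_deg R n.+1 1%:M (U false) pole (oU false) p0.
  rewrite det1 sgz1 oner_eq0 => /(_ isT); apply: eq_is_deg => [|y Uy]; first exact: (oU false).
  rewrite mulmx1 farE//; first exact: (UP false).
  have y0 : y != 0 := UP false _ Uy.
  have e0 : 0 < enorm y by rewrite lt0r enorm_eq0 y0 enorm_ge0.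
  by rewrite mxE -(ler_pM2l e0) mulVKf ?gt_eqF//; move: Uy; rewrite /U /=; lra.
have aZ := adm_zeros aL; have [_ cZ _ _ _] := aZ.
have aC : adm (L 1) cap ([set y | punctured y /\ L 1 y = 0] `&` ~` U false).
  apply: (adm_sub aZ) => //; first exact: open_cap.
  - exact: (UP true).
  - by apply: compact_closedI => //; apply: open_closedC; exact: (oU false).
  - by move=> y [[y0 e] nU]; have [[] //] := cov y y0 e.
  - move=> y Cy e; split; first by split => //; exact: (UP true _ Cy).
    by move=> Uf; have := dis true false y Cy Uf.
have [z2 dz2] := is_deg_exists aC.
have dU (i : bool) : i \in [:: true; false] -> is_deg (L 1) (U i) (if i then z2 else 1) by case: i.
have u2 : uniq [:: true; false] by [].
have := @is_deg_sum R n.+1 bool (L 1) punctured _ U (fun i => if i then z2 else 1)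
  [:: true; false] aL oU UP dis u2 cov dU.
rewrite big_cons big_seq1 => dS; have zE := is_deg_uniq aL d2 dS.
have <- : z2 = (-1) ^+ n * z by apply: (addIr 1); rewrite -zE addrC.
by rewrite /= -L1; split => //; eexists; exact: aC.
Qed.
End ExpandedSphereMap.

(** * Adding the cells of one dimension *)

Section IndexStep.
Context {R : realType} {Y : topologicalType} (X : cw_structure (R := R) Y).
Variables (y0 : Y) (S : {set X}) (n : nat) (g : Y -> Y).
Local Notation A := (body (skel S n)).
Local Notation B := (body (skel S n.+1)).
Hypothesis cS : subcomplex S.
Hypotheses (cg : {within B, continuous g}) (gA : forall y, A y -> A (g y)).
Hypothesis gB : forall y, B y -> B (g y).
Variables (k : forall s : X, 'rV[R]_(dm s).+1 -> 'rV[R]_(dm s).+1) (zs : X -> int).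
Arguments k s _ : clear implicits.
Definition top_cell (s : X) := (s \in S) && (dm s == n).
Hypothesis kE : forall s (d : 'rV_(dm s)), top_cell s -> cdisc d ->
  k s (wrapv d) = cell_sph s (g (ch s d)).
Hypothesis kp : forall s, top_cell s -> k s pole = pole.
Hypothesis dk : forall s, top_cell s -> is_deg (radial (k s)) setT (zs s).

Let cSn : subcomplex (skel S n.+1) := subcomplex_skel (n := n.+1) cS.
Let cSn' : subcomplex (skel S n) := subcomplex_skel (n := n) cS.

Lemma top_skel s : top_cell s -> s \in skel S n.+1.
Proof. by move=> /andP[sS /eqP sn]; rewrite skelE sS sn ltnSn. Qed.

Lemma top_dm s : top_cell s -> dm s = n. Proof. by move=> /andP[_ /eqP]. Qed.

Lemma top_ch s d : top_cell s -> cdisc d -> B (ch s d).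
Proof. by move=> ts cd; apply: body_cdisc => //; exact: top_skel. Qed.

Lemma top_map_within s : top_cell s -> {within usphere, continuous (k s)}.
Proof.
move=> ts; apply: sphere_within.
apply: (@subspace_eq_continuous _ _ _ (fun d => cell_sph s (g (ch s d)))).
  by move=> d; rewrite inE /from_subspace /= => cd; rewrite kE.
apply: (@within_precomp _ _ _ (fun d => g (ch s d)) (cell_sph s) _ B).
- apply: (@within_precomp _ _ _ (ch s) g _ B) => //; first exact: cw_cont.
  by move=> d cd; exact: top_ch.
- by move=> d cd; apply: gB; exact: top_ch.
- by apply: cell_sph_within => //; exact: top_dm.
Qed.

Lemma top_map_sphere s v : top_cell s -> usphere v -> usphere (k s v).
Proof.
move=> ts v1; have [->|[d od ->]] := usphere_cover v1; first by rewrite kp//; exact: pole_sphere.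
by rewrite kE//; [exact: cell_sph_sphere|exact: odisc_sub].
Qed.

Variables (N : nat) (iota : Y -> 'rV[R]_N) (rho : 'rV[R]_N -> Y) (P : set 'rV[R]_N).
Hypothesis E : enr B iota rho P.

Lemma near_B x : P x -> \forall q \near x, B (rho q).
Proof.
have [oP _ _ _ rB] := E => Px; have := near_open oP Px.
by apply: filterS => q; exact: rB.
Qed.

Definition cell_dom (s : X) : set 'rV[R]_N :=
  [set x : 'rV[R]_N | P x /\ exists d : 'rV_(dm s), [/\ odisc d, enorm d < 1/2 & ch s d = rho x]].

(** The points retracted into the open cell [s], written as a complement of the other cells so that
    openness is visible. *)
Definition open_cell_dom (s : X) : set 'rV[R]_N := P `&` rho @^-1` (~` body (skel S n.+1 :\ s)%SET).

Lemma subcomplexD1 s : top_cell s -> subcomplex (skel S n.+1 :\ s)%SET.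
Proof.
move=> ts t d; rewrite in_setD1 => /andP[nts tS] d1.
have [u [e [uS ut oe Eu]]] := cSn tS d1; exists u, e; split => //.
rewrite in_setD1 uS andbT; apply: contraTneq ut => ->; rewrite -leqNgt (top_dm ts).
by move: tS; rewrite skelE ltnS => /andP[].
Qed.

Lemma open_cell_domE s x : top_cell s ->
  open_cell_dom s x <-> P x /\ exists2 d, odisc d & ch s d = rho x.
Proof.
move=> ts; have [_ _ _ _ rB] := E; split.
  move=> [Px nb]; split => //; have [t [d [tS od e]]] := rB _ Px.
  have [st|nst] := pselect (t = s); first by subst t; exists d.
  by exfalso; apply: nb; exists t, d; split => //; rewrite in_setD1 tS andbT; apply/eqP.
move=> [Px [d od e]]; split => //= -[t [d' [tS od' e']]].
have st : t = s by apply: (cw_disj od' od); rewrite e.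
by move: tS; rewrite st in_setD1 eqxx.
Qed.

Lemma open_open_cell_dom s : top_cell s -> open (open_cell_dom s).
Proof.
move=> ts; have [oP _ cr _ _] := E; apply: open_preim => //.
by apply: closed_openC; apply: closed_body; exact: subcomplexD1.
Qed.

(** Commutativity between the cap and the ambient space: [psi] goes through the expanded
    characteristic map and [g], and [phi] retracts and collapses to the sphere of [s]. On the sphere
    the composite is the expanded [k s], whose degree is [cap_deg]; in the ambient space it is [g]
    after the push. *)
Lemma cell_contribution s : top_cell s ->
  open (cell_dom s) /\ is_deg (fix_map iota rho (fun y => g (push X n 1 y))) (cell_dom s) ((-1) ^+ dm s * zs s).
Proof.
move=> ts; have sn := top_dm ts; have [oP ci cr ir rB] := E.
have cks := top_map_within ts.
have [[K aK] dc] := cap_deg cks (fun v => top_map_sphere ts) (kp ts) (dk ts).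
pose chp (y : 'rV[R]_(dm s).+1) := ch s (expandv 1 (unwrapv (direction y))).
pose psi y := iota (g (chp y)).
pose phi x := cell_sph s (rho x).
have chB y : B (chp y) by apply: top_ch => //; apply: cdisc_expand; exact: ler01.
have cpsi y : cap y -> ctat psi y.
  move=> cy; have [y1 y2] := cap_direction cy; have y0' := cap_neq0 cy.
  apply: (ctat_within (f := fun y => g (chp y)) ci).
    by apply: (@filterS _ (nbhs y) _ setT) => [q _|]; [exact: gB|exact: filterT].
  apply: (ctat_within (f := chp) cg).
    by apply: (@filterS _ (nbhs y) _ setT) => [q _|]; [exact: chB|exact: filterT].
  apply: (@ctat_within _ _ _ (fun y => expandv 1 (unwrapv (direction y))) (ch s) cdisc).
  - exact: cw_cont.
  - by apply: (@filterS _ (nbhs y) _ setT) => [q _|]; [exact: cdisc_expand|exact: filterT].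
  apply: (@ctat_comp _ _ _ (fun y => (1 : R, unwrapv (direction y))) (fun q => expandv q.1 q.2)); last exact: ctat_expand.
  apply: ctat_pair; first exact: ctat_cst.
  by apply: ctat_unwrapv; [lra|apply: ctat_direction => //; exact: ctat_id].
have oC := open_open_cell_dom ts.
have cphi x : open_cell_dom s x -> ctat phi x.
  move=> [Px _]; apply: (ctat_within (f := rho) (cell_sph_within cS sn)); last exact: cr.
  exact: near_B.
have capP (y : 'rV[R]_(dm s).+1) : cap y -> direction y <> pole.
  by move=> /cap_direction[_ h] e; move: h; rewrite e pole0; lra.
have pE y : cap y -> phi (psi y) = k s (expand_sphere 1 (direction y)).
  move=> cy; have [_ rr] := ir _ (gB (chB y)); rewrite /phi /psi rr.
  rewrite /expand_sphere ifN; last by apply/eqP; exact: capP.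
  by rewrite kE//; exact: cdisc_expand.
pose F (y : 'rV[R]_(dm s).+1) := y - k s (expand_sphere 1 (direction y)).
have oD : open (fix_dom psi cap (open_cell_dom s)).
  by apply: open_preim => //; exact: open_cap.
have zD y : cap y -> F y = 0 -> open_cell_dom s (psi y).
  move=> cy /subr0_eq e; apply/(open_cell_domE _ ts).
  have [Pi rr] := ir _ (gB (chB y)); split => //; rewrite /psi rr.
  apply: cell_sph_not_pole => h; move: e; rewrite -pE// /phi /psi rr h => yp.
  by move: cy; rewrite yp /cap /= pole0; have := enorm_ge0 (pole : 'rV[R]_(dm s).+1); lra.
have aZ := adm_zeros aK; have [_ cZ _ _ _] := aZ.
have d1 : is_deg (fun y => y - phi (psi y)) (fix_dom psi cap (open_cell_dom s)) ((-1) ^+ dm s * zs s).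
  have h := proj1 (is_deg_excision _ aZ oD (@subIsetl _ _ _) _) dc.
  apply: eq_is_deg (h _) => [|y [cy _]|y [cy e]]; [exact: oD|by rewrite pE|].
  by split => //; exact: zD.
have cF : compact (comm_fix psi phi cap (open_cell_dom s)).
  have -> : comm_fix psi phi cap (open_cell_dom s) = [set y | cap y /\ F y = 0].
    apply/seteqP; split => y; first by move=> [cy _ e]; split => //; rewrite /F -pE// e subrr.
    by move=> [cy e]; split => //; [exact: zD|rewrite pE//; apply/esym/subr0_eq].
  exact: cZ.
have capE (d : 'rV[R]_(dm s)) : odisc d -> cap (wrapv d) <-> enorm d < 1/2.
  move=> od; have w1 := wrapv_sphere (odisc_sub od).
  rewrite (cap_usphere w1) wrapv0; have := enorm_sq d; have := enorm_ge0 d.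
  by move: (enorm d) (normsq d) => e q e0 eq; split => h; nra.
have dE : fix_dom phi (open_cell_dom s) cap = cell_dom s.
  apply/seteqP; split => x.
    move=> [/(open_cell_domE _ ts)[Px [d od e]] /=]; rewrite /phi -e cell_sph_odisc// => /(capE _ od) e2.
    by split => //; exists d.
  move=> [Px [d [od e2 e]]]; split; first by apply/(open_cell_domE _ ts); split => //; exists d.
  by rewrite /= /phi -e cell_sph_odisc//; apply/capE.
have oW : open (cell_dom s) by rewrite -dE; apply: open_preim => //; exact: open_cap.
have := comm_deg open_cap oC cpsi cphi cF d1.
rewrite dE => dW; split => //; apply: eq_is_deg dW => // x [Px [d [od e2 e]]].
rewrite /fix_map -e push_odisc// /psi /chp /phi -e cell_sph_odisc//.
by rewrite direction_id ?wrapvK//; exact: wrapv_sphere (odisc_sub od).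
Qed.

Definition low_dom : set 'rV[R]_N := [set x | P x /\ 1/2 < height X n (rho x)].

Lemma push1_within : {within B, continuous (push X n 1)}.
Proof.
apply: (@icyl_slice R Y B (fun t => push X n t) (push_within cS y0)).
by rewrite ler01 lexx.
Qed.

Lemma height_rho_ctat x : P x -> ctat (fun x => height X n (rho x)) x.
Proof.
have [oP ci cr ir rB] := E => Px.
by apply: (ctat_within (f := rho) (height_within (n := n) cS)); [exact: near_B|exact: cr].
Qed.

Lemma open_low_dom : open low_dom.
Proof.
have [oP _ _ _ _] := E.
apply: (@open_preim _ _ (fun x => height X n (rho x)) P [set h : R | 1/2 < h]) => //.
  exact: height_rho_ctat.
Qed.

(** Commutativity between a neighbourhood of [A] and the points retracted to height above 1/2, which
    the push sends into [A]. The push fixes [A], so on that side the composite is [g] itself. *)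
Lemma low_contribution zA : deg_index (R := R) A g zA ->
  is_deg (fix_map iota rho (fun y => g (push X n 1 y))) low_dom zA.
Proof.
move=> [NA [iA [rA [PA [EA dA]]]]].
have [oP ci cr ir rB] := E; have [oPA ciA crA irA rBA] := EA.
have cgA : {within A, continuous g} by apply: within_sub cg; exact: skel_sub.
have cA : compact A by exact: (compact_body y0 cSn').
pose phi a := iota (rA a).
pose psi x := iA (g (push X n 1 (rho x))).
have AB := @skel_sub R Y X n S.
have cphi a : PA a -> ctat phi a.
  move=> Pa; apply: (ctat_within (f := rA) ci); last exact: crA.
  by have := near_open oPA Pa; apply: filterS => q /rBA/AB.
have lowA x : low_dom x -> A (push X n 1 (rho x)).
  by move=> [Px h]; apply: (push1_A cS); [exact: rB|exact: ltW].
have cpsi x : low_dom x -> ctat psi x.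
  move=> lx; have nl := near_open open_low_dom lx.
  apply: (@ctat_within _ _ _ (fun x => g (push X n 1 (rho x))) iA A) => //.
    by apply: filterS nl => q /lowA; exact: gA.
  apply: (@ctat_within _ _ _ (fun x => push X n 1 (rho x)) g A) => //.
    by apply: filterS nl => q /lowA.
  apply: (ctat_within (f := rho) push1_within); first by apply: near_B; case: lx.
  by apply: cr; case: lx.
have phiL a : PA a -> low_dom (phi a).
  move=> Pa; have Aa := rBA _ Pa; have [Pi rr] := ir _ (AB _ Aa).
  split => //; rewrite /phi rr (@height_A R Y X n S _ Aa); lra.
have pE a : PA a -> psi (phi a) = iA (g (rA a)).
  by move=> Pa; have Aa := rBA _ Pa; have [Pi rr] := ir _ (AB _ Aa); rewrite /psi /phi rr (@push_A R Y X n S _ _ Aa).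
have qE x : low_dom x -> phi (psi x) = iota (g (push X n 1 (rho x))).
  by move=> /lowA/gA Ax; have [_ rr] := irA _ Ax; rewrite /phi /psi rr.
have D1 : fix_dom phi PA low_dom = PA.
  by apply/seteqP; split => a; [case|move=> Pa; split => //; exact: phiL].
have D2 : fix_dom psi low_dom PA = low_dom.
  apply/seteqP; split => x; first by case.
  by move=> lx; split => //; have [] := irA _ (gA (lowA _ lx)).
have d1 : is_deg (fun x => x - psi (phi x)) (fix_dom phi PA low_dom) zA.
  by rewrite D1; apply: eq_is_deg dA => // a Pa; rewrite pE.
have cF : compact (comm_fix phi psi PA low_dom).
  have -> : comm_fix phi psi PA low_dom = [set a | PA a /\ fix_map iA rA g a = 0].
    apply/seteqP; split => a.
      by move=> [Pa _ e]; split => //; rewrite /fix_map -pE// e subrr.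
    by move=> [Pa /subr0_eq e]; split => //; [exact: phiL|rewrite pE].
  by have [_ cZ _ _ _] := adm_zeros (fix_adm cA cgA gA EA).
have := comm_deg oPA open_low_dom cphi cpsi cF d1; rewrite D2.
by apply: eq_is_deg => [|x lx]; [exact: open_low_dom|rewrite qE].
Qed.

(** No fixed point has height exactly 1/2: the push sends such a point into the lower skeleton,
    which [g] preserves and where the height is 1. So the zeros split between [low_dom], indexed by
    [None], and the domains of the cells. *)
Lemma push_fix_deg zA : deg_index (R := R) A g zA ->
  is_deg (fix_map iota rho (fun y => g (push X n 1 y))) P
    (zA + \sum_(s | top_cell s) (-1) ^+ dm s * zs s).
Proof.
move=> dA; have [oP ci cr ir rB] := E.
have cB : compact B by exact: (compact_body y0 cSn).
have gpB y : B y -> B (g (push X n 1 y)).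
  by move=> By; apply: gB; apply: push_body => //; exact: ler01.
have cgp : {within B, continuous (fun y => g (push X n 1 y))}.
  apply: (@within_precomp _ _ _ (push X n 1) g B B) => //; first exact: push1_within.
  by move=> y By; apply: push_body => //; exact: ler01.
have aP := fix_adm cB cgp gpB E.
pose U (o : option X) : set 'rV[R]_N := if o is Some s then
  if top_cell s then cell_dom s else set0 else low_dom.
have oU o : open (U o).
  case: o => [s|]; last exact: open_low_dom.
  rewrite /U; case: ifP => [ts|_]; last exact: open0.
  by have [] := cell_contribution ts.
have UP o : U o `<=` P.
  case: o => [s|]; last by move=> x [].
  by rewrite /U; case: ifP => [ts|_] x // [].
have cellH s x : top_cell s -> cell_dom s x -> height X n (rho x) < 1/2.
  by move=> ts [_ [d [od e2 <-]]]; rewrite height_odisc// top_dm.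
have dis (i j : option X) x : U i x -> U j x -> i = j.
  case: i => [s|]; case: j => [t|] //; rewrite /U.
  - case: ifP => // ts; case: ifP => // tt [_ [d [od _ e]]] [_ [d' [od' _ e']]].
    by rewrite (cw_disj od od')// e.
  - by case: ifP => // ts /(cellH _ _ ts) h1 [_ h2]; exfalso; lra.
  - by case: ifP => // tt [_ h2] /(cellH _ _ tt) h1; exfalso; lra.
pose r := None :: [seq Some s | s <- enum top_cell].
have ur : uniq r.
  rewrite /r /= map_inj_uniq ?enum_uniq ?andbT; last by move=> ? ? [].
  by apply/mapP => -[].
have cov x : P x -> fix_map iota rho (fun y => g (push X n 1 y)) x = 0 -> exists2 o, o \in r & U o x.
  move=> Px fx.
  have [h1|h1] := ltrP (1/2) (height X n (rho x)); first by exists None; [rewrite inE eqxx|].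
  have [y By [iy gy]] := fix_map_zero gpB E Px fx.
  have [_ ry] := ir _ By; have xy : rho x = y by rewrite -iy ry.
  rewrite xy in h1.
  have h2 : height X n y < 1/2.
    rewrite lt_neqAle h1 andbT; apply/eqP => h3.
    have : A y by rewrite -gy; apply: gA; apply: push1_A => //; rewrite h3.
    by move=> /(@height_A R Y X n S); rewrite h3; lra.
  have [s [d [sS od e]]] := By; have [sS' [sn|sn]] := skelS_cases sS.
    by exfalso; move: h2; rewrite -e height_low//; [lra|exact: odisc_sub].
  have ts : top_cell s by rewrite /top_cell sS' sn eqxx.
  exists (Some s); first by rewrite inE /= map_f// mem_enum.
  rewrite /U ts; split => //; exists d; split => //; last by rewrite xy.
  by move: h2; rewrite -e height_odisc.
pose z (o : option X) : int := if o is Some s then (-1) ^+ dm s * zs s else zA.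
have dU o : o \in r -> is_deg (fix_map iota rho (fun y => g (push X n 1 y))) (U o) (z o).
  rewrite inE => /predU1P[->|/mapP[s]]; first exact: low_contribution.
  rewrite mem_enum => ts ->; rewrite /U /z [top_cell s]ts.
  by have [] := cell_contribution ts.
have := is_deg_sum aP oU UP dis ur cov dU.
by rewrite /r big_cons big_map /= big_enum.
Qed.
End IndexStep.

Section IndexStepConclusion.
Context {R : realType} {Y : topologicalType} (X : cw_structure (R := R) Y).
Variables (y0 : Y) (S : {set X}) (n : nat) (g : Y -> Y).
Local Notation A := (body (skel S n)).
Local Notation B := (body (skel S n.+1)).
Hypothesis cS : subcomplex S.
Hypotheses (cg : {within B, continuous g}) (gA : forall y, A y -> A (g y)).
Hypothesis gB : forall y, B y -> B (g y).
Variables (k : forall s : X, 'rV[R]_(dm s).+1 -> 'rV[R]_(dm s).+1) (zs : X -> int).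
Arguments k s _ : clear implicits.
Hypothesis kE : forall s (d : 'rV_(dm s)), top_cell S n s -> cdisc d ->
  k s (wrapv d) = cell_sph s (g (ch s d)).
Hypothesis kp : forall s, top_cell S n s -> k s pole = pole.
Hypothesis dk : forall s, top_cell S n s -> is_deg (radial (k s)) setT (zs s).

Lemma index_step zA : deg_index (R := R) A g zA ->
  deg_index (R := R) B g (zA + \sum_(s | top_cell S n s) (-1) ^+ dm s * zs s).
Proof.
move=> dA; have cSn : subcomplex (skel S n.+1) := subcomplex_skel (n := n.+1) cS.
have [cB [N [iota [rho [P E]]]]] := body_enr y0 cSn.
have dP := push_fix_deg y0 cS cg gA gB kE kp dk E dA.
pose H (t : R) y := g (push X n (1 - t) y).
have H01 (t : R) : 0 <= t <= 1 -> 0 <= 1 - t <= 1 by move=> /andP[t0 t1]; apply/andP; split; lra.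
have cH : {within icyl B, continuous (fun p : R * Y => H p.1 p.2)}.
  apply: (@within_precomp _ _ _ (fun p : R * Y => push X n (1 - p.1) p.2) g _ B) => //.
    apply: (@within_precomp _ _ _ (fun p : R * Y => (1 - p.1, p.2)) (fun p => push X n p.1 p.2) _ (icyl B)).
    - apply: within_ctat => p _; apply: ctat_pair; last exact: ctat_snd.
      by apply: ctatB; [exact: ctat_cst|exact: ctat_fst].
    - by move=> p [p1 Bp]; split => //; exact: H01.
    - exact: push_within.
  by move=> p [/H01/andP[p0 _] Bp]; exact: push_body.
have HB (t : R) y : 0 <= t <= 1 -> B y -> B (H t y).
  by move=> /H01/andP[t0 _] By; apply: gB; exact: push_body.
have := @deg_index_homotopy R Y B H cB cH HB (zA + \sum_(s | top_cell S n s) (-1) ^+ dm s * zs s).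
case.
  exists N, iota, rho, P; split => //.
  by apply: eq_is_deg dP => [|x _]; [case: E|rewrite /H /fix_map subr0].
move=> N' [iota' [rho' [P' [E' d']]]]; exists N', iota', rho', P'; split => //.
have [oP' _ _ _ rB'] := E'.
apply: eq_is_deg d' => // x /rB' Bx; by rewrite /fix_map /H subrr (@push0 R Y X n S).
Qed.
End IndexStepConclusion.

Section CWIndex.
Context {R : realType} {Y : topologicalType} (X : cw_structure (R := R) Y).
Variables (y0 : Y) (S : {set X}) (g : Y -> Y).
Hypothesis cS : subcomplex S.
Hypotheses (cg : {within body S, continuous g}).
Hypothesis gS : forall n y, body (skel S n) y -> body (skel S n) (g y).
Variables (k : forall s : X, 'rV[R]_(dm s).+1 -> 'rV[R]_(dm s).+1) (zs : X -> int).
Arguments k s _ : clear implicits.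
Hypothesis kE : forall s (d : 'rV_(dm s)), s \in S -> cdisc d -> k s (wrapv d) = cell_sph s (g (ch s d)).
Hypothesis kp : forall s, s \in S -> k s pole = pole.
Hypothesis dk : forall s, s \in S -> is_deg (radial (k s)) setT (zs s).

Lemma deg_index_set0 : deg_index (R := R) (body (skel S 0)) g 0.
Proof.
have E0 : body (skel S 0) = set0.
  by apply/seteqP; split => y // [s [d [+ _ _]]]; rewrite skelE andbF.
have [_ [N [iota [rho [P E]]]]] := body_enr y0 (subcomplex_skel (n := 0) cS).
exists N, iota, rho, P; split => //; have [_ _ _ _ rB] := E.
have -> : P = set0 by apply/seteqP; split => x // /rB; rewrite E0.
exact: is_deg_set0.
Qed.

Lemma skel_deg_index n :
  deg_index (R := R) (body (skel S n)) g (\sum_(s in S | (dm s < n)%N) (-1) ^+ dm s * zs s).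
Proof.
elim: n => [|n IH].
  rewrite big_pred0 => [|s]; last by rewrite andbF.
  exact: deg_index_set0.
have -> : \sum_(s in S | (dm s < n.+1)%N) (-1) ^+ dm s * zs s =
    \sum_(s in S | (dm s < n)%N) (-1) ^+ dm s * zs s + \sum_(s | top_cell S n s) (-1) ^+ dm s * zs s.
  rewrite (bigID (fun s => dm s < n)%N) /=; congr (_ + _); apply: eq_bigl => s.
    by rewrite -andbA; congr (_ && _); apply: andb_idl => /ltnW.
  by rewrite /top_cell -andbA; congr (_ && _); rewrite ltnS -leqNgt -eqn_leq.
apply: (index_step y0 cS _ _ _ _ _ _ IH).
- apply: within_sub cg; apply: bodyS; apply/fintype.subsetP => s.
  by rewrite skelE => /andP[].
- exact: gS.
- exact: gS.
- by move=> s d /andP[sS _]; exact: kE.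
- by move=> s /andP[sS _]; exact: kp.
- by move=> s /andP[sS _]; exact: dk.
Qed.

Lemma cw_deg_index : deg_index (R := R) (body S) g (\sum_(s in S) (-1) ^+ dm s * zs s).
Proof.
have := skel_deg_index (\max_(s : X) dm s).+1.
have -> : skel S (\max_(s : X) dm s).+1 = S.
  by apply/setP => s; rewrite skelE ltnS leq_bigmax andbT.
suff <- : \sum_(s in S | (dm s < (\max_(s : X) dm s).+1)%N) (-1) ^+ dm s * zs s = \sum_(s in S) (-1) ^+ dm s * zs s by [].
by apply: eq_bigl => s; rewrite ltnS leq_bigmax andbT.
Qed.
End CWIndex.

(** * Orbit spaces of G-CW complexes *)
Section Subconjugacy.
Variable G : topologicalGroupType.
Implicit Types (A B C : set G) (H K : closed_subgroup G).

Lemma subconj_trans A B C : subconj A B -> subconj B C -> subconj A C.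
Proof.
move=> [g gP] [k kP]; exists (g * k)%g => h /gP/kP.
by rewrite invgM !mulgA.
Qed.

Lemma conj_subconj A B : conjugate A B -> subconj A B.
Proof. by move=> [g gP]; exists g => h /gP. Qed.

Lemma conj_subconj' A B : conjugate A B -> subconj B A.
Proof. by move=> /conjugate_sym/conj_subconj. Qed.

Lemma sub_subconj A B : A `<=` B -> subconj A B.
Proof. by move=> AB; exists 1%g => h Ah; rewrite invg1 mul1g mulg1; exact: AB. Qed.

Lemma conj_class_eqP H K : \pi_(conj_class G) H = \pi_(conj_class G) K <->
  conjugate (subgroup_set H) (subgroup_set K).
Proof.
split; first by move=> /eqmodP/asboolP.
by move=> h; apply/eqmodP/asboolP.
Qed.

Lemma conj_repr (c : conj_class G) K :
  conjugate (subgroup_set (repr c)) (subgroup_set K) <-> c = \pi_(conj_class G) K.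
Proof. by rewrite -conj_class_eqP reprK. Qed.
End Subconjugacy.

Section FreegSums.
Context {K : choiceType}.

Lemma freegU_sum (I : finType) (P : pred I) (k : I -> int) (x : K) :
  << \sum_(i | P i) k i *g x >> = \sum_(i | P i) << k i *g x >> :> {freeg K / int}.
Proof.
apply: (big_morph (fun k => << k *g x >> : {freeg K / int})); last exact: freegU0.
by move=> a b; rewrite freegUD.
Qed.

Lemma freegU_fibers (I : finType) (cls : I -> K) (w : I -> int) (r : seq K) :
  uniq r -> (forall i, cls i \in r) ->
  \sum_(c <- r) << \sum_(i | cls i == c) w i *g c >> = \sum_i << w i *g cls i >> :> {freeg K / int}.
Proof.
move=> ur cr.
transitivity (\sum_(c <- r) \sum_(i | cls i == c) << w i *g cls i >> : {freeg K / int}).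
  by apply: eq_bigr => c _; rewrite freegU_sum; apply: eq_bigr => i /eqP ->.
rewrite (exchange_big_dep predT)//=; apply: eq_bigr => i _.
rewrite (eq_bigl (pred1 (cls i))) => [|c]; last by rewrite /= eq_sym.
by rewrite -big_filter filter_pred1_uniq// big_seq1.
Qed.
End FreegSums.

Section OrbitCW.
Context {R : realType} {G : topologicalGroupType}.
Hypothesis hG : subconjugacy_order G.
Variable X : gspace G.
Local Notation Y := (orbit_space X).
Variable C : cw_structure (R := R) Y.
Variable tp : C -> closed_subgroup G.
(** Lifts of the characteristic maps to [X]. They carry the isotropy types, and homotopies on the
    orbit space are tested along them. *)
Variable lf : forall s : C, 'rV[R]_(dm s) -> X.
Arguments lf s _ : clear implicits.
Hypothesis clf : forall s, {within cdisc, continuous (lf s)}.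
Hypothesis lfE : forall s d, cdisc d -> ch s d = orbit_of (lf s d).
Hypothesis isoE : forall s d, odisc d ->
  conjugate (subgroup_set (tp s)) (isotropy (lf s d)).
Hypothesis isoB : forall s d, cdisc d ->
  subconj (subgroup_set (tp s)) (isotropy (lf s d)).

Lemma orbit_ofP (x y : X) : orbit_of x = orbit_of y <-> exists g, act g x = y.
Proof.
split; first by move=> /eqmodP/asboolP.
by move=> h; apply/eqmodP/asboolP.
Qed.

Lemma orbit_ofK (q : Y) : orbit_of (repr q) = q. Proof. exact: reprK. Qed.

Lemma orbit_of_continuous : continuous (@orbit_of G X).
Proof. exact: pi_continuous. Qed.

Lemma isotropy_act (g : G) (x : X) : conjugate (isotropy x) (isotropy (act g x)).
Proof.
exists g^-1%g => h; rewrite /isotropy /= invgK -!actM; split => e.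
  by rewrite -!mulgA mulVg mulg1 actM e.
have := congr1 (act g^-1%g) e; rewrite -!actM !mulgA mulVg mul1g -!mulgA mulVg mulg1.
by rewrite act1.
Qed.

Lemma orbit_isotropy (x y : X) : orbit_of x = orbit_of y -> conjugate (isotropy x) (isotropy y).
Proof. by move=> /orbit_ofP[g <-]; exact: isotropy_act. Qed.

Lemma cell_isotropy s d x : odisc d -> ch s d = orbit_of x ->
  conjugate (subgroup_set (tp s)) (isotropy x).
Proof.
move=> od e; apply: conjugate_trans (isoE od) _; apply: orbit_isotropy.
by rewrite -lfE//; exact: odisc_sub.
Qed.

Lemma face_subconj s (d : 'rV_(dm s)) t (e : 'rV_(dm t)) : cdisc d -> odisc e ->
  ch t e = ch s d -> subconj (subgroup_set (tp s)) (subgroup_set (tp t)).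
Proof.
move=> cd oe E; apply: subconj_trans (isoB cd) _; apply: conj_subconj'.
by apply: (cell_isotropy oe); rewrite E lfE.
Qed.

Definition ge_cells (K : closed_subgroup G) : {set C} :=
  finset (fun s => `[< subconj (subgroup_set K) (subgroup_set (tp s)) >]).

Definition gt_cells (K : closed_subgroup G) : {set C} :=
  finset (fun s => `[< subconj (subgroup_set K) (subgroup_set (tp s)) /\
    ~ conjugate (subgroup_set K) (subgroup_set (tp s)) >]).

Lemma ge_subcomplex K : subcomplex (ge_cells K).
Proof.
move=> s d; rewrite inE => /asboolP Ks d1; have [t [e [ts oe E]]] := cw_bd d1.
exists t, e; split => //; rewrite inE; apply/asboolP; apply: subconj_trans Ks _.
by apply: face_subconj oe E; rewrite /cdisc /= d1.
Qed.

(** Passing to a face enlarges the type. If the face had type conjugate to [K], the type of the cell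
    would lie between two conjugates of [K], and antisymmetry would make it conjugate to [K] too. *)
Lemma gt_subcomplex K : subcomplex (gt_cells K).
Proof.
move=> s d; rewrite inE => /asboolP[Ks nKs] d1; have [t [e [ts oe E]]] := cw_bd d1.
have st : subconj (subgroup_set (tp s)) (subgroup_set (tp t)).
  by apply: face_subconj oe E; rewrite /cdisc /= d1.
exists t, e; split => //; rewrite inE; apply/asboolP; split; first exact: subconj_trans Ks st.
move=> /conj_subconj' tK; apply: nKs; apply: hG => //; exact: subconj_trans st tK.
Qed.

Lemma cell_point (y : Y) : exists s d, [/\ odisc d, ch s d = y & orbit_of (lf s d) = y].
Proof.
have [s [d [od e]]] := cw_cover C y; exists s, d; split => //.
by rewrite -lfE//; exact: odisc_sub.
Qed.

Lemma ge_body K : @orbit_of G X @` @stratum_ge G X K = body (ge_cells K).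
Proof.
apply/seteqP; split => y.
  move=> [x Kx <-]; have [s [d [od e _]]] := cell_point (orbit_of x).
  exists s, d; split => //; rewrite inE; apply/asboolP; apply: subconj_trans Kx _.
  by apply: conj_subconj'; exact: cell_isotropy od e.
move=> [s [d [+ od <-]]]; rewrite inE => /asboolP Ks; exists (lf s d).
  by apply: subconj_trans Ks _; apply: conj_subconj; exact: isoE.
by rewrite -lfE//; exact: odisc_sub.
Qed.

Lemma gt_body K : @orbit_of G X @` @stratum_gt G X K = body (gt_cells K).
Proof.
apply/seteqP; split => y.
  move=> [x [Kx nKx] <-]; have [s [d [od e _]]] := cell_point (orbit_of x).
  have cs := cell_isotropy od e.
  exists s, d; split => //; rewrite inE; apply/asboolP; split.
    by apply: subconj_trans Kx _; exact: conj_subconj'.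
  by move=> Ks; apply: nKx; exact: conjugate_trans Ks cs.
move=> [s [d [+ od <-]]]; rewrite inE => /asboolP[Ks nKs]; exists (lf s d); last first.
  by rewrite -lfE//; exact: odisc_sub.
split; first by apply: subconj_trans Ks _; apply: conj_subconj; exact: isoE.
by move=> Kx; apply: nKs; apply: conjugate_trans Kx _; apply: conjugate_sym; exact: isoE.
Qed.

Lemma orbit_mapE (f : X -> X) x : (forall g x, f (act g x) = act g (f x)) ->
  orbit_map f (orbit_of x) = orbit_of (f x).
Proof.
move=> fE; apply/orbit_ofP; have /orbit_ofP[g ge] := orbit_ofK (orbit_of x).
by exists g; rewrite -fE ge.
Qed.

Lemma isotropy_map (f : X -> X) x : (forall g x, f (act g x) = act g (f x)) ->
  isotropy x `<=` isotropy (f x).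
Proof. by move=> fE g gx; rewrite /isotropy /= -fE gx. Qed.

Lemma ge_invariant (f : X -> X) K y : (forall g x, f (act g x) = act g (f x)) ->
  body (ge_cells K) y -> body (ge_cells K) (orbit_map f y).
Proof.
move=> fE; rewrite -ge_body => -[x Kx <-]; exists (f x); last by rewrite orbit_mapE.
by apply: subconj_trans Kx _; apply: sub_subconj; exact: isotropy_map.
Qed.

(** If [f x] had type [(K)], the type of [x] would lie between [(K)] and [(K)], which antisymmetry
    excludes. *)
Lemma gt_invariant (f : X -> X) K y : (forall g x, f (act g x) = act g (f x)) ->
  body (gt_cells K) y -> body (gt_cells K) (orbit_map f y).
Proof.
move=> fE; rewrite -gt_body => -[x [Kx nKx] <-]; exists (f x); last by rewrite orbit_mapE.
have xf : subconj (isotropy x) (isotropy (f x)) by apply: sub_subconj; exact: isotropy_map.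
split; first exact: subconj_trans Kx xf.
move=> Kf; apply: nKx.
have [s [d [od e _]]] := cell_point (orbit_of x); have cs := cell_isotropy od e.
apply: (conjugate_trans _ cs); apply: hG; first by apply: subconj_trans Kx _; exact: conj_subconj'.
apply: subconj_trans (conj_subconj cs) _; apply: subconj_trans xf _.
exact: conj_subconj'.
Qed.

Variables (f f' : X -> X) (h : X * R -> X).
Hypotheses (gf : is_gmap f) (gf' : is_gmap f') (hh : is_ghomotopy f' f h).

Definition orbit_htpy (t : R) (y : Y) : Y := orbit_of (h (repr y, t)).

Lemma orbit_htpyE (t : R) x : 0 <= t <= 1 -> orbit_htpy t (orbit_of x) = orbit_of (h (x, t)).
Proof.
have [_ hE _ _] := hh => t01; apply/orbit_ofP; have /orbit_ofP[g ge] := orbit_ofK (orbit_of x).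
by exists g; rewrite -hE// ge.
Qed.

(** Nothing says that the orbit map times the interval is a quotient map, so continuity is tested on
    closed cells, along their lifts to [X]. *)
Lemma orbit_htpy_within (y0 : Y) (S : {set C}) : subcomplex S ->
  {within icyl (body S), continuous (fun p => orbit_htpy p.1 p.2)}.
Proof.
have [chh _ _ _] := hh; move=> cS; apply: (cw_within_icyl y0) => // s sS.
apply: (@subspace_eq_continuous _ _ _ (fun q : R * 'rV_(dm s) => orbit_of (h (lf s q.2, q.1)))).
  move=> [t d]; rewrite inE /from_subspace /= => -[/= t01 cd].
  by rewrite lfE// orbit_htpyE.
apply: (@within_precomp _ _ _ (fun q : R * 'rV_(dm s) => h (lf s q.2, q.1)) (@orbit_of G X) _ setT) => //.
  apply: (@within_precomp _ _ _ (fun q : R * 'rV_(dm s) => (lf s q.2, q.1)) h _ (@cylinder R X)) => //.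
    have /subspace_continuousP cl : {within icyl cdisc, continuous (fun q : R * 'rV_(dm s) => (q.1, lf s q.2))}.
      exact: (icyl_within (@clf s)).
    apply/subspace_continuousP => q iq.
    apply: (@cvg_comp _ _ _ (fun q : R * 'rV_(dm s) => (q.1, lf s q.2)) (fun p => (p.2, p.1)) _ (nbhs (q.1, lf s q.2))).
      exact: cl.
    exact: (ctat_pair (@ctat_snd _ _ (q.1, lf s q.2)) (@ctat_fst _ _ (q.1, lf s q.2))).
  by move=> [t d] [].
by apply: continuous_subspaceT; exact: orbit_of_continuous.
Qed.

Lemma orbit_index_homotopy (y0 : Y) (S : {set C}) z : subcomplex S ->
  (forall (t : R) y, 0 <= t <= 1 -> body S y -> body S (orbit_htpy t y)) ->
  deg_index (R := R) (body S) (orbit_map f') z -> deg_index (R := R) (body S) (orbit_map f) z.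
Proof.
have [_ _ h0 h1] := hh => cS HS.
have E0 : orbit_htpy 0 = orbit_map f' by apply/funext => y; rewrite /orbit_htpy h0.
have E1 : orbit_htpy 1 = orbit_map f by apply/funext => y; rewrite /orbit_htpy h1.
rewrite -E0 -E1; apply: (@deg_index_homotopy R Y (body S) orbit_htpy) => //.
  exact: compact_body.
exact: orbit_htpy_within.
Qed.

Lemma orbit_map_within (y0 : Y) (S : {set C}) : subcomplex S -> {within body S, continuous (orbit_map f)}.
Proof.
have [_ _ _ h1] := hh => cS.
have -> : orbit_map f = orbit_htpy 1 by apply/funext => y; rewrite /orbit_htpy h1.
apply: (@icyl_slice R Y (body S) orbit_htpy (orbit_htpy_within y0 cS)).
by rewrite ler01 lexx.
Qed.

Lemma orbit_map_within' (y0 : Y) (S : {set C}) : subcomplex S -> {within body S, continuous (orbit_map f')}.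
Proof.
have [_ _ h0 _] := hh => cS.
have -> : orbit_map f' = orbit_htpy 0 by apply/funext => y; rewrite /orbit_htpy h0.
apply: (@icyl_slice R Y (body S) orbit_htpy (orbit_htpy_within y0 cS)).
by rewrite ler01 lexx.
Qed.

Hypothesis cell' : forall n y, body (skel [set: C]%SET n) y -> body (skel [set: C]%SET n) (orbit_map f' y).
Variables (k : forall s : C, 'rV[R]_(dm s).+1 -> 'rV[R]_(dm s).+1) (zs : C -> int).
Arguments k s _ : clear implicits.
Hypothesis kE : forall s (d : 'rV_(dm s)), cdisc d -> k s (wrapv d) = cell_sph s (orbit_map f' (ch s d)).
Hypothesis kp : forall s, k s pole = pole.
Hypothesis dk : forall s, is_deg (radial (k s)) setT (zs s).

(** Invariance of [S] is asked for all equivariant maps, so that every stage of the homotopy from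
    [f'] to [f] preserves it; only [f'] is cellular. *)
Lemma stratum_index (y0 : Y) (S : {set C}) : subcomplex S ->
  (forall f : X -> X, (forall g x, f (act g x) = act g (f x)) ->
     forall y, body S y -> body S (orbit_map f y)) ->
  fixed_point_index R (body S) (orbit_map f) = \sum_(s in S) (-1) ^+ dm s * zs s.
Proof.
move=> cS inv.
have HS (t : R) y : 0 <= t <= 1 -> body S y -> body S (orbit_htpy t y).
  move=> t01; have [_ hE _ _] := hh.
  exact: (inv (fun x => h (x, t)) (fun g x => hE g x t t01)).
apply: fixed_point_indexE.
- exact: compact_body.
- exact: orbit_map_within.
- by apply: inv; case: gf.
apply: (orbit_index_homotopy y0 cS HS).
apply: (cw_deg_index y0 cS _ _ _ _ _ (k := k)).
- exact: orbit_map_within'.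
- move=> n y By.
  have h1 : body S (orbit_map f' y).
    apply: inv; first by case: gf'.
    by apply: bodyS By; apply/fintype.subsetP => s; rewrite skelE => /andP[].
  have [s [d [sS od e]]] := h1.
  have h2 : body (skel [set: C]%SET n) (orbit_map f' y).
    apply: cell'; apply: bodyS By; apply/fintype.subsetP => t.
    by rewrite !skelE inE => /andP[].
  have [t [d' [tS od' e']]] := h2.
  have st : s = t by apply: (cw_disj od od'); rewrite e.
  exists s, d; split => //; rewrite skelE sS.
  by move: tS; rewrite skelE -st => /andP[].
- by move=> s d _; exact: kE.
- by move=> s _; exact: kp.
- by move=> s _; exact: dk.
Qed.

(** The two strata of a class differ by the cells of exactly that type, and the difference of the
    two indices is the sum over these. *)
Lemma fixed_orbit_index_formula (y0 : Y) :
  fixed_orbit_index R f = \sum_(s : C) << (-1) ^+ dm s * zs s *g \pi_(conj_class G) (tp s) >>.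
Proof.
pose cls (s : C) : conj_class G := \pi_(conj_class G) (tp s).
pose r := undup [seq cls s | s <- enum C].
have ur : uniq r by exact: undup_uniq.
have rP s : cls s \in r by rewrite mem_undup map_f// mem_enum.
have otE : orbit_types X = [set` r].
  apply/seteqP; split => c /=.
    move=> [x cx]; have [s [d [od e _]]] := cell_point (orbit_of x).
    have : conjugate (subgroup_set (repr c)) (subgroup_set (tp s)).
      by apply: conjugate_trans cx _; apply: conjugate_sym; exact: cell_isotropy od e.
    by move=> /conj_repr ->; exact: rP.
  rewrite mem_undup => /mapP[s _ ->]; exists (lf s 0).
  apply: conjugate_trans (isoE (s := s) (d := 0) _); last by rewrite /odisc /= normsq0 ltr01.
  by apply/conj_repr.
rewrite /fixed_orbit_index otE -fsbig_seq//.
rewrite -(freegU_fibers (fun s => (-1) ^+ dm s * zs s) ur rP).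
apply: eq_bigr => c _; congr << _ *g c >>.
rewrite ge_body gt_body (stratum_index y0 (@ge_subcomplex _)); last first.
  by move=> k' kE' y; exact: ge_invariant.
rewrite (stratum_index y0 (@gt_subcomplex _)); last by move=> k' kE' y; exact: gt_invariant.
rewrite (bigID (fun s => cls s == c)) /=.
have -> : \sum_(s in ge_cells (repr c) | cls s != c) (-1) ^+ dm s * zs s =
    \sum_(s in gt_cells (repr c)) (-1) ^+ dm s * zs s.
  apply: eq_bigl => s; rewrite !inE; apply/andP/asboolP.
    move=> [/asboolP h1 /eqP h2]; split => // /conj_repr e; apply: h2.
    by rewrite e.
  move=> [h1 h2]; split; first exact/asboolP.
  by apply/eqP => e; apply: h2; apply/conj_repr; rewrite -e.
rewrite addrK; apply: eq_bigl => s; rewrite inE; apply: andb_idl => /eqP e.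
by apply/asboolP; apply: conj_subconj; apply/conj_repr; rewrite -e.
Qed.
End OrbitCW.

Lemma Tagged_inj (I : eqType) (T : I -> Type) i (x y : T i) : existT T i x = existT T i y -> x = y.
Proof.
apply: Eqdep_dec.inj_pair2_eq_dec => a b.
by case: (eqVneq a b) => [|/eqP]; [left|right].
Qed.

Section SetTypes.
Context {T : topologicalType} {A : set T}.
Variable x0 : set_type A.

Definition to_set (x : T) : set_type A :=
  if pselect (A x) is left p then exist _ x (mem_set p) else x0.

Lemma to_setK x : A x -> set_val (to_set x) = x.
Proof. by rewrite /to_set; case: pselect. Qed.

Lemma set_valK (x : set_type A) : to_set (set_val x) = x.
Proof. by apply: val_inj; exact: (to_setK (set_valP x)). Qed.

Lemma set_type_within (U : topologicalType) (f : U -> set_type A) (B : set U) :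
  {within B, continuous (fun x => set_val (f x))} -> {within B, continuous f}.
Proof. by move=> cf x; apply: (continuous_comp_initial cf). Qed.

Lemma to_set_within : {within A, continuous to_set}.
Proof.
apply: set_type_within; apply: (@subspace_eq_continuous _ _ _ (fun x : T => x)).
  by move=> x; rewrite inE /from_subspace /= => Ax; rewrite to_setK.
by apply: within_ctat => x _; exact: ctat_id.
Qed.

Lemma set_val_ctat (x : set_type A) : ctat (@set_val _ A) x.
Proof. exact: initial_continuous. Qed.

Lemma compact_set_type : compact A -> compact [set: set_type A].
Proof.
move=> cA; have -> : [set: set_type A] = to_set @` A.
  by apply/seteqP; split => // x _; exists (set_val x); [exact: set_valP|exact: set_valK].
exact: within_image to_set_within.
Qed.
End SetTypes.

Section DiscPoints.
Context {R : realType} {n : nat}.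
Implicit Types d : 'rV[R]_n.

Lemma odisc0 : odisc (0 : 'rV[R]_n).
Proof. by rewrite /odisc /= normsq0 ltr01. Qed.

Definition to_disc d : disc R n := @to_set _ cdisc (exist _ 0 (mem_set (odisc_sub odisc0))) d.

Lemma to_discK d : cdisc d -> set_val (to_disc d) = d.
Proof. exact: to_setK. Qed.

Lemma disc_cdisc (d : disc R n) : cdisc (set_val d).
Proof. exact: set_valP. Qed.

Lemma disc_inj (d e : disc R n) : set_val d = set_val e -> d = e.
Proof. by move=> h; apply: val_inj. Qed.

Lemma disc_valK (d : disc R n) : to_disc (set_val d) = d.
Proof. exact: set_valK. Qed.

Lemma disc_interiorE d : cdisc d -> disc_interior (to_disc d) <-> odisc d.
Proof. by move=> cd; rewrite /disc_interior to_discK. Qed.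

Lemma to_disc_within : {within cdisc, continuous to_disc}.
Proof. exact: to_set_within. Qed.
End DiscPoints.

(** * The cell structure of the orbit space of a G-CW complex *)

Section OrbitCells.
Context {R : realType} {G : topologicalGroupType} {X : pgspace G} (C : gcw R X).
Local Notation Y := (orbit_space X).
Local Notation cell_point t p :=
  (existT (fun n => {s : cell C n & (coset (cell_type s) * disc R n)%type}) _
    (existT (fun s => (coset (cell_type s) * disc R _)%type) t p)).

Definition orbit_cell : finType := {i : 'I_(gcw_dim C).+1 & cell C i}.
Definition orbit_dm (s : orbit_cell) : nat := tag s.
Definition cell_of (s : orbit_cell) : cell C (orbit_dm s) := tagged s.
(** The disc over the trivial coset: on the open cell its isotropy is the type of the cell itself,
    and not only a conjugate. *)
Definition orbit_lift (s : orbit_cell) (d : 'rV[R]_(orbit_dm s)) : X :=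
  cell_char (cell_of s) (coset_of _ 1%g, to_disc d).
Arguments orbit_lift s _ : clear implicits.
Definition orbit_ch (s : orbit_cell) (d : 'rV[R]_(orbit_dm s)) : Y := orbit_of (orbit_lift s d).
Arguments orbit_ch s _ : clear implicits.

Lemma orbit_cellP n (s : cell C n) : exists t : orbit_cell,
  existT (fun n => cell C n) n s = existT (fun n => cell C n) (orbit_dm t) (cell_of t).
Proof.
have nC : (n < (gcw_dim C).+1)%N.
  by rewrite ltnS leqNgt; apply/negP => h; exact: gcw_finite h s.
by exists (existT (fun i : 'I_(gcw_dim C).+1 => cell C i) (Ordinal nC) s).
Qed.

Lemma orbit_cell_inj (s t : orbit_cell) :
  existT (fun n => cell C n) (orbit_dm s) (cell_of s) = existT (fun n => cell C n) (orbit_dm t) (cell_of t) ->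
  s = t.
Proof.
case: s t => [[i pi] a] [[j pj] b]; rewrite /orbit_dm /cell_of /= => e.
have eij : i = j := congr1 (fun u => projT1 u) e.
subst j; rewrite (eq_irrelevance pi pj) in a e *.
by rewrite (Tagged_inj e).
Qed.

Lemma part_inj n (s : cell C n) c d m (t : cell C m) c' e :
  disc_interior d -> disc_interior e -> cell_char s (c, d) = cell_char t (c', e) ->
  cell_point s (c, d) = cell_point t (c', e).
Proof.
move=> od oe E; have [p [_ pu]] := gcw_part C (cell_char s (c, d)).
rewrite -(pu (existT _ n (existT _ s (c, d))))//.
by rewrite -(pu (existT _ m (existT _ t (c', e))))//; split.
Qed.

Lemma cell_char_act n (s : cell C n) g d :
  cell_char s (coset_of _ g, d) = act g (cell_char s (coset_of _ 1%g, d)).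
Proof. by rewrite -gcw_act coset_actE mulg1. Qed.

Lemma orbit_char n (s : cell C n) c d :
  orbit_of (cell_char s (c, d)) = orbit_of (cell_char s (coset_of _ 1%g, d)).
Proof.
rewrite -(coset_ofK c) cell_char_act; apply/esym/orbit_ofP.
by exists (repr c).
Qed.

Lemma orbit_char_eq n (s : cell C n) d (x : X) :
  orbit_of (cell_char s (coset_of _ 1%g, d)) = orbit_of x -> exists c, cell_char s (c, d) = x.
Proof. by move=> /orbit_ofP[g e]; exists (coset_of _ g); rewrite cell_char_act. Qed.

Lemma orbit_ch_sigma (s t : orbit_cell) d e : odisc d -> odisc e -> orbit_ch s d = orbit_ch t e ->
  exists c c', cell_point (cell_of s) (c, to_disc d) = cell_point (cell_of t) (c', to_disc e).
Proof.
move=> od oe E; have [c h] := orbit_char_eq E.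
exists c, (coset_of _ 1%g); apply: part_inj h.
- by apply/disc_interiorE => //; exact: odisc_sub.
- by apply/disc_interiorE => //; exact: odisc_sub.
Qed.

Lemma orbit_ch_disj (s t : orbit_cell) d e : odisc d -> odisc e -> orbit_ch s d = orbit_ch t e -> s = t.
Proof.
move=> od oe /(orbit_ch_sigma od oe)[c [c' E]]; apply: orbit_cell_inj.
exact: (congr1 (fun p => existT (fun n => cell C n) (projT1 p) (projT1 (projT2 p))) E).
Qed.

Lemma orbit_ch_inj (s : orbit_cell) d e : odisc d -> odisc e -> orbit_ch s d = orbit_ch s e -> d = e.
Proof.
move=> od oe /(orbit_ch_sigma od oe)[c [c' E]].
have := Tagged_inj (Tagged_inj E) => /(congr1 snd) /= h.
by rewrite -(to_discK (odisc_sub od)) h to_discK//; exact: odisc_sub.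
Qed.

(** Induction on [n]: a point of a closed cell is in its open part or, by [gcw_boundary], in a
    smaller skeleton. *)
Lemma skeleton_open_cell n (x : X) : skeleton C n x ->
  exists t d, [/\ (orbit_dm t <= n)%N, odisc d & orbit_ch t d = orbit_of x].
Proof.
elim/ltn_ind: n x => n IH x [m [s [[c d] [mn <-]]]].
have [od|nd] := pselect (disc_interior d).
  have [t e] := orbit_cellP s; have et := congr1 (fun u => projT1 u) e; rewrite /= in et.
  subst m; have es := Tagged_inj e; subst s.
  exists t, (set_val d); split => //; rewrite /orbit_ch /orbit_lift disc_valK.
  by apply: esym; apply: orbit_char.
have [m' m'm sx] := @gcw_boundary _ _ _ C _ s c _ nd.
have [t [e [tm oe E]]] := IH m' (leq_trans m'm mn) _ sx.
by exists t, e; split => //; rewrite (leq_trans tm)// (leq_trans (ltnW m'm)).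
Qed.

Lemma orbit_lift_within s : {within cdisc, continuous (orbit_lift s)}.
Proof.
apply: (@within_precomp _ _ _ to_disc (fun e => cell_char (cell_of s) (coset_of (cell_type (cell_of s)) 1%g, e)) _ setT) => //.
  exact: to_disc_within.
apply: within_ctat => e _; apply: (@ctat_comp _ _ _ (fun e => (coset_of (cell_type (cell_of s)) 1%g, e)) (cell_char (cell_of s))).
  by apply: ctat_pair; [exact: ctat_cst|exact: ctat_id].
exact: gcw_continuous.
Qed.

Lemma orbit_ch_within s : {within cdisc, continuous (orbit_ch s)}.
Proof.
apply: (@within_precomp _ _ _ (orbit_lift s) (@orbit_of G X) _ setT) => //.
  exact: orbit_lift_within.
by apply: continuous_subspaceT; exact: orbit_of_continuous.
Qed.

Lemma orbit_ch_bd (s : orbit_cell) d : normsq d = 1 ->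
  exists t e, [/\ (orbit_dm t < orbit_dm s)%N, odisc e & orbit_ch t e = orbit_ch s d].
Proof.
move=> d1; have cd : cdisc d by rewrite /cdisc /= d1.
have nd : ~ disc_interior (to_disc d) by move/(disc_interiorE cd); rewrite /odisc /= d1 ltxx.
have [m ms sx] := @gcw_boundary _ _ _ C _ (cell_of s) (coset_of _ 1%g) _ nd.
have [t [e [tm oe E]]] := skeleton_open_cell sx.
by exists t, e; split => //; exact: leq_ltn_trans tm ms.
Qed.

Lemma point_skeleton (x : X) : skeleton C (gcw_dim C) x.
Proof.
have [[n [s [c d]]] [[/= od e] _]] := gcw_part C x.
exists n, s, (c, d); split => //; rewrite leqNgt; apply/negP => h; exact: gcw_finite h s.
Qed.

Lemma orbit_ch_cover y : exists s d, odisc d /\ orbit_ch s d = y.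
Proof.
rewrite -(orbit_ofK y); have [t [d [_ od e]]] := skeleton_open_cell (point_skeleton (repr y)).
by exists t, d.
Qed.

(** Pulled back along a characteristic map, a union of orbits is [G/H] times a subset of the disc,
    so the test in [X] reduces to one on the disc. *)
Lemma orbit_ch_top n (A : set Y) :
  (forall y, A y -> exists s d, [/\ (orbit_dm s <= n)%N, odisc d & orbit_ch s d = y]) ->
  (forall s, (orbit_dm s <= n)%N -> closed (cdisc `&` orbit_ch s @^-1` A)) -> closed A.
Proof.
move=> An h.
suff cl : closed (@orbit_of G X @^-1` A).
  have op : open (@orbit_of G X @^-1` (~` A)).
    have -> : @orbit_of G X @^-1` (~` A) = ~` (@orbit_of G X @^-1` A) by [].
    exact: closed_openC.
  by rewrite -[A]setCK; apply: open_closedC.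
have sub : @orbit_of G X @^-1` A `<=` skeleton C n.
  move=> x /An[s [d [sn od e]]]; have [c <-] := orbit_char_eq e.
  by exists (orbit_dm s), (cell_of s), (c, to_disc d).
apply/(gcw_top sub) => m s mn.
have [t e] := orbit_cellP s; have et := congr1 (fun u => projT1 u) e; rewrite /= in et.
subst m; have es := Tagged_inj e; subst s.
have -> : cell_char (cell_of t) @^-1` (@orbit_of G X @^-1` A) =
    snd @^-1` (set_val @^-1` (cdisc `&` orbit_ch t @^-1` A)).
  apply/seteqP; split => -[c d] /=; rewrite orbit_char /orbit_ch /orbit_lift disc_valK.
    by split => //; exact: disc_cdisc.
  by case.
apply: closed_comp => [p _|]; first exact: ctat_snd.
apply: closed_comp => [p _|]; first exact: set_val_ctat.
exact: h.
Qed.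

Definition orbit_cw : cw_structure (R := R) Y :=
  CWStructure orbit_ch_within orbit_ch_disj orbit_ch_inj orbit_ch_bd orbit_ch_cover orbit_ch_top.

Definition orbit_tp (s : orbit_cw) : closed_subgroup G := cell_type (cell_of s).

Lemma orbit_isotropy_sub (s : orbit_cw) d :
  subgroup_set (orbit_tp s) `<=` isotropy (orbit_lift s d).
Proof.
move=> g sg; rewrite /isotropy /= /orbit_lift -cell_char_act; congr (cell_char _ (_, _)).
by apply/coset_ofP; rewrite mulg1; have [_ H1 HM] := subgroupP (orbit_tp s); have := HM _ _ sg H1; rewrite mulg1.
Qed.

Lemma orbit_isotropyE (s : orbit_cw) d : odisc d ->
  isotropy (orbit_lift s d) = subgroup_set (orbit_tp s).
Proof.
move=> od; apply/seteqP; split; last exact: orbit_isotropy_sub.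
move=> g; rewrite /isotropy /= /orbit_lift -cell_char_act => e.
have oi : disc_interior (to_disc d) by apply/disc_interiorE => //; exact: odisc_sub.
have := Tagged_inj (Tagged_inj (part_inj oi oi e)) => /(congr1 fst) /= /coset_ofP.
have [_ H1 HM] := subgroupP (orbit_tp s); rewrite mulg1 => h.
by have := HM _ _ h H1; rewrite mulg1 invgK.
Qed.
End OrbitCells.

Lemma jacobianE (R : realType) n (F : 'rV[R]_n -> 'rV[R]_n) (x : 'rV[R]_n) i j :
  jacobian F x i j = 'd F x (delta_mx 0 i) 0 j.
Proof. by rewrite /jacobian mxE. Qed.

Lemma jacobian_addc (R : realType) n (F : 'rV[R]_n -> 'rV[R]_n) (c x : 'rV[R]_n) :
  differentiable F x -> differentiable (fun y => F y + c) x /\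
  jacobian (fun y => F y + c) x = jacobian F x.
Proof.
move=> dF; have dc : differentiable (cst c) x by exact: differentiable_cst.
split; first exact: (differentiableD dF dc).
have e : 'd (fun y => F y + c) x = 'd F x \+ 'd (cst c) x :> (_ -> _) := diffD dF dc.
have z : 'd (cst c) x = 0 :> (_ -> _) by exact: diff_cst.
have ev v : 'd (fun y => F y + c) x v = 'd F x v.
  apply: etrans (congr1 (fun f => f v) e) _.
  apply: etrans (addr0 ('d F x v)).
  exact: (congr1 (fun w => 'd F x v + w) (congr1 (fun f => f v) z)).
apply/matrixP => i j; have h := congr1 (fun w : 'rV[R]_n => w 0 j) (ev (delta_mx 0 i)).
exact: etrans (jacobianE _ _ _ _) (etrans h (esym (jacobianE _ _ _ _))).
Qed.

(** * Local degrees and the degrees of cell maps *)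

Section SphereDegree.
Context {R : realType} {n : nat}.
Local Notation V := 'rV[R]_n.+1.

Definition to_sphere (v : V) : sphere R n := insubd sphere_pt v.
Definition sphere_vec (k : sphere R n -> sphere R n) (v : V) : V := set_val (k (to_sphere v)).

Lemma to_sphereK v : usphere v -> set_val (to_sphere v) = v.
Proof. by move=> v1; exact: (insubdK sphere_pt (mem_set v1)). Qed.

Lemma sphere_usphere (x : sphere R n) : usphere (set_val x).
Proof. exact: set_valP. Qed.

Lemma sphere_inj (x y : sphere R n) : set_val x = set_val y -> x = y.
Proof. exact: val_inj. Qed.

Lemma sphere_valK (x : sphere R n) : to_sphere (set_val x) = x.
Proof. by apply: sphere_inj; rewrite to_sphereK//; exact: sphere_usphere. Qed.

Lemma sphere_vec_usphere k v : usphere (sphere_vec k v).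
Proof. exact: sphere_usphere. Qed.

Lemma to_sphere_within : {within usphere, continuous to_sphere}.
Proof.
apply: set_type_within; apply: (@subspace_eq_continuous _ _ _ (fun d : V => d)).
  by move=> d; rewrite inE /from_subspace /= => cd; rewrite to_sphereK.
by apply: within_ctat => d _; exact: ctat_id.
Qed.

Lemma sphere_vec_within k : continuous k -> {within usphere, continuous (sphere_vec k)}.
Proof.
move=> ck; apply: (@within_precomp _ _ _ to_sphere (fun x => set_val (k x)) _ setT) => //.
  exact: to_sphere_within.
apply: within_ctat => x _; apply: (ctat_comp (f := k)); first exact: ck.
exact: set_val_ctat.
Qed.

Lemma radial_homotopy (H : R -> V -> V) z : {within icyl usphere, continuous (fun q => H q.1 q.2)} ->
  (forall (t : R) v, 0 <= t <= 1 -> usphere v -> usphere (H t v)) ->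
  is_deg (radial (H 0)) setT z -> is_deg (radial (H 1)) setT z.
Proof.
move=> cH HS.
pose L (t : R) := radial (H (clamp t)).
have E0 : L 0 = radial (H 0) by rewrite /L clampE ?lexx ?ler01.
have E1 : L 1 = radial (H 1) by rewrite /L clampE ?lexx ?ler01.
rewrite -E0 -E1; apply: (@is_deg_homotopy _ _ L setT [set 0]).
- exact: openT.
- exact: compact_set1.
- by [].
- move=> t y _ _; change (ctat (fun p : R * V => enorm p.2 *: H (clamp p.1) (direction p.2)) (t, y)).
  have ce : ctat (fun p : R * V => enorm p.2) (t, y) by apply: ctat_enorm; exact: ctat_snd.
  have [y0|y0] := eqVneq y 0.
    apply: (ctat_scale0 (M := 1)) => //; first by apply/eqP; rewrite /= y0 enorm_eq0.
    apply: (@filterS _ (nbhs (t, y)) _ setT) => [[u x] _|]; last exact: filterT.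
    have [->|x0] := eqVneq x 0; first by left; apply/eqP; rewrite /= enorm_eq0.
    right; apply: le_trans (norm_le_enorm _) _; rewrite /enorm.
    by have -> : normsq (H (clamp u) (direction x)) = 1; [exact: HS (clamp_itv _) (normsq_direction x0)|rewrite sqrtr1].
  apply: ctatZ => //.
  exact: (ctat_clamp_direction (f := fun q => H q.1 q.2)).
- move=> t y _ _ /eqP; rewrite /L /radial scaler_eq0 enorm_eq0 => /orP[/eqP //|/eqP h].
  have [->//|y0] := eqVneq y 0; exfalso.
  have := HS (clamp t) _ (clamp_itv t) (normsq_direction y0 : usphere _); rewrite /usphere /= h normsq0.
  by move=> /esym/eqP; rewrite oner_eq0.
Qed.

Lemma antipt_val : set_val (@sphere_antipt R n) = - pole.
Proof. by []. Qed.

(** The zeros of the radial extension plus the pole are the preimages of -1, and the translation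
    does not affect the Jacobian. As the extension preserves norms, the zeros stay in the unit ball
    while the pole is scaled to 0. *)
Lemma local_degree_sum (k : sphere R n -> sphere R n) (s : seq (sphere R n)) :
  {within usphere, continuous (sphere_vec k)} -> uniq s ->
  (forall x, x \in s <-> k x = sphere_antipt) -> (forall x, x \in s -> regular_at k x) ->
  is_deg (radial (sphere_vec k)) setT (\sum_(x <- s) local_degree k x).
Proof.
move=> ck us sP sr; have cd := ctat_kdir ck.
have k1 v : normsq v = 1 -> normsq (sphere_vec k v) = 1 by move=> _; exact: sphere_vec_usphere.
have [_ _ _ cr r0] := radial_adm cd k1.
have er := enorm_radial k1.
pose F y := radial (sphere_vec k) y + pole.
pose H (t : R) y := radial (sphere_vec k) y + (1 - t) *: pole.
have E1 : radial (sphere_vec k) = H 1 by apply/funext => y; rewrite /H subrr scale0r addr0.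
have ep : enorm (pole : V) = 1 by rewrite /enorm (pole_sphere : normsq _ = 1) sqrtr1.
rewrite E1; apply: (@is_deg_homotopy _ _ H setT [set y : V | enorm y <= 1]).
- exact: openT.
- exact: compact_ball_enorm.
- by [].
- move=> t y _ _; change (ctat (fun p : R * V => H p.1 p.2) (t, y)).
  apply: ctatDv.
    by apply: (ctat_comp (f := snd) (g := radial (sphere_vec k))); [exact: ctat_snd|exact: cr].
  apply: ctatZ; last exact: ctat_cst.
  by apply: ctatB; [exact: ctat_cst|exact: ctat_fst].
- move=> t y /andP[t0 t1] _ /eqP; rewrite addr_eq0 => /eqP/(congr1 (fun v : V => enorm v)) /=.
  by rewrite er -scaleNr enormZ ep mulr1 normrN ger0_norm => [->|]; lra.
have EF : H 0 = F by apply/funext => y; rewrite /H subr0 scale1r.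
rewrite EF.
have usv : uniq [seq (set_val x : V) | x <- s] by rewrite map_inj_uniq// => x y; exact: sphere_inj.
have dF x : x \in s -> differentiable (radial (sphere_vec k)) (set_val x).
  by move=> /sr[[/nbhs_singleton]].
have jF x : x \in s -> differentiable F (set_val x) /\
    jacobian F (set_val x) = jacobian (radial (sphere_vec k)) (set_val x).
  by move=> /dF; exact: jacobian_addc.
have [|y|y ys|_ dX] := @regular_deg _ _ F setT _ usv openT.
- by move=> y _; apply: ctatDv; [exact: cr|exact: ctat_cst].
- split=> [/mapP[x xs ->]|[_ /eqP]].
    split => //; rewrite /F /radial direction_id; last exact: sphere_usphere.
    rewrite /enorm (sphere_usphere x : normsq _ = 1) sqrtr1 scale1r /sphere_vec sphere_valK.
    by rewrite (proj1 (sP x) xs) antipt_val addNr.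
  rewrite addr_eq0 => /eqP e.
  have y1 : enorm y = 1 by rewrite -er e -scaleN1r enormZ normrN1 mul1r ep.
  have uy : usphere y by rewrite /usphere /= -enorm_sq y1 expr1n.
  apply/mapP; exists (to_sphere y); last by rewrite to_sphereK.
  apply/sP; apply: sphere_inj; rewrite antipt_val -e /radial y1 scale1r.
  by rewrite direction_id.
- move: ys => /mapP[x xs ->]; have [d ->] := jF x xs; split => //.
  by have [] := sr x xs.
have sE : \sum_(x <- s) local_degree k x =
    \sum_(x <- [seq (set_val x : V) | x <- s]) sgz (\det (jacobian F x)).
  rewrite big_map; apply: eq_big_seq => x xs; have [_ jx] := jF x xs.
  by rewrite jx.
by rewrite sE.
Qed.
End SphereDegree.

Section SmashDegree.
Context {R : realType} {G : topologicalGroupType} {n : nat}.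
Variables (H K : closed_subgroup G).

Lemma smash_of_continuous (c : coset H) : continuous (fun s : sphere R n => smash_of H c s).
Proof.
move=> s; apply: (@ctat_comp _ _ _ (fun s : sphere R n => (c, s)) (collapse_of (@smash_base R G H n))).
  by apply: ctat_pair; [exact: ctat_cst|exact: ctat_id].
exact: pi_continuous.
Qed.

Lemma smash_sphere_continuous : continuous (@smash_sphere R G H n).
Proof.
apply/quotient_continuous.
rewrite (_ : _ \o _ = snd); first by move=> p; exact: ctat_snd.
by apply/funext => -[c s]; exact: (smash_sphereE c s).
Qed.

Lemma smash_sphere_pt : smash_sphere (pg_pt (half_smash R H n)) = sphere_pt.
Proof. exact: smash_sphereE. Qed.
End SmashDegree.

Section TransverseDegree.
Context {R : realType} {G : topologicalGroupType} {n : nat}.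
Variables (H K : closed_subgroup G).
Variable k : half_smash R H n -> half_smash R K n.

Lemma sphere_map_continuous (k' : half_smash R H n -> half_smash R K n) :
  continuous k' -> continuous (sphere_map k').
Proof.
move=> ck s; apply: (ctat_comp (f := fun s => k' (smash_of H (coset_of H 1%g) s))); last exact: smash_sphere_continuous.
by apply: (ctat_comp (f := fun s => smash_of H (coset_of H 1%g) s)); [exact: smash_of_continuous|exact: ck].
Qed.

Lemma smash_homotopy_deg (k0 k' : half_smash R H n -> half_smash R K n) z : ghomotopic R k0 k' ->
  is_deg (radial (sphere_vec (sphere_map k0))) setT z ->
  is_deg (radial (sphere_vec (sphere_map k'))) setT z.
Proof.
move=> [h [ch _ h0 h1]].
pose L (t : R) v := set_val (smash_sphere (h (smash_of H (coset_of H 1%g) (to_sphere v), t))).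
have E0 : sphere_vec (sphere_map k0) = L 0.
  by apply/funext => v; rewrite /sphere_vec /sphere_map /L h0.
have E1 : sphere_vec (sphere_map k') = L 1.
  by apply/funext => v; rewrite /sphere_vec /sphere_map /L h1.
rewrite E0 E1; apply: radial_homotopy; last by move=> t v _ _; exact: sphere_usphere.
apply: (@within_precomp _ _ _ (fun q : R * 'rV[R]_n.+1 => (smash_of H (coset_of H 1%g) (to_sphere q.2), q.1))
  (fun p => set_val (smash_sphere (h p))) _ (@cylinder R (half_smash R H n))).
- have c1 := icyl_within (@to_sphere_within R n).
  apply: (@within_precomp _ _ _ (fun q : R * 'rV[R]_n.+1 => (q.1, to_sphere q.2))
    (fun p : R * sphere R n => (smash_of H (coset_of H 1%g) p.2, p.1)) _ setT) => //.
  apply: within_ctat => p _; apply: ctat_pair; last exact: ctat_fst.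
  by apply: (ctat_comp (f := snd)); [exact: ctat_snd|exact: smash_of_continuous].
- by move=> [t v] [].
- apply: (@within_precomp _ _ _ h (fun x => set_val (smash_sphere x)) _ setT) => //.
  apply: within_ctat => x _; apply: (ctat_comp (f := @smash_sphere R G K n)); first exact: smash_sphere_continuous.
  exact: set_val_ctat.
Qed.

Lemma transverse_deg (D : transverse_deformation k) :
  is_deg (radial (sphere_vec (sphere_map k))) setT
    (\sum_(p <- td_points D) local_degree (sphere_map (td_map D)) p.1).
Proof.
have [[ct _] _] := td_gmap D.
have h : ghomotopic R (td_map D) k.
  by apply: ghomotopic_sym; have [h [hh _]] := td_homotopic D; exists h.
apply: (smash_homotopy_deg h).
have -> : \sum_(p <- td_points D) local_degree (sphere_map (td_map D)) p.1 =
    \sum_(x <- unzip1 (td_points D)) local_degree (sphere_map (td_map D)) x.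
  by rewrite big_map.
apply: local_degree_sum.
- by apply: sphere_vec_within; exact: sphere_map_continuous.
- exact: td_uniq.
- exact: td_preimage.
- by move=> x /mapP[p pD ->]; exact: td_regular.
Qed.
End TransverseDegree.

Section CellMapDegree.
Context {R : realType} {G : topologicalGroupType} {X : pgspace G} (C : gcw R X).

Lemma wrapE n (d : disc R n) : set_val (wrap d) = wrapv (set_val d).
Proof. by []. Qed.

Lemma pole_sphere_pt n : set_val (@sphere_pt R n) = pole.
Proof. by []. Qed.

Lemma wrap_bd n (d : disc R n) : ~ disc_interior d -> wrap d = sphere_pt.
Proof.
move=> nd; apply: sphere_inj; rewrite wrapE pole_sphere_pt; apply: wrapv_pole.
have := disc_cdisc d; rewrite /cdisc /= le_eqVlt => /predU1P[//|h].
by exfalso; apply: nd.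
Qed.

Lemma wrap_pt n (d : disc R n) : wrap d = sphere_pt -> ~ disc_interior d.
Proof. by move=> e od; apply: (wrapv_not_pole (d := set_val d) od); rewrite -wrapE e. Qed.

Lemma wrap_inj n (d e : disc R n) : disc_interior d -> disc_interior e -> wrap d = wrap e -> d = e.
Proof. by move=> od oe E; apply: disc_inj; apply: wrapv_inj => //; rewrite -!wrapE E. Qed.

Lemma smash_of_inj (H : closed_subgroup G) n c c' (v w : sphere R n) :
  smash_of H c v = smash_of H c' w -> (c, v) = (c', w) \/ (v = sphere_pt /\ w = sphere_pt).
Proof. by move=> /collapse_ofP. Qed.

Variable n : nat.
Implicit Types s t : cell C n.

Lemma cell_projE t c d : disc_interior d -> cell_proj t (cell_char t (c, d)) = smash_of (cell_type t) c (wrap d).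
Proof.
move=> od; rewrite /cell_proj; apply: xget_eq => [|z [c' [d' [od' E ->]]]]; first by exists c, d.
by have [-> ->] := Tagged_inj (Tagged_inj (part_inj od' od E)).
Qed.

Lemma cell_proj_out t x : (forall c d, disc_interior d -> cell_char t (c, d) <> x) ->
  cell_proj t x = pg_pt (half_smash R (cell_type t) n).
Proof. by move=> h; rewrite /cell_proj; case: xgetP => // z _ [c [d [od /h]]]; case. Qed.

Lemma skeleton_proj t m x : (m < n)%N -> skeleton C m x ->
  cell_proj t x = pg_pt (half_smash R (cell_type t) n).
Proof.
move=> mn /skeleton_open_cell[u [e [um oe E]]]; apply: cell_proj_out => c d od ex.
have [c' h] := orbit_char_eq E.
have oe' : disc_interior (to_disc e) by apply/disc_interiorE => //; exact: odisc_sub.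
have := congr1 (fun p => projT1 p) (part_inj oe' od (etrans h (esym ex))) => /= e'.
by move: um; rewrite e' leqNgt mn.
Qed.

Variable f : X -> X.
Hypothesis cf : cellular C f.

Lemma cell_map_bd t s c d : ~ disc_interior d ->
  cell_proj t (f (cell_char s (c, d))) = pg_pt (half_smash R (cell_type t) n).
Proof.
move=> nd; have [m mn sx] := @gcw_boundary _ _ _ C _ s c _ nd.
by apply: skeleton_proj mn _; exact: cf.
Qed.

(** Two representatives of a point of the smash product differ only over the base point, that is on
    the boundary of the cell, and from there a cellular map lands in the lower skeleton. *)
Lemma cell_map_char s t c d :
  @cell_map R G X C n f s t (smash_of (cell_type s) c (wrap d)) = cell_proj t (f (cell_char s (c, d))).
Proof.
rewrite /cell_map; apply: xget_eq => [|z [c' [d' [E ->]]]]; first by exists c, d.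
have bd : wrap d = sphere_pt -> wrap d' = sphere_pt ->
    cell_proj t (f (cell_char s (c', d'))) = cell_proj t (f (cell_char s (c, d))).
  by move=> /wrap_pt h /wrap_pt h'; rewrite !cell_map_bd.
have [e|[? ?]] := smash_of_inj E; last exact: bd.
have cc := congr1 fst e; have w := congr1 snd e; rewrite /= in cc w.
have [od|nd] := pselect (disc_interior d); last by apply: bd; rewrite -?w wrap_bd.
have od' : disc_interior d'.
  by apply: contrapT => nd'; apply: (wrap_pt _ od); rewrite w wrap_bd.
by rewrite cc (wrap_inj od od' w).
Qed.

Lemma cell_map_pt s t : @cell_map R G X C n f s t (smash_of (cell_type s) (coset_of _ 1%g) sphere_pt) =
  pg_pt (half_smash R (cell_type t) n).
Proof.
rewrite /cell_map; case: xgetP => // z _ [c [d [E ->]]]; apply: cell_map_bd.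
by apply: wrap_pt; have [/(congr1 snd)/= <-|[_]] := smash_of_inj E.
Qed.
End CellMapDegree.

Section GCWIndex.
Context {R : realType} {G : topologicalGroupType} {X : pgspace G} (C : gcw R X).

(** The bridge between orbit space and [X]: the collapse onto a cell of the orbit space is the
    projection of [X] to that cell, divided by [G]. *)
Lemma cell_sph_proj (s : orbit_cw C) x :
  cell_sph s (orbit_of x) = set_val (smash_sphere (cell_proj (cell_of s) x)).
Proof.
have [[c [d [od <-]]]|h] := pselect (exists c d, disc_interior d /\ cell_char (cell_of s) (c, d) = x).
  rewrite cell_projE// smash_sphereE wrapE orbit_char.
  have -> : orbit_of (cell_char (cell_of s) (coset_of _ 1%g, d)) = ch s (set_val d).
    by rewrite /= /orbit_ch /orbit_lift disc_valK.
  exact: cell_sph_odisc.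
rewrite cell_proj_out => [|c d od E]; last by apply: h; exists c, d.
rewrite smash_sphere_pt; apply: cell_sph_out => d od /orbit_char_eq[c E].
apply: h; exists c, (to_disc d); split => //.
by apply/disc_interiorE => //; exact: odisc_sub.
Qed.

Variables (f : X -> X) (gf : is_gmap f) (cf : cellular C f).

Definition cell_sphere_map (s : orbit_cw C) : 'rV[R]_(dm s).+1 -> 'rV[R]_(dm s).+1 :=
  sphere_vec (sphere_map (@cell_map R G X C _ f (cell_of s) (cell_of s))).

Lemma cell_sphere_mapE (s : orbit_cw C) (d : 'rV_(dm s)) : cdisc d ->
  cell_sphere_map (wrapv d) = cell_sph s (orbit_map f (ch s d)).
Proof.
move=> cd; rewrite /cell_sphere_map /sphere_vec /sphere_map.
have -> : to_sphere (wrapv d) = wrap (to_disc d).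
  by apply: sphere_inj; rewrite wrapE to_discK// to_sphereK//; exact: wrapv_sphere.
rewrite cell_map_char// -cell_sph_proj; congr cell_sph.
by rewrite orbit_mapE//; case: gf.
Qed.

Lemma cell_sphere_map_pole (s : orbit_cw C) : @cell_sphere_map s pole = pole.
Proof.
rewrite /cell_sphere_map /sphere_vec /sphere_map.
have -> : to_sphere (pole : 'rV[R]_(dm s).+1) = sphere_pt.
  by apply: sphere_inj; rewrite pole_sphere_pt to_sphereK//; exact: pole_sphere.
by rewrite cell_map_pt// smash_sphere_pt.
Qed.

Lemma orbit_map_skel m (y : orbit_space X) : body (skel [set: orbit_cw C]%SET m) y ->
  body (skel [set: orbit_cw C]%SET m) (orbit_map f y).
Proof.
move=> [s [d [+ od <-]]]; rewrite skelE => /andP[_ sm].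
case: m sm => // m; rewrite ltnS => sm.
have sx : skeleton C m (orbit_lift d) by exists (dm s), (cell_of s), (coset_of _ 1%g, to_disc d).
have [t [e [tm oe E]]] := skeleton_open_cell (cf sx).
exists t, e; split => //; first by rewrite skelE inE.
by rewrite [RHS]orbit_mapE//; case: gf.
Qed.

Lemma gcw_index_formula (hG : subconjugacy_order G) (f0 : X -> X) (zs : orbit_cw C -> int) :
  is_gmap f0 -> ghomotopic R f0 f ->
  (forall s, is_deg (radial (@cell_sphere_map s)) setT (zs s)) ->
  fixed_orbit_index R f0 = \sum_(s : orbit_cw C)
    << (-1) ^+ dm s * zs s *g \pi_(conj_class G) (orbit_tp s) >>.
Proof.
move=> gf0 /ghomotopic_sym[h hh] dz.
apply: (@fixed_orbit_index_formula R G hG X (orbit_cw C) (@orbit_tp _ _ _ C)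
  (@orbit_lift _ _ _ C) _ _ _ _ f0 f h gf0 gf hh _ cell_sphere_map) => //.
- exact: orbit_lift_within.
- by move=> s d od; rewrite orbit_isotropyE//; exact: conjugate_refl.
- by move=> s d _; apply: sub_subconj; exact: orbit_isotropy_sub.
- exact: orbit_map_skel.
- exact: cell_sphere_mapE.
- exact: cell_sphere_map_pole.
- exact: orbit_of (pg_pt X).
Qed.

Variable D : cell_deformations C f.

Definition cell_degree (s : orbit_cw C) : int :=
  \sum_(p <- td_points (D (cell_of s) (cell_of s)))
     local_degree (sphere_map (td_map (D (cell_of s) (cell_of s)))) p.1.

Lemma gcw_fixed_orbit_index (hG : subconjugacy_order G) (f0 : X -> X) :
  is_gmap f0 -> ghomotopic R f0 f ->
  fixed_orbit_index R f0 = \sum_(s : orbit_cw C)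
    << (-1) ^+ dm s * cell_degree s *g \pi_(conj_class G) (orbit_tp s) >>.
Proof.
move=> gf0 hh; apply: gcw_index_formula => // s.
exact: transverse_deg.
Qed.
End GCWIndex.

(** * Hattori-Stallings traces *)
Section TraceOfMatrix.
Variables (S : pzRingType) (J : finType) (e : J -> S) (A : J -> J -> S).
Hypothesis ee : forall s, e s * e s = e s.
Hypothesis eA : forall t s, e t * A t s = A t s.
Local Notation P := (idem_module e).

Definition coordinate (s : J) (v : P) : (S^c)^o := val v s.

Lemma coordinate_linear s : linear (coordinate s).
Proof. by move=> a u v; rewrite /coordinate linearP !ffunE. Qed.

HB.instance Definition _ s :=
  GRing.isLinear.Build (S^c) P ((S^c)^o) _ (coordinate s) (coordinate_linear s).

Lemma unit_vec_subproof s : [ffun t => if t == s then e s else 0 : (S^c)^o] \in idem_sum e.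
Proof.
apply/idem_sumP => t; rewrite !ffunE; case: eqP => [->|_]; first exact: ee.
exact: mulr0.
Qed.

(** With the coordinates this is a dual basis of the projective module; its entry is [e s], the unit
    of the summand. *)
Definition unit_vec s : P := exist (fun w => w \in idem_sum e) _ (unit_vec_subproof s).

Lemma coordinateZ s (a : S^c) (v : P) : coordinate s (a *: v) = (coordinate s v : S) * (a : S).
Proof. by rewrite linearZ. Qed.

Lemma unit_vecE (v : P) : v = \sum_s (coordinate s v : S^c) *: unit_vec s.
Proof.
apply/val_inj/ffunP => t; rewrite -[LHS]/(coordinate t v) -[RHS]/(coordinate t _) linear_sum.
rewrite (bigD1 t)//= big1 => [|s st]; rewrite coordinateZ /coordinate /= ffunE.
  rewrite eqxx addr0; have /idem_sumP h := valP v.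
  exact: (esym (h t)).
by rewrite eq_sym (negPf st) mul0r.
Qed.

Lemma mx_map_unit t s : coordinate t (mx_map eA (unit_vec s)) = A t s * e s.
Proof.
rewrite /coordinate /= ffunE (bigD1 s)//= big1 => [|u us]; rewrite ffunE ?eqxx ?addr0//.
by rewrite (negPf us) mulr0.
Qed.

Lemma mx_mapD u v : mx_map eA (u + v) = mx_map eA u + mx_map eA v.
Proof.
apply/val_inj/ffunP => t; rewrite /= !ffunE -big_split /=.
by apply: eq_bigr => s _; rewrite !ffunE mulrDr.
Qed.

Lemma mx_map0 : mx_map eA 0 = 0.
Proof. by apply: (addrI (mx_map eA 0)); rewrite -mx_mapD !addr0. Qed.

Lemma mx_mapZ (a : S^c) v : mx_map eA (a *: v) = a *: mx_map eA v.
Proof.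
apply/val_inj/ffunP => t; rewrite /= !ffunE.
transitivity ((\sum_s A t s * (val v s : S)) * (a : S)) => //.
rewrite (@mulr_suml S); apply: eq_bigr => s _; rewrite ffunE.
exact: (@mulrA S).
Qed.

(** The dual basis presents the endomorphism as a sum of elementary tensors. *)
Lemma hs_trace_exists : exists t, hs_trace (mx_map eA) t.
Proof.
pose xi j : {linear P -> (S^c)^o} := coordinate j.
pose x j := mx_map eA (unit_vec j).
pose en := @enum_val J predT.
exists (\sum_(i < #|J|) (xi (en i) (x (en i)) : S)), #|J|, (fun i => x (en i)), (fun i => xi (en i)).
split=> [y|]; last by exists 0%N, (fun=> 0), (fun=> 0); rewrite big_ord0 subrr.
rewrite {1}(unit_vecE y) (big_morph _ mx_mapD mx_map0).
rewrite (reindex en) /=; last by exists enum_rank => i _; rewrite /en ?enum_valK ?enum_rankK.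
by apply: eq_bigr => i _; rewrite mx_mapZ.
Qed.

Section Eps.
Variables (U : zmodType) (eps : S -> U).
Hypothesis epsB : forall a b, eps (a - b) = eps a - eps b.
Hypothesis epsM : forall a b, eps (a * b) = eps (b * a).

Let eps0 : eps 0 = 0.
Proof. by have := epsB 0 0; rewrite !subrr. Qed.

Let epsD a b : eps (a + b) = eps a + eps b.
Proof. by rewrite -{1}[b]opprK -[- b]sub0r !epsB eps0 sub0r opprK. Qed.

Let eps_sum (I : finType) (F : I -> S) : eps (\sum_i F i) = \sum_i eps (F i).
Proof. exact: (big_morph eps epsD eps0). Qed.

(** Evaluated for an arbitrary presentation, so that independence of the presentation is a
    consequence. Expanding [x j] in the dual basis gives products of coordinates and functionals; as
    [eps] is a trace they may be commuted, and then they add up to the diagonal. *)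
Lemma hs_trace_eps t : hs_trace (mx_map eA) t -> eps t = \sum_s eps (A s s).
Proof.
move=> [m [x [xi [xiE [l [a [b ab]]]]]]].
have -> : eps t = eps (\sum_j (xi j (x j) : S)).
  apply/eqP; rewrite -subr_eq0 -epsB ab eps_sum big1// => j _.
  by rewrite epsB epsM subrr.
rewrite eps_sum.
have h j : (xi j (x j) : S) = \sum_s (xi j (unit_vec s) : S) * (coordinate s (x j) : S).
  rewrite {1}(unit_vecE (x j)) linear_sum; apply: eq_bigr => s _.
  exact: (linearZ_LR (xi j) (coordinate s (x j)) (unit_vec s)).
transitivity (\sum_j \sum_s eps ((coordinate s (x j) : S) * (xi j (unit_vec s) : S))).
  by apply: eq_bigr => j _; rewrite h eps_sum; apply: eq_bigr => s _; rewrite epsM.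
rewrite exchange_big /=; apply: eq_bigr => s _; rewrite -eps_sum.
have <- : coordinate s (mx_map eA (unit_vec s)) =
    \sum_j (coordinate s (x j) : S) * (xi j (unit_vec s) : S).
  by rewrite xiE linear_sum; apply: eq_bigr => j _; exact: coordinateZ.
by rewrite mx_map_unit epsM eA.
Qed.
End Eps.
End TraceOfMatrix.

Lemma freegU_scale (K : choiceType) (k : int) (x : K) :
  << k *g x >> = k *: << x >> :> {freeg K / int}.
Proof. by apply/eqP/freeg_eqP => z; rewrite coeffZ !coeffU mul1r. Qed.

Section Augmentation.
Variables (R : realType) (G : topologicalGroupType) (O : {fset closed_subgroup G}).
Hypothesis hG : subconjugacy_order G.
Local Notation eps := (@isotropy_eps R G O).

Lemma isotropy_epsB (a b : isotropy_ring R O) : eps (a - b) = eps a - eps b.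
Proof. exact: lift_is_additive. Qed.

Lemma isotropy_epsN (a : isotropy_ring R O) : eps (- a) = - eps a.
Proof. by have := isotropy_epsB 0 a; have := isotropy_epsB 0 0; rewrite !subrr => ->; rewrite !sub0r. Qed.

Lemma isotropy_epsD (a b : isotropy_ring R O) : eps (a + b) = eps a + eps b.
Proof. by rewrite -[b]opprK isotropy_epsB (isotropy_epsN (- b)). Qed.

Lemma isotropy_eps0 : eps 0 = 0.
Proof. by have := isotropy_epsB 0 0; rewrite !subrr. Qed.

Lemma isotropy_epsU (k : int) (m : orbit_mor R O) : eps << k *g m >> =
  k *: (if mor_src m == mor_tgt m then class_of (fsval (mor_src m)) else 0).
Proof. exact: liftU. Qed.

Lemma gmap_subconj (H K : closed_subgroup G) :
  orbit_gmap H K -> subconj (subgroup_set H) (subgroup_set K).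
Proof.
move=> f; have [_ fE] := orbit_gmapP f.
have [_ H1 _] := subgroupP H.
exists (repr (val f (coset_of H 1%g))) => h Hh.
rewrite -mulgA; apply/coset_ofP; rewrite -coset_actE !coset_ofK.
rewrite -[RHS](fE h); congr (val f _).
rewrite [RHS](coset_actE _ h) mulg1.
by apply/coset_ofP; rewrite invg1 mul1g.
Qed.

(** If both composites exist, the two groups are subconjugate to each other, hence conjugate by
    antisymmetry, and [eps] sees the same class on either side. *)
Lemma isotropy_eps_comp (b a : orbit_mor R O) :
  eps (mor_comp b a) = eps (mor_comp a b).
Proof.
rewrite -[a]morK -[b]morK; move: (mor_hom a) (mor_hom b).
move: (mor_src a) (mor_tgt a) (mor_src b) (mor_tgt b) => H K' K L {}a {}b.
have [e1|ne1] := pselect (K' = K); have [e2|ne2] := pselect (L = H).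
- subst K' L; rewrite !mor_compE !isotropy_epsU /mor_src /mor_tgt /= !eqxx.
  congr (_ *: _); rewrite /class_of (proj2 (conj_class_eqP (fsval H) (fsval K)))//; apply: hG.
    exact: gmap_subconj (repr a).
  exact: gmap_subconj (repr b).
- subst K'; rewrite mor_compE [X in _ = eps X]mor_comp0// isotropy_eps0 isotropy_epsU.
  by rewrite /mor_src /mor_tgt /=; case: eqP => [/esym//|_]; rewrite scaler0.
- subst L; rewrite mor_compE mor_comp0// isotropy_eps0 isotropy_epsU.
  by rewrite /mor_src /mor_tgt /=; case: eqP => [/esym//|_]; rewrite scaler0.
- by rewrite !mor_comp0.
Qed.

Lemma isotropy_epsM (a b : isotropy_ring R O) : eps (a * b) = eps (b * a).
Proof.
elim/isotropy_ind: a => [|x y IH IH'|x IH|H K a].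
- by rewrite mul0r mulr0.
- by rewrite mulrDl mulrDr !isotropy_epsD IH IH'.
- by rewrite mulNr mulrN !isotropy_epsN IH.
elim/isotropy_ind: b => [|x y IH IH'|x IH|H' K' b].
- by rewrite mul0r mulr0.
- by rewrite mulrDl mulrDr !isotropy_epsD IH IH'.
- by rewrite mulNr mulrN !isotropy_epsN IH.
rewrite -[_ * _ in LHS]/(isotropy_mul _ _) -[_ * _ in RHS]/(isotropy_mul _ _).
by rewrite !isotropy_mulUU isotropy_eps_comp.
Qed.

Section Complex.
Variables (X : pgspace G) (C : gcw R X) (f : X -> X).
Hypothesis CO : forall n (s : cell C n), cell_type s \in O.
Variable D : cell_deformations C f.

Lemma isotropy_eps_coeff n (s : cell C n) : eps (chain_coeff CO D s s) =
  (\sum_(p <- td_points (D s s)) local_degree (sphere_map (td_map (D s s))) p.1)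
    *: class_of (cell_type s).
Proof.
rewrite /chain_coeff (big_morph _ isotropy_epsD isotropy_eps0) scaler_suml.
by apply: eq_bigr => p _; rewrite isotropy_epsU /mor_src /mor_tgt /= eqxx.
Qed.

(** All elements of the coset have the same image under [eps], and there is one, so the choice made
    by [xget] is forced. *)
Lemma eps_ab_trace n : eps_ab (hs_trace (@cell_chain_map R G X C f O CO D n)) =
  \sum_(s : cell C n)
    (\sum_(p <- td_points (D s s)) local_degree (sphere_map (td_map (D s s))) p.1)
    *: class_of (cell_type s).
Proof.
have tE t : hs_trace (@cell_chain_map R G X C f O CO D n) t -> eps t =
    \sum_(s : cell C n) eps (chain_coeff CO D s s).
  by apply: hs_trace_eps; [move=> s; exact: orbit_idemE|exact: isotropy_epsB|exact: isotropy_epsM].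
under eq_bigr do rewrite -isotropy_eps_coeff.
have [t0 t0P] : exists t, hs_trace (@cell_chain_map R G X C f O CO D n) t.
  by apply: hs_trace_exists => s; exact: orbit_idemE.
rewrite /eps_ab; apply: xget_eq.
  by exists t0 => //; exact: tE.
by move=> _ [t tP <-]; exact: tE.
Qed.

Lemma hom_lefschetzE : hom_lefschetz CO D = \sum_(s : orbit_cw C)
    << (-1) ^+ dm s * cell_degree D s *g \pi_(conj_class G) (orbit_tp s) >>.
Proof.
rewrite /hom_lefschetz.
under eq_bigr do rewrite eps_ab_trace scaler_sumr.
rewrite (@sig_big_dep _ _ _ _ (fun i : 'I_(gcw_dim C).+1 => cell C i : finType) predT (fun _ => predT)) /=.
apply: eq_bigr => -[i s] _.
by rewrite freegU_scale scalerA.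
Qed.
End Complex.
End Augmentation.

Lemma reduced_index_hom_lefschetz (R : realType) (G : topologicalGroupType)
    (hG : subconjugacy_order G) (X : pgspace G) (C : gcw R X) (f f' : X -> X)
    (O : {fset closed_subgroup G}) (CO : forall n (s : cell C n), cell_type s \in O)
    (D : cell_deformations C f') :
  is_pgmap f -> is_pgmap f' -> cellular C f' -> pghomotopic R f f' ->
  reduced_fixed_orbit_index R f = reduced_hom_lefschetz CO D.
Proof.
move=> [gf _] [gf' _] cf [h [hh _]].
rewrite /reduced_fixed_orbit_index /reduced_hom_lefschetz (hom_lefschetzE hG).
by rewrite (@gcw_fixed_orbit_index R G X C f' gf' cf D hG f gf (ex_intro _ h hh)).
Qed.

Section SmashClosed.
Context {R : realType} {G : topologicalGroupType} (H : closed_subgroup G).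

Lemma wrap_continuous n : continuous (@wrap R n).
Proof.
have h : {within setT, continuous (@wrap R n)}.
  apply: set_type_within; apply: within_ctat => d _.
  by apply: ctat_wrapv; exact: set_val_ctat.
by move=> d; apply: (@ctat_within _ _ _ id (@wrap R n) setT d h); [exact: filterT|exact: ctat_id].
Qed.

Lemma wrap_cover n (v : sphere R n) : v = sphere_pt \/ exists2 d, disc_interior d & v = wrap d.
Proof.
have [e|[d od e]] := usphere_cover (sphere_usphere v); first by left; exact: sphere_inj.
right; exists (to_disc d); first by apply/disc_interiorE => //; exact: odisc_sub.
by apply: sphere_inj; rewrite wrapE to_discK//; exact: odisc_sub.
Qed.

Lemma wrap_onto n (v : sphere R n.+1) : exists d, v = wrap d.
Proof.
have [->|[d _ ->]] := wrap_cover v; last by exists d.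
exists (to_disc (delta_mx 0 0)); apply/esym/wrap_bd => /disc_interiorE.
by rewrite /cdisc /odisc /= normsq_e0 ltxx => /(_ (lexx _)).
Qed.

Lemma compact_disc n : compact [set: disc R n].
Proof. exact: (compact_set_type (to_disc 0) (@compact_cdisc R n)). Qed.

Lemma closed_wrap_graph n : closed [set q : disc R n * sphere R n | wrap q.1 = q.2].
Proof.
have -> : [set q : disc R n * sphere R n | wrap q.1 = q.2] =
    (fun q : disc R n * sphere R n => wrapv (set_val q.1) - set_val q.2) @^-1` [set 0].
  apply/seteqP; split => -[d s] /=; first by move=> <-; rewrite wrapE subrr.
  by move=> /eqP; rewrite subr_eq0 => /eqP e; apply: sphere_inj; rewrite wrapE.
apply: closed_comp => [q _|]; last by apply: compact_closed; [exact: norm_hausdorff|exact: compact_set1].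
apply: (@ctatBv (disc R n * sphere R n)%type R 'rV[R]_n.+1 (fun q => wrapv (set_val q.1)) (fun q => set_val q.2)).
  apply: ctat_wrapv; apply: (ctat_comp (f := fst)); [exact: ctat_fst|exact: set_val_ctat].
by apply: (ctat_comp (f := snd)); [exact: ctat_snd|exact: set_val_ctat].
Qed.

(** That discs suffice to test the product with [G/H] comes from compactness of the disc: a point
    outside the set has a neighbourhood avoiding it for all [d] at once. In positive dimension
    [wrap] is onto, so nothing is missed. *)
Lemma closed_smash n (A : set (half_smash R H n.+1)) :
  closed [set p : coset H * disc R n.+1 | A (smash_of H p.1 (wrap p.2))] -> closed A.
Proof.
move=> cE.
suff cl : closed (collapse_of (@smash_base R G H n.+1) @^-1` A).
  have op : open (collapse_of (@smash_base R G H n.+1) @^-1` (~` A)) by exact: closed_openC.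
  by rewrite -[A]setCK; apply: open_closedC.
rewrite -[X in closed X]setCK; apply: open_closedC; rewrite openE => -[c s] /= nB.
pose P (p : coset H * sphere R n.+1) (d : disc R n.+1) :=
  ~ (A (smash_of H p.1 (wrap d)) /\ wrap d = p.2).
have cov : \forall p \near nbhs (c, s), [set: disc R n.+1] `<=` P p.
  apply: (compact_near_coveringP _).1 (@compact_disc n.+1) _ _ _ _ _ => d _.
  have op : open [set q : disc R n.+1 * (coset H * sphere R n.+1) | P q.2 q.1].
    rewrite -[X in open X]setCK; apply: closed_openC.
    have -> : ~` [set q : disc R n.+1 * (coset H * sphere R n.+1) | P q.2 q.1] =
        (fun q => (q.2.1, q.1)) @^-1` [set p : coset H * disc R n.+1 | A (smash_of H p.1 (wrap p.2))] `&`
        (fun q => (q.1, q.2.2)) @^-1` [set q : disc R n.+1 * sphere R n.+1 | wrap q.1 = q.2].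
      apply/seteqP; split => q /=; first by move=> /contrapT.
      by move=> h; apply.
    apply: closedI.
      apply: closed_comp => [q _|//]; apply: (@ctat_pair _ _ _ (fun q => q.2.1) (fun q => q.1)); last exact: ctat_fst.
      by apply: (ctat_comp (f := snd)); [exact: ctat_snd|exact: ctat_fst].
    apply: closed_comp => [q _|]; last exact: closed_wrap_graph.
    apply: ctat_pair; first exact: ctat_fst.
    by apply: (ctat_comp (f := snd)); [exact: ctat_snd|exact: ctat_snd].
  have := @open_nbhs_nbhs _ (d, (c, s)) _ (conj op _).
  by apply => -[h e]; apply: nB; move: h; rewrite e.
apply: (@filterS _ (nbhs (c, s)) _ (fun p => [set: disc R n.+1] `<=` P p)) cov => -[c' s'] /= h.
have [d e] := wrap_onto s'.
by move=> As; apply: (h d I); rewrite /= -e.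
Qed.
End SmashClosed.

(** * Wedges of equivariant 1-spheres *)
Section WedgeCells.
Context {R : realType} {G : topologicalGroupType} {I : finType} (H : I -> closed_subgroup G).
Local Notation S i := (half_smash R (H i) 1).
Local Notation X := (wedge_space (fun i => S i)).
Local Notation win i x := (@wedge_in G I (fun i => S i) i x).
Local Notation wproj i := (@wedge_proj G I (fun i => S i) i).

Lemma wedge_in_pt i : win i (pg_pt (S i)) = pg_pt X.
Proof. exact: (@wedge_in'_pt G I (fun i => S i) (Some i) None). Qed.

Lemma wedge_proj_id i x : wproj i (win i x) = x.
Proof. by rewrite wedge_projE /=; case: eqP => // e; rewrite eq_axiomK. Qed.

Lemma wedge_proj_neq i j x : j <> i -> wproj i (win j x) = pg_pt (S i).
Proof. by move=> ji; rewrite wedge_projE /=; case: eqP. Qed.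

Lemma wedge_proj_pt i : wproj i (pg_pt X) = pg_pt (S i).
Proof. by rewrite -(wedge_in_pt i) wedge_proj_id. Qed.

Lemma wedge_in_eq_pt i x : win i x = pg_pt X -> x = pg_pt (S i).
Proof. by move=> e; rewrite -(wedge_proj_id x) e wedge_proj_pt. Qed.

Lemma wedge_in_inj i j x y : win i x = win j y -> x <> pg_pt (S i) ->
  existT (fun i => pg_gspace (S i) : Type) i x = existT (fun i => pg_gspace (S i) : Type) j y.
Proof.
move=> e xp; have [ji|/eqP ji] := eqVneq j i.
  by subst j; rewrite -(wedge_proj_id x) e wedge_proj_id.
by exfalso; apply: xp; rewrite -(wedge_proj_id x) e wedge_proj_neq.
Qed.

Lemma smash_pt_of i c : smash_of (H i) c sphere_pt = pg_pt (S i).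
Proof. by apply/collapse_ofP; right. Qed.

Lemma smash_wrap_pt i c d : disc_interior d -> smash_of (H i) c (wrap d) <> pg_pt (S i).
Proof.
move=> od /smash_of_inj[/(congr1 snd)/= e|[e _]]; exact: (wrap_pt e).
Qed.

Definition wedge_cell (n : nat) : finType :=
  match n with 0 => unit | 1 => I | _ => void end.

Definition wedge_cell_type n : wedge_cell n -> closed_subgroup G :=
  match n with 0 => fun _ => full_subgroup G | 1 => H | _ => fun s => match s with end end.

Definition wedge_cell_char n :
    forall s : wedge_cell n, coset (wedge_cell_type s) * disc R n -> X :=
  match n with
  | 0 => fun _ _ => pg_pt X
  | 1 => fun i p => win i (smash_of (H i) p.1 (wrap p.2))
  | _ => fun s => match s with end
  end.

Definition wedge_cells : cell_family R X := CellFamily wedge_cell_char.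
Local Notation W := wedge_cells.

Lemma wedge_finite n : (1 < n)%N -> cell W n -> False.
Proof. by case: n => [|[|n]]. Qed.

Lemma wedge_char_continuous n (s : cell W n) : continuous (cell_char s).
Proof.
case: n s => [|[|n]] s; [exact: cst_continuous| |by case: s].
move=> p; apply: (ctat_comp (f := fun p : coset (H s) * disc R 1 => smash_of (H s) p.1 (wrap p.2)));
  last first.
  exact: (@wedge_lift_continuous _ _ _ (Some s)).
apply: (ctat_comp (f := fun p : coset (H s) * disc R 1 => (p.1, wrap p.2))); last exact: pi_continuous.
apply: ctat_pair; first exact: ctat_fst.
apply: (@ctat_comp _ _ _ snd (@wrap R 1)); first exact: ctat_snd.
by apply: wrap_continuous.
Qed.

Lemma wedge_char_act n (s : cell W n) g c d :
  cell_char s (coset_act g c, d) = act g (cell_char s (c, d)).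
Proof.
case: n s c d => [|[|n]] /=; [by move=> s c d; exact: (esym (act_pt X g))| |by case].
move=> s c d; rewrite /= /wedge_in [RHS]wedge_actE; congr (wedge_in' _).
by apply: esym; exact: (collapse_actE (@smash_base_act R G (H s) 1) g (c, wrap d)).
Qed.

Lemma disc0_eq (d e : disc R 0) : d = e.
Proof. by apply: disc_inj; apply/rowP => -[]. Qed.

Lemma wedge_part (x : X) :
  exists! p : {n : nat & {s : cell W n & (coset (cell_type s) * disc R n)%type}},
    let q := tagged (tagged p) in disc_interior q.2 /\ cell_char _ q = x.
Proof.
have base : exists! p : {n : nat & {s : cell W n & (coset (cell_type s) * disc R n)%type}},
    let q := tagged (tagged p) in disc_interior q.2 /\ cell_char _ q = pg_pt X.
  exists (existT (fun n => {s : cell W n & (coset (cell_type s) * disc R n)%type}) 0%N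
    (existT (fun s : cell W 0 => (coset (cell_type s) * disc R 0)%type) tt (coset_of _ 1%g, to_disc 0))).
  split=> [|[[|[|n]] [s [c d]]] /=].
  - by split => //; apply/disc_interiorE; [exact: odisc_sub odisc0|exact: odisc0].
  - by case: s c => c _; rewrite (disc0_eq (to_disc 0) d) (coset_full (coset_of _ 1%g) c).
  - move=> [od e]; exfalso; apply: (@smash_wrap_pt s c _ od).
    exact: wedge_in_eq_pt e.
  - by case: s c.
have [k [z ->]] := wedge_surj x; case: k z => [i|] z /=; last first.
  by rewrite (coset_full z (coset_of _ 1%g)).
have [[c v] zE] : exists p, z = smash_of (H i) p.1 p.2.
  by exists (repr (z : collapse _)); rewrite /smash_of -surjective_pairing collapse_ofK.
rewrite {}zE /=; have [->|[d od ->]] := wrap_cover v.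
  by rewrite smash_pt_of [wedge_in' _]wedge_in_pt.
exists (existT (fun n => {s : cell W n & (coset (cell_type s) * disc R n)%type}) 1%N
    (existT (fun s : cell W 1 => (coset (cell_type s) * disc R 1)%type) i (c, d))).
split=> [|[[|[|n]] [s [c' d']]] /=]; first by split.
- move=> [_ e]; exfalso; apply: (@smash_wrap_pt i c _ od).
  exact: wedge_in_eq_pt (esym e).
- move=> [od' e]; have E := wedge_in_inj e (@smash_wrap_pt s c' _ od').
  have si : s = i := congr1 (fun p => projT1 p) E.
  subst s; have /smash_of_inj[F|[F _]] := Tagged_inj E; last by case: (wrap_pt F).
  have /= -> := congr1 fst F; have /= w := congr1 snd F.
  by rewrite (wrap_inj od' od w).
- by case: s c' d'.
Qed.

Lemma wedge_boundary n (s : cell W n) c d : ~ disc_interior d ->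
  exists2 m, (m < n)%N & skeleton W m (cell_char s (c, d)).
Proof.
case: n s c d => [|[|n]] s c d nd; last by case: s c.
  exfalso; apply: nd; rewrite (disc0_eq d (to_disc 0)).
  by apply/disc_interiorE; [exact: odisc_sub odisc0|exact: odisc0].
exists 0%N => //; exists 0%N, tt, (coset_of _ 1%g, to_disc 0); split => //=.
by rewrite wrap_bd// smash_pt_of wedge_in_pt.
Qed.

Lemma wedge_skeleton0 x : skeleton W 0 x -> x = pg_pt X.
Proof. by move=> [[|m] [s [p [+ <-]]]]. Qed.

(** Closedness is tested on the summands, and on each of them by [closed_smash] along its 1-cell.
    For [n = 0] the set is empty or the base point. *)
Lemma wedge_top n (A : set X) : A `<=` skeleton W n ->
  (closed A <-> forall m (s : cell W m), (m <= n)%N -> closed (cell_char s @^-1` A)).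
Proof.
move=> An; split=> [cA m s _|h].
  by apply: closed_comp => // p _; exact: wedge_char_continuous.
suff cl o : closed (@wedge_lift _ _ (fun o => pg_pt (summand (fun i => S i) o)) o @^-1` A).
  rewrite -[A]setCK; apply: open_closedC; apply/wedge_openP => o.
  exact: closed_openC (cl o).
case: o => [i|] /=; last first.
  set B := _ @^-1` A; have [Bp|Bp] := pselect (B (coset_of _ 1%g)).
    suff -> : B = setT by exact: closedT.
    by apply/seteqP; split => // z _; rewrite (coset_full z (coset_of _ 1%g)).
  suff -> : B = set0 by exact: closed0.
  by apply/seteqP; split => // z; rewrite (coset_full z (coset_of _ 1%g)).
apply: closed_smash; case: n An h => [|n] An h; last exact: (h 1%N i).
have [Ap|Ap] := pselect (A (pg_pt X)); last first.
  set B := mkset _; suff -> : B = set0 by exact: closed0.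
  apply/seteqP; split => // p Ap'; apply: Ap.
  by rewrite -(wedge_skeleton0 (An _ Ap')).
set B := mkset _.
have -> : B = (fun p => (p.2, sphere_pt)) @^-1` [set q : disc R 1 * sphere R 1 | wrap q.1 = q.2].
  apply/seteqP; split => -[c d]; rewrite /B /=.
    move=> /An/wedge_skeleton0 e.
    have : smash_of (H i) c (wrap d) = pg_pt (S i) by exact: wedge_in_eq_pt e.
    by move=> /smash_of_inj[/(congr1 snd)|[]].
  move=> ->; rewrite smash_pt_of.
  have -> // : wedge_lift (fun o => pg_pt (summand (fun i => S i) o)) (i := Some i) (pg_pt (S i)) = pg_pt X.
  exact: wedge_in_pt.
apply: closed_comp => [p _|]; last exact: closed_wrap_graph.
by apply: (@ctat_pair _ _ _ snd (fun=> sphere_pt)); [exact: ctat_snd|exact: ctat_cst].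
Qed.

Lemma wedge_base : exists s : cell W 0,
  cell_type s = full_subgroup G /\ forall p, cell_char s p = pg_pt X.
Proof. by exists tt. Qed.

Definition wedge_gcw : gcw R X :=
  GCW wedge_finite wedge_char_continuous wedge_char_act wedge_part wedge_boundary wedge_top wedge_base.
End WedgeCells.

Lemma is_deg_id (R : realType) n : is_deg (id : 'rV[R]_n -> 'rV[R]_n) setT 1.
Proof.
have := @lin_deg R n 1%:M setT 0 openT I; rewrite det1 sgz1 oner_neq0 => /(_ isT).
by under eq_fun do rewrite subr0 mulmx1.
Qed.

Section WedgeIndex.
Context {R : realType} {G : topologicalGroupType} {I : finType} (H : I -> closed_subgroup G).
Local Notation S i := (half_smash R (H i) 1).
Local Notation X := (wedge_space (fun i => S i)).
Local Notation win i x := (@wedge_in G I (fun i => S i) i x).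
Local Notation wproj i := (@wedge_proj G I (fun i => S i) i).
Local Notation C := (wedge_gcw (R := R) H).

Variable f : X -> X.
Hypothesis pf : is_pgmap f.

(** Only the base point imposes a condition: the 1-skeleton is the whole wedge. *)
Lemma wedge_cellular : cellular C f.
Proof.
move=> [|n] x.
  move=> /wedge_skeleton0 ->; rewrite (pf.2).
  by exists 0%N, tt, (coset_of _ 1%g, to_disc 0).
move=> _; have [[m [s [c d]]] [[/= _ e] _]] := wedge_part (f x).
exists m, s, (c, d); split => //; by case: m s c d e => [|[|m]] //=.
Qed.

Lemma wedge_cell_proj (i : I) x : @cell_proj R G X C 1 i x = wproj i x.
Proof.
have [[c [d [od <-]]]|h] := pselect (exists c d, disc_interior d /\ @cell_char R G X C 1 i (c, d) = x).
  by rewrite cell_projE//= wedge_proj_id.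
rewrite cell_proj_out => [|c d od E]; last by apply: h; exists c, d.
have [[m [s [c d]]] [[/= od e] _]] := wedge_part x; rewrite -e.
case: m s c d od e => [|[|m]] /=; [by rewrite wedge_proj_pt| |by case].
move=> s c d od e; rewrite wedge_proj_neq// => si; apply: h; subst s.
by exists c, d.
Qed.

Lemma wedge_cell_map (i : I) :
  sphere_map (@cell_map R G X C 1 f i i) = sphere_map (wedge_proj i \o f \o wedge_in (i := i)).
Proof.
apply/funext => v; rewrite /sphere_map; congr smash_sphere.
have [d ->] := wrap_onto v.
rewrite (@cell_map_char R G X C 1 f wedge_cellular i i).
exact: wedge_cell_proj.
Qed.

(** The 0-cell contributes the identity of [S^0], of degree 1; this is the term [1 (G)] that the
    reduction subtracts. *)
Lemma wedge_base_map : sphere_map (@cell_map R G X C 0 f tt tt) = id.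
Proof.
apply/funext => v; rewrite /sphere_map; have [->|[d od ->]] := wrap_cover v.
  by rewrite (@cell_map_pt R G X C 0 f wedge_cellular tt tt) smash_sphere_pt.
rewrite (@cell_map_char R G X C 0 f wedge_cellular tt tt) /= (pf.2).
have -> : pg_pt X = @cell_char R G X C 0 tt (coset_of _ 1%g, d) by [].
by rewrite cell_projE// smash_sphereE.
Qed.

Lemma radial_base : radial (sphere_vec (sphere_map (@cell_map R G X C 0 f tt tt))) = id.
Proof.
apply/funext => y; rewrite wedge_base_map /radial /sphere_vec.
have [->|y0] := eqVneq y 0; first by rewrite /enorm normsq0 sqrtr0 scale0r.
by rewrite to_sphereK ?directionK//; exact: normsq_direction.
Qed.

Lemma wedge_fixed_orbit_index (hG : subconjugacy_order G) (zs : I -> int) :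
  (forall i, is_deg (radial (sphere_vec (sphere_map (wedge_proj i \o f \o wedge_in (i := i))))) setT (zs i)) ->
  reduced_fixed_orbit_index R f = \sum_i (- zs i) *: class_of (H i).
Proof.
move=> dz; have [gf _] := pf.
pose zs' n : cell C n -> int := match n with 0 => fun _ => 1 | 1 => zs | _ => fun _ => 0 end.
pose zc (s : orbit_cw C) : int := zs' _ (cell_of s).
have dzc (s : orbit_cw C) : is_deg (radial (@cell_sphere_map R G X C f s)) setT (zc s).
  rewrite /zc /cell_sphere_map; case: s => -[[|[|n]] hn] s //=; rewrite /cell_of /orbit_dm /=.
    by case: s; rewrite radial_base; exact: is_deg_id.
  by rewrite wedge_cell_map; exact: dz.
rewrite /reduced_fixed_orbit_index (gcw_index_formula gf wedge_cellular hG gf (ghomotopic_refl R gf) dzc).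
pose F n (s : cell C n) : Ugroup G :=
  << (-1) ^+ n * zs' n s *g \pi_(conj_class G) (cell_type s) >>.
have -> : \sum_(s : orbit_cw C) << (-1) ^+ dm s * zc s *g \pi_(conj_class G) (orbit_tp s) >> =
    \sum_(i < 2) \sum_(s : cell C i) F i s.
  rewrite (@sig_big_dep _ _ _ _ (fun i : 'I_2 => cell C i : finType) predT (fun _ => predT)) /=.
  exact: eq_bigr.
rewrite big_ord_recl big_ord1 /=.
have -> : \sum_(s : cell C 0) F 0%N s = class_of (full_subgroup G).
  rewrite (big_pred1 tt); last by case.
  by rewrite /F expr0 mulr1.
rewrite addrC addKr; apply: eq_bigr => i _.
by rewrite /F /= expr1 mulN1r freegU_scale.
Qed.
End WedgeIndex.

(** * Self maps of the circle *)
Section Circle.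
Context {R : realType}.
Local Notation V := 'rV[R]_2.
Implicit Types (u v w : V) (a b t : R).

Definition turn : R := pi *+ 2.

(** The exponential [exp(i t)], with complex numbers as rows of length 2; [cmul] and [cpow] are
    complex multiplication and powers. *)
Definition cis t : V := \row_(j < 2) if j == 0 then cos t else sin t.

Definition cmul u v : V := \row_(j < 2)
  if j == 0 then u 0 0 * v 0 0 - u 0 1 * v 0 1 else u 0 0 * v 0 1 + u 0 1 * v 0 0.

Definition cpow m v : V := iter m (cmul v) (cis 0).

Lemma turn_gt0 : 0 < turn.
Proof. by rewrite /turn mulr2n addr_gt0 ?pi_gt0. Qed.

Lemma row2P u v : u 0 0 = v 0 0 -> u 0 1 = v 0 1 -> u = v.
Proof.
move=> e0 e1; apply/rowP => j; case: j => -[|[|//]] p.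
  by rewrite (_ : Ordinal p = 0)//; apply: val_inj.
by rewrite (_ : Ordinal p = 1)//; apply: val_inj.
Qed.

Lemma cis0E t : cis t 0 0 = cos t. Proof. by rewrite mxE. Qed.
Lemma cis1E t : cis t 0 1 = sin t. Proof. by rewrite mxE. Qed.
Lemma cmul0E u v : cmul u v 0 0 = u 0 0 * v 0 0 - u 0 1 * v 0 1. Proof. by rewrite mxE. Qed.
Lemma cmul1E u v : cmul u v 0 1 = u 0 0 * v 0 1 + u 0 1 * v 0 0. Proof. by rewrite mxE. Qed.

Lemma normsq2 v : normsq v = v 0 0 ^+ 2 + v 0 1 ^+ 2.
Proof.
rewrite /normsq big_ord_recl big_ord1; congr (_ + v 0 _ ^+ 2).
exact: val_inj.
Qed.

Lemma cis_sphere t : usphere (cis t).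
Proof. by rewrite /usphere /= normsq2 cis0E cis1E cos2Dsin2. Qed.

Lemma cisD a b : cis (a + b) = cmul (cis a) (cis b).
Proof.
apply: row2P; rewrite ?cmul0E ?cmul1E !cis0E !cis1E; first exact: cosD.
by rewrite sinD addrC.
Qed.

Lemma cmulC u v : cmul u v = cmul v u.
Proof. by apply: row2P; rewrite ?cmul0E ?cmul1E; ring. Qed.

Lemma cmulA u v w : cmul u (cmul v w) = cmul (cmul u v) w.
Proof. by apply: row2P; rewrite ?(cmul0E, cmul1E); ring. Qed.

Lemma cmulDr u v w : cmul u (v + w) = cmul u v + cmul u w.
Proof. by apply: row2P; rewrite ?(cmul0E, cmul1E, mxE); ring. Qed.

Lemma cmulZl c u v : cmul (c *: u) v = c *: cmul u v.
Proof. by apply: row2P; rewrite ?(cmul0E, cmul1E, mxE); ring. Qed.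

Lemma cmulZr c u v : cmul u (c *: v) = c *: cmul u v.
Proof. by rewrite cmulC cmulZl cmulC. Qed.

Lemma normsq_cmul u v : normsq (cmul u v) = normsq u * normsq v.
Proof. by rewrite !normsq2 cmul0E cmul1E; ring. Qed.

Lemma cpowS m v : cpow m.+1 v = cmul v (cpow m v). Proof. by []. Qed.

Lemma cpow_cis m t : cpow m (cis t) = cis (t *+ m).
Proof. by elim: m => [|m IH]; rewrite ?mulr0n// cpowS IH mulrS cisD. Qed.

Lemma cpowZ m c v : cpow m (c *: v) = c ^+ m *: cpow m v.
Proof.
elim: m => [|m IH]; first by rewrite scale1r.
by rewrite !cpowS IH cmulZl cmulZr scalerA exprS.
Qed.

Lemma cis_turn t (m : int) : cis (t + turn *~ m) = cis t.
Proof.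
have per k : cis (t + turn *+ k) = cis t.
  by apply: row2P; rewrite ?(cis0E, cis1E); [exact: (@periodicn R R cos turn (@cosD2pi R))|exact: (@periodicn R R sin turn (@sinD2pi R))].
case: m => k; first exact: per.
apply: row2P; rewrite NegzE mulrNz ?(cis0E, cis1E).
  by rewrite -[in RHS](subrK (turn *+ k.+1) t) (@periodicn R R cos turn (@cosD2pi R)).
by rewrite -[in RHS](subrK (turn *+ k.+1) t) (@periodicn R R sin turn (@sinD2pi R)).
Qed.

Lemma floor_turn t : 0 <= t - turn *~ Num.floor (t / turn) < turn.
Proof.
have T := turn_gt0; have /andP[h1 h2] := real_floor_itv (num_real (t / turn)).
rewrite -mulrzr subr_ge0 mulrC -ler_pdivlMr// h1 ltrBlDr -[X in _ < X + _]mul1r -mulrDl -ltr_pdivrMr//.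
by rewrite addrC -[1]/(1%:~R) -intrD.
Qed.

Lemma cis_eq1 t : 0 <= t < turn -> cis t = cis 0 -> t = 0.
Proof.
move=> /andP[t0 tT] e; apply/eqP; rewrite eq_le t0 andbT leNgt; apply/negP => tp.
have s0 : sin t = 0 by rewrite -cis1E e cis1E sin0.
have c1 : cos t = 1 by rewrite -cis0E e cis0E cos0.
have [tpi|tpi|tpi] := ltgtP t pi.
- by have := sin_gt0_pi (x := t); rewrite tp tpi s0 ltxx => /(_ isT).
- have : 0 < sin (t - pi).
    by apply: sin_gt0_pi; rewrite subr_gt0 tpi ltrBlDr -mulr2n.
  by rewrite -[sin _]opprK -sinDpi subrK s0 oppr0 ltxx.
- by move: c1; rewrite tpi cospi => /eqP; rewrite eq_sym -subr_eq0 opprK -mulr2n pnatr_eq0.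
Qed.

Lemma cis_inj a b : cis a = cis b -> exists m : int, a = b + turn *~ m.
Proof.
move=> e; exists (Num.floor ((a - b) / turn)).
have := cis_eq1 (floor_turn (a - b)); rewrite -[- (turn *~ _)]mulrNz cis_turn cisD e -cisD subrr => /(_ erefl).
by rewrite mulrNz => /eqP; rewrite subr_eq0 subr_eq addrC => /eqP.
Qed.

Lemma cis_onto v : usphere v -> exists2 t, 0 <= t < turn & v = cis t.
Proof.
rewrite /usphere /= normsq2 => v1.
suff [t vt] : exists t, v = cis t.
  exists (t - turn *~ Num.floor (t / turn)); first exact: floor_turn.
  by rewrite -mulrNz cis_turn.
have v01 : -1 <= v 0 0 <= 1 by apply/andP; split; nra.
have s2 : Num.sqrt (1 - v 0 0 ^+ 2) = `|v 0 1| by rewrite -v1 addrC addKr sqrtr_sqr.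
have cE : cos (acos (v 0 0)) = v 0 0 by rewrite acosK// in_itv.
have [v0|v0] := lerP 0 (v 0 1).
  by exists (acos (v 0 0)); apply: row2P; rewrite ?cis0E ?cis1E ?cE// sin_acos// s2 ger0_norm.
exists (- acos (v 0 0)); apply: row2P; rewrite ?cis0E ?cis1E ?cosN ?cE// sinN sin_acos// s2 ltr0_norm//.
by rewrite opprK.
Qed.

Lemma ctat_row2 (T : topologicalType) (f g : T -> R) p : ctat f p -> ctat g p ->
  ctat (fun q => \row_(j < 2) if j == 0 then f q else g q) p.
Proof. move=> cf cg; apply: ctat_row => j.
have -> : (fun q => (\row_(j < 2) if j == 0 then f q else g q) 0 j) = if j == 0 then f else g.
  by apply/funext => q; rewrite mxE; case: (j == 0).
by case: (j == 0). Qed.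

Lemma ctat_cis (T : topologicalType) (f : T -> R) p : ctat f p -> ctat (fun q => cis (f q)) p.
Proof.
move=> cf; apply: ctat_row2.
  by apply: (ctat_comp cf); exact: continuous_cos.
by apply: (ctat_comp cf); exact: continuous_sin.
Qed.

Lemma ctat_cmul (T : topologicalType) (f g : T -> V) p : ctat f p -> ctat g p -> ctat (fun q => cmul (f q) (g q)) p.
Proof.
move=> cf cg.
have cf0 : ctat (fun q => f q 0 0) p by exact: ctat_coord.
have cf1 : ctat (fun q => f q 0 1) p by exact: ctat_coord.
have cg0 : ctat (fun q => g q 0 0) p by exact: ctat_coord.
have cg1 : ctat (fun q => g q 0 1) p by exact: ctat_coord.
apply: ctat_row2; first by apply: ctatB; exact: ctatM.
by apply: ctatD; exact: ctatM.
Qed.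

Lemma ctat_cpow (T : topologicalType) (f : T -> V) m p : ctat f p -> ctat (fun q => cpow m (f q)) p.
Proof. by move=> cf; elim: m => [|m IH]; [exact: ctat_cst|exact: ctat_cmul]. Qed.
End Circle.

(** * Lifting along the covering of the circle *)

Section PathLifting.
Context {R : realType}.
Local Notation V := 'rV[R]_2.

Lemma within_subspace (T U : topologicalType) (A : set T) (f : T -> U) :
  (forall x : subspace A, A x -> @ctat (subspace A) U f x) -> {within A, continuous f}.
Proof.
move=> cf; apply/subspace_continuousP => x Ax.
by have := cf x Ax; rewrite /ctat nbhs_subspace_in.
Qed.

(** Together with [cwedge], the real and imaginary part of [conj(u) v]: the cosine and sine of the
    angle from [u] to [v]. *)
Definition cdot (u v : V) : R := u 0 0 * v 0 0 + u 0 1 * v 0 1.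
Definition cwedge (u v : V) : R := u 0 0 * v 0 1 - u 0 1 * v 0 0.

Lemma cdot_cwedge (u v : V) : usphere u -> usphere v -> cdot u v ^+ 2 + cwedge u v ^+ 2 = 1.
Proof.
rewrite /usphere /= !normsq2 => u1 v1.
transitivity ((u 0 0 ^+ 2 + u 0 1 ^+ 2) * (v 0 0 ^+ 2 + v 0 1 ^+ 2)); first by rewrite /cdot /cwedge; ring.
by rewrite u1 v1 mulr1.
Qed.

Lemma cdot_gt0 (u v : V) : usphere u -> usphere v -> `|v - u| < 1 -> 0 < cdot u v.
Proof.
move=> u1 v1 h.
have h0 := le_lt_trans (coord_le_norm (v - u) 0) h.
have h1 := le_lt_trans (coord_le_norm (v - u) 1) h.
move: u1 v1 h0 h1; rewrite /usphere /= !normsq2 !mxE !ltr_norml /cdot => u1 v1 /andP[a b] /andP[c d].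
have : (v 0 0 - u 0 0) ^+ 2 < 1 by nra.
have : (v 0 1 - u 0 1) ^+ 2 < 1 by nra.
by nra.
Qed.

Lemma cwedge_bound (u v : V) : usphere u -> usphere v -> 0 < cdot u v -> -1 < cwedge u v < 1.
Proof. by move=> u1 v1 c0; have := cdot_cwedge u1 v1 => h; apply/andP; split; nra. Qed.

Lemma cis_step (u v : V) t : usphere u -> usphere v -> 0 < cdot u v -> cis t = u ->
  cis (t + asin (cwedge u v)) = v.
Proof.
move=> u1 v1 c0 e; have /andP[b1 b2] := cwedge_bound u1 v1 c0.
have b : -1 <= cwedge u v <= 1 by rewrite !ltW.
have sE : sin (asin (cwedge u v)) = cwedge u v by rewrite asinK// in_itv.
have cE : cos (asin (cwedge u v)) = cdot u v.
  by rewrite cos_asin// -(cdot_cwedge u1 v1) addrK sqrtr_sqr ger0_norm// ltW.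
rewrite cisD e; move: u1; rewrite /usphere /= normsq2 => u1.
apply: row2P; rewrite ?(cmul0E, cmul1E) cis0E cis1E sE cE /cdot /cwedge.
  by rewrite -[RHS]mul1r -u1; ring.
by rewrite -[RHS]mul1r -u1; ring.
Qed.

Lemma ctat_cwedge (T : topologicalType) (f g : T -> V) p :
  ctat f p -> ctat g p -> ctat (fun q => cwedge (f q) (g q)) p.
Proof. by move=> cf cg; apply: ctatB; apply: ctatM; exact: ctat_coord. Qed.

Lemma asin_0 : asin (0 : R) = 0.
Proof.
rewrite -[in LHS](@sin0 R) sinK// in_itv /= oppr_le0.
by have := @pi_ge0 R => h; rewrite divr_ge0.
Qed.

Lemma within_uniform N (K : set 'rV[R]_N) (f : 'rV[R]_N -> V) : compact K ->
  {within K, continuous f} ->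
  exists2 r : R, 0 < r & forall b x, K b -> K x -> `|x - b| < r -> `|f x - f b| < 1.
Proof.
move=> cK /subspace_continuousP cf.
have [|r r0 h] := @compact_uniform R 'rV[R]_N K (fun b x => K b -> K x -> `|f x - f b| < 1) cK.
  move=> b Kb.
  have nb : \forall x \near b, K x -> `|f b - f x| < 2^-1.
    by have := cf b Kb => /cvgrPdist_lt/(_ 2^-1); rewrite invr_gt0 ltr0n => /(_ isT).
  exists ((fun x => K x -> `|f b - f x| < 2^-1), (fun x => K x -> `|f b - f x| < 2^-1)) => //.
  move=> [p q] [/= hp hq] Kp Kq.
  have -> : f q - f p = (f b - f p) - (f b - f q) by apply/rowP => i; rewrite !mxE; ring.
  apply: le_lt_trans (ler_normB _ _) _; rewrite (splitr 1) div1r.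
  by apply: ltrD; [exact: hp|exact: hq].
by exists r => // b x Kb Kx xb; exact: (h b Kb x xb Kb Kx).
Qed.

Section Convex.
Variables (N : nat) (K : set 'rV[R]_N) (p0 : 'rV[R]_N).
Hypothesis cK : compact K.
Hypothesis Kp : K p0.
Hypothesis Kstar : forall v (t : R), K v -> 0 <= t <= 1 -> K (p0 + t *: (v - p0)).

(** The lift adds up angles along the segment from [p0]. By uniform continuity consecutive values
    are closer than 1, so their scalar product is positive and the angle is [asin] of their wedge,
    which is continuous. *)
Lemma star_lift (f : 'rV[R]_N -> V) (t0 : R) : {within K, continuous f} ->
  (forall v, K v -> usphere (f v)) -> cis t0 = f p0 ->
  exists L : 'rV[R]_N -> R, [/\ {within K, continuous L}, forall v, K v -> cis (L v) = f v & L p0 = t0].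
Proof.
move=> cf f1 ft0; have [r r0 rP] := within_uniform cK cf.
have [M M0 MP] : exists2 M : R, 0 < M & forall v, K v -> `|v - p0| <= M.
  have [A [_ h]] := compact_bounded cK.
  exists (`|A| + 1 + `|p0|) => [|v Kv]; first by rewrite ltr_wpDr// ltr_wpDl.
  apply: le_trans (ler_normB _ _) _; rewrite lerD2r; apply: (h _ _ v Kv).
  by rewrite (le_lt_trans (ler_norm A))// ltrDl.
pose m := (Num.truncn (M / r)).+1.
have m0 : 0 < m%:R :> R by rewrite ltr0n.
have mP : M / m%:R < r by rewrite ltr_pdivrMr// mulrC -ltr_pdivrMr// truncnS_gt.
pose pt j v := p0 + (j%:R / m%:R) *: (v - p0).
have Kpt j v : (j <= m)%N -> K v -> K (pt j v).
  move=> jm Kv; apply: Kstar => //; rewrite divr_ge0//= ler_pdivrMr// mul1r ler_nat //.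
have dpt j v : K v -> `|pt j.+1 v - pt j v| < r.
  move=> Kv; have -> : pt j.+1 v - pt j v = m%:R^-1 *: (v - p0).
    by rewrite /pt opprD addrACA subrr add0r -scalerBl -mulrBl -natrB// subSnn div1r.
  rewrite normrZ ger0_norm ?invr_ge0 ?ltW//.
  apply: le_lt_trans mP; rewrite mulrC; apply: ler_wpM2r; first by rewrite invr_ge0 ltW.
  exact: MP.
pose L j v := t0 + \sum_(i < j) asin (cwedge (f (pt i v)) (f (pt i.+1 v))).
have gt0 j v : (j < m)%N -> K v -> 0 < cdot (f (pt j v)) (f (pt j.+1 v)).
  move=> jm Kv; have k1 := Kpt _ _ (ltnW jm) Kv; have k2 := Kpt _ _ jm Kv.
  by apply: cdot_gt0; [exact: f1|exact: f1|exact: rP (dpt _ _ Kv)].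
have LE j v : (j <= m)%N -> K v -> cis (L j v) = f (pt j v).
  move=> + Kv; elim: j => [|j IH] jm; first by rewrite /L big_ord0 addr0 ft0 /pt mul0r scale0r addr0.
  rewrite /L big_ord_recr addrA; apply: cis_step; [| |exact: gt0|exact/IH/ltnW].
    by apply: f1; apply: Kpt => //; exact: ltnW.
  by apply: f1; exact: Kpt.
have cpt j : (j <= m)%N -> {within K, continuous (fun v => f (pt j v))}.
  move=> jm; apply: (@within_precomp _ _ _ (pt j) f K K) => //; last by move=> v; exact: Kpt.
  apply: within_ctat => v _; apply: ctatDv; first exact: ctat_cst.
  by apply: ctatZ; [exact: ctat_cst|apply: ctatBv; [exact: ctat_id|exact: ctat_cst]].
have cL j : (j <= m)%N -> forall x : subspace K, K x -> @ctat (subspace K) R (L j) x.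
  elim: j => [|j IH] jm x Kx.
    by rewrite /L; under eq_fun do rewrite big_ord0; exact: ctat_cst.
  have -> : L j.+1 = fun v => L j v + asin (cwedge (f (pt j v)) (f (pt j.+1 v))).
    by apply/funext => v; rewrite /L big_ord_recr addrA.
  apply: ctatD; first exact: (IH (ltnW jm)).
  have c1 : @ctat (subspace K) V (fun v => f (pt j v)) x by exact: (cpt j (ltnW jm) x).
  have c2 : @ctat (subspace K) V (fun v => f (pt j.+1 v)) x by exact: (cpt j.+1 jm x).
  apply: (@ctat_comp _ _ _ (fun v : subspace K => cwedge (f (pt j v)) (f (pt j.+1 v))) asin).
    exact: (@ctat_cwedge (subspace K) (fun v => f (pt j v)) (fun v => f (pt j.+1 v)) x c1 c2).
  apply: continuous_asin; apply: cwedge_bound; [| |exact: gt0].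
    by apply: f1; apply: Kpt => //; exact: ltnW.
  by apply: f1; exact: Kpt.
have pt0 j : pt j p0 = p0 by rewrite /pt subrr scaler0 addr0.
exists (L m); split.
- by apply: within_subspace; exact: cL.
- by move=> v Kv; rewrite LE// /pt divff ?gt_eqF// scale1r addrC subrK.
- rewrite /L big1 ?addr0// => i _; rewrite !pt0 (_ : cwedge _ _ = 0) ?asin_0//.
  by rewrite /cwedge mulrC subrr.
Qed.

(** Along a segment the two lifts always differ by a multiple of [turn]; a nonzero difference at the
    end would force the value [turn / 2] in between. *)
Lemma star_lift_unique (L L' : 'rV[R]_N -> R) :
  {within K, continuous L} -> {within K, continuous L'} ->
  (forall v, K v -> cis (L v) = cis (L' v)) -> L p0 = L' p0 -> forall v, K v -> L v = L' v.
Proof.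
move=> cL cL' e e0 v Kv; apply: contrapT => ne.
pose g (t : R) := p0 + t *: (v - p0).
pose D t := `|L (g t) - L' (g t)|.
have cg (h : 'rV[R]_N -> R) : {within K, continuous h} -> {within `[0, 1], continuous (h \o g)}.
  apply: within_precomp => [|t]; last by rewrite /= in_itv/=; exact: Kstar.
  apply: within_ctat => t _; apply: ctatDv; first exact: ctat_cst.
  by apply: ctatZ; [exact: ctat_id|exact: ctat_cst].
have cD : {within `[0, 1], continuous D}.
  apply: within_subspace => t _.
  have c : @ctat (subspace (`[0, 1]%classic : set R)) R (fun t => L (g t) - L' (g t)) t.
    by apply: ctatB; [exact: cg cL t|exact: cg cL' t].
  exact: (cvg_norm c).
have D0 : D 0 = 0 by rewrite /D /g scale0r addr0 e0 subrr normr0.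
have [m mE] := cis_inj (e v Kv).
have T := @turn_gt0 R.
have D1 : turn <= D 1.
  have -> : D 1 = `|turn *~ m| by rewrite /D /g scale1r [p0 + _]addrC subrK mE addrC addKr.
  rewrite -mulrzr normrM gtr0_norm//; apply: ler_peMr; first exact: ltW.
  rewrite -intr_norm ler1z; have : m != 0 by apply/eqP => m0; apply: ne; rewrite mE m0 mulr0z addr0.
  by lia.
have [|c] := @IVT R D 0 1 (turn / 2) ler01 cD.
  by rewrite D0 min_l ?max_r ?(le_trans (ltW T) D1)//; apply/andP; split; lra.
rewrite in_itv /= => c01; rewrite /D.
have [k ->] := cis_inj (e _ (Kstar Kv c01)).
rewrite addrC addKr -mulrzr normrM gtr0_norm// => /(mulfI (lt0r_neq0 T)).
rewrite -intr_norm => /(congr1 (fun x => x * 2)); rewrite mulVf ?pnatr_eq0// -[2]/(2%:~R) -intrM.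
by move=> /eqP; rewrite -[1]/(1%:~R) eqr_int => /eqP; lia.
Qed.
End Convex.
End PathLifting.

(** * Singular chains and homology traces *)

Lemma bump0 j : bump 0 j = j.+1.
Proof. by []. Qed.

Section FreeLift.
Variables (K : choiceType) (M : lmodType int).
Implicit Types (f : K -> M) (c : {freeg K / int}).

Lemma fgliftB f c d : fglift f (c - d) = fglift f c - fglift f d.
Proof. exact: lift_is_additive. Qed.

Lemma fglift0 f : fglift f 0 = 0.
Proof. by have := fgliftB f 0 0; rewrite !subrr. Qed.

Lemma fgliftN f c : fglift f (- c) = - fglift f c.
Proof. by have := fgliftB f 0 c; rewrite fglift0 !sub0r. Qed.

Lemma fgliftD f c d : fglift f (c + d) = fglift f c + fglift f d.
Proof. by rewrite -[d]opprK fgliftB (fgliftN f (- d)). Qed.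

Lemma fglift_sum f (J : Type) (r : seq J) (F : J -> {freeg K / int}) :
  fglift f (\sum_(j <- r) F j) = \sum_(j <- r) fglift f (F j).
Proof. by rewrite (big_morph _ (fgliftD f) (fglift0 f)). Qed.

Lemma fgliftE f c : fglift f c = \sum_(k <- dom c) coeff k c *: f k.
Proof. by rewrite -{1}(freeg_sumE c) fglift_sum; apply: eq_bigr => k _; rewrite liftU. Qed.

Lemma fgliftU f k : fglift f << k >> = f k.
Proof. by rewrite liftU scale1r. Qed.

Lemma fgliftZ f (m : int) c : fglift f (m *: c) = m *: fglift f c.
Proof.
rewrite -[in LHS](freeg_sumE c) scaler_sumr fglift_sum fgliftE scaler_sumr.
by apply: eq_bigr => k _; rewrite freegU_scale !scalerA -freegU_scale liftU.
Qed.

Lemma eq_fglift f g c : (forall k, k \in dom c -> f k = g k) -> fglift f c = fglift g c.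
Proof. by move=> fg; rewrite !fgliftE; apply: eq_big_seq => k /fg ->. Qed.
End FreeLift.

Lemma fglift_comp (K K' : choiceType) (M : lmodType int) (f : K -> {freeg K' / int}) (g : K' -> M)
  (c : {freeg K / int}) : fglift g (fglift f c) = fglift (fun k => fglift g (f k)) c.
Proof.
rewrite [RHS]fgliftE (fgliftE f c) fglift_sum.
by apply: eq_bigr => k _; rewrite fgliftZ.
Qed.

Lemma fglift_id (K : choiceType) (c : {freeg K / int}) : fglift (fun k => << k >> : {freeg K / int}) c = c.
Proof. by rewrite fgliftE -[RHS]freeg_sumE; apply: eq_bigr => k _; rewrite [RHS]freegU_scale. Qed.

Lemma fglift_addf (K : choiceType) (M : lmodType int) (f g : K -> M) (c : {freeg K / int}) :
  fglift (fun k => f k + g k) c = fglift f c + fglift g c.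
Proof. by rewrite !fgliftE -big_split; apply: eq_bigr => k _; rewrite scalerDr. Qed.

Lemma fglift_oppf (K : choiceType) (M : lmodType int) (f : K -> M) (c : {freeg K / int}) :
  fglift (fun k => - f k) c = - fglift f c.
Proof. by rewrite !fgliftE -sumrN; apply: eq_bigr => k _; rewrite scalerN. Qed.

Section Chains.
Context {R : realType}.
Local Notation D := (simplex R).

Section ContinuousChains.
Context {Y : topologicalType}.
Local Notation ch n := (chain R Y n).

Definition cont_chain n (c : ch n) : Prop := forall s, s \in dom c -> continuous s.

Lemma singular_cont n (c : ch n) : singular_chain setT c <-> cont_chain c.
Proof. by split=> h s /h; [case|split]. Qed.

Lemma cont_chain0 n : cont_chain (0 : ch n).
Proof. by move=> s; rewrite dom0. Qed.

Lemma cont_chainD n (c d : ch n) : cont_chain c -> cont_chain d -> cont_chain (c + d).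
Proof. by move=> hc hd s /domD_subset; rewrite mem_cat => /orP[/hc|/hd]. Qed.

Lemma cont_chainN n (c : ch n) : cont_chain c -> cont_chain (- c).
Proof. by move=> hc s; rewrite domN => /hc. Qed.

Lemma cont_chainB n (c d : ch n) : cont_chain c -> cont_chain d -> cont_chain (c - d).
Proof. by move=> hc hd; apply: cont_chainD => //; exact: cont_chainN. Qed.

Lemma cont_chainZ n (m : int) (c : ch n) : cont_chain c -> cont_chain (m *: c).
Proof. by move=> hc s /domZ_subset/hc. Qed.

Lemma cont_chainU n (s : D n -> Y) : continuous s -> cont_chain (<< s >> : ch n).
Proof. by move=> cs t; rewrite domU1 inE => /eqP ->. Qed.

Lemma cont_chain_sum n (J : eqType) (r : seq J) (P : pred J) (F : J -> ch n) :
  (forall j, j \in r -> P j -> cont_chain (F j)) -> cont_chain (\sum_(j <- r | P j) F j).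
Proof.
move=> h; rewrite big_seq_cond; apply: (big_ind (@cont_chain n)) => [|c d|j /andP[jr Pj]].
- exact: cont_chain0.
- exact: cont_chainD.
- exact: h.
Qed.
End ContinuousChains.

Lemma cont_chain_lift (Y Z : topologicalType) n m (f : (D n -> Y) -> chain R Z m) (c : chain R Y n) :
  (forall s, continuous s -> cont_chain (f s)) -> cont_chain c -> cont_chain (fglift f c).
Proof.
move=> h hc; rewrite fgliftE; apply: cont_chain_sum => s sc _.
by apply: cont_chainZ; apply: h; exact: hc.
Qed.

Lemma simplex_inj n (v w : D n) : set_val v = set_val w -> v = w.
Proof. exact: val_inj. Qed.

Lemma face_mxE n (i : 'I_n.+2) (v : 'rV[R]_n.+1) (k : 'I_n.+2) :
  face_mx i v 0 k = if k == i then 0 else v 0 (inord (unbump i k)).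
Proof.
rewrite mxE; case: unliftP => [j ->|->]; last by rewrite eqxx.
rewrite eq_sym (negPf (neq_lift i j)) /=; congr (v 0 _); apply: val_inj.
by rewrite /= bumpK inordK.
Qed.

Lemma face_face n (i : 'I_n.+3) (j : 'I_n.+2) (v : D n) : (i <= j)%N ->
  face i (face j v) = face (fintype.lift ord0 j) (face (inord i) v).
Proof.
move=> ij; apply: simplex_inj; apply/rowP => k.
rewrite /= !face_mxE; have kn := ltn_ord k; have jn := ltn_ord j.
have i2 : (i < n.+2)%N by rewrite (leq_ltn_trans ij).
have ui : (unbump i k < n.+2)%N by rewrite /unbump; lia.
rewrite -!val_eqE /= bump0 !(inordK ui) (inordK i2).
have [kj|kj] := eqVneq (k : nat) j.+1.
  have -> : unbump i k = j by rewrite /unbump; lia.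
  by rewrite eqxx if_same.
have uj : (unbump j.+1 k < n.+2)%N by rewrite /unbump; lia.
rewrite (inordK uj); have [ki|ki] := eqVneq (k : nat) i.
  have -> : unbump j.+1 k = i by rewrite /unbump; lia.
  by rewrite eqxx.
have -> : (unbump i k == j) = false by apply/eqP; rewrite /unbump; lia.
have -> : (unbump j.+1 k == i) = false by apply/eqP; rewrite /unbump; lia.
by congr (set_val v 0 (inord _)); rewrite /unbump; lia.
Qed.

Section Boundary.
Context {Y : topologicalType}.
Local Notation ch n := (chain R Y n).

Lemma boundaryU n (s : D n.+1 -> Y) :
  boundary (<< s >> : ch n.+1) = \sum_(i < n.+2) (-1) ^+ i *: << s \o face i >>.
Proof. exact: fgliftU. Qed.

Lemma boundaryB n (c d : ch n.+1) : boundary (c - d) = boundary c - boundary d.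
Proof. exact: fgliftB. Qed.

Lemma boundaryD n (c d : ch n.+1) : boundary (c + d) = boundary c + boundary d.
Proof. exact: fgliftD. Qed.

Lemma boundaryN n (c : ch n.+1) : boundary (- c) = - boundary c.
Proof. exact: fgliftN. Qed.

Lemma boundary0 n : boundary (0 : ch n.+1) = 0.
Proof. exact: fglift0. Qed.

Lemma boundaryZ n (m : int) (c : ch n.+1) : boundary (m *: c) = m *: boundary c.
Proof. exact: fgliftZ. Qed.

Lemma boundary_sum n (J : Type) (r : seq J) (F : J -> ch n.+1) :
  boundary (\sum_(j <- r) F j) = \sum_(j <- r) boundary (F j).
Proof. exact: fglift_sum. Qed.

(** The term [(i, j)] with [i <= j] is paired with [(j + 1, i)]: by [face_face] the simplices agree,
    and the signs are opposite. *)
Lemma boundary_boundaryU n (s : D n.+2 -> Y) : boundary (boundary (<< s >> : ch n.+2)) = 0.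
Proof.
pose F (p : 'I_n.+3 * 'I_n.+2) : ch n := (-1) ^+ (p.1 + p.2) *: << s \o face p.1 \o face p.2 >>.
have -> : boundary (boundary (<< s >> : ch n.+2)) = \sum_p F p.
  rewrite boundaryU boundary_sum -(pair_bigA _ (fun i j => F (i, j))) /=.
  apply: eq_bigr => i _; rewrite boundaryZ boundaryU scaler_sumr.
  by apply: eq_bigr => j _; rewrite scalerA -exprD.
rewrite (bigID (fun p : 'I_n.+3 * 'I_n.+2 => (p.1 <= p.2)%N)) /=.
pose h (p : 'I_n.+3 * 'I_n.+2) : 'I_n.+3 * 'I_n.+2 := (fintype.lift ord0 p.2, inord p.1).
pose h' (p : 'I_n.+3 * 'I_n.+2) : 'I_n.+3 * 'I_n.+2 := (inord p.2, inord p.1.-1).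
rewrite [X in _ + X](reindex_onto h h') => [|[i j]] /=; last first.
  rewrite -ltnNge => ji; rewrite /h /h' /=.
  have j3 : (j < n.+3)%N by rewrite (ltn_trans (ltn_ord j)).
  have i2 : (i.-1 < n.+2)%N by have := ltn_ord i; lia.
  congr (_, _); apply: val_inj => /=; last by rewrite !inordK.
  by rewrite inordK// bump0 prednK//; exact: leq_ltn_trans ji.
rewrite [X in _ + X](eq_bigl (fun p : 'I_n.+3 * 'I_n.+2 => (p.1 <= p.2)%N)) => [|[i j]] /=; last first.
  rewrite -ltnNge /h /h' /= bump0.
  apply/idP/idP => [/andP[h1 /eqP[h2 h3]]|ij].
    have [ij|ij] := ltnP i n.+2; first by move: h1; rewrite inordK.
    have q := ltn_ord (inord i : 'I_n.+2).
    move: h2 => /(congr1 val) /=; rewrite inordK => [h2|]; last exact: ltnW.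
    by move: q; rewrite h2 ltnNge ij.
  have i2 : (i < n.+2)%N by rewrite (leq_ltn_trans ij).
  rewrite inordK// ltnS ij /=; apply/eqP; congr (_, _); apply: val_inj => /=.
    by rewrite inordK.
  by rewrite add0n (inordK (ltn_ord j)).
rewrite -big_split /= big1// => -[i j] /= ij.
have i2 : (i < n.+2)%N by rewrite (leq_ltn_trans ij).
have -> : F (h (i, j)) = - F (i, j).
  rewrite /F /h /= inordK// bump0 addSn exprS mulN1r scaleNr addnC; congr (- (_ *: << _ >>)).
  by apply/funext => v; exact: (congr1 s (esym (face_face v ij))).
by rewrite subrr.
Qed.

Lemma boundary_boundary n (c : ch n.+2) : boundary (boundary c) = 0.
Proof.
rewrite {1}/boundary /boundary fglift_comp fgliftE big1// => s _.
have := boundary_boundaryU s; rewrite boundaryU /boundary => ->.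
by rewrite scaler0.
Qed.
End Boundary.

Definition push_chain (Y Z : topologicalType) (f : Y -> Z) n (c : chain R Y n) : chain R Z n :=
  fglift (fun s : D n -> Y => << f \o s >> : chain R Z n) c.

Lemma boundary_push (Y Z : topologicalType) (f : Y -> Z) n (c : chain R Y n.+1) :
  boundary (push_chain f c) = push_chain f (boundary c).
Proof.
rewrite /push_chain /boundary !fglift_comp; apply: eq_fglift => s _.
rewrite fgliftU fglift_sum; apply: eq_bigr => i _.
by rewrite fgliftZ fgliftU.
Qed.

Lemma cont_push (Y Z : topologicalType) (f : Y -> Z) n (c : chain R Y n) :
  continuous f -> cont_chain c -> cont_chain (push_chain f c).
Proof.
move=> cf; apply: cont_chain_lift => s cs; apply: cont_chainU => v.
exact: (ctat_comp (cs v) (cf _)).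
Qed.

Lemma pushB (Y Z : topologicalType) (f : Y -> Z) n (c d : chain R Y n) : push_chain f (c - d) = push_chain f c - push_chain f d.
Proof. exact: fgliftB. Qed.

Lemma push_comp (Y Z W : topologicalType) (f : Y -> Z) (g : Z -> W) n (c : chain R Y n) :
  push_chain g (push_chain f c) = push_chain (g \o f) c.
Proof. by rewrite /push_chain fglift_comp; apply: eq_fglift => s _; rewrite fgliftU. Qed.

Section TraceUnique.
Variables (Y : topologicalType) (f : Y -> Y) (cf : continuous f) (n : nat).
Local Notation ch := (chain R Y n).
Local Notation T := (@torsion_class R Y setT n).

Lemma torsion_bd (c : ch) : is_boundary setT c -> T c.
Proof. by move=> h; exists 1; rewrite scale1r. Qed.

Lemma torsion0 : T 0.
Proof.
apply: torsion_bd; exists 0; split; last exact: boundary0.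
by apply/singular_cont; exact: cont_chain0.
Qed.

Lemma torsionD (c d : ch) : T c -> T d -> T (c + d).
Proof.
move=> [m [m0 [b [/singular_cont sb bE]]]] [k [k0 [b' [/singular_cont sb' bE']]]].
exists (k * m); split; first exact: mulf_neq0.
exists (k *: b + m *: b'); split.
  by apply/singular_cont; apply: cont_chainD; exact: cont_chainZ.
by rewrite boundaryD !boundaryZ bE bE' !scalerA scalerDr [m * k]mulrC.
Qed.

Lemma torsionZ (m : int) (c : ch) : T c -> T (m *: c).
Proof.
move=> [k [k0 [b [/singular_cont sb bE]]]]; exists k; split => //; exists (m *: b); split.
  by apply/singular_cont; exact: cont_chainZ.
by rewrite boundaryZ bE !scalerA mulrC.
Qed.

Lemma torsionN (c : ch) : T c -> T (- c).
Proof. by rewrite -scaleN1r; exact: torsionZ. Qed.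

Lemma torsion_sum (J : finType) (F : J -> ch) : (forall j, T (F j)) -> T (\sum_j F j).
Proof. by move=> h; apply: (big_ind T) => [|c d|j _]; [exact: torsion0|exact: torsionD|exact: h]. Qed.

Lemma torsion_push (c : ch) : T c -> T (chain_map f c).
Proof.
move=> [m [m0 [b [/singular_cont sb bE]]]]; exists m; split => //; exists (push_chain f b); split.
  by apply/singular_cont; exact: cont_push.
by rewrite boundary_push bE -[chain_map f c]/(push_chain f c) /push_chain fgliftZ.
Qed.

Definition tequiv (c d : ch) := T (c - d).

Lemma tequiv_sym c d : tequiv c d -> tequiv d c.
Proof. by move=> /torsionN; rewrite opprB. Qed.

Lemma tequiv_trans c d e : tequiv c d -> tequiv d e -> tequiv c e.
Proof. by move=> h1 h2; have := torsionD h1 h2; rewrite subrKA. Qed.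

Definition comb d (z : 'I_d -> ch) (a : 'rV[int]_d) : ch := \sum_i a 0 i *: z i.

Lemma comb_trans d d' (z : 'I_d -> ch) (w : 'I_d' -> ch) (A : 'M[int]_(d', d)) (a : 'rV_d') :
  (forall j, tequiv (w j) (comb z (row j A))) -> tequiv (comb w a) (comb z (a *m A)).
Proof.
move=> h; rewrite /tequiv.
have -> : comb w a - comb z (a *m A) = \sum_j a 0 j *: (w j - comb z (row j A)).
  under [RHS]eq_bigr do rewrite scalerBr.
  rewrite sumrB; congr (_ - _); rewrite /comb.
  under [RHS]eq_bigr do rewrite scaler_sumr.
  rewrite exchange_big; apply: eq_bigr => i _; rewrite mxE scaler_suml.
  by apply: eq_bigr => j _; rewrite scalerA mxE.
by apply: torsion_sum => j; apply: torsionZ; exact: h.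
Qed.

Lemma comb_map d (z : 'I_d -> ch) (a : 'rV_d) : chain_map f (comb z a) = comb (fun i => chain_map f (z i)) a.
Proof. by rewrite /chain_map /comb fglift_sum; apply: eq_bigr => i _; rewrite fgliftZ. Qed.

Lemma comb_delta d (z : 'I_d -> ch) (A : 'M[int]_d) j :
  row j A = row j 1%:M -> comb z (row j A) = z j.
Proof.
move=> ->; rewrite /comb (bigD1 j)//= !mxE eqxx scale1r big1 ?addr0// => i ij.
by rewrite !mxE eq_sym (negPf ij) scale0r.
Qed.

Lemma comb_inj d (z : 'I_d -> ch) (a b : 'rV_d) : (forall i, is_cycle setT (z i)) ->
  (forall c, is_cycle setT c -> exists! a : 'rV[int]_d, torsion_class setT (c - \sum_i a 0 i *: z i)) ->
  tequiv (comb z a) (comb z b) -> a = b.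
Proof.
move=> zc zb ab.
have cyc : is_cycle setT (comb z a).
  have lin : forall i, is_cycle setT (a 0 i *: z i).
    move=> i; have := zc i; case: (n) z {zc zb ab} => [|m] z /=.
      by move=> /singular_cont h; apply/singular_cont; exact: cont_chainZ.
    move=> [/singular_cont h h0]; split; first by apply/singular_cont; exact: cont_chainZ.
    by rewrite boundaryZ h0 scaler0.
  rewrite /comb; apply: (big_ind (@is_cycle R Y setT n)) => [|c d'|i _]; last exact: lin.
    case: (n) => [|m] /=; first by apply/singular_cont; exact: cont_chain0.
    by split; [apply/singular_cont; exact: cont_chain0|exact: boundary0].
  case: (n) c d' => [|m] c d' /=.
    by move=> /singular_cont hc /singular_cont hd; apply/singular_cont; exact: cont_chainD.
  move=> [/singular_cont hc hc0] [/singular_cont hd hd0]; split.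
    by apply/singular_cont; exact: cont_chainD.
  by rewrite boundaryD hc0 hd0 addr0.
have [x [_ xu]] := zb _ cyc.
have xa : x = a by apply: xu; rewrite -/(comb z a) subrr; exact: torsion0.
by rewrite -xa; apply: xu; exact: ab.
Qed.

(** Two bases modulo torsion are related by mutually inverse integer matrices that intertwine the
    matrices of [f]. Coordinates are rows here, hence the transposes. *)
Lemma homology_trace_uniq t t' : is_homology_trace R setT f n t -> is_homology_trace R setT f n t' -> t = t'.
Proof.
move=> [d [z [M [zc zb zM ->]]]] [d' [z' [M' [zc' zb' zM' ->]]]].
have [A AP] : exists A : 'M[int]_(d', d), forall j, tequiv (z' j) (comb z (row j A)).
  have /choice[g gP] : forall j, exists a, tequiv (z' j) (comb z a).
    by move=> j; have [a [h _]] := zb _ (zc' j); exists a.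
  by exists (\matrix_j g j) => j; rewrite rowK.
have [B BP] : exists B : 'M[int]_(d, d'), forall j, tequiv (z j) (comb z' (row j B)).
  have /choice[g gP] : forall j, exists a, tequiv (z j) (comb z' a).
    by move=> j; have [a [h _]] := zb' _ (zc j); exists a.
  by exists (\matrix_j g j) => j; rewrite rowK.
have fz j : tequiv (chain_map f (z j)) (comb z (row j M^T)).
  have := zM j; rewrite /tequiv /comb; congr (T (_ - _)).
  by apply: eq_bigr => i _; rewrite !mxE.
have fz' j : tequiv (chain_map f (z' j)) (comb z' (row j M'^T)).
  have := zM' j; rewrite /tequiv /comb; congr (T (_ - _)).
  by apply: eq_bigr => i _; rewrite !mxE.
have AM : A *m M^T = M'^T *m A.
  apply/row_matrixP => j; rewrite !row_mul; apply: (comb_inj zc zb).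
  apply: (@tequiv_trans _ (chain_map f (z' j))); last first.
    by apply: tequiv_trans (fz' j) _; exact: comb_trans.
  apply: tequiv_sym; apply: (@tequiv_trans _ (chain_map f (comb z (row j A)))).
    by have := torsion_push (AP j); rewrite /tequiv /chain_map fgliftB.
  by rewrite comb_map; exact: comb_trans.
have AB : A *m B = 1%:M.
  apply/row_matrixP => j; rewrite row_mul; apply: (comb_inj zc' zb').
  rewrite (@comb_delta _ z' 1%:M j)//; apply: tequiv_sym.
  by apply: tequiv_trans (AP j) _; exact: comb_trans.
have BA : B *m A = 1%:M.
  apply/row_matrixP => j; rewrite row_mul; apply: (comb_inj zc zb).
  rewrite (@comb_delta _ z 1%:M j)//; apply: tequiv_sym.
  by apply: tequiv_trans (BP j) _; exact: comb_trans.
rewrite -[RHS]mxtrace_tr -[M'^T]mulmx1 -AB mulmxA -AM -mulmxA mxtrace_mulC -mulmxA BA mulmx1.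
by rewrite mxtrace_tr.
Qed.
End TraceUnique.
End Chains.

Section Simplices.
Context {R : realType}.
Local Notation D := (simplex R).
Local Notation ch n := (chain R R n).

Definition csimplex n : set 'rV[R]_n.+1 := [set v | (forall i, 0 <= v 0 i) /\ \sum_i v 0 i = 1].

Lemma vertex_subproof n : csimplex (delta_mx 0 0 : 'rV[R]_n.+1).
Proof.
split=> [i|]; first by rewrite mxE ler0n.
rewrite (bigD1 ord0)//= mxE !eqxx big1 ?addr0// => i i0.
by rewrite mxE eqxx (negPf i0).
Qed.

Definition simplex_vertex n : D n := exist _ (delta_mx 0 0) (mem_set (@vertex_subproof n)).

Definition to_simplex n (v : 'rV[R]_n.+1) : D n := to_set (simplex_vertex n) v.

Lemma to_simplexK n (v : 'rV[R]_n.+1) : csimplex v -> set_val (to_simplex v) = v.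
Proof. exact: to_setK. Qed.

Lemma simplexP n (v : D n) : csimplex (set_val v).
Proof. exact: set_valP. Qed.

Lemma simplex_valK n (v : D n) : to_simplex (set_val v) = v.
Proof. exact: set_valK. Qed.

Lemma csimplex_le1 n (v : 'rV[R]_n.+1) i : csimplex v -> v 0 i <= 1.
Proof. by move=> [v0 <-]; rewrite (bigD1 i)//= lerDl sumr_ge0. Qed.

Lemma csimplex_star n (p v : 'rV[R]_n.+1) (t : R) : csimplex p -> csimplex v -> 0 <= t <= 1 ->
  csimplex (p + t *: (v - p)).
Proof.
move=> [p0 p1] [v0 v1] /andP[t0 t1]; split=> [i|].
  by rewrite !mxE; have := p0 i; have := v0 i; nra.
under eq_bigr do rewrite !mxE.
by rewrite big_split /= -mulr_sumr sumrB p1 v1 subrr mulr0 addr0.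
Qed.

Lemma closed_csimplex n : closed (@csimplex n).
Proof.
have -> : @csimplex n = (\bigcap_(i in [set: 'I_n.+1]) (fun v : 'rV[R]_n.+1 => v 0 i) @^-1` [set x | 0 <= x]) `&`
    (fun v : 'rV[R]_n.+1 => \sum_i v 0 i) @^-1` [set 1].
  apply/seteqP; split => v /=; first by move=> [h1 h2]; split => // i _; exact: h1.
  by move=> [h1 h2]; split => // i; exact: (h1 i I).
apply: closedI.
  apply: closed_bigI => i _; apply: closed_comp => [v _|]; last exact: closed_ge.
  by apply: (@ctat_coord _ _ _ id); exact: ctat_id.
apply: closed_comp => [v _|]; last by apply: compact_closed; [exact: norm_hausdorff|exact: compact_set1].
by apply: ctat_sum => i; apply: (@ctat_coord _ _ _ id); exact: ctat_id.
Qed.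

Lemma compact_csimplex n : compact (@csimplex n).
Proof.
apply: (subclosed_compact (@closed_csimplex n) (@compact_cdisc R n.+1)) => v cv.
have [v0 v1] := cv; rewrite /cdisc /= /normsq -v1; apply: ler_sum => i _.
by rewrite expr2 ler_piMr// csimplex_le1.
Qed.

Lemma to_simplex_within n : {within @csimplex n, continuous (@to_simplex n)}.
Proof. exact: to_set_within. Qed.

Lemma simplex_ctat n (Z : topologicalType) (g : 'rV[R]_n.+1 -> Z) :
  {within @csimplex n, continuous g} -> continuous (fun v : D n => g (set_val v)).
Proof.
move=> cg v; apply: (ctat_within (B := @csimplex n)) => //; last exact: set_val_ctat.
by apply: (@filterS _ (nbhs v) _ setT) => [w _|]; [exact: simplexP|exact: filterT].
Qed.

Lemma into_simplex n (Z : topologicalType) (g : Z -> D n) z :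
  ctat (fun x => set_val (g x)) z -> ctat g z.
Proof.
move=> cg; have -> : g = fun x => to_simplex (set_val (g x)).
  by apply/funext => x; rewrite simplex_valK.
apply: (ctat_within (B := @csimplex n)) => //; first exact: to_simplex_within.
by apply: (@filterS _ (nbhs z) _ setT) => [w _|]; [exact: simplexP|exact: filterT].
Qed.

Lemma ctat_simplex_coord n i (v : D n) : ctat (fun w : D n => set_val w 0 i) v.
Proof. by apply: (@ctat_coord _ _ _ (@set_val _ (@csimplex n))); exact: set_val_ctat. Qed.

Lemma face_continuous n (i : 'I_n.+2) : continuous (@face R n i).
Proof.
move=> v; apply: into_simplex; apply: ctat_row => j.
have -> : (fun w : D n => set_val (face i w) 0 j) = fun w => if j == i then 0 else set_val w 0 (inord (unbump i j)).
  by apply/funext => w; rewrite -face_mxE.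
by case: (j == i); [exact: ctat_cst|exact: ctat_simplex_coord].
Qed.

Lemma cont_boundary (Y : topologicalType) n (c : chain R Y n.+1) : cont_chain c -> cont_chain (boundary c).
Proof.
apply: cont_chain_lift => s cs; apply: cont_chain_sum => i _ _; apply: cont_chainZ.
by apply: cont_chainU => v; apply: (@ctat_comp _ _ _ (face i) s); [exact: face_continuous|exact: cs].
Qed.

Lemma simplex_lift n (s : D n -> 'rV[R]_2) (t0 : R) : continuous s -> (forall v, usphere (s v)) ->
  cis t0 = s (simplex_vertex n) ->
  exists L : D n -> R, [/\ continuous L, forall v, cis (L v) = s v & L (simplex_vertex n) = t0].
Proof.
move=> cs s1 st; have [] := @star_lift R n.+1 (@csimplex n) (delta_mx 0 0) (@compact_csimplex n)
  _ (s \o @to_simplex n) t0.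
- by move=> v t cv; apply: csimplex_star => //; exact: vertex_subproof.
- apply: (@within_precomp _ _ _ (@to_simplex n) s _ setT) => //; first exact: to_simplex_within.
  exact: continuous_subspaceT.
- by move=> v _; exact: s1.
- rewrite st /=; congr s; apply: simplex_inj; rewrite to_simplexK//; exact: vertex_subproof.
move=> L [cL LE L0]; exists (fun v => L (set_val v)); split => //.
  exact: simplex_ctat.
by move=> v; rewrite LE /= ?simplex_valK//; exact: simplexP.
Qed.

Lemma simplex_lift_unique n (L L' : D n -> R) : continuous L -> continuous L' ->
  (forall v, cis (L v) = cis (L' v)) -> L (simplex_vertex n) = L' (simplex_vertex n) -> L = L'.
Proof.
move=> cL cL' e e0; apply/funext => v.
have w (F : D n -> R) : continuous F -> {within @csimplex n, continuous (F \o @to_simplex n)}.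
  move=> cF; apply: (@within_precomp _ _ _ (@to_simplex n) F _ setT) => //; first exact: to_simplex_within.
  exact: continuous_subspaceT.
have v0 : to_simplex (delta_mx 0 0) = simplex_vertex n.
  by apply: simplex_inj; rewrite to_simplexK//; exact: vertex_subproof.
have := @star_lift_unique R n.+1 (@csimplex n) (delta_mx 0 0) _
  (L \o @to_simplex n) (L' \o @to_simplex n) (w _ cL) (w _ cL') _ _ (set_val v) (simplexP v).
rewrite /= simplex_valK; apply.
- by move=> u t cu; apply: csimplex_star => //; exact: vertex_subproof.
- by move=> u _; exact: e.
- by rewrite v0.
Qed.

Definition tail n (v : 'rV[R]_n.+2) : 'rV[R]_n.+1 := \row_j v 0 (fintype.lift ord0 j).

(** The join with the point 0 of the line. At the cone point the inner argument is a default value,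
    multiplied by 0. *)
Definition cone n (s : D n -> R) (v : D n.+1) : R :=
  (1 - set_val v 0 0) * s (to_simplex ((1 - set_val v 0 0)^-1 *: tail (set_val v))).

Lemma tail_simplex n (v : D n.+1) : set_val v 0 0 != 1 ->
  csimplex ((1 - set_val v 0 0)^-1 *: tail (set_val v)).
Proof.
have [v0 v1] := simplexP v; have := csimplex_le1 0 (simplexP v).
rewrite le_eqVlt => /predU1P[->|h _]; first by rewrite eqxx.
have p : 0 < 1 - set_val v 0 0 by rewrite subr_gt0.
split=> [i|]; first by rewrite !mxE; apply: mulr_ge0; [rewrite invr_ge0 ltW|exact: v0].
under eq_bigr do rewrite !mxE.
have E : 1 - set_val v 0 0 = \sum_i set_val v 0 (fintype.lift ord0 i).
  transitivity (\sum_i set_val v 0 i - set_val v 0 0); first by rewrite v1.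
  by rewrite big_ord_recl addrC addKr.
by rewrite -mulr_sumr -E mulVf// gt_eqF.
Qed.

Lemma cone_face0 n (s : D n -> R) : cone s \o face ord0 = s.
Proof.
apply/funext => v; rewrite /cone /=.
have -> : face_mx ord0 (set_val v) 0 0 = 0 by rewrite face_mxE eqxx.
rewrite subr0 mul1r invr1 scale1r; congr s; rewrite -[RHS]simplex_valK; congr to_simplex.
by apply/rowP => j; rewrite !mxE liftK.
Qed.

Lemma cone_face n (s : D n.+1 -> R) (i : 'I_n.+2) :
  cone s \o face (fintype.lift ord0 i) = cone (s \o face i).
Proof.
apply/funext => v; rewrite /cone /=.
have e0 : face_mx (fintype.lift ord0 i) (set_val v) 0 0 = set_val v 0 0.
  by rewrite face_mxE /= (_ : inord _ = 0)//; apply: val_inj; rewrite /= inordK.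
rewrite e0; have [->|v1] := eqVneq (set_val v 0 0) 1; first by rewrite subrr !mul0r.
congr (_ * s _); apply: simplex_inj.
rewrite -[RHS]/(face_mx i (set_val (to_simplex _))) (to_simplexK (tail_simplex v1)).
have te : (1 - set_val v 0 0)^-1 *: tail (face_mx (fintype.lift ord0 i) (set_val v)) =
    face_mx i ((1 - set_val v 0 0)^-1 *: tail (set_val v)).
  apply/rowP => j; rewrite mxE mxE !face_mxE (inj_eq (@lift_inj _ ord0)).
  case: eqP => [_|ji]; first by rewrite mulr0.
  rewrite mxE mxE; congr (_ * set_val v 0 _); apply: val_inj => /=; rewrite !bump0.
  have jn := ltn_ord j; have ij : (j : nat) <> i by move=> h; apply: ji; exact: val_inj.
  have iN := ltn_ord i.
  rewrite !inordK /unbump; lia.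
rewrite -te -[set_val (face _ v)]/(face_mx (fintype.lift ord0 i) (set_val v)) to_simplexK//.
have <- : set_val (face (fintype.lift ord0 i) v) 0 0 = set_val v 0 0 by [].
by apply: tail_simplex; rewrite /= e0.
Qed.

Lemma cone_point (s : D 0 -> R) : cone s \o face (fintype.lift ord0 ord0) = cst 0.
Proof.
apply/funext => v; rewrite /cone /=.
have -> : face_mx (fintype.lift ord0 ord0) (set_val v) 0 0 = 1.
  transitivity (\sum_i set_val v 0 i); last exact: (simplexP v).2.
  rewrite big_ord1 face_mxE /=; congr (set_val v 0 _).
  by apply: val_inj; rewrite /= inordK.
by rewrite subrr mul0r.
Qed.

Lemma compact_simplex n : compact [set: D n].
Proof. exact: (compact_set_type (simplex_vertex n) (@compact_csimplex n)). Qed.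

Lemma cone_continuous n (s : D n -> R) : continuous s -> continuous (cone s).
Proof.
move=> cs v; have c0 : ctat (fun w : D n.+1 => 1 - set_val w 0 0) v.
  by apply: ctatB; [exact: ctat_cst|exact: ctat_simplex_coord].
have [v1|v1] := eqVneq (set_val v 0 0) 1.
  (* At the cone point the factor tends to 0 and compactness of the simplex bounds [s]. *)
  have [M Mb] : exists M : R, forall w, `|s w| <= M.
    have /compact_bounded[A [_ h]] : compact (s @` setT).
      by apply: continuous_compact; [exact: continuous_subspaceT|exact: compact_simplex].
    by exists (A + 1) => w; apply: (h (A + 1)); [rewrite ltrDl|exists w].
  apply: (@ctat_scale0 R (D n.+1) R^o (fun w => 1 - set_val w 0 0)
    (fun w => s (to_simplex ((1 - set_val w 0 0)^-1 *: tail (set_val w)))) M v c0); first by rewrite v1 subrr.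
  by apply: (@filterS _ (nbhs v) _ setT) => [w _|]; [right; exact: Mb|exact: filterT].
apply: (@ctatM (D n.+1) R (fun w => 1 - set_val w 0 0)
  (fun w => s (to_simplex ((1 - set_val w 0 0)^-1 *: tail (set_val w)))) v c0).
have ne : 1 - set_val v 0 0 != 0 by rewrite subr_eq0 eq_sym.
apply: (ctat_comp (f := fun w : D n.+1 => to_simplex ((1 - set_val w 0 0)^-1 *: tail (set_val w)))); last exact: cs.
apply: (ctat_within (B := @csimplex n)); first exact: to_simplex_within.
  have nv : nbhs v [set w : D n.+1 | 1 - set_val w 0 0 != 0] by exact: (cvgr_neq0 _ c0 ne).
  apply: (@filterS _ (nbhs v) _ [set w : D n.+1 | 1 - set_val w 0 0 != 0]) nv => w; rewrite /=  subr_eq0 eq_sym; exact: tail_simplex.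
apply: ctatZ; first by apply: ctatV.
by apply: ctat_row => j; under eq_fun do rewrite mxE; exact: ctat_simplex_coord.
Qed.

Definition Cone n : ch n -> ch n.+1 := fglift (fun s : D n -> R => << cone s >> : ch n.+1).

Lemma cont_Cone n (c : ch n) : cont_chain c -> cont_chain (Cone c).
Proof. by apply: cont_chain_lift => s cs; apply: cont_chainU; exact: cone_continuous. Qed.

(** Coning contracts the singular complex of the line; in dimension 0 the augmentation remains. *)
Lemma boundary_Cone n (c : ch n.+1) : boundary (Cone c) = c - Cone (boundary c).
Proof.
rewrite /boundary /Cone !fglift_comp -[X in X - _](fglift_id c) -fglift_oppf -fglift_addf.
apply: eq_fglift => s _; rewrite fgliftU big_ord_recl expr0 scale1r cone_face0; congr (_ + _).
rewrite fglift_sum -sumrN; apply: eq_bigr => i _.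
rewrite fgliftZ fgliftU cone_face -scaleNr; congr (_ *: _).
by rewrite /= bump0 exprS mulN1r.
Qed.

Definition point_chain (m : int) (t : R) : ch 0 := m *: << cst t >>.

Definition aug (Y : topologicalType) (c : chain R Y 0) : int := fglift (fun=> (1 : int^o)) c.

Lemma augZ (Y : topologicalType) (c : chain R Y 0) (M : lmodType int) (x : M) :
  aug c *: x = fglift (fun=> x) c.
Proof.
rewrite /aug !fgliftE scaler_suml; apply: eq_bigr => k _; congr (_ *: _); exact: mulr1.
Qed.

Lemma boundary_Cone0 (c : ch 0) : boundary (Cone c) = c - point_chain (aug c) 0.
Proof.
rewrite /boundary /Cone !fglift_comp /point_chain augZ -[X in X - _](fglift_id c).
rewrite -fglift_oppf -fglift_addf.
apply: eq_fglift => s _; rewrite fgliftU big_ord_recl big_ord1 expr0 scale1r cone_face0; congr (_ + _).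
by rewrite /= bump0 expr1 scaleN1r cone_point.
Qed.
End Simplices.

(** * The homology of the circle from the chains of the line *)

Section CircleHomology.
Context {R : realType}.
Local Notation D := (simplex R).
Local Notation Y := (sphere R 1).
Local Notation ch n := (chain R R n).
Local Notation chY n := (chain R Y n).

Definition cisp (t : R) : Y := exist _ (cis t) (mem_set (cis_sphere t)).
Definition turns (m : int) (t : R) : R := t + turn *~ m.

Lemma cisp_inj a b : cisp a = cisp b <-> cis a = cis b.
Proof. by split=> [/(congr1 set_val)//|h]; exact: sphere_inj. Qed.

Lemma cisp_continuous : continuous cisp.
Proof.
have h : {within setT, continuous cisp}.
  by apply: set_type_within; apply: within_ctat => t _; apply: ctat_cis; exact: ctat_id.
by move=> t; apply: (@ctat_within _ _ _ id cisp setT t h); [exact: filterT|exact: ctat_id].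
Qed.

Lemma cisp_shift m : cisp \o turns m = cisp.
Proof. by apply/funext => t; apply/cisp_inj; exact: cis_turn. Qed.

Lemma shift_shift m k : turns m \o turns k = turns (k + m).
Proof. by apply/funext => t; rewrite /turns /= mulrzDr addrA. Qed.

Lemma shift0 : turns 0 = id.
Proof. by apply/funext => t; rewrite /turns mulr0z addr0. Qed.

Lemma shift_continuous m : continuous (turns m).
Proof. by move=> t; apply: ctatD; [exact: ctat_id|exact: ctat_cst]. Qed.

Lemma cis_inj_itv a b : 0 <= a < turn -> 0 <= b < turn -> cis a = cis b -> a = b :> R.
Proof.
move=> /andP[a0 aT] /andP[b0 bT] /cis_inj[m e]; have T := @turn_gt0 R.
have [m0|m0|m0] := ltgtP m 0; last by rewrite e m0 mulr0z addr0.
- have : turn *~ m <= - turn :> R.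
    by rewrite -mulrN1z ler_pMz2l//; lia.
  by move=> h; move: a0; rewrite e; lra.
- have : turn <= turn *~ m :> R by rewrite -[X in X <= _]mulr1z ler_pMz2l//; lia.
  by move=> h; move: aT; rewrite e; lra.
Qed.

(** A choice of lift for each simplex, by the position of its first vertex. It is not compatible
    with faces: the face of a chosen lift may be off by some turns, which [level] counts. *)
Definition clift n (s : D n -> Y) : D n -> R := xget (cst 0)
  [set L | [/\ continuous L, forall v, cisp (L v) = s v & 0 <= L (simplex_vertex n) < turn]].

Lemma cliftP n (s : D n -> Y) : continuous s ->
  [/\ continuous (clift s), forall v, cisp (clift s v) = s v & 0 <= clift s (simplex_vertex n) < turn].
Proof.
move=> cs; have [t t0 tE] := cis_onto (sphere_usphere (s (simplex_vertex n))).
have [|||L [cL LE L0]] := @simplex_lift R n (fun v => set_val (s v)) t.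
- by move=> v; apply: (ctat_comp (f := s)); [exact: cs|exact: set_val_ctat].
- by move=> v; exact: sphere_usphere.
- by rewrite tE.
rewrite /clift; case: xgetP => [_ -> //|/(_ L)[]]; split=> [//|v|]; last by rewrite L0.
by apply: sphere_inj; exact: LE.
Qed.

Lemma clift_uniq n (s : D n -> Y) L : continuous s -> continuous L -> (forall v, cisp (L v) = s v) ->
  0 <= L (simplex_vertex n) < turn -> clift s = L.
Proof.
move=> cs cL LE L0; have [cl lE l0] := cliftP cs.
have e v : cis (clift s v) = cis (L v) by apply/cisp_inj; rewrite lE LE.
by apply: simplex_lift_unique => //; exact: cis_inj_itv.
Qed.

Definition level n (r : D n -> R) : int := Num.floor (r (simplex_vertex n) / turn).

Lemma levelE n (r : D n -> R) : continuous r -> r = turns (level r) \o clift (cisp \o r).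
Proof.
move=> cr; have crs : continuous (turns (- level r) \o r).
  by move=> v; apply: (@ctat_comp _ _ _ r (turns (- level r))); [exact: cr|exact: shift_continuous].
have -> : clift (cisp \o r) = turns (- level r) \o r.
  apply: clift_uniq => //.
  - by move=> v; apply: (@ctat_comp _ _ _ r cisp); [exact: cr|exact: cisp_continuous].
  - by move=> v; exact: (congr1 (fun f => f (r v)) (cisp_shift _)).
  - by rewrite /turns /= mulrNz; exact: floor_turn.
by apply/funext => v /=; rewrite /turns -addrA -mulrzDr addNr mulr0z addr0.
Qed.

(** A telescoping sum, for either sign of [m]: applying [tau] and subtracting leaves the translate
    by [m] turns minus [r]. *)
Definition run n (m : int) (r : D n -> R) : ch n :=
  match m with
  | Posz k => \sum_(i < k) << turns i \o r >>
  | Negz k => - \sum_(i < k.+1) << turns (Negz i) \o r >>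
  end.

Local Notation tau := (push_chain (turns 1)).

Lemma tauU n (r : D n -> R) : tau (<< r >> : ch n) = << turns 1 \o r >>.
Proof. exact: fgliftU. Qed.

Lemma run_tau n m (r : D n -> R) : tau (run m r) - run m r = << turns m \o r >> - << r >>.
Proof.
have sh (i : int) : tau (<< turns i \o r >> : ch n) = << turns (i + 1) \o r >>.
  by rewrite tauU; congr (<< _ >>); rewrite compA shift_shift.
case: m => k.
  rewrite /= /push_chain fglift_sum -sumrB; elim: k => [|k IH].
    by rewrite big_ord0 (_ : turns _ = id) ?subrr//; exact: shift0.
  rewrite big_ord_recr /= IH -/(push_chain _ _) sh addrC.
  have -> : (k : int) + 1 = k.+1 by rewrite -natz natr1 natz.
  by rewrite subrKA.
have -> : tau (run (Negz k) r) - run (Negz k) r =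
    \sum_(i < k.+1) ((<< turns (Negz i) \o r >> : ch n) - << turns (- (i : int)) \o r >>).
  rewrite /run /push_chain fgliftN fglift_sum opprK addrC -sumrB.
  apply: eq_bigr => i _; rewrite -/(push_chain _ _) sh; congr (_ - << turns _ \o _ >>).
  by lia.
rewrite NegzE; elim: k.+1 => [|j IH]; first by rewrite big_ord0 oppr0 shift0 subrr.
by rewrite big_ord_recr /= IH addrC NegzE subrKA.
Qed.

Lemma aug_sum (Z : topologicalType) (J : Type) (r : seq J) (F : J -> chain R Z 0) :
  aug (\sum_(j <- r) F j) = \sum_(j <- r) aug (F j).
Proof. exact: (@fglift_sum _ int^o). Qed.

Lemma augU (Z : topologicalType) (s : D 0 -> Z) : aug (<< s >> : chain R Z 0) = 1.
Proof. exact: (@fgliftU _ int^o). Qed.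

Lemma aug_run m (r : D 0 -> R) : aug (run m r) = m.
Proof.
case: m => k; rewrite /run ?NegzE; last first.
  rewrite /aug fgliftN; congr (- _); rewrite -/(aug _) aug_sum.
  by under eq_bigr do rewrite augU; rewrite sumr_const card_ord natz.
by rewrite aug_sum; under eq_bigr do rewrite augU; rewrite sumr_const card_ord natz.
Qed.

Lemma cont_run n m (r : D n -> R) : continuous r -> cont_chain (run m r).
Proof.
move=> cr; have h i : cont_chain (<< turns i \o r >> : ch n).
  by apply: cont_chainU => v; apply: (@ctat_comp _ _ _ r (turns i)); [exact: cr|exact: shift_continuous].
by case: m => k; [|apply: cont_chainN]; apply: cont_chain_sum => i _ _; exact: h.
Qed.

Definition project_chain n (c : ch n) : chY n := push_chain cisp c.
Definition lift_chain n : chY n -> ch n := fglift (fun s : D n -> Y => << clift s >> : ch n).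
(** Division by [tau - 1]. With [tau_climb] and the injectivity from [tau_fixed] it plays the part
    of the exact sequence of the covering. *)
Definition climb n : ch n -> ch n := fglift (fun r : D n -> R => run (level r) (clift (cisp \o r))).

Lemma cont_down n (c : ch n) : cont_chain c -> cont_chain (project_chain c).
Proof. exact/cont_push/cisp_continuous. Qed.

Lemma cont_cisp n (r : D n -> R) : continuous r -> continuous (cisp \o r).
Proof. by move=> cr v; apply: (@ctat_comp _ _ _ r cisp); [exact: cr|exact: cisp_continuous]. Qed.

Lemma cont_up n (c : chY n) : cont_chain c -> cont_chain (lift_chain c).
Proof. by apply: cont_chain_lift => s cs; apply: cont_chainU; have [] := cliftP cs. Qed.

Lemma cont_climb n (c : ch n) : cont_chain c -> cont_chain (climb c).
Proof.
apply: cont_chain_lift => s cs; apply: cont_run.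
by have [] := cliftP (cont_cisp cs).
Qed.

Lemma cont_tau n (c : ch n) : cont_chain c -> cont_chain (tau c).
Proof. exact/cont_push/shift_continuous. Qed.

Lemma down_up n (c : chY n) : cont_chain c -> project_chain (lift_chain c) = c.
Proof.
move=> cc; rewrite /project_chain /lift_chain /push_chain fglift_comp -[RHS]fglift_id.
apply: eq_fglift => s /cc cs; rewrite fgliftU; congr (<< _ >>).
by apply/funext => v /=; have [] := cliftP cs.
Qed.

Lemma down_tau n (c : ch n) : project_chain (tau c) = project_chain c.
Proof. by rewrite /project_chain push_comp cisp_shift. Qed.

Lemma tau_climb n (c : ch n) : cont_chain c -> tau (climb c) - climb c = c - lift_chain (project_chain c).
Proof.
move=> cc; rewrite /climb /lift_chain /project_chain /push_chain !fglift_comp -[X in _ = X - _](fglift_id c).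
rewrite -!fglift_oppf -!fglift_addf; apply: eq_fglift => r /cc cr.
by rewrite fgliftU [LHS]run_tau -levelE.
Qed.

Lemma coeff_push (Z W : topologicalType) (h : Z -> W) n (c : chain R Z n) s :
  injective h -> coeff (h \o s) (push_chain h c) = coeff s c.
Proof.
move=> hi; rewrite /push_chain fgliftE -[in RHS](freeg_sumE c) !raddf_sum /=.
apply: eq_bigr => k _; rewrite coeffZ !coeffU mul1r; congr (_ * _%:R).
have [->|ks] := eqVneq k s; first by rewrite !eqxx.
case: eqP => // e; exfalso; move/eqP: ks; apply.
by apply/funext => v; apply: hi; exact: (congr1 (fun f => f v) e).
Qed.

Lemma shift_inj m : injective (turns m).
Proof. by move=> a b /addIr. Qed.

(** A finite support that is stable under translation by [turn] is empty. *)
Lemma tau_fixed n (c : ch n) : tau c = c -> c = 0.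
Proof.
move=> tc; apply/eqP; rewrite -dom_eq0; apply: contrapT => /negP.
case E : (dom c) => [//|r l] _.
have rc : r \in dom c by rewrite E inE eqxx.
have it (j : nat) : turns j \o r \in dom c.
  elim: j => [|j IH]; first by rewrite (_ : _ \o r = r)//; apply/funext => v; rewrite /= /turns mulr0z addr0.
  have -> : turns j.+1 \o r = turns 1 \o (turns j \o r).
    by rewrite compA shift_shift -natz -natr1 natz.
  by rewrite mem_dom -{1}tc coeff_push -?mem_dom//; exact: shift_inj.
have /uniq_leq_size h : uniq [seq turns (j : nat) \o r | j <- iota 0 (size (dom c)).+1].
  rewrite map_inj_uniq ?iota_uniq// => i j /(congr1 (fun f => f (simplex_vertex n))) /= /addrI.
  by move=> /(mulrIn (lt0r_neq0 (@turn_gt0 R))).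
have /h : {subset [seq turns (j : nat) \o r | j <- iota 0 (size (dom c)).+1] <= dom c}.
  by move=> s /mapP[j _ ->].
by rewrite size_map size_iota ltnn.
Qed.

Lemma tau_eq n (b c : ch n) : tau b - b = tau c - c -> b = c.
Proof.
move=> e; apply/eqP; rewrite -subr_eq0; apply/eqP/tau_fixed.
move/eqP: e; rewrite subr_eq pushB => /eqP ->.
by rewrite addrAC [_ - c - _]addrAC subrr sub0r addrC.
Qed.

Lemma aug_boundary (Z : topologicalType) (c : chain R Z 1) : aug (boundary c) = 0.
Proof.
rewrite /aug /boundary fglift_comp fgliftE big1// => s _.
rewrite -/(aug _) aug_sum big_ord_recl big_ord1 /aug !fgliftZ !fgliftU.
by rewrite expr0 /= /bump expr1 scale1r scaleN1r subrr scaler0.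
Qed.

Lemma aug_push (Z W : topologicalType) (h : Z -> W) (c : chain R Z 0) : aug (push_chain h c) = aug c.
Proof. by rewrite /aug /push_chain fglift_comp; apply: (@eq_fglift _ int^o) => s _; exact: (@fgliftU _ int^o). Qed.

(** The lift has boundary [(tau - 1) b]. Correcting it by [(tau - 1) (Cone b)] gives a cycle of the
    line, which [Cone] fills; under projection the correction disappears. *)
Lemma fill_lift n (c : chY n.+1) (b : ch n) : cont_chain c -> boundary c = 0 -> cont_chain b ->
  boundary (lift_chain c) = tau b - b -> boundary (Cone b) = b ->
  exists2 e, cont_chain e & boundary e = c.
Proof.
move=> cc c0 cb bE kb.
pose u := lift_chain c - (tau (Cone b) - Cone b).
have cu : cont_chain u.
  apply: cont_chainB; first exact: cont_up.
  by apply: cont_chainB; [apply: cont_tau|]; exact: cont_Cone.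
have u0 : boundary u = 0.
  by rewrite /u !boundaryB boundary_push kb bE subrr.
exists (project_chain (Cone u)); first by apply: cont_down; exact: cont_Cone.
rewrite /project_chain boundary_push boundary_Cone u0 [Cone 0]fglift0 subr0 -/(project_chain u).
by rewrite /u /project_chain !pushB -!/(project_chain _) down_tau subrr subr0 down_up.
Qed.

Lemma down_boundary_up n (c : chY n.+1) : cont_chain c -> project_chain (boundary (lift_chain c)) = boundary c.
Proof. by move=> cc; rewrite /project_chain -boundary_push -/(project_chain _) down_up. Qed.

Lemma circle_high_cycle n (c : chY n.+2) : cont_chain c -> boundary c = 0 ->
  exists2 e, cont_chain e & boundary e = c.
Proof.
move=> cc c0; have cu := cont_up cc.
have cT := cont_boundary cu.
have bE := tau_climb cT; rewrite down_boundary_up// c0 [lift_chain 0]fglift0 subr0 in bE.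
have b0 : boundary (climb (boundary (lift_chain c))) = 0.
  by apply: tau_eq; rewrite /push_chain fglift0 subr0 -/(push_chain _ _) -boundary_push -boundaryB bE boundary_boundary.
apply: (@fill_lift _ c (climb (boundary (lift_chain c)))) => //; first exact: cont_climb.
by rewrite boundary_Cone b0 [Cone 0]fglift0 subr0.
Qed.

(** The connecting map from [H_1] of the circle to [H_0] of the line, which is the integers: the
    winding number. *)
Definition wind (c : chY 1) : int := aug (climb (boundary (lift_chain c))).

Lemma circle_cycle (c : chY 1) : cont_chain c -> boundary c = 0 -> wind c = 0 ->
  exists2 e, cont_chain e & boundary e = c.
Proof.
move=> cc c0 w0; have cu := cont_up cc.
have cT := cont_boundary cu.
have bE := tau_climb cT; rewrite down_boundary_up// c0 [lift_chain 0]fglift0 subr0 in bE.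
apply: (@fill_lift _ c (climb (boundary (lift_chain c)))) => //; first exact: cont_climb.
by rewrite boundary_Cone0 -/(wind c) w0 /point_chain scale0r subr0.
Qed.

(** The boundary of the lift and the lift of the boundary differ by a chain [a] that projects to 0,
    hence is divisible by [tau - 1]. By injectivity the division commutes with the boundary, and the
    augmentation of a boundary is 0. *)
Lemma wind_boundary (e : chY 2) : cont_chain e -> wind (boundary e) = 0.
Proof.
move=> ce; have cb := cont_boundary ce.
pose a := boundary (lift_chain e) - lift_chain (boundary e).
have ca : cont_chain a by apply: cont_chainB; [apply: cont_boundary|]; exact: cont_up.
have a0 : project_chain a = 0 by rewrite /a /project_chain pushB -!/(project_chain _) down_boundary_up// down_up// subrr.
have aE := tau_climb ca; rewrite a0 [lift_chain 0]fglift0 subr0 in aE.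
have bE := tau_climb (cont_boundary (cont_up cb)).
rewrite down_boundary_up// boundary_boundary [lift_chain 0]fglift0 subr0 in bE.
rewrite /wind; have -> : climb (boundary (lift_chain (boundary e))) = boundary (- climb a).
  apply: tau_eq; rewrite bE boundaryN /push_chain fgliftN -/(push_chain _ _) -boundary_push -opprD.
  by rewrite -(boundaryB (tau (climb a)) (climb a)) aE /a boundaryB boundary_boundary sub0r opprK.
exact: aug_boundary.
Qed.

Lemma windB c d : wind (c - d) = wind c - wind d.
Proof. by rewrite /wind /lift_chain fgliftB boundaryB /climb fgliftB /aug fgliftB. Qed.

Lemma windZ m c : wind (m *: c) = m * wind c.
Proof. by rewrite /wind /lift_chain fgliftZ boundaryZ /climb fgliftZ /aug fgliftZ. Qed.
End CircleHomology.

Section CircleTrace.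
Context {R : realType}.
Local Notation D := (simplex R).
Local Notation Y := (sphere R 1).
Local Notation chY n := (chain R Y n).

Lemma simplex0_eq (v w : D 0) : v = w.
Proof.
apply: simplex_inj; apply/rowP => i; rewrite (ord1 i).
by have [_ h1] := simplexP v; have [_ h2] := simplexP w; rewrite !big_ord1 in h1 h2; rewrite h1 h2.
Qed.

Definition end0 : D 1 := face (fintype.lift ord0 ord0) (simplex_vertex 0).
Definition end1 : D 1 := face ord0 (simplex_vertex 0).

Lemma end0E : end0 = simplex_vertex 1.
Proof.
apply: simplex_inj; apply: row2P; rewrite [LHS]face_mxE /=.
  by rewrite (ord1 (inord _)) /= !mxE.
by rewrite /= mxE.
Qed.

Lemma end0_coord : set_val end0 0 1 = 0. Proof. by rewrite end0E /= mxE. Qed.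

Lemma end1_coord : set_val end1 0 1 = 1.
Proof.
by rewrite [LHS]face_mxE /= (ord1 (inord _)) mxE.
Qed.

Lemma boundary1 (Z : topologicalType) (s : D 1 -> Z) :
  boundary (<< s >> : chain R Z 1) = << cst (s end1) >> - << cst (s end0) >>.
Proof.
rewrite boundaryU big_ord_recl big_ord1 expr0 scale1r /= /bump expr1 scaleN1r.
congr (<< _ >> - << _ >>); apply/funext => v /=; rewrite (simplex0_eq v (simplex_vertex 0))//.
Qed.

Lemma wind_path (r : D 1 -> R) m : continuous r -> r end0 = 0 -> r end1 = turn *~ m ->
  wind << cisp \o r >> = m.
Proof.
move=> cr r0 r1; have T := @turn_gt0 R.
have ur : clift (cisp \o r) = r.
  apply: clift_uniq => //; first exact: cont_cisp.
  by rewrite -end0E r0 lexx.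
have lv (t : R) : aug (climb (<< cst t >> : chain R R 0)) = Num.floor (t / turn).
  by rewrite /climb fgliftU aug_run.
rewrite /wind /lift_chain fgliftU ur boundary1 /climb fgliftB -!/(climb _) /aug fgliftB -!/(aug _) !lv r0 r1.
rewrite mul0r -mulrzr mulrAC divff ?gt_eqF// mul1r intrKfloor.
by rewrite -[X in Num.floor X]/(0%:~R) intrKfloor subr0.
Qed.

Definition loop_lift (v : D 1) : R := set_val v 0 1 * turn.
Definition loop : D 1 -> Y := cisp \o loop_lift.

Lemma loop_lift_continuous : continuous loop_lift.
Proof. by move=> v; apply: (@ctatM (D 1) R (fun v => set_val v 0 1) (fun=> turn)); [exact: ctat_simplex_coord|exact: ctat_cst]. Qed.

Lemma loop_continuous : continuous loop.
Proof. exact/cont_cisp/loop_lift_continuous. Qed.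

Lemma loop_end0 : loop_lift end0 = 0. Proof. by rewrite /loop_lift end0_coord mul0r. Qed.
Lemma loop_end1 : loop_lift end1 = turn. Proof. by rewrite /loop_lift end1_coord mul1r. Qed.

Lemma cisp_turn : cisp turn = cisp 0 :> Y.
Proof. by apply/cisp_inj; have := @cis_turn R 0 1; rewrite add0r. Qed.

Lemma wind_loop : wind << loop >> = 1.
Proof. by apply: wind_path; [exact: loop_lift_continuous|exact: loop_end0|rewrite loop_end1]. Qed.

Variable k : Y -> Y.
Hypothesis ck : continuous k.
Hypothesis kp : k sphere_pt = sphere_pt.

Lemma cisp0 : cisp 0 = sphere_pt :> Y.
Proof.
by apply: sphere_inj; apply: row2P; rewrite ?cis0E ?cis1E ?cos0 ?sin0 /= mxE.
Qed.

Lemma sphere_map_lift : exists (r : D 1 -> R) (m : int),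
  [/\ continuous r, forall v, cisp (r v) = k (loop v), r end0 = 0 & r end1 = turn *~ m].
Proof.
have [|||r [cr rE r0]] := @simplex_lift R 1 (fun v => set_val (k (loop v))) 0.
- move=> v; apply: (ctat_comp (f := fun v => k (loop v))); last exact: set_val_ctat.
  by apply: (ctat_comp (f := loop)); [exact: loop_continuous|exact: ck].
- by move=> v; exact: sphere_usphere.
- by rewrite -end0E /loop /= loop_end0 cisp0 kp -cisp0.
have rE' v : cisp (r v) = k (loop v) by apply: sphere_inj; exact: rE.
have /cis_inj[m e] : cis (r end1) = cis 0.
  by apply/cisp_inj; rewrite rE' /loop /= loop_end1 cisp_turn cisp0.
by exists r, m; split => //; [rewrite end0E|rewrite e add0r].
Qed.

Lemma trace_high n : is_homology_trace R setT k n.+2 0.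
Proof.
exists 0%N, (fun=> 0), 0; split; [by case| |by case|by rewrite mxtrace0].
move=> c [/singular_cont cc c0]; have [e ce eE] := circle_high_cycle cc c0.
exists 0; split; last by move=> a _; apply/rowP => -[].
rewrite big_ord0 subr0; apply: torsion_bd; exists e; split => //; exact/singular_cont.
Qed.

Lemma cycle_wind_torsion (c : chY 1) : cont_chain c -> boundary c = 0 -> wind c = 0 -> torsion_class setT c.
Proof.
move=> cc c0 w0; have [e ce eE] := circle_cycle cc c0 w0.
by apply: torsion_bd; exists e; split => //; exact/singular_cont.
Qed.

Lemma torsion_wind (c : chY 1) : torsion_class setT c -> wind c = 0.
Proof.
move=> [m [m0 [b [/singular_cont cb bE]]]]; have := wind_boundary cb.
by rewrite bE windZ => /eqP; rewrite mulf_eq0 (negPf m0) => /eqP.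
Qed.

Lemma loop_cycle : boundary (<< loop >> : chY 1) = 0.
Proof. by rewrite boundary1 /loop /= loop_end0 loop_end1 cisp_turn subrr. Qed.

(** A common frame for [H_0] with [aug] and [H_1] with [wind]: a functional whose kernel on cycles
    is the torsion classes and whose value on [z] is 1 makes [z] a basis, and the trace is its value
    on the image of [z]. *)
Lemma rank_one_trace n (z : chY n) (h : chY n -> int) (m : int) :
  {morph h : c d / c - d} -> (forall j c, h (j *: c) = j * h c) -> h z = 1 ->
  is_cycle setT z -> is_cycle setT (chain_map k z) -> h (chain_map k z) = m ->
  (forall c, is_cycle setT c -> h c = 0 -> torsion_class setT c) ->
  (forall c, torsion_class setT c -> h c = 0) -> is_homology_trace R setT k n m.
Proof.
move=> hB hZ hz cz ckz hk h0 h1.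
have cy (c : chY n) j : is_cycle setT c -> is_cycle setT (c - j *: z).
  case: (n) c z cz {hB hZ hz ckz hk h0 h1} => [|l] c z'.
    by move=> /singular_cont h2 /singular_cont h3; apply/singular_cont/cont_chainB => //; exact: cont_chainZ.
  move=> [/singular_cont h2 e2] [/singular_cont h3 e3]; split.
    by apply/singular_cont/cont_chainB => //; exact: cont_chainZ.
  by rewrite boundaryB boundaryZ e2 e3 scaler0 subrr.
exists 1%N, (fun=> z), m%:M; split; [by []| | |by rewrite mxtrace_scalar].
  move=> c cc; exists (const_mx (h c)); split.
    by rewrite big_ord1 mxE; apply: h0; [exact: cy|rewrite hB hZ hz mulr1 subrr].
  move=> a; rewrite big_ord1 => /h1; rewrite hB hZ hz mulr1 => /eqP.
  rewrite subr_eq0 => /eqP e; apply/rowP => i; rewrite mxE e; congr (a 0 _); exact: esym (ord1 i).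
move=> j; rewrite big_ord1 (ord1 j) mxE eqxx mulr1n.
by apply: h0; [exact: cy|rewrite hB hZ hz hk mulr1 subrr].
Qed.

Lemma trace1 r m : continuous r -> (forall v, cisp (r v) = k (loop v)) -> r end0 = 0 ->
  r end1 = turn *~ m -> is_homology_trace R setT k 1 m.
Proof.
move=> cr rE r0 r1.
have kl : chain_map k (<< loop >> : chY 1) = << cisp \o r >>.
  by rewrite /chain_map fgliftU; congr (<< _ >>); apply/funext => v /=; rewrite rE.
apply: (@rank_one_trace 1 << loop >> wind); [exact: windB|exact: windZ|exact: wind_loop| | | | |exact: torsion_wind].
- by split; [apply/singular_cont/cont_chainU; exact: loop_continuous|exact: loop_cycle].
- rewrite kl; split; first by apply/singular_cont/cont_chainU; exact: cont_cisp.
  by rewrite boundary1 /= r0 r1 -[turn *~ m]add0r (proj2 (cisp_inj _ 0) (cis_turn 0 m)) subrr.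
- by rewrite kl; exact: wind_path.
- by move=> c [/singular_cont cc c0]; exact: cycle_wind_torsion.
Qed.

Lemma torsion_aug (c : chY 0) : torsion_class setT c -> aug c = 0.
Proof.
move=> [m [m0 [b [_ bE]]]]; have := aug_boundary b.
by rewrite bE /aug fgliftZ => /eqP; rewrite mulf_eq0 (negPf m0) => /eqP.
Qed.

Lemma aug_torsion (c : chY 0) : cont_chain c -> aug c = 0 -> torsion_class setT c.
Proof.
move=> cc c0; apply: torsion_bd; exists (project_chain (Cone (lift_chain c))); split.
  by apply/singular_cont/cont_down/cont_Cone/cont_up.
have au : aug (lift_chain c) = 0 by rewrite -[LHS](aug_push cisp) -/(project_chain _) down_up.
by rewrite /project_chain boundary_push boundary_Cone0 au /point_chain scale0r subr0 -/(project_chain _) down_up.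
Qed.

Lemma trace0 : is_homology_trace R setT k 0 1.
Proof.
pose z : chY 0 := << cst sphere_pt >>.
have cz : is_cycle setT z by apply/singular_cont/cont_chainU; exact: cst_continuous.
have kz : chain_map k z = z.
  by rewrite /chain_map /z fgliftU; congr (<< _ >>); apply/funext => v /=.
apply: (@rank_one_trace 0 z (@aug R _)); rewrite ?kz ?augU//.
- by move=> c d; rewrite /aug fgliftB.
- by move=> j c; rewrite /aug fgliftZ.
- by move=> c /singular_cont; exact: aug_torsion.
- exact: torsion_aug.
Qed.

Lemma circle_lefschetz r m : continuous r -> (forall v, cisp (r v) = k (loop v)) -> r end0 = 0 ->
  r end1 = turn *~ m -> reduced_lefschetz R setT k = - m.
Proof.
move=> cr rE r0 r1.
have tr n t : is_homology_trace R setT k n t -> homology_trace R setT k n = t.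
  by move=> h; apply: xget_eq => // t' h'; exact: homology_trace_uniq h' h.
have -> : reduced_lefschetz R setT k = lefschetz R setT k - 1 by [].
have -> : lefschetz R setT k = \sum_(n \in `I_2) (-1) ^+ n * homology_trace R setT k n.
  apply/esym/fsbig_widen => // -[|[|n]] [_ /= h]; [by case: h|by case: h|].
  by rewrite (tr _ _ (trace_high n)) mulr0.
rewrite -fsbig_ord big_ord_recl big_ord1 /= (tr _ _ trace0) (tr _ _ (trace1 cr rE r0 r1)).
have -> : bump 0 0 = 1%N by [].
ring.
Qed.
End CircleTrace.

(** * Degrees of powers and of circle maps *)

Section PowerDegree.
Context {R : realType}.
Local Notation V := 'rV[R]_2.

(** Multiplication by [w] as a real matrix acting on rows. Its determinant is [|w|^2], so all simple
    zeros of a complex polynomial count with sign +1. *)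
Definition cmat (w : V) : 'M[R]_2 := \matrix_(i, j)
  if i == 0 then w 0 j else if j == 0 then - w 0 1 else w 0 0.

Lemma sum2 (F : 'I_2 -> R) : \sum_i F i = F 0 + F 1.
Proof. by rewrite big_ord_recl big_ord1; congr (_ + F _); apply: val_inj. Qed.

Lemma cmatE (y w : V) : y *m cmat w = cmul y w.
Proof.
by apply: row2P; rewrite ?(cmul0E, cmul1E) [LHS]mxE sum2 ![cmat w _ _]mxE /=; ring.
Qed.

Lemma det_cmat (w : V) : \det (cmat w) = normsq w.
Proof.
rewrite (expand_det_row _ 0) sum2 /cofactor !det_mx11 normsq2 !mxE /= /bump /=.
by rewrite !(expr0, expr1, addn0, add0n); ring.
Qed.

Lemma cmul0r (v : V) : cmul v 0 = 0.
Proof. by apply: row2P; rewrite ?(cmul0E, cmul1E) !mxE; ring. Qed.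

Lemma cmul_norm (u v : V) : `|cmul u v| <= 2 * `|u| * `|v|.
Proof.
have h (a b c d : R) : `|a| <= `|u| -> `|b| <= `|u| -> `|c| <= `|v| -> `|d| <= `|v| ->
    `|a * c| + `|b * d| <= 2 * `|u| * `|v|.
  move=> au bu cv dv; rewrite !normrM -mulrA [2 * _]mulr_natl mulr2n.
  by apply: lerD; apply: ler_pM.
apply: norm_le_coord => [|j]; first by rewrite !mulr_ge0.
rewrite mxE; case: ifP => _.
  by apply: le_trans (ler_normB _ _) _; apply: h; exact: coord_le_norm.
by apply: le_trans (ler_normD _ _) _; apply: h; exact: coord_le_norm.
Qed.

(** The quotient [(y^m - x^m) / (y - x)] as a polynomial; its continuity in [y] gives the
    derivative. *)
Fixpoint cpow_slope (x : V) m (y : V) : V :=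
  if m is m'.+1 then cmul y (cpow_slope x m' y) + cpow m' x else 0.

Lemma cpow_slopeE x m y : cpow m y - cpow m x = cmul (y - x) (cpow_slope x m y).
Proof.
elim: m => [|m IH]; first by rewrite subrr cmul0r.
rewrite !cpowS /= cmulDr cmulA [cmul (y - x) y]cmulC -cmulA -IH.
by apply: row2P; rewrite !mxE /= ?mxE /=; ring.
Qed.

Lemma cpow_slope_diag x m : cpow_slope x m.+1 x = m.+1%:R *: cpow m x.
Proof.
elim: m => [|m IH]; first by rewrite /= cmul0r add0r scale1r.
rewrite -[LHS]/(cmul x (cpow_slope x m.+1 x) + cpow m.+1 x) IH cmulZr -cpowS.
by rewrite -[X in _ + X]scale1r -scalerDl natr1.
Qed.

Lemma ctat_cpow_slope x m y : ctat (cpow_slope x m) y.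
Proof.
elim: m => [|m IH]; first exact: ctat_cst.
apply: ctatDv; last exact: ctat_cst.
by apply: ctat_cmul => //; exact: ctat_id.
Qed.

Lemma lin_at_cpow m x c : lin_at (fun y => cpow m.+1 y - c) x (cmat (m.+1%:R *: cpow m x)).
Proof.
move=> e e0; have /cvgrPdist_lt/(_ (e / 2)) := @ctat_cpow_slope x m.+1 x.
rewrite divr_gt0// => /(_ isT); apply: (@filterS _ (nbhs x)) => y /ltW h.
rewrite cmatE -cpow_slope_diag.
have -> : cpow m.+1 y - c - (cpow m.+1 x - c) - cmul (y - x) (cpow_slope x m.+1 x) =
    cmul (y - x) (cpow_slope x m.+1 y - cpow_slope x m.+1 x).
  rewrite [RHS](_ : _ = cmul (y - x) (cpow_slope x m.+1 y) - cmul (y - x) (cpow_slope x m.+1 x)).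
    by rewrite -cpow_slopeE opprB addrA subrK.
  by apply: row2P; rewrite !mxE /=; ring.
apply: le_trans (cmul_norm _ _) _; rewrite distrC in h.
have n0 : 0 <= `|y - x| by [].
by have := ler_wpM2l n0 h; lra.
Qed.

Lemma enorm_cmul (u v : V) : enorm (cmul u v) = enorm u * enorm v.
Proof. by rewrite /enorm normsq_cmul sqrtrM// normsq_ge0. Qed.

Lemma enorm_cis (t : R) : enorm (cis t) = 1.
Proof. by have := cis_sphere t; rewrite /usphere /= /enorm => ->; rewrite sqrtr1. Qed.

Lemma enorm_cpow m (v : V) : enorm (cpow m v) = enorm v ^+ m.
Proof. by elim: m => [|m IH]; rewrite ?enorm_cis// cpowS enorm_cmul IH exprS. Qed.

Lemma cpow_radial m (y : V) : cpow m y = enorm y ^+ m *: cpow m (direction y) .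
Proof. by rewrite -cpowZ directionK. Qed.

Lemma normsq_cpow m (v : V) : normsq v = 1 -> normsq (cpow m v) = 1.
Proof.
move=> v1; elim: m => [|m IH]; last by rewrite cpowS normsq_cmul v1 IH mulr1.
exact: (cis_sphere 0).
Qed.

Lemma ctat_cpow_direction m (y : V) : y != 0 -> ctat (fun y => cpow m (direction y)) y.
Proof. by move=> y0; apply: ctat_cpow; apply: ctat_direction => //; exact: ctat_id. Qed.

Definition roots1 m : seq V := [seq cis (turn * (j%:R / m%:R)) | j <- iota 0 m].

Lemma roots1P m (y : V) : y \in roots1 m.+1 <-> [set: V] y /\ cpow m.+1 y - cis 0 = 0.
Proof.
have M : 0 < m.+1%:R :> R by rewrite ltr0n.
have T := @turn_gt0 R.
split.
  move=> /mapP[j _ ->]; split => //; rewrite cpow_cis.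
  have -> : turn * (j%:R / m.+1%:R) *+ m.+1 = turn *+ j :> R.
    by rewrite -[LHS]mulr_natr -mulrA divfK ?gt_eqF// mulr_natr.
  by rewrite -[turn *+ j]add0r (cis_turn 0 j) subrr.
move=> [_ /eqP]; rewrite subr_eq0 => /eqP e.
have y1 : usphere y.
  have := enorm_cpow m.+1 y; rewrite e enorm_cis => /esym/eqP.
  rewrite pexprn_eq1 ?enorm_ge0//= => /eqP h.
  by rewrite /usphere /= -[normsq y]sqr_sqrtr ?normsq_ge0// -/(enorm y) h expr1n.
have [t /andP[t0 tT] yt] := cis_onto y1.
move: e; rewrite yt cpow_cis => /cis_inj[j]; rewrite add0r => tj.
have jE : t = turn * (j%:~R / m.+1%:R).
  by rewrite mulrA mulrzr -tj -[t *+ _]mulr_natr mulfK// gt_eqF.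
have j0 : 0 <= j.
  by move: t0; rewrite jE pmulr_rge0// pmulr_lge0 ?invr_gt0// ler0z.
have jm : j < m.+1.
  by move: tT; rewrite jE gtr_pMr// ltr_pdivrMr// mul1r -[m.+1%:R]/(m.+1%:~R) ltr_int.
case: j j0 jm jE {tj} => // j _ jm ->; apply/mapP; exists j => //.
by rewrite mem_iota.
Qed.

Lemma roots1_uniq m : uniq (roots1 m.+1).
Proof.
have M : 0 < m.+1%:R :> R by rewrite ltr0n.
have T := @turn_gt0 R.
rewrite map_inj_in_uniq ?iota_uniq// => i j; rewrite !mem_iota /= !add0n => im jm.
have r (l : nat) : (l < m.+1)%N -> 0 <= (turn * (l%:R / m.+1%:R) : R) < turn.
  move=> lm; rewrite gtr_pMr// ltr_pdivrMr// mul1r ltr_nat lm andbT.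
  by apply: mulr_ge0; [exact: ltW|apply: divr_ge0; [exact: ler0n|exact: ltW]].
move=> /(cis_inj_itv (r _ im) (r _ jm)) /(mulfI (lt0r_neq0 T)).
move=> /(mulIf _); rewrite invr_eq0 gt_eqF// => /(_ isT) /eqP.
by rewrite eqr_nat => /eqP.
Qed.

(** The radial extension is deformed to [y^(m+1) - 1], whose zeros are the roots of unity. Both main
    terms point in the same direction, and outside the unit disc their sum is longer than the
    constant being subtracted. *)
Lemma cpow_deg m : is_deg (radial (@cpow R m.+1)) setT m.+1.
Proof.
have aR := radial_adm (@ctat_cpow_direction m.+1) (@normsq_cpow m.+1).
have [z dz] := is_deg_exists aR.
pose H (t : R) (y : V) : V := (1 - t) *: radial (@cpow R m.+1) y + t *: cpow m.+1 y - t *: cis 0.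
have cF (x : V) : setT x -> ctat (fun y => cpow m.+1 y - cis 0) x.
  by move=> _; apply: ctatBv; [apply: ctat_cpow; exact: ctat_id|exact: ctat_cst].
have rt (x : V) : x \in roots1 m.+1 -> 0 < normsq (m.+1%:R *: cpow m x).
  move=> /roots1P[_ /eqP]; rewrite subr_eq0 => /eqP e.
  rewrite lt_neqAle normsq_ge0 andbT eq_sym normsq_eq0 scaler_eq0 pnatr_eq0 /=; apply/eqP => h.
  have : enorm (cpow m.+1 x) = 1 by rewrite e enorm_cis.
  by rewrite cpowS h cmul0r /enorm normsq0 sqrtr0 => /eqP; rewrite eq_sym oner_eq0.
have lF (x : V) : x \in roots1 m.+1 -> lin_at (fun y => cpow m.+1 y - cis 0) x (cmat (m.+1%:R *: cpow m x)) /\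
    \det (cmat (m.+1%:R *: cpow m x)) != 0.
  by move=> xs; split; [exact: lin_at_cpow|rewrite det_cmat gt_eqF// rt].
have [a1 d1] := regular_lin_deg (roots1_uniq m) openT cF (@roots1P m) lF.
have cH (t : R) (y : V) : ctat (fun p : R * V => H p.1 p.2) (t, y).
  apply: (@ctatBv (R * V)%type R V (fun p => (1 - p.1) *: radial (@cpow R m.+1) p.2 + p.1 *: cpow m.+1 p.2) (fun p => p.1 *: cis 0)).
    apply: ctatDv; last by apply: ctatZ; [exact: ctat_fst|apply: ctat_cpow; exact: ctat_snd].
    apply: ctatZ; first by apply: ctatB; [exact: ctat_cst|exact: ctat_fst].
    apply: (@ctat_comp _ _ _ snd (radial (@cpow R m.+1))); first exact: ctat_snd.
    exact: (ctat_radial (@ctat_cpow_direction m.+1) (@normsq_cpow m.+1)).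
  by apply: ctatZ; [exact: ctat_fst|exact: ctat_cst].
have dH : is_deg (H 1) setT z.
  apply: (@is_deg_homotopy R 2 H setT [set y : V | enorm y <= 1] z openT) => //.
  - exact: compact_ball_enorm.
  - by move=> t y _ _; exact: cH.
  - move=> t y /andP[t0 t1] _ /eqP; rewrite /H subr_eq0 cpow_radial /radial !scalerA -scalerDl => /eqP e.
    have := congr1 (fun v => enorm v) e; rewrite !enormZ enorm_cis enorm_cpow.
    have r0 := enorm_ge0 y; have rm : 0 <= enorm y ^+ m.+1 by rewrite exprn_ge0.
    rewrite /= !ger0_norm//; last by rewrite addr_ge0 ?mulr_ge0 ?subr_ge0.
    have [->|y0] := eqVneq y 0; first by rewrite /enorm normsq0 sqrtr0 ler01.
    have -> : enorm (direction y) = 1 by rewrite /enorm normsq_direction// sqrtr1.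
    rewrite expr1n !mulr1 leNgt => h; apply/negP => r1.
    have rm1 : 1 < enorm y ^+ m.+1 by rewrite exprn_egt1.
    have h1 : (1 - t) * 1 <= (1 - t) * enorm y by apply: ler_wpM2l; [rewrite subr_ge0|exact: ltW].
    have h2 : t * 1 <= t * enorm y ^+ m.+1 by apply: ler_wpM2l; [|exact: ltW].
    have h3 : t = 1 by lra.
    by move: h; rewrite h3 subrr mul0r add0r mul1r => h; rewrite h ltxx in rm1.
  - by apply: eq_is_deg dz => [|y _]; [exact: openT|rewrite /H subr0 scale1r !scale0r addr0 subr0].
have dH' : is_deg (fun y : V => cpow m.+1 y - cis 0) setT z.
  by apply: eq_is_deg dH => [|y _]; [exact: openT|rewrite /H subrr scale0r add0r !scale1r].
suff <- : z = m.+1 by [].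
rewrite (is_deg_uniq a1 dH' d1) (eq_big_seq (fun=> 1)) => [|x xs].
  by rewrite big_const_seq count_predT iter_addr_0 size_map size_iota natz.
by apply: gtr0_sgz; rewrite det_cmat rt.
Qed.

Definition conj_mx : 'M[R]_2 := diag_mx (\row_(j < 2) if j == 0 then 1 else -1).

Lemma conj_mxE (v : V) : v *m conj_mx = \row_(j < 2) if j == 0 then v 0 0 else - v 0 1.
Proof.
apply: row2P; rewrite [LHS]mxE sum2 !mxE /=; ring.
Qed.

Lemma det_conj_mx : \det conj_mx = -1.
Proof. by rewrite det_diag big_ord_recl big_ord1 !mxE /= mul1r. Qed.

Lemma conj_cis (t : R) : cis t *m conj_mx = cis (- t).
Proof. by rewrite conj_mxE; apply: row2P; rewrite !mxE /= ?cosN ?sinN. Qed.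

(** Negative powers are conjugates of positive ones, which is correct on the unit circle. *)
Definition cpowz (m : int) (v : V) : V :=
  match m with Posz j => cpow j v | Negz j => cpow j.+1 v *m conj_mx end.

Lemma cpowz_cis m (t : R) : cpowz m (cis t) = cis (t *~ m).
Proof. by case: m => j; rewrite /cpowz cpow_cis// conj_cis NegzE mulrNz. Qed.

(** A constant map with value 1 misses -1, so its sum of local degrees is empty. *)
Lemma cst_deg : is_deg (radial (@cpow R 0)) setT 0.
Proof.
pose c : sphere R 1 -> sphere R 1 := cst (cisp 0).
have cc : {within usphere, continuous (sphere_vec c)} by apply: within_ctat => v _; exact: ctat_cst.
have nc x : x \in [::] <-> c x = sphere_antipt.
  split=> // e; have /eqP := congr1 (fun y : sphere R 1 => set_val y 0 0) e.
  by rewrite /= cis0E cos0 !mxE !eqxx -subr_eq0 opprK -mulr2n pnatr_eq0.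
by have := @local_degree_sum R 1 c [::] cc isT nc; rewrite big_nil; apply.
Qed.

Lemma cpowz_deg m : is_deg (radial (cpowz m)) setT m.
Proof.
case: m => [[|j]|j]; [exact: cst_deg|exact: cpow_deg|].
have aR := radial_adm (@ctat_cpow_direction j.+1) (@normsq_cpow j.+1).
have d0 : \det conj_mx != 0 :> R by rewrite det_conj_mx oppr_eq0 oner_neq0.
have := linear_deg aR d0 (@cpow_deg j); rewrite det_conj_mx sgzN sgz1 mulN1r -NegzE.
apply: eq_is_deg => [|y _]; first exact: openT.
by rewrite /radial scalemxAl.
Qed.

Lemma normsq_cpowz m (v : V) : usphere v -> usphere (cpowz m v).
Proof. by move=> /cis_onto[t _ ->]; rewrite cpowz_cis; exact: cis_sphere. Qed.

Lemma ctat_cpowz m (y : V) : ctat (cpowz m) y.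
Proof.
case: m => j; first by apply: ctat_cpow; exact: ctat_id.
apply: ctat_mulmx => [|i l]; last exact: ctat_cst.
by apply: ctat_cpow; exact: ctat_id.
Qed.
End PowerDegree.

Section CircleDegree.
Context {R : realType}.
Local Notation V := 'rV[R]_2.
Local Notation D := (simplex R).

(** The circle as the 1-simplex with its ends identified; on the simplex it is [loop]. *)
Definition arc (v : V) : V := cis (v 0 1 * turn).

Lemma ctat_arc (T : topologicalType) (f : T -> V) p : ctat f p -> ctat (fun q => arc (f q)) p.
Proof.
move=> cf; apply: (@ctat_cis R T (fun q => f q 0 1 * turn)).
by apply: ctatM; [exact: ctat_coord|exact: ctat_cst].
Qed.

Definition arc_point (x : R) : V := \row_(j < 2) if j == 0 then 1 - x else x.

Lemma arc_point_simplex x : 0 <= x <= 1 -> csimplex (arc_point x).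
Proof.
move=> /andP[x0 x1]; split=> [i|]; first by rewrite mxE; case: ifP => // _; rewrite subr_ge0.
by rewrite sum2 !mxE /= subrK.
Qed.

Lemma arc_onto v : usphere v -> exists2 u : V, csimplex u & arc u = v.
Proof.
move=> /cis_onto[t /andP[t0 tT] ->]; have T := @turn_gt0 R.
exists (arc_point (t / turn)).
  apply: arc_point_simplex; apply/andP; split; first by apply: divr_ge0 => //; exact: ltW.
  by rewrite ler_pdivrMr// mul1r; exact: ltW.
by rewrite /arc mxE /= divfK// gt_eqF.
Qed.

Lemma arc_within_icyl (Z : topologicalType) (f : R * V -> Z) :
  {within icyl (@csimplex R 1), continuous (fun q => f (q.1, arc q.2))} ->
  {within icyl usphere, continuous f}.
Proof.
have -> : usphere = arc @` @csimplex R 1.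
  apply/seteqP; split=> [v /arc_onto[u cu <-]|_ [u _ <-]]; [by exists u|exact: cis_sphere].
apply: quotient_within_icyl; [exact: norm_hausdorff|exact: compact_csimplex|exact: closed_csimplex|].
by apply: within_ctat => v _; apply: ctat_arc; exact: ctat_id.
Qed.

Lemma eq_radial (k k' : V -> V) : (forall v, usphere v -> k v = k' v) -> forall y, radial k y = radial k' y.
Proof.
move=> kk y; rewrite /radial; have [->|y0] := eqVneq y 0.
  by rewrite /enorm normsq0 sqrtr0 !scale0r.
by rewrite kk//; exact: normsq_direction.
Qed.

Variable k : sphere R 1 -> sphere R 1.
Hypothesis ck : continuous k.
Variables (r : D 1 -> R) (m : int).
Hypothesis cr : continuous r.
Hypothesis rE : forall v, cisp (r v) = k (loop v).
Hypothesis r0 : r end0 = 0.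
Hypothesis r1 : r end1 = turn *~ m.

Let F (t : R) (v : V) : V := cis ((1 - t) * r (to_simplex v) + t * ((v 0 1 * turn) *~ m)).

(** Points of the simplex identified by [arc] are equal or the two ends, and there the deformed
    lifts differ by [m] turns at all times. *)
Lemma arc_same (u v : V) t : csimplex u -> csimplex v -> arc u = arc v -> F t u = F t v.
Proof.
have T := @turn_gt0 R.
have eqv (u' v' : V) : csimplex u' -> csimplex v' -> u' 0 1 = v' 0 1 -> u' = v'.
  move=> [_ h] [_ h'] e; apply: row2P => //.
  by move: h h'; rewrite !sum2 e => <- /addIr.
have ends (u' v' : V) : csimplex u' -> csimplex v' -> u' 0 1 = 0 -> v' 0 1 = 1 -> F t u' = F t v'.
  move=> cu cv u0 v1.
  have -> : u' = set_val end0 by apply: eqv => //; [exact: simplexP|rewrite end0_coord].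
  have -> : v' = set_val end1 by apply: eqv => //; [exact: simplexP|rewrite end1_coord].
  rewrite /F !simplex_valK r0 r1 end0_coord end1_coord mul0r mul1r mul0rz !mulr0 addr0.
  rewrite -mulrDl subrK mul1r -[X in _ = cis X]add0r; exact: (esym (cis_turn 0 m)).
move=> cu cv e; have [uv|ne] := eqVneq (u 0 1) (v 0 1); first by rewrite (eqv _ _ cu cv uv).
have bu : 0 <= u 0 1 <= 1 by rewrite cu.1 csimplex_le1.
have bv : 0 <= v 0 1 <= 1 by rewrite cv.1 csimplex_le1.
have [j jE] := cis_inj e.
have {}jE : u 0 1 = v 0 1 + j%:~R.
  by apply: (mulIf (lt0r_neq0 T)); rewrite jE mulrDl -[turn *~ j]mulrzr [turn * _]mulrC.
have j0 : j != 0 by apply: contra_neq ne => j0; rewrite jE j0 addr0.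
have [jn|jp] : (j <= -1) \/ (1 <= j) by lia.
  have : j%:~R <= -1 :> R by rewrite -[-1]/((-1)%:~R) ler_int.
  by move=> h; apply: ends => //; lra.
have : 1 <= j%:~R :> R by rewrite -[1]/(1%:~R) ler_int.
by move=> h; apply: esym; apply: ends => //; lra.
Qed.

(** The lift is deformed linearly, with its ends fixed, to the one of constant speed, which turns
    [k] into the [m]-th power. *)
Lemma circle_degree : is_deg (radial (sphere_vec k)) setT m.
Proof.
pose g (v : V) : V := xget 0 [set u : V | csimplex u /\ arc u = v].
have gP v : usphere v -> csimplex (g v) /\ arc (g v) = v.
  move=> /arc_onto[u cu uv]; rewrite /g; case: xgetP => [_ -> //|/(_ u)[]]; by split.
pose H (t : R) (v : V) : V := F t (g v).
have cH : {within icyl usphere, continuous (fun q : R * V => H q.1 q.2)}.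
  apply: arc_within_icyl.
  apply: (@subspace_eq_continuous _ _ _ (fun q : R * V => F q.1 q.2)).
    move=> -[t v]; rewrite inE /from_subspace /H /= => -[_ /= cv].
    have [c1 c2] := gP _ (cis_sphere (v 0 1 * turn)).
    by apply: arc_same => //; rewrite c2.
  apply: within_subspace => q [q1 q2].
  have cR : {within icyl (@csimplex R 1), continuous (fun q : R * V => r (to_simplex q.2))}.
    apply: (@within_precomp _ _ _ snd (fun v : V => r (to_simplex v)) _ (@csimplex R 1)) => [|p []//|].
      by apply: within_ctat => p _; exact: ctat_snd.
    apply: (@within_precomp _ _ _ (@to_simplex R 1) r _ setT) => //; first exact: to_simplex_within.
    exact: continuous_subspaceT.
  have c1 : {within icyl (@csimplex R 1), continuous (fun q : R * V => 1 - q.1)}.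
    by apply: within_ctat => p _; apply: ctatB; [exact: ctat_cst|exact: ctat_fst].
  have c2 : {within icyl (@csimplex R 1), continuous (fun q : R * V => q.1 * ((q.2 0 1 * turn) *~ m))}.
    apply: within_ctat => p _; apply: ctatM; first exact: ctat_fst.
    have -> : (fun q : R * V => (q.2 0 1 * turn) *~ m) = fun q => q.2 0 1 * (turn *~ m).
      by apply/funext => x; rewrite mulrzAr.
    by apply: ctatM; [apply: ctat_coord; exact: ctat_snd|exact: ctat_cst].
  apply: (@ctat_cis R (subspace (icyl (@csimplex R 1)))
    (fun q => (1 - q.1) * r (to_simplex q.2) + q.1 * ((q.2 0 1 * turn) *~ m)) q).
  by apply: ctatD; [apply: ctatM; [exact: c1 q|exact: cR q]|exact: c2 q].
have H0 v : usphere v -> sphere_vec k v = H 0 v.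
  move=> v1; have [c1 c2] := gP v v1.
  rewrite /H /F subr0 mul1r mul0r addr0 -[cis _]/(set_val (cisp _)) rE.
  congr (set_val (k _)); apply: sphere_inj; rewrite to_sphereK// /loop /loop_lift /=.
  by rewrite to_simplexK// -[cis _]/(arc _) c2.
have H1 v : usphere v -> H 1 v = cpowz m v.
  move=> v1; have [c1 c2] := gP v v1.
  by rewrite /H /F subrr mul0r add0r mul1r -{2}c2 /arc cpowz_cis.
have aK : adm (radial (sphere_vec k)) setT [set 0].
  apply: radial_adm => [y y0|v v1]; last exact: sphere_usphere.
  by apply: ctat_kdir => //; apply: sphere_vec_within.
have [z dz] := is_deg_exists aK.
suff <- : z = m by [].
have dH : is_deg (radial (H 0)) setT z.
  by apply: eq_is_deg dz => [|y _]; [exact: openT|exact: eq_radial].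
have d1 : is_deg (radial (H 1)) setT z.
  by apply: radial_homotopy dH => // t v _ v1; exact: cis_sphere.
have aP : adm (radial (@cpowz R m)) setT [set 0].
  apply: radial_adm => [y y0|v v1]; last exact: normsq_cpowz.
  apply: (@ctat_comp _ _ _ (@direction R 2) (cpowz m)); last exact: ctat_cpowz.
  by apply: ctat_direction => //; exact: ctat_id.
apply: (is_deg_uniq aP _ (@cpowz_deg R m)).
by apply: eq_is_deg d1 => [|y _]; [exact: openT|exact: eq_radial].
Qed.
End CircleDegree.

(** On the circle the unreduced Lefschetz number is [1 - m], so the degree [m] is minus the reduced
    one. *)
Lemma circle_degree_lefschetz (R : realType) (k : sphere R 1 -> sphere R 1) : continuous k ->
  k sphere_pt = sphere_pt -> is_deg (radial (sphere_vec k)) setT (- reduced_lefschetz R setT k).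
Proof.
move=> ck kp; have [r [m [cr rE r0 r1]]] := sphere_map_lift ck kp.
by rewrite (circle_lefschetz ck kp cr rE r0 r1) opprK; exact: circle_degree cr rE r0 r1.
Qed.

Lemma wedge_proj_continuous (G : topologicalGroupType) (I : choiceType) (X : I -> pgspace G) (i : I) :
  continuous (@wedge_proj G I X i).
Proof.
apply: wedge_fun_continuous => [k x|].
  case: k x => [j|] x /=; last exact: cst_continuous.
  by case: (j =P i) => [e|_]; [subst j; exact: cvg_id|exact: cst_continuous].
suff E k : summand_proj i (pg_pt (summand X k)) = pg_pt (X i) by move=> k k'; rewrite !E.
by case: k => //= j; case: (j =P i) => // e; subst j.
Qed.

Theorem proposition6p3 (R : realType) (G : topologicalGroupType)
    (hG : subconjugacy_order G) :
  (forall (I : finType) (H : I -> closed_subgroup G)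
      (X := wedge_space (fun i => half_smash R (H i) 1)) (f : X -> X),
    is_pgmap f ->
    reduced_fixed_orbit_index R f =
      \sum_(i : I)
        reduced_lefschetz R setT (sphere_map (wedge_proj i \o f \o wedge_in (i := i)))
          *: class_of (H i))
  /\
  (forall (X : pgspace G) (C : gcw R X) (f f' : X -> X)
      (O : {fset closed_subgroup G}) (CO : forall n (s : cell C n), cell_type s \in O)
      (D : cell_deformations C f'),
    is_pgmap f -> is_pgmap f' -> cellular C f' -> pghomotopic R f f' ->
    reduced_fixed_orbit_index R f = reduced_hom_lefschetz CO D).
Proof.
split=> [I H X f pf|X C f f' O CO D]; last exact: reduced_index_hom_lefschetz.
(* The degree is minus the Lefschetz number and a 1-cell enters with sign -1, so no sign is left in
   the formula. *)
rewrite (@wedge_fixed_orbit_index R G I H f pf hG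
  (fun i => - reduced_lefschetz R setT (sphere_map (wedge_proj i \o f \o wedge_in (i := i))))).
  by apply: eq_bigr => i _; rewrite opprK.
move=> i; apply: circle_degree_lefschetz.
  apply: sphere_map_continuous => z.
  have [[cf _] _] := pf.
  apply: (@ctat_comp _ _ _ (fun z => f (@wedge_in G I (fun i => half_smash R (H i) 1) i z)) (@wedge_proj G I (fun i => half_smash R (H i) 1) i)).
    apply: (@ctat_comp _ _ _ (@wedge_in G I (fun i => half_smash R (H i) 1) i) f); last exact: cf.
    exact: (@wedge_lift_continuous _ _ _ (Some i)).
  exact: (@wedge_proj_continuous G I (fun i => half_smash R (H i) 1) i _).
have [_ fp] := pf; rewrite /sphere_map smash_pt_of /= wedge_in_pt fp.
by rewrite wedge_proj_pt smash_sphere_pt.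
Qed.
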